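(* Let $G=(E_8^C)^{\sigma'_4,\mathfrak{so}(6,C)}=\{\alpha\in E_8^C\mid\sigma'_4\alpha=\alpha\sigma'_4,\ \mathrm{ad}(R_D)\alpha=\alpha\,\mathrm{ad}(R_D)\text{ for all }D\in\mathfrak{so}(6,C)\}$, and let $G_{1_-}=\{\alpha\in G\mid\alpha 1_-=1_-\}$. The homogeneous space $G/G_{1_-}$ is diffeomorphic to the space $(\mathfrak W^C)_{\sigma'_4,\mathfrak{so}(6,C)}$: $$(E_8^C)^{\sigma'_4,\mathfrak{so}(6,C)}/((E_8^C)^{\sigma'_4,\mathfrak{so}(6,C)})_{1_-}\simeq(\mathfrak W^C)_{\sigma'_4,\mathfrak{so}(6,C)}.$$ In particular, the group $(E_8^C)^{\sigma'_4,\mathfrak{so}(6,C)}$ is connected.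
   Context: Octonions and Jordan algebra. $\mathfrak C$ is the real division algebra of octonions with standard basis $e_0=1,e_1,\dots,e_7$, conjugation $x\mapsto\overline x$; $C=\mathbf R\oplus i\mathbf R$ is the field of complex numbers, and $\mathfrak C^C=\mathfrak C\otimes_{\mathbf R}C$ with $C$-linearly extended product and conjugation. $\mathfrak J^C$ is the space of $3\times3$ matrices $$X=\begin{pmatrix}\xi_1&x_3&\overline x_2\\ \overline x_3&\xi_2&x_1\\ x_2&\overline x_1&\xi_3\end{pmatrix},\quad \xi_k\in C,\ x_k\in\mathfrak C^C.$$ $E_k$ is the element with $\xi_k=1$ and all other entries $0$; $F_k(x)$ is the element with $x_k=x$ and all other entries $0$; $E$ is the unit matrix. Put $X\circ Y=\frac12(XY+YX)$, $(X,Y)=\mathrm{tr}(X\circ Y)$, $X\times Y=\frac12(2X\circ Y-\mathrm{tr}(X)Y-\mathrm{tr}(Y)X+(\mathrm{tr}(X)\mathrm{tr}(Y)-(X,Y))E)$, $\tilde T X=T\circ X$. $F_4^C$ is the group of $C$-linear automorphisms of $(\mathfrak J^C,\circ)$, with Lie algebra $\mathfrak f_4^C$ of derivations. $\mathfrak e_6^C=\{\delta+\tilde T\mid\delta\in\mathfrak f_4^C,\ T\in\mathfrak J^C,\ \mathrm{tr}(T)=0\}$. $E_7^C$. $\mathfrak P^C=\mathfrak J^C\oplus\mathfrak J^C\oplus C\oplus C$. For $\phi\in\mathfrak e_6^C$, $A,B\in\mathfrak J^C$, $\nu\in C$, $\varPhi(\phi,A,B,\nu)$ is the linear map of $\mathfrak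 P^C$ $$(X,Y,\xi,\eta)\mapsto(\phi X-\tfrac13\nu X+2B\times Y+\eta A,\ 2A\times X-{}^t\phi Y+\tfrac13\nu Y+\xi B,\ (A,Y)+\nu\xi,\ (B,X)-\nu\eta),$$ where ${}^t\phi$ is the transpose for $(\cdot,\cdot)$; these form the Lie algebra $\mathfrak e_7^C$. For $P=(X,Y,\xi,\eta)$, $Q=(Z,W,\zeta,\omega)$, $P\times Q=\varPhi(\phi,A,B,\nu)$ with $\phi=-\frac12(X\vee W+Z\vee Y)$, $A=-\frac14(2Y\times W-\xi Z-\zeta X)$, $B=\frac14(2X\times Z-\eta W-\omega Y)$, $\nu=\frac18((X,W)+(Z,Y)-3(\xi\omega+\zeta\eta))$, where $X\vee W=[\tilde X,\tilde W]+(X\circ W-\frac13(X,W)E)^{\sim}$. Also $\{P,Q\}=(X,W)-(Z,Y)+\xi\omega-\zeta\eta$. $E_7^C=\{\alpha\in\mathrm{Iso}_C(\mathfrak P^C)\mid\alpha(P\times Q)\alpha^{-1}=\alpha P\times\alpha Q\}$, and $F_4^C\subset E_7^C$ via $\alpha(X,Y,\xi,\eta)=(\alpha X,\alpha Y,\xi,\eta)$. $E_8^C$. $\mathfrak e_8^C=\mathfrak e_7^C\oplus\mathfrak P^C\oplus\mathfrak P^C\oplus C\oplus C\oplus C$ with bracket $[(\varPhi_1,P_1,Q_1,r_1,s_1,t_1),(\varPhi_2,P_2,Q_2,r_2,s_2,t_2)]=(\varPhi,P,Q,r,s,t)$: $\varPhi=[\varPhi_1,\varPhi_2]+P_1\times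 Q_2-P_2\times Q_1$; $P=\varPhi_1P_2-\varPhi_2P_1+r_1P_2-r_2P_1+s_1Q_2-s_2Q_1$; $Q=\varPhi_1Q_2-\varPhi_2Q_1-r_1Q_2+r_2Q_1+t_1P_2-t_2P_1$; $r=-\frac18\{P_1,Q_2\}+\frac18\{P_2,Q_1\}+s_1t_2-s_2t_1$; $s=\frac14\{P_1,P_2\}+2r_1s_2-2r_2s_1$; $t=-\frac14\{Q_1,Q_2\}-2r_1t_2+2r_2t_1$. $E_8^C=\{\alpha\in\mathrm{Iso}_C(\mathfrak e_8^C)\mid\alpha[R,R']=[\alpha R,\alpha R']\}$. $E_7^C\subset E_8^C$ via $\alpha(\varPhi,P,Q,r,s,t)=(\alpha\varPhi\alpha^{-1},\alpha P,\alpha Q,r,s,t)$. Put $1_-=(0,0,0,0,0,1)\in\mathfrak e_8^C$. The element $\sigma'_4\in F_4^C$: in terms of the entries of $X$, it fixes $\xi_1,\xi_2,\xi_3$ and maps $x_1\mapsto-e_1x_1e_1$, $x_2\mapsto e_1x_2$, $x_3\mapsto-x_3e_1$. It is regarded as an element of $E_8^C$ via the inclusions $F_4^C\subset E_7^C\subset E_8^C$. Here $\mathfrak{so}(6,C)$ denotes $\{D\in\mathfrak f_4^C\mid DE_i=0\ (i=1,2,3),\ DF_1(e_k)=0\ (k=0,1)\}$ and, for such $D$, $R_D=(\varPhi(D,0,0,0),0,0,0,0,0)\in\mathfrak e_8^C$. The space $\mathfrak W^C$. With $B_8$ the Killing form of $\mathfrak e_8^C$, for $R\in\mathfrak e_8^C$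 define $R\times R:\mathfrak e_8^C\to\mathfrak e_8^C$ by $(R\times R)R_1=[R,[R,R_1]]+\frac1{30}B_8(R,R_1)R$. Then $\mathfrak W^C=\{R\in\mathfrak e_8^C\mid R\times R=0,\ R\neq0\}$ and $(\mathfrak W^C)_{\sigma'_4,\mathfrak{so}(6,C)}=\{R\in\mathfrak W^C\mid\sigma'_4R=R,\ [R_D,R]=0\text{ for all }D\in\mathfrak{so}(6,C)\}$. *)

(* Defs.v *)
From HB Require Import structures.
From mathcomp Require Import all_boot all_order all_algebra.
From mathcomp Require Import all_classical all_reals all_analysis.
From mathcomp Require Import complex ring.

Set Implicit Arguments.
Unset Strict Implicit.
Unset Printing Implicit Defensive.

Import Order.TTheory GRing.Theory Num.Theory.
Import numFieldNormedType.Exports VectorInternalTheory.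
Local Open Scope classical_set_scope.
Local Open Scope ring_scope.

(* The algebra is written over an arbitrary numFieldType F; the objects carrying
   a superscript C are the instances F := R[i], with R : realType. *)

Section Subspace.
Context (F : fieldType) (V : vectType F).

(* The subspace whose set of elements is S, when S is a linear subspace. *)
Definition vspace_of (S : set V) : {vspace V} :=
  xget 0%VS [set U : {vspace V} | forall v, v \in U <-> S v].

Lemma vspace_ofP (S : set V) : S 0 ->
  (forall a u v, S u -> S v -> S (a *: u + v)) ->
  forall v, v \in vspace_of S <-> S v.
Proof.
move=> S0 Slin.
suff [U HU] : exists U : {vspace V}, forall v, v \in U <-> S v.
  rewrite /vspace_of; case: xgetP => [W _ HW //|/(_ U)]; by case.
pose Q (n : nat) := `[< exists U : {vspace V},
  (forall v, v \in U -> S v) /\ \dim U = n >].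
have Q0 : exists n, Q n.
  exists 0%N; apply/asboolP; exists 0%VS; split; last by rewrite dimv0.
  by move=> v; rewrite memv0 => /eqP->.
have Qb n : Q n -> (n <= \dim {:V})%N.
  by move/asboolP=> [U [_ <-]]; exact/dimvS/subvf.
case: (ex_maxnP Q0 Qb) => n /asboolP[U [US dU]] nmax.
exists U => v; split; first exact: US.
move=> Sv; apply: contrapT => /negP vU.
have : (n < \dim (U + <[v]>))%N.
  rewrite -dU ltn_neqAle dimvS ?addvSl // andbT; apply/negP => /eqP E.
  have /eqP UE : (U == U + <[v]>)%VS by rewrite eqEdim addvSl E leqnn.
  by move/negP: vU; apply; rewrite UE memvE addvSr.
rewrite ltnNge => /negP; apply; apply: nmax; apply/asboolP.
exists (U + <[v]>)%VS; split => // w /memv_addP[u Uu [x /vlineP[k ->] ->]].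
by rewrite addrC; apply: Slin => //; exact: US.
Qed.

End Subspace.

Section Trace.
Context (F : comNzRingType) (V : vectType F).

Definition endo_trace (f : V -> V) : F := \tr (lin1_mx (v2r \o f \o r2v)).

End Trace.

Section Octonions.
Context (F : fieldType).

Notation oct := 'rV[F]_8.

(* 'rV[F]_8 is the octonion algebra with coefficients extended to F; e_i is the
   i-th basis vector.  Triples (i, j, k) with e_i e_j = e_k, up to cyclic permutation. *)
Definition oct_triples : seq (nat * nat * nat) :=
  [:: (1, 2, 3); (1, 4, 5); (2, 5, 7); (3, 4, 7);
      (3, 5, 6); (6, 4, 2); (6, 7, 1)]%N.

Definition oct_line (i j k : nat) : bool :=
  has (fun t : nat * nat * nat => let: (a, b, c) := t in
         (i, j, k) \in [:: (a, b, c); (b, c, a); (c, a, b)]) oct_triples.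

(* The coefficient of e_k in e_i e_j. *)
Definition oct_coef (i j k : nat) : F :=
  if i == 0%N then (j == k)%:R
  else if j == 0%N then (i == k)%:R
  else if i == j then - (k == 0%N)%:R
  else (oct_line i j k)%:R - (oct_line j i k)%:R.

Definition oct_mul (x y : oct) : oct :=
  \row_k \sum_(i < 8) \sum_(j < 8) oct_coef i j k * x 0 i * y 0 j.

Definition oct_conj (x : oct) : oct :=
  \row_(k < 8) (if k == 0 then x 0 k else - x 0 k).

Definition oct_e (k : nat) : oct := \row_i (i == k :> nat)%:R.

Lemma oct_mulPl a x y z :
  oct_mul (a *: x + y) z = a *: oct_mul x z + oct_mul y z.
Proof.
apply/rowP => k; rewrite !mxE mulr_sumr -big_split /=; apply: eq_bigr => i _.
rewrite mulr_sumr -big_split /=; apply: eq_bigr => j _; rewrite !mxE.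
by rewrite mulrDr mulrDl !mulrA (mulrC a).
Qed.

Lemma oct_mulPr a x y z :
  oct_mul x (a *: y + z) = a *: oct_mul x y + oct_mul x z.
Proof.
apply/rowP => k; rewrite !mxE mulr_sumr -big_split /=; apply: eq_bigr => i _.
rewrite mulr_sumr -big_split /=; apply: eq_bigr => j _; rewrite !mxE.
by rewrite mulrDr mulrCA.
Qed.

Lemma oct_conjP a x y :
  oct_conj (a *: x + y) = a *: oct_conj x + oct_conj y.
Proof.
apply/rowP => k; rewrite !mxE; case: ifP => // _.
by rewrite opprD mulrN.
Qed.

Lemma oct_conjK x : oct_conj (oct_conj x) = x.
Proof. by apply/rowP => k; rewrite !mxE; case: (k == 0); rewrite ?opprK. Qed.

Lemma oct_conj_mul x y : oct_conj (oct_mul x y) = oct_mul (oct_conj y) (oct_conj x).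
Proof.
have line0 i j : oct_line i j 0 = false.
  by rewrite /oct_line /= !inE !xpair_eqE /= !andbF.
apply/rowP => k; rewrite /oct_conj /oct_mul !mxE.
transitivity (\sum_(i < 8) \sum_(j < 8) (if k == 0 then oct_coef i j k
  else - oct_coef i j k) * x 0 i * y 0 j).
  case: eqP => // _; rewrite -sumrN; apply: eq_bigr => i _.
  by rewrite -sumrN; apply: eq_bigr => j _; rewrite !mulNr.
rewrite exchange_big; apply: eq_bigr => i _; apply: eq_bigr => j _.
rewrite !mxE /oct_coef.
have e8 (a : 'I_8) : (a == 0) = (a == 0%N :> nat) by [].
rewrite !e8 (eq_sym (j : nat) i).
have [i0|i0] := eqVneq (i : nat) 0%N; have [j0|j0] := eqVneq (j : nat) 0%N.
- rewrite i0 j0 /=; have [_|_] := eqVneq (k : nat) 0%N.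
    by rewrite !mul1r mulrC.
  by rewrite oppr0 !mul0r.
- have [jk|jk] := eqVneq (j : nat) k.
    by rewrite -jk (negbTE j0) !mulrN !mulNr !mul1r mulrC.
  by rewrite oppr0 if_same !mul0r.
- have [ik|ik] := eqVneq (i : nat) k.
    by rewrite -ik (negbTE i0) !mulrN !mulNr !mul1r mulrC.
  by rewrite oppr0 if_same !mul0r.
- have [ij|ij] := eqVneq (i : nat) j.
    case: (k == 0%N :> nat); last by rewrite /= !oppr0 !mul0r.
    by rewrite !mulrN !mulNr opprK mulrAC.
  have [->|k0] := eqVneq (k : nat) 0%N; first by rewrite !line0 subrr !mul0r.
  by rewrite opprB !mulrN !mulNr opprK mulrAC.
Qed.

End Octonions.

Section Jordan.
Context (F : numFieldType).

Notation oct := 'rV[F]_8.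

(* (xi, x) stands for the Hermitian matrix with diagonal entries xi_k and
   off-diagonal entries x_k; the row k of x is x_k.  The subscripts 1, 2, 3 are
   the elements 0, 1, 2 of 'I_3, and ordS and ord_pred are the cyclic successor
   and predecessor. *)
Definition jord : vectType F := ('rV[F]_3 * 'M[F]_(3, 8))%type.

Definition jmat (X : jord) : 'M[oct]_3 := \matrix_(i, j)
  if i == j then X.1 0 i *: oct_e F 0
  else if j == ordS i then row (ord_pred i) X.2
  else oct_conj (row (ord_pred j) X.2).

Definition jord_of_mx (M : 'M[oct]_3) : jord :=
  (\row_k M k k 0 0, \matrix_(k, l) M (ordS k) (ord_pred k) 0 l).

Definition omx_mul (M N : 'M[oct]_3) : 'M[oct]_3 :=
  \matrix_(i, j) \sum_k oct_mul (M i k) (N k j).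

Definition jsym_mx (X Y : jord) : 'M[oct]_3 := \matrix_(i, j)
  (2^-1 *: (omx_mul (jmat X) (jmat Y) i j + omx_mul (jmat Y) (jmat X) i j)).

End Jordan.

(* X o Y; locked, to keep unification from unfolding it. *)
HB.lock Definition jmul (F : numFieldType) (X Y : jord F) : jord F :=
  jord_of_mx (jsym_mx X Y).

Section JordanProduct.
Context (F : numFieldType).

Notation oct := 'rV[F]_8.
Notation jord := (jord F).

Definition jE : jord := (const_mx 1, 0).
Definition jEk (k : 'I_3) : jord := (delta_mx 0 k, 0).
Definition jFk (k : 'I_3) (x : oct) : jord :=
  (0, \matrix_(l, j) if l == k then x 0 j else 0).

Definition jtr (X : jord) : F := \sum_k X.1 0 k.
Definition jdot (X Y : jord) : F := jtr (jmul X Y).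
Definition jcross (X Y : jord) : jord :=
  2^-1 *: (2 *: jmul X Y - jtr X *: Y - jtr Y *: X
           + (jtr X * jtr Y - jdot X Y) *: jE).

Lemma ordS3 (i j : 'I_3) : i != j -> j != ordS i -> i = ordS j.
Proof.
move=> ij jS; apply/eqP.
by move: ij jS; move: i j; do 2 (case=> [[|[|[|]]]] //= ?).
Qed.

Lemma jmat_conj (X : jord) i j : oct_conj (jmat X i j) = jmat X j i.
Proof.
rewrite !mxE (eq_sym j i); case: (eqVneq i j) => [->|ij].
  apply/rowP => k; rewrite !mxE.
  by case: ifP => //; rewrite -val_eqE /= => ->; rewrite mulr0 oppr0.
case: (eqVneq j (ordS i)) => [jS|jS].
  rewrite (_ : (i == ordS j) = false); last first.
    by rewrite jS; move: (i); case=> [[|[|[|]]]].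
  by [].
by rewrite (ordS3 ij jS) eqxx oct_conjK.
Qed.

Lemma jmatK : cancel (@jmat F) (@jord_of_mx F).
Proof.
case=> xi x; rewrite /jord_of_mx; congr pair.
  by apply/rowP => k; rewrite !mxE eqxx /= !mxE mulr1.
apply/matrixP => k l; rewrite mxE /jmat mxE.
have [-> ->] : (ordS k == ord_pred k) = false /\ ord_pred k == ordS (ordS k).
  by move: k; case=> [[|[|[|]]]].
by rewrite ordSK mxE.
Qed.

Lemma oct_conj_sum (I : finType) (f : I -> oct) :
  oct_conj (\sum_i f i) = \sum_i oct_conj (f i).
Proof.
apply/rowP => k; rewrite !(mxE, summxE); case: eqP => k0.
  by apply: eq_bigr => i _; rewrite !mxE k0.
by rewrite -sumrN; apply: eq_bigr => i _; rewrite !mxE; case: eqP.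
Qed.

Lemma oct_conjD (x y : oct) : oct_conj (x + y) = oct_conj x + oct_conj y.
Proof. by rewrite -[x]scale1r oct_conjP !scale1r. Qed.

Lemma oct_conjZ a (x : oct) : oct_conj (a *: x) = a *: oct_conj x.
Proof.
by apply/rowP => k; rewrite !mxE; case: ifP => // _; rewrite mulrN.
Qed.

(* The symmetrized product of two Hermitian matrices is Hermitian, so jmul
   loses no information when it reads off six of its entries. *)
Lemma jmat_jmul (X Y : jord) : jmat (jmul X Y) = jsym_mx X Y.
Proof.
rewrite jmul.unlock.
have H i j : oct_conj (jsym_mx X Y i j) = jsym_mx X Y j i.
  rewrite ![jsym_mx _ _ _ _]mxE oct_conjZ oct_conjD ![omx_mul _ _ _ _]mxE.
  rewrite !oct_conj_sum addrC; congr (_ *: (_ + _)); apply: eq_bigr => k _;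
    by rewrite oct_conj_mul !jmat_conj.
apply/matrixP => i j; rewrite mxE.
case: (eqVneq i j) => [<-|ij].
  rewrite [X in X *: _]mxE; move: (H i i).
  move: (jsym_mx X Y i i) => z /rowP Hz; apply/rowP => k.
  rewrite !mxE; case: (eqVneq k 0) => [->|k0]; first by rewrite mulr1.
  rewrite -val_eqE in k0; rewrite (negbTE k0) mulr0.
  move: (Hz k); rewrite mxE -val_eqE (negbTE k0) => /eqP.
  rewrite eq_sym -addr_eq0 -mulr2n -mulr_natl mulf_eq0 pnatr_eq0 /=.
  by move/eqP->.
have R k : row (ord_pred k) (jord_of_mx (jsym_mx X Y)).2 = jsym_mx X Y k (ordS k).
  apply/rowP => l; rewrite 2!mxE.
  have -> : ordS (ord_pred k) = k by rewrite ord_predK.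
  congr (jsym_mx X Y _ _ _ _); by move: k; case=> [[|[|[|]]]] // ?; apply: val_inj.
case: (eqVneq j (ordS i)) => [->|jS]; first exact: R.
by rewrite R H -(ordS3 ij jS).
Qed.

End JordanProduct.

Section JordanLinear.
Context (F : numFieldType).

Notation oct := 'rV[F]_8.
Notation jord := (jord F).

Lemma jord_eq (u v : jord) : (forall k, u.1 0 k = v.1 0 k) ->
  (forall k l, u.2 k l = v.2 k l) -> u = v.
Proof.
case: u v => [u1 u2] [v1 v2] /= H1 H2.
by congr pair; [apply/rowP | apply/matrixP].
Qed.

Lemma jmat_lin a (X Y : jord) i j :
  jmat (a *: X + Y) i j = a *: jmat X i j + jmat Y i j.
Proof.
rewrite !mxE; case: ifP => _ /=; first by rewrite scalerDl scalerA.
case: ifP => _; first by rewrite linearP.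
by rewrite linearP oct_conjP.
Qed.

Lemma jmulC (X Y : jord) : jmul X Y = jmul Y X.
Proof.
rewrite !jmul.unlock; congr jord_of_mx; apply/matrixP => i j.
by rewrite !mxE addrC.
Qed.

Lemma jmul_linr (X : jord) a Y Z :
  jmul X (a *: Y + Z) = a *: jmul X Y + jmul X Z.
Proof.
have L i j : jsym_mx X (a *: Y + Z) i j = a *: jsym_mx X Y i j + jsym_mx X Z i j.
  rewrite [LHS]mxE [in RHS]mxE [X in _ = _ + X]mxE.
  have -> : omx_mul (jmat X) (jmat (a *: Y + Z)) i j =
      a *: omx_mul (jmat X) (jmat Y) i j + omx_mul (jmat X) (jmat Z) i j.
    rewrite ![omx_mul _ _ _ _]mxE scaler_sumr -big_split; apply: eq_bigr => k _.
    by rewrite jmat_lin oct_mulPr.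
  have -> : omx_mul (jmat (a *: Y + Z)) (jmat X) i j =
      a *: omx_mul (jmat Y) (jmat X) i j + omx_mul (jmat Z) (jmat X) i j.
    rewrite ![omx_mul _ _ _ _]mxE scaler_sumr -big_split; apply: eq_bigr => k _.
    by rewrite jmat_lin oct_mulPl.
  by rewrite scalerA mulrC -scalerA -scalerDr scalerDr addrACA -!scalerDr.
rewrite !jmul.unlock; move: L.
move: (jsym_mx X (a *: Y + Z)) (jsym_mx X Y) (jsym_mx X Z) => M N1 N2 L.
by apply: jord_eq => [k|k l]; rewrite /jord_of_mx /= !mxE L !mxE.
Qed.

Lemma jmul_linl (X : jord) a Y Z :
  jmul (a *: Y + Z) X = a *: jmul Y X + jmul Z X.
Proof. by rewrite jmulC jmul_linr !(jmulC X). Qed.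

Lemma jtr_lin a (X Y : jord) : jtr (a *: X + Y) = a * jtr X + jtr Y.
Proof.
by rewrite /jtr mulr_sumr -big_split; apply: eq_bigr => k _; rewrite !mxE.
Qed.

Lemma jdotC (X Y : jord) : jdot X Y = jdot Y X.
Proof. by rewrite /jdot jmulC. Qed.

Lemma jdot_linr (X : jord) a Y Z :
  jdot X (a *: Y + Z) = a * jdot X Y + jdot X Z.
Proof. by rewrite /jdot jmul_linr jtr_lin. Qed.

Lemma jdot_linl (X : jord) a Y Z :
  jdot (a *: Y + Z) X = a * jdot Y X + jdot Z X.
Proof. by rewrite /jdot jmul_linl jtr_lin. Qed.

Lemma jcrossC (X Y : jord) : jcross X Y = jcross Y X.
Proof.
rewrite /jcross jmulC jdotC (mulrC (jtr X)); congr (_ *: (_ + _)).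
by rewrite addrAC.
Qed.

Lemma jcross_linr (X : jord) a Y Z :
  jcross X (a *: Y + Z) = a *: jcross X Y + jcross X Z.
Proof.
rewrite /jcross jmul_linr jdot_linr jtr_lin.
move: (jmul X Y) (jmul X Z) (jdot X Y) (jdot X Z) (jtr X) (jtr Y) (jtr Z) (jE F).
move=> XY XZ dY dZ tX tY tZ E.
by apply: jord_eq => [k|k l] /=; rewrite !mxE; ring.
Qed.

Lemma jcross_linl (X : jord) a Y Z :
  jcross (a *: Y + Z) X = a *: jcross Y X + jcross Z X.
Proof. by rewrite jcrossC jcross_linr !(jcrossC X). Qed.

Lemma oct_mul_conj0 (x y : oct) :
  oct_mul x (oct_conj y) 0 0 = \sum_i x 0 i * y 0 i.
Proof.
have line0 i j : oct_line i j 0 = false.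
  by rewrite /oct_line /= !inE !xpair_eqE /= !andbF.
rewrite mxE; apply: eq_bigr => i _.
rewrite (bigD1 i) //= big1 ?addr0 => [|j ji]; last first.
  rewrite /oct_coef /= !line0 subrr.
  have /negbTE ij : (i : nat) != j by rewrite eq_sym.
  have [i0|i0] := eqVneq (i : nat) 0%N.
    by move: ij; rewrite i0 eq_sym => ->; rewrite !mul0r.
  by rewrite ij if_same !mul0r.
rewrite mxE /oct_coef eqxx /=.
have -> : (i == 0) = (i == 0%N :> nat) by [].
by case: (_ == _); rewrite ?mul1r // mulrN !mulNr mul1r opprK.
Qed.

Lemma jdotE (X Y : jord) : jdot X Y =
  \sum_k X.1 0 k * Y.1 0 k + 2 * \sum_k \sum_l X.2 k l * Y.2 k l.
Proof.
pose ip (x y : oct) := \sum_i x 0 i * y 0 i.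
have ipC x y : ip x y = ip y x by apply: eq_bigr => i _; rewrite mulrC.
have ip_conj x y : ip (oct_conj x) (oct_conj y) = ip x y.
  by apply: eq_bigr => i _; rewrite !mxE; case: ifP => // _; rewrite mulrNN.
have S : jdot X Y = \sum_i \sum_j ip (jmat X i j) (jmat Y i j).
  rewrite /jdot /jtr jmul.unlock; apply: eq_bigr => i _.
  rewrite !mxE !summxE -big_split mulr_sumr /=; apply: eq_bigr => j _.
  rewrite -(jmat_conj Y i j) -(jmat_conj X i j) !oct_mul_conj0 -/(ip _ _).
  rewrite -/(ip _ _) (ipC (jmat Y i j)) -mulr2n -[ip _ _ *+ 2]mulr_natl mulrA.
  by rewrite mulVf ?mul1r // pnatr_eq0.
have D i : ip (jmat X i i) (jmat Y i i) = X.1 0 i * Y.1 0 i.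
  rewrite /ip (bigD1 0) //= big1 ?addr0 => [|l l0].
    by rewrite !mxE eqxx !mxE !mulr1.
  rewrite !mxE eqxx !mxE -val_eqE /= in l0 *.
  by rewrite (negbTE l0) mulr0 mul0r.
have U i : ip (jmat X i (ordS i)) (jmat Y i (ordS i)) =
    \sum_l X.2 (ord_pred i) l * Y.2 (ord_pred i) l.
  apply: eq_bigr => l _; rewrite !mxE.
  have -> : (i == ordS i) = false by move: i; case=> [[|[|[|]]]].
  by rewrite eqxx !mxE.
have V i : ip (jmat X (ordS i) i) (jmat Y (ordS i) i) =
    \sum_l X.2 (ord_pred i) l * Y.2 (ord_pred i) l.
  by rewrite -!(jmat_conj _ i) ip_conj U.
pose i0 : 'I_3 := inord 0; pose i1 : 'I_3 := inord 1; pose i2 : 'I_3 := inord 2.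
have big3 (f : 'I_3 -> F) : \sum_i f i = f i0 + f i1 + f i2.
  rewrite !big_ord_recl big_ord0 addr0 addrA.
  by congr (f _ + f _ + f _); apply: val_inj; rewrite /= inordK.
rewrite S !big3.
move: (U i0) (U i1) (U i2) (V i0) (V i1) (V i2) (D i0) (D i1) (D i2).
have -> : ordS i0 = i1 by apply: val_inj; rewrite /= !inordK.
have -> : ordS i1 = i2 by apply: val_inj; rewrite /= !inordK.
have -> : ordS i2 = i0 by apply: val_inj; rewrite /= !inordK.
have -> : ord_pred i0 = i2 by apply: val_inj; rewrite /= !inordK.
have -> : ord_pred i1 = i0 by apply: val_inj; rewrite /= !inordK.
have -> : ord_pred i2 = i1 by apply: val_inj; rewrite /= !inordK.
by do 9 move->; ring.
Qed.

Lemma jdotEk (X : jord) k : jdot X (jEk F k) = X.1 0 k.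
Proof.
rewrite jdotE /= (bigD1 k) //= big1 => [|j jk]; last first.
  by rewrite mxE (negbTE jk) andbF mulr0.
rewrite big1 => [|j _]; last by rewrite big1 // => l _; rewrite mxE mulr0.
by rewrite mxE !eqxx !(mulr0,addr0,mulr1).
Qed.

Lemma jdotFk (X : jord) k (l : 'I_8) :
  jdot X (jFk k (oct_e F l)) = 2 * X.2 k l.
Proof.
rewrite jdotE /= big1 ?add0r => [|j _]; last by rewrite mxE mulr0.
congr (_ * _); rewrite (bigD1 k) //= [X in _ + X]big1 ?addr0 => [|j jk]; last first.
  by rewrite big1 // => i _; rewrite mxE (negbTE jk) mulr0.
rewrite (bigD1 l) //= big1 ?addr0 => [|i il]; last first.
  by rewrite !mxE eqxx (negbTE il : (i == l :> nat) = false) mulr0.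
by rewrite !mxE !eqxx mulr1.
Qed.

Lemma jord_decomp (X : jord) : X = \sum_k X.1 0 k *: jEk F k +
  \sum_k \sum_(l < 8) X.2 k l *: jFk k (oct_e F l).
Proof.
apply: jord_eq => [k|k l].
  rewrite raddfD /= !(raddf_sum (@fst _ _)) /= !mxE !summxE.
  rewrite (bigD1 k) //= big1 => [|j jk]; last first.
    by rewrite !mxE eq_sym (negbTE jk) andbF mulr0.
  rewrite big1 => [|j _]; last first.
    rewrite raddf_sum summxE big1 // => l _.
    by rewrite !mxE mulr0.
  by rewrite !mxE !eqxx mulr1 !addr0.
rewrite raddfD /= !(raddf_sum (@snd _ _)) /= !mxE !summxE.
rewrite big1 ?add0r => [|j _]; last by rewrite !mxE mulr0.
rewrite (bigD1 k) //= [X in _ + X]big1 ?addr0 => [|j jk]; last first.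
  rewrite raddf_sum summxE big1 // => i _.
  by rewrite !mxE eq_sym (negbTE jk) mulr0.
rewrite raddf_sum summxE (bigD1 l) //= big1 ?addr0 => [|j jl]; last first.
  by rewrite !mxE eqxx eq_sym (negbTE jl : (j == l :> nat) = false) mulr0.
by rewrite !mxE !eqxx mulr1.
Qed.

End JordanLinear.

Section E6E7.
Context (F : numFieldType).

Notation oct := 'rV[F]_8.
Notation jord := (jord F).

HB.instance Definition _ (T : jord) :=
  GRing.isLinear.Build F jord jord *:%R (jmul T)
    (fun a X Y => jmul_linr T a X Y).

(* T~ *)
Definition jmult (T : jord) : 'End(jord) := linfun (jmul T).

Definition lie (U : vectType F) (f g : 'End(U)) : 'End(U) :=
  ((f \o g) - (g \o f))%VF.

Definition f4 : set 'End(jord) :=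
  [set D | forall X Y, D (jmul X Y) = jmul (D X) Y + jmul X (D Y)].

Definition e6 : set 'End(jord) :=
  [set phi | exists D T, [/\ f4 D, jtr T = 0 & phi = D + jmult T]].

(* The transpose for jdot, read off on the orthogonal basis E_k, F_k(e_l)
   (norms 1 and 2). *)
Definition jtransp_fun (phi : 'End(jord)) (Y : jord) : jord :=
  (\row_k jdot (phi (jEk F k)) Y,
   \matrix_(k < 3, l < 8) (jdot (phi (jFk k (oct_e F l))) Y / 2)).

Lemma jlin1 a (U V : jord) k : (a *: U + V).1 0 k = a * U.1 0 k + V.1 0 k.
Proof. by rewrite !mxE. Qed.

Lemma jlin2 a (U V : jord) k l : (a *: U + V).2 k l = a * U.2 k l + V.2 k l.
Proof. by rewrite !mxE. Qed.

Lemma jtransp_fun1 phi Y k : (jtransp_fun phi Y).1 0 k = jdot (phi (jEk F k)) Y.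
Proof. exact: mxE. Qed.

Lemma jtransp_fun2 phi Y k l :
  (jtransp_fun phi Y).2 k l = jdot (phi (jFk k (oct_e F l))) Y / 2.
Proof. exact: mxE. Qed.

Lemma jtransp_linear phi : linear (jtransp_fun phi).
Proof.
move=> a X Y; apply: jord_eq => [k|k l].
  by rewrite [RHS]jlin1 !jtransp_fun1 jdot_linr.
by rewrite [RHS]jlin2 !jtransp_fun2 jdot_linr mulrDl mulrA.
Qed.

HB.instance Definition _ phi :=
  GRing.isLinear.Build F jord jord *:%R (jtransp_fun phi) (jtransp_linear phi).

Definition jtransp (phi : 'End(jord)) : 'End(jord) := linfun (jtransp_fun phi).

Lemma jtranspP (phi : 'End(jord)) X Y : jdot (phi X) Y = jdot X (jtransp phi Y).
Proof.
have dotl Z (g : jord -> F) : (forall a U V, g (a *: U + V) = a * g U + g V) ->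
    g Z = \sum_k Z.1 0 k * g (jEk F k) +
      \sum_k \sum_(l < 8) Z.2 k l * g (jFk k (oct_e F l)).
  move=> gl.
  have g0 : g 0 = 0.
    by have := gl (-1) 0 0; rewrite scaler0 addr0 mulN1r addNr.
  have gD U V : g (U + V) = g U + g V by have := gl 1 U V; rewrite scale1r mul1r.
  have gZ a U : g (a *: U) = a * g U by have := gl a U 0; rewrite addr0 g0 addr0.
  rewrite {1}(jord_decomp Z) gD !(big_morph g gD g0).
  congr (_ + _); apply: eq_bigr => k _; first by rewrite gZ.
  by rewrite (big_morph g gD g0); apply: eq_bigr => l _; rewrite gZ.
rewrite (dotl X (fun X => jdot (phi X) Y)); last first.
  by move=> a U V; rewrite linearP jdot_linl.
rewrite jdotE mulr_sumr; congr (_ + _).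
  by apply: eq_bigr => k _; rewrite lfunE /= mxE.
apply: eq_bigr => k _; rewrite mulr_sumr; apply: eq_bigr => l _.
by rewrite lfunE /= mxE mulrCA [2 * _]mulrC divfK // pnatr_eq0.
Qed.

Definition freud : vectType F := (jord * jord * F^o * F^o)%type.

Definition Phi_fun (phi : 'End(jord)) (A B : jord) (nu : F) (P : freud) : freud :=
  let: (X, Y, xi, eta) := P in
  (phi X - (nu / 3) *: X + 2 *: jcross B Y + eta *: A,
   2 *: jcross A X - jtransp phi Y + (nu / 3) *: Y + xi *: B,
   jdot A Y + nu * xi,
   jdot B X - nu * eta).

Lemma Phi_linear phi A B nu : linear (Phi_fun phi A B nu).
Proof.
move=> a [[[X Y] xi] eta] [[[X' Y'] xi'] eta'].
have pE : phi (a *: X + X') = a *: phi X + phi X' by exact: linearP.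
have tE : jtransp phi (a *: Y + Y') = a *: jtransp phi Y + jtransp phi Y'.
  exact: linearP.
rewrite /Phi_fun /= pE tE !jcross_linr !jdot_linr {pE tE}.
move: (jtransp phi Y) (jtransp phi Y') (phi X) (phi X') => tY tY' pX pX'.
move: (jcross B Y) (jcross B Y') (jcross A X) (jcross A X') => c1 c2 c3 c4.
move: (jdot A Y) (jdot A Y') (jdot B X) (jdot B X') => d1 d2 d3 d4.
congr (_, _, _, _).
- by apply: jord_eq => [k|k l] /=; rewrite !mxE /GRing.scale /=; ring.
- by apply: jord_eq => [k|k l] /=; rewrite !mxE /GRing.scale /=; ring.
- by rewrite /= /GRing.scale /=; ring.
- by rewrite /= /GRing.scale /=; ring.
Qed.

HB.instance Definition _ phi A B nu :=
  GRing.isLinear.Build F freud freud *:%R (Phi_fun phi A B nu)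
    (Phi_linear phi A B nu).

Definition Phi phi A B nu : 'End(freud) := linfun (Phi_fun phi A B nu).

Lemma PhiE phi A B nu P : Phi phi A B nu P = Phi_fun phi A B nu P.
Proof. exact: lfunE. Qed.

Definition e7 : {vspace 'End(freud)} :=
  vspace_of [set f | exists phi A B nu, e6 phi /\ f = Phi phi A B nu].

Definition jvee (X W : jord) : 'End(jord) :=
  lie (jmult X) (jmult W) + jmult (jmul X W - (jdot X W / 3) *: jE F).

(* P x Q *)
Definition fcross (P Q : freud) : 'End(freud) :=
  let: (X, Y, xi, eta) := P in
  let: (Z, W, zeta, omega) := Q in
  Phi (- 2^-1 *: (jvee X W + jvee Z Y))
      (- 4^-1 *: (2 *: jcross Y W - xi *: Z - zeta *: X))
      (4^-1 *: (2 *: jcross X Z - eta *: W - omega *: Y))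
      (8^-1 * (jdot X W + jdot Z Y - 3 * (xi * omega + zeta * eta))).

(* {P, Q} *)
Definition fskew (P Q : freud) : F :=
  let: (X, Y, xi, eta) := P in
  let: (Z, W, zeta, omega) := Q in
  jdot X W - jdot Z Y + xi * omega - zeta * eta.

Lemma e6_lin a phi psi : e6 phi -> e6 psi -> e6 (a *: phi + psi).
Proof.
case=> [D [T [HD HT ->]]] [D' [T' [HD' HT' ->]]].
exists (a *: D + D'), (a *: T + T'); split.
- move=> X Y; rewrite !lfunE /= !lfunE /= HD HD' jmul_linl jmul_linr.
  by rewrite scalerDr addrACA.
- by rewrite jtr_lin HT HT' mulr0 addr0.
- apply/lfunP => X; rewrite !lfunE /= !lfunE /= !lfunE /= !lfunE /=.
  by rewrite jmul_linl scalerDr addrACA.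
Qed.

Lemma jtransp_lin a phi psi Y :
  jtransp (a *: phi + psi) Y = a *: jtransp phi Y + jtransp psi Y.
Proof.
have E (W : jord) : (a *: phi + psi) W = a *: phi W + psi W.
  by rewrite add_lfunE scale_lfunE.
have T chi : jtransp chi Y = jtransp_fun chi Y by exact: lfunE.
rewrite [LHS]T; have -> := T phi; have -> := T psi.
apply: jord_eq => [k|k l].
  by rewrite [RHS]jlin1 !jtransp_fun1 E jdot_linl.
by rewrite [RHS]jlin2 !jtransp_fun2 E jdot_linl mulrDl mulrA.
Qed.

Lemma Phi_lin a phi A B nu phi' A' B' nu' :
  a *: Phi phi A B nu + Phi phi' A' B' nu' =
  Phi (a *: phi + phi') (a *: A + A') (a *: B + B') (a * nu + nu').
Proof.
apply/lfunP => -[[[X Y] xi] eta]; rewrite add_lfunE scale_lfunE !PhiE.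
have pE : (a *: phi + phi') X = a *: phi X + phi' X.
  by rewrite add_lfunE scale_lfunE.
rewrite /Phi_fun jtransp_lin !jcross_linl !jdot_linl pE {pE}.
move: (jtransp phi Y) (jtransp phi' Y) (phi X) (phi' X) => tY tY' pX pX'.
move: (jcross B Y) (jcross B' Y) (jcross A X) (jcross A' X) => c1 c2 c3 c4.
move: (jdot A Y) (jdot A' Y) (jdot B X) (jdot B' X) => d1 d2 d3 d4.
congr (_, _, _, _).
- by apply: jord_eq => [k|k l] /=; rewrite !mxE /GRing.scale /=; ring.
- by apply: jord_eq => [k|k l] /=; rewrite !mxE /GRing.scale /=; ring.
- by rewrite /= /GRing.scale /=; ring.
- by rewrite /= /GRing.scale /=; ring.
Qed.

Lemma e7P f : f \in e7 <-> exists phi A B nu, e6 phi /\ f = Phi phi A B nu.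
Proof.
have E0 : e6 0.
  exists 0, 0; split.
  - by move=> X Y; rewrite !lfunE /= (_ : jmul 0 Y = 0) ?linear0 ?addr0 // jmulC linear0.
  - by rewrite /jtr big1 // => k _; rewrite mxE.
  - rewrite add0r; apply/lfunP => X; rewrite !lfunE /=.
    by rewrite jmulC linear0.
rewrite /e7; apply: (@vspace_ofP _ _ [set f | _]) => /=.
  exists 0, 0, 0, 0; split => //.
  have := Phi_lin (-1) 0 0 0 0 0 0 0 0.
  by rewrite scaleN1r addNr !scaleN1r !oppr0 !addr0 mulr0.
move=> a u v [phi [A [B [nu [H ->]]]]] [phi' [A' [B' [nu' [H' ->]]]]].
exists (a *: phi + phi'), (a *: A + A'), (a *: B + B'), (a * nu + nu').
by split; [exact: e6_lin | exact: Phi_lin].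
Qed.

End E6E7.

Section E8.
Context (F : numFieldType).

Notation freud := (freud F).
Notation e7 := (e7 F).

Definition e8 : vectType F :=
  (subvs_of e7 * freud * freud * F^o * F^o * F^o)%type.

(* Here and below vsproj e7 is applied to elements of e7 (in E7_E8_fun, when b is
   in E_7): it just turns them into elements of the type subvs_of e7. *)
Definition bracket (R1 R2 : e8) : e8 :=
  let: (f1, P1, Q1, r1, s1, t1) := R1 in
  let: (f2, P2, Q2, r2, s2, t2) := R2 in
  (vsproj e7 (lie (vsval f1) (vsval f2) + fcross P1 Q2 - fcross P2 Q1),
   vsval f1 P2 - vsval f2 P1 + r1 *: P2 - r2 *: P1 + s1 *: Q2 - s2 *: Q1,
   vsval f1 Q2 - vsval f2 Q1 - r1 *: Q2 + r2 *: Q1 + t1 *: P2 - t2 *: P1,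
   - (8^-1 * fskew P1 Q2) + 8^-1 * fskew P2 Q1 + s1 * t2 - s2 * t1,
   4^-1 * fskew P1 P2 + 2 * r1 * s2 - 2 * r2 * s1,
   - (4^-1 * fskew Q1 Q2) - 2 * r1 * t2 + 2 * r2 * t1).

Definition killing (R1 R2 : e8) : F :=
  endo_trace (fun R => bracket R1 (bracket R2 R)).

Definition E8 : set 'End(e8) :=
  [set alpha : 'End(e8) | bijective alpha /\ forall R R',
     alpha (bracket R R') = bracket (alpha R) (alpha R')].

Definition one_minus : e8 := (0, 0, 0, 0, 0, 1).

Definition W8 : set e8 :=
  [set R | (forall R1, bracket R (bracket R R1) + (killing R R1 / 30) *: R = 0)
           /\ R != 0].

(* The inclusions of F_4 in E_7 and of E_7 in E_8. *)
Definition F4_E7_fun (a : 'End(jord F)) (P : freud) : freud :=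
  let: (X, Y, xi, eta) := P in (a X, a Y, xi, eta).

Lemma F4_E7_linear a : linear (F4_E7_fun a).
Proof.
by move=> k [[[X Y] xi] eta] [[[X' Y'] xi'] eta']; rewrite /= !linearP.
Qed.

HB.instance Definition _ a :=
  GRing.isLinear.Build F freud freud *:%R (F4_E7_fun a) (F4_E7_linear a).

Definition F4_E7 a : 'End(freud) := linfun (F4_E7_fun a).

Definition E7_E8_fun (b : 'End(freud)) (R : e8) : e8 :=
  let: (f, P, Q, r, s, t) := R in
  (vsproj e7 (b \o vsval f \o b^-1)%VF, b P, b Q, r, s, t).

Lemma E7_E8_linear b : linear (E7_E8_fun b).
Proof.
move=> k [[[[[f P] Q] r] s] t] [[[[[f' P'] Q'] r'] s'] t'].
have E : (b \o vsval (k *: f + f') \o b^-1 =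
    k *: (b \o vsval f \o b^-1) + (b \o vsval f' \o b^-1))%VF.
  rewrite linearP; apply/lfunP => x.
  by rewrite !(comp_lfunE, add_lfunE, scale_lfunE) linearP.
have EP : b (k *: P + P') = k *: b P + b P' by exact: linearP.
have EQ : b (k *: Q + Q') = k *: b Q + b Q' by exact: linearP.
have EV U V : vsproj e7 (k *: U + V) = k *: vsproj e7 U + vsproj e7 V.
  exact: linearP.
rewrite /E7_E8_fun /= E EP EQ EV {E EP EQ EV}.
move: (b P) (b P') (b Q) (b Q') => bP bP' bQ bQ'.
move: (vsproj e7 (b \o vsval f \o b^-1)%VF) => g.
by move: (vsproj e7 (b \o vsval f' \o b^-1)%VF) => g'.
Qed.

HB.instance Definition _ b :=
  GRing.isLinear.Build F e8 e8 *:%R (E7_E8_fun b) (E7_E8_linear b).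

Definition E7_E8 b : 'End(e8) := linfun (E7_E8_fun b).

Definition sigma4_fun (X : jord F) : jord F :=
  (X.1, \matrix_(k < 3)
     if k == 0 then - oct_mul (oct_mul (oct_e F 1) (row k X.2)) (oct_e F 1)
     else if k == 1 then oct_mul (oct_e F 1) (row k X.2)
     else - oct_mul (row k X.2) (oct_e F 1)).

Lemma sigma4_linear : linear sigma4_fun.
Proof.
move=> a X Y; congr pair; apply/row_matrixP => k.
rewrite !linearP /= !rowK linearP.
case: ifP => _; first by rewrite oct_mulPr oct_mulPl opprD scalerN.
by case: ifP => _; rewrite ?oct_mulPr // oct_mulPl opprD scalerN.
Qed.

HB.instance Definition _ :=
  GRing.isLinear.Build F (jord F) (jord F) *:%R sigma4_fun sigma4_linear.

Definition sigma4 : 'End(e8) := E7_E8 (F4_E7 (linfun sigma4_fun)).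

Definition so6 : set 'End(jord F) :=
  [set D | [/\ f4 D, forall k, D (jEk F k) = 0
             & D (jFk 0 (oct_e F 0)) = 0 /\ D (jFk 0 (oct_e F 1)) = 0]].

Definition R_D (D : 'End(jord F)) : e8 :=
  (vsproj e7 (Phi D 0 0 0), 0, 0, 0, 0, 0).

Definition E8_sigma4_so6 : set 'End(e8) :=
  [set alpha : 'End(e8) | [/\ E8 alpha, (sigma4 \o alpha = alpha \o sigma4)%VF
    & forall D, so6 D -> forall R,
        bracket (R_D D) (alpha R) = alpha (bracket (R_D D) R)]].

Definition E8_sigma4_so6_stab : set 'End(e8) :=
  [set alpha : 'End(e8) | E8_sigma4_so6 alpha /\ alpha one_minus = one_minus].

Definition W8_sigma4_so6 : set e8 :=
  [set R | [/\ W8 R, sigma4 R = R & forall D, so6 D -> bracket (R_D D) R = 0]].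

End E8.

Arguments E8_sigma4_so6 F : clear implicits.
Arguments E8_sigma4_so6_stab F : clear implicits.
Arguments W8_sigma4_so6 F : clear implicits.

(* Smooth manifolds are handled as spaces with a sheaf of smooth real
   functions: smooth_on O f means that f is of class C^oo on the open set O.
   A diffeomorphism is a homeomorphism that identifies the sheaves. *)
Section Smooth.
Context (R : realType).

Fixpoint Cn (N n : nat) (U : set 'rV[R]_N) (f : 'rV[R]_N -> R^o) : Prop :=
  match n with
  | 0%N => forall x, U x -> {for x, continuous f}
  | m.+1 => forall v, (forall x, U x -> derivable f x v) /\
                      Cn m U (fun x => 'D_v f x)
  end.

Definition Coo (N : nat) (U : set 'rV[R]_N) (f : 'rV[R]_N -> R^o) : Prop :=
  forall n, Cn n U f.

Record smooth_space := SmoothSpace {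
  carrier :> Type;
  is_open : set carrier -> Prop;
  smooth_on : set carrier -> (carrier -> R) -> Prop }.

Definition diffeomorphic (X Y : smooth_space) : Prop :=
  exists f : X -> Y, [/\ bijective f,
    forall O : set Y, is_open (f @^-1` O) <-> is_open O
    & forall (O : set Y) (g : Y -> R), is_open O ->
        smooth_on (f @^-1` O) (g \o f) <-> smooth_on O g].

(* The real coordinates of a complex vector space. *)
Definition realify (V : vectType R[i]) (v : V) : 'rV[R]_(dim V + dim V) :=
  row_mx (map_mx (@complex.Re R) (v2r v)) (map_mx (@complex.Im R) (v2r v)).

(* A subset of V with the structure induced by V; this is the manifold structure
   when the subset is an embedded submanifold. *)
Definition sub_space (V : vectType R[i]) (A : set V) : smooth_space :=
  @SmoothSpace {v : V | A v}
    (fun O => exists2 U, open U & O = [set v | U (realify (sval v))])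
    (fun O f => forall x, O x -> exists U g,
       [/\ open U, U (realify (sval x)), Coo U g
         & forall y, O y -> U (realify (sval y)) -> f y = g (realify (sval y))]).

(* For a quotient manifold (p a surjective submersion), a function on an open
   set O is smooth iff its pullback to p^-1(O) is. *)
Definition quotient_space (X : smooth_space) (Y : Type) (p : X -> Y) :
    smooth_space :=
  @SmoothSpace Y (fun O => is_open (p @^-1` O))
    (fun O f => smooth_on (p @^-1` O) (f \o p)).

Definition lcoset (V : vectType R[i]) (H : set 'End(V)) (a : 'End(V)) :
    set 'End(V) := [set (a \o b)%VF | b in H].

Definition coset_of_set (V : vectType R[i]) (G H : set 'End(V)) : Type :=
  {C : set 'End(V) | exists2 a, G a & C = lcoset H a}.

Definition coset_proj (V : vectType R[i]) (G H : set 'End(V))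
    (a : {a | G a}) : coset_of_set G H :=
  exist _ (lcoset H (sval a)) (ex_intro2 _ _ (sval a) (svalP a) erefl).

(* G / H *)
Definition homogeneous_space (V : vectType R[i]) (G H : set 'End(V)) :
    smooth_space :=
  @quotient_space (sub_space G) _ (@coset_proj V G H).

End Smooth.

(* Main.v *)
From HB Require Import structures.
Require Import Defs.
From mathcomp Require Import all_boot all_order all_algebra.
From mathcomp Require Import all_classical all_reals all_analysis.
From mathcomp Require Import complex ring.
Set Implicit Arguments.
Unset Strict Implicit.
Unset Printing Implicit Defensive.
Import Order.TTheory GRing.Theory Num.Theory.
Import numFieldNormedType.Exports VectorInternalTheory.
Local Open Scope classical_set_scope.
Local Open Scope ring_scope.

(* Let k be the subalgebra of e8 fixed by sigma'_4 and centralised by so(6), and G0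
   the group generated by the exp(ad x), with x in k and ad x nilpotent.
   If the last coordinate t of R = (Phi, P, Q, r, s, t) in W' is nonzero, the
   exponentials of (0, Q/t, 0, 0, 0, 0) and of a multiple of 1^- = (0, 0, 0, 0, 1, 0)
   remove Q and r; the quadratic equations R x R = 0 leave only t 1_-, and a torus
   given by four exponentials turns it into 1_-. This element of G0 depends
   rationally on R.  If t vanished on the whole G0-orbit of R, then R would lie in the
   image of so(6) and centralise so(6), hence be 0. So G0 is transitive on W' and the
   orbit map G -> W' has local smooth sections: G/G_{1_-} -> W' is a diffeomorphism.
   Moreover G = G0: modulo G0 an element of G fixes successively 1_-, 1^-, the two
   scalar directions of P^C, the idempotents E_k and the F_1(e_0), F_1(e_1); what
   remains is a finite group of signs, realised by tori in G0. Every generator of G0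
   lies on the polynomial path exp(t ad x), so G is connected. *)

(** Every group element used is a finite product of polynomial automorphisms, so membership in the
    group, rational dependence on [R] and paths to the identity are all read off from truncated
    exponential series. The closure of e_6 and e_7 and the Jacobi identity of e_8 rest on the
    symmetric cubic form [(X, Y x Z)] and on its adjoint identity [X## = det(X) X], spread by
    polarisation. The so(6)-invariants of the Jordan algebra are spanned by E_k, F_1(e_0), F_1(e_1);
    on this five-dimensional space all the normalisations take place. Reaching [t != 0] is
    nonlinear, but the set of points whose orbit misses it is stable under brackets, since a
    polynomial that vanishes identically has zero linear coefficient; the question becomes linear
    algebra. Connectedness comes from generation by exponentials. The delicate case there is a map
    that fixes e_0, negates e_1 and is a sign on e_2, ..., e_7: it has determinant -1 on the
    octonions, and triality excludes it. Square roots and ['i] enter only at the end, to adjust the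
    scalars left over on the frame. *)

(** * Octonion identities in coordinates *)

Section OctonionIdentities.
Context (F : numFieldType).

Notation oct := 'rV[F]_8.
Local Notation conj := (@oct_conj F).
Local Notation "x ** y" := (@oct_mul F x y) (at level 40, left associativity).

Definition oip (x y : oct) : F := \sum_i x 0 i * y 0 i.

(** With the eight coordinates explicit, an octonion identity becomes eight polynomial identities
    for [ring]. *)
Definition oct8 a0 a1 a2 a3 a4 a5 a6 a7 : oct :=
  \row_(i < 8) [:: a0; a1; a2; a3; a4; a5; a6; a7]`_i.

Lemma oct8_ind (P : oct -> Prop) :
  (forall a0 a1 a2 a3 a4 a5 a6 a7, P (oct8 a0 a1 a2 a3 a4 a5 a6 a7)) -> forall x, P x.
Proof.
move=> H x; suff -> : x = oct8 (x 0 (inord 0)) (x 0 (inord 1)) (x 0 (inord 2)) (x 0 (inord 3)) (x 0 (inord 4)) (x 0 (inord 5)) (x 0 (inord 6)) (x 0 (inord 7)) by [].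
apply/rowP => -[[|[|[|[|[|[|[|[|]]]]]]]] //= ?]; rewrite mxE /=; congr (x _ _);
  by apply: val_inj; rewrite /= inordK.
Qed.

Lemma oct8_mul a0 a1 a2 a3 a4 a5 a6 a7 b0 b1 b2 b3 b4 b5 b6 b7 :
  oct8 a0 a1 a2 a3 a4 a5 a6 a7 ** oct8 b0 b1 b2 b3 b4 b5 b6 b7 = oct8
    (a0 * b0 - a1 * b1 - a2 * b2 - a3 * b3 - a4 * b4 - a5 * b5 - a6 * b6 - a7 * b7)
    (a0 * b1 + a1 * b0 + a2 * b3 - a3 * b2 + a4 * b5 - a5 * b4 + a6 * b7 - a7 * b6)
    (a0 * b2 - a1 * b3 + a2 * b0 + a3 * b1 - a4 * b6 + a5 * b7 + a6 * b4 - a7 * b5)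
    (a0 * b3 + a1 * b2 - a2 * b1 + a3 * b0 + a4 * b7 + a5 * b6 - a6 * b5 - a7 * b4)
    (a0 * b4 - a1 * b5 + a2 * b6 - a3 * b7 + a4 * b0 + a5 * b1 - a6 * b2 + a7 * b3)
    (a0 * b5 + a1 * b4 - a2 * b7 - a3 * b6 - a4 * b1 + a5 * b0 + a6 * b3 + a7 * b2)
    (a0 * b6 - a1 * b7 - a2 * b4 + a3 * b5 + a4 * b2 - a5 * b3 + a6 * b0 + a7 * b1)
    (a0 * b7 + a1 * b6 + a2 * b5 + a3 * b4 - a4 * b3 - a5 * b2 - a6 * b1 + a7 * b0)
.
Proof.
apply/rowP => -[k Hk]; rewrite !mxE.
do 8 (case: k Hk => [|k] Hk //; first by
  rewrite !big_ord_recl !big_ord0 !mxE /oct_coef /=; ring).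
Qed.

Lemma oct8_conj a0 a1 a2 a3 a4 a5 a6 a7 :
  conj (oct8 a0 a1 a2 a3 a4 a5 a6 a7) = oct8 a0 (- a1) (- a2) (- a3) (- a4) (- a5) (- a6) (- a7).
Proof.
by apply/rowP => -[[|[|[|[|[|[|[|[|]]]]]]]] //= ?]; rewrite !mxE.
Qed.

Lemma oct8D a0 a1 a2 a3 a4 a5 a6 a7 b0 b1 b2 b3 b4 b5 b6 b7 : oct8 a0 a1 a2 a3 a4 a5 a6 a7 + oct8 b0 b1 b2 b3 b4 b5 b6 b7 =
  oct8 (a0 + b0) (a1 + b1) (a2 + b2) (a3 + b3) (a4 + b4) (a5 + b5) (a6 + b6) (a7 + b7).
Proof. by apply/rowP => -[[|[|[|[|[|[|[|[|]]]]]]]] //= ?]; rewrite !mxE. Qed.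

Lemma oct8N a0 a1 a2 a3 a4 a5 a6 a7 : - oct8 a0 a1 a2 a3 a4 a5 a6 a7 =
  oct8 (- a0) (- a1) (- a2) (- a3) (- a4) (- a5) (- a6) (- a7).
Proof. by apply/rowP => -[[|[|[|[|[|[|[|[|]]]]]]]] //= ?]; rewrite !mxE. Qed.

Lemma oct8Z c a0 a1 a2 a3 a4 a5 a6 a7 : c *: oct8 a0 a1 a2 a3 a4 a5 a6 a7 =
  oct8 (c * a0) (c * a1) (c * a2) (c * a3) (c * a4) (c * a5) (c * a6) (c * a7).
Proof. by apply/rowP => -[[|[|[|[|[|[|[|[|]]]]]]]] //= ?]; rewrite !mxE. Qed.

Lemma oct8_e (k : nat) : oct_e F k =
  oct8 (0 == k)%N%:R (1 == k)%N%:R (2 == k)%N%:R (3 == k)%N%:R (4 == k)%N%:R (5 == k)%N%:R (6 == k)%N%:R (7 == k)%N%:R.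
Proof. by apply/rowP => -[[|[|[|[|[|[|[|[|]]]]]]]] //= ?]; rewrite !mxE. Qed.

Lemma oct8_ip a0 a1 a2 a3 a4 a5 a6 a7 b0 b1 b2 b3 b4 b5 b6 b7 : oip (oct8 a0 a1 a2 a3 a4 a5 a6 a7) (oct8 b0 b1 b2 b3 b4 b5 b6 b7) =
  a0 * b0 + a1 * b1 + a2 * b2 + a3 * b3 + a4 * b4 + a5 * b5 + a6 * b6 + a7 * b7.
Proof. by rewrite /oip !big_ord_recl big_ord0 !mxE /= addr0 !addrA. Qed.

Definition oct8E := (oct8_conj, oct8_mul, oct8N, oct8D, oct8Z, oct8_ip).

Lemma oct_mul1 x : oct_e F 0 ** x = x.
Proof. by elim/oct8_ind: x => *; rewrite oct8_e /= oct8E; congr oct8; ring. Qed.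

Lemma oct_mulr1 x : x ** oct_e F 0 = x.
Proof. by elim/oct8_ind: x => *; rewrite oct8_e /= oct8E; congr oct8; ring. Qed.

Lemma oip_conj x y : oip (conj x) (conj y) = oip x y.
Proof.
by elim/oct8_ind: x => *; elim/oct8_ind: y => *; rewrite !oct8E; ring.
Qed.

(** Both sides are the real part of a triple product, which is independent of the bracketing and
    invariant under cyclic permutation. *)
Lemma oip_conj_mulC x y z : oip (conj (x ** y)) z = oip (conj (y ** z)) x.
Proof.
by elim/oct8_ind: x => *; elim/oct8_ind: y => *; elim/oct8_ind: z => *;
  rewrite !oct8E; ring.
Qed.

Lemma oct_conj_mulK x y : conj x ** (x ** y) = oip x x *: y.
Proof.
elim/oct8_ind: x => *; elim/oct8_ind: y => *; rewrite !oct8E; congr oct8; ring.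
Qed.

(** The middle Moufang identity [(xy)(zx) = x(yz)x], with [x w x] expanded through the inner
    product; the adjoint identity of the Jordan algebra needs it in this form. *)
Lemma oct_moufang x y z : (x ** y) ** (z ** x) =
  (2 * oip (conj (y ** z)) x) *: x - oip x x *: conj (y ** z).
Proof.
elim/oct8_ind: x => *; elim/oct8_ind: y => *; elim/oct8_ind: z => *.
rewrite !oct8E; congr oct8; ring.
Qed.

End OctonionIdentities.

(** * Coordinates of vectors and comparison of polynomial coefficients *)

Section VectorCoordinates.
Context (F : fieldType) (V : vectType F).
Implicit Types u v : V.

Definition vco u i : F := v2r u 0 i.

Lemma vco_eq u v : (forall i, vco u i = vco v i) -> u = v.
Proof.
by move=> H; apply: (can_inj (@v2rK _ V)); apply/rowP => i; exact: H.
Qed.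

Lemma vcoD u v i : vco (u + v) i = vco u i + vco v i.
Proof. by rewrite /vco linearD mxE. Qed.
Lemma vcoN u i : vco (- u) i = - vco u i.
Proof. by rewrite /vco linearN mxE. Qed.
Lemma vcoZ a u i : vco (a *: u) i = a * vco u i.
Proof. by rewrite /vco linearZ mxE. Qed.
Lemma vco0 i : vco 0 i = 0.
Proof. by rewrite /vco linear0 mxE. Qed.
Definition vcoE := (vcoD, vcoN, vcoZ, vco0).

End VectorCoordinates.

(* Decides equality of two linear combinations of vectors, read on coordinates. *)
Ltac vring := apply: vco_eq => ?; rewrite !vcoE; ring.
Ltac vfield := apply: vco_eq => ?; rewrite !vcoE; field => //.

Section Polynomial.
Context (F : numFieldType).

(** In characteristic zero the first [size p] natural numbers are distinct roots, more than a
    nonzero [p] can have. *)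
Lemma poly_nat_roots (p : {poly F}) : (forall t, p.[t] = 0) -> p = 0.
Proof.
move=> H; apply/eqP/negP => /negP p0.
have := @max_poly_roots _ p [seq i%:R | i <- iota 0 (size p)] p0.
have -> : all (root p) [seq i%:R | i <- iota 0 (size p)].
  by apply/allP => x _; apply/rootP; exact: H.
rewrite map_inj_uniq ?iota_uniq; last exact: (mulrIn (oner_neq0 F)).
by rewrite size_map size_iota ltnn => /(_ erefl erefl).
Qed.

(** Comparison of coefficients with values in a vector space. It serves both for linearising
    identities and for passing from one-parameter groups to brackets. *)
Lemma vpoly_eq0 (V : vectType F) n (v : nat -> V) :
  (forall t : F, \sum_(i < n) t ^+ i *: v i = 0) -> forall i, (i < n)%N -> v i = 0.
Proof.
move=> H i iN; apply: vco_eq => k; rewrite vco0.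
pose p : {poly F} := \poly_(j < n) vco (v j) k.
have : p = 0.
  apply: poly_nat_roots => t; rewrite horner_poly.
  transitivity (vco (\sum_(i < n) t ^+ i *: v i) k); last by rewrite H vco0.
  rewrite (big_morph (fun u => vco u k) (fun u v => vcoD u v k) (vco0 k)).
  by apply: eq_bigr => j _; rewrite vcoZ mulrC.
by move/polyP/(_ i); rewrite coef_poly iN coef0.
Qed.

Lemma poly_eq0 n (v : nat -> F) :
  (forall t : F, \sum_(i < n) t ^+ i * v i = 0) -> forall i, (i < n)%N -> v i = 0.
Proof. exact: (@vpoly_eq0 F^o). Qed.

End Polynomial.

Section OctonionLinear.
Context (F : numFieldType).
Notation oct := 'rV[F]_8.
Local Notation "x ** y" := (@oct_mul F x y) (at level 40, left associativity).
Implicit Types x y z : oct.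

Lemma oct_mul0l x : 0 ** x = 0.
Proof. by apply/rowP => k; rewrite !mxE big1 // => i _; rewrite big1 // => j _; rewrite mxE mulr0 mul0r. Qed.
Lemma oct_mul0r x : x ** 0 = 0.
Proof. by apply/rowP => k; rewrite !mxE big1 // => i _; rewrite big1 // => j _; rewrite mxE mulr0. Qed.
Lemma oct_mulDl x y z : (x + y) ** z = x ** z + y ** z.
Proof. by rewrite -[x]scale1r oct_mulPl !scale1r. Qed.
Lemma oct_mulDr x y z : z ** (x + y) = z ** x + z ** y.
Proof. by rewrite -[x]scale1r oct_mulPr !scale1r. Qed.
Lemma oct_mulZl a x z : (a *: x) ** z = a *: (x ** z).
Proof. by rewrite -[a *: x]addr0 oct_mulPl oct_mul0l addr0. Qed.
Lemma oct_mulZr a x z : z ** (a *: x) = a *: (z ** x).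
Proof. by rewrite -[a *: x]addr0 oct_mulPr oct_mul0r addr0. Qed.
Lemma oct_mulNl x z : (- x) ** z = - (x ** z).
Proof. by rewrite -scaleN1r oct_mulZl scaleN1r. Qed.
Lemma oct_mulNr x z : z ** (- x) = - (z ** x).
Proof. by rewrite -scaleN1r oct_mulZr scaleN1r. Qed.
Definition oct_mul_lin := (oct_mulDl, oct_mulDr, oct_mulZl, oct_mulZr, oct_mulNl,
  oct_mulNr, oct_mul0l, oct_mul0r).

Lemma oct_conjN x : oct_conj (- x) = - oct_conj x.
Proof. by rewrite -scaleN1r oct_conjZ scaleN1r. Qed.
Lemma oct_conj0 : oct_conj (0 : oct) = 0.
Proof. by rewrite -[X in oct_conj X](scale0r (0 : oct)) oct_conjZ scale0r. Qed.
Definition oct_conj_lin := (oct_conjN, @oct_conjD F, @oct_conjZ F, oct_conj0, @oct_conjK F).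

Lemma oipC x y : oip x y = oip y x.
Proof. by apply: eq_bigr => i _; rewrite mulrC. Qed.
Lemma oipDl x y z : oip (x + y) z = oip x z + oip y z.
Proof. by rewrite /oip -big_split; apply: eq_bigr => i _; rewrite mxE mulrDl. Qed.
Lemma oipDr x y z : oip z (x + y) = oip z x + oip z y.
Proof. by rewrite !(oipC z) oipDl. Qed.
Lemma oipZl a x z : oip (a *: x) z = a * oip x z.
Proof. by rewrite /oip mulr_sumr; apply: eq_bigr => i _; rewrite mxE mulrA. Qed.
Lemma oipZr a x z : oip z (a *: x) = a * oip z x.
Proof. by rewrite !(oipC z) oipZl. Qed.
Lemma oipNl x z : oip (- x) z = - oip x z.
Proof. by rewrite -scaleN1r oipZl mulN1r. Qed.
Lemma oipNr x z : oip z (- x) = - oip z x.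
Proof. by rewrite !(oipC z) oipNl. Qed.
Lemma oip0l x : oip 0 x = 0.
Proof. by rewrite -[X in oip X _](scale0r (0 : oct)) oipZl mul0r. Qed.
Lemma oip0r x : oip x 0 = 0.
Proof. by rewrite oipC oip0l. Qed.
Definition oip_lin := (oipDl, oipDr, oipZl, oipZr, oipNl, oipNr, oip0l, oip0r).

Lemma oct_mul_conjK x y : (y ** x) ** oct_conj x = oip x x *: y.
Proof.
have := oct_conj_mulK (oct_conj x) (oct_conj y); rewrite oct_conjK => H.
by rewrite -[LHS]oct_conjK oct_conj_mul oct_conjK [oct_conj (y ** x)]oct_conj_mul H oip_conj !oct_conj_lin.
Qed.

End OctonionLinear.

(** * The Jordan algebra in coordinates; the adjoint identity *)

Section JordanCoordinates.
Context (F : numFieldType).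
Notation oct := 'rV[F]_8.
Notation jord := (jord F).
Local Notation "x ** y" := (@oct_mul F x y) (at level 40, left associativity).

Definition jmk (a b c : F) (x y z : oct) : jord :=
  (\row_i [:: a; b; c]`_i, \matrix_(i < 3, j < 8) [:: x; y; z]`_i 0 j).

Lemma jord_ind3 (P : jord -> Prop) :
  (forall a b c x y z, P (jmk a b c x y z)) -> forall X, P X.
Proof.
move=> H [d o].
suff -> : (d, o) = jmk (d 0 (inord 0)) (d 0 (inord 1)) (d 0 (inord 2))
    (row (inord 0) o) (row (inord 1) o) (row (inord 2) o) by [].
congr pair.
  apply/rowP => -[[|[|[|]]] //= ?]; rewrite mxE /=; congr (d _ _);
    by apply: val_inj; rewrite /= inordK.
apply/matrixP => -[[|[|[|]]] //= ?] j; rewrite !mxE /=; congr (o _ _);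
  by apply: val_inj; rewrite /= inordK.
Qed.

Lemma jmk_inj a b c x y z a' b' c' x' y' z' :
  jmk a b c x y z = jmk a' b' c' x' y' z' ->
  [/\ [/\ a = a', b = b' & c = c'] & [/\ x = x', y = y' & z = z']].
Proof.
case=> /rowP H /matrixP K; split; split.
- by have := H 0; rewrite !mxE.
- by have := H (inord 1); rewrite !mxE inordK.
- by have := H (inord 2); rewrite !mxE inordK.
- by apply/rowP => j; have := K 0 j; rewrite !mxE.
- by apply/rowP => j; have := K (inord 1) j; rewrite !mxE inordK.
- by apply/rowP => j; have := K (inord 2) j; rewrite !mxE inordK.
Qed.

Lemma jmkD a b c x y z a' b' c' x' y' z' :
  jmk a b c x y z + jmk a' b' c' x' y' z' =
  jmk (a + a') (b + b') (c + c') (x + x') (y + y') (z + z').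
Proof.
congr pair; first by apply/rowP => -[[|[|[|]]] //= ?]; rewrite !mxE.
by apply/matrixP => -[[|[|[|]]] //= ?] j; rewrite !mxE.
Qed.

Lemma jmkZ k a b c x y z :
  k *: jmk a b c x y z = jmk (k * a) (k * b) (k * c) (k *: x) (k *: y) (k *: z).
Proof.
congr pair; first by apply/rowP => -[[|[|[|]]] //= ?]; rewrite !mxE.
by apply/matrixP => -[[|[|[|]]] //= ?] j; rewrite !mxE.
Qed.

Lemma jmkN a b c x y z :
  - jmk a b c x y z = jmk (- a) (- b) (- c) (- x) (- y) (- z).
Proof. by rewrite -scaleN1r jmkZ !scaleN1r !mulN1r. Qed.

Lemma jmk0 : jmk 0 0 0 0 0 0 = 0.
Proof.
congr pair; first by apply/rowP => -[[|[|[|]]] //= ?]; rewrite !mxE.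
by apply/matrixP => -[[|[|[|]]] //= ?] j; rewrite !mxE.
Qed.

Lemma jmk_jE : jE F = jmk 1 1 1 0 0 0.
Proof.
congr pair; first by apply/rowP => -[[|[|[|]]] //= ?]; rewrite !mxE.
by apply/matrixP => -[[|[|[|]]] //= ?] j; rewrite !mxE.
Qed.

Lemma jmk_jEk (k : 'I_3) :
  jEk F k = jmk (k == 0%N :> nat)%:R (k == 1%N :> nat)%:R (k == 2%N :> nat)%:R 0 0 0.
Proof.
congr pair; last by apply/matrixP => -[[|[|[|]]] //= ?] j; rewrite !mxE.
apply/rowP => i; rewrite !mxE /= -val_eqE.
by case: k i => [[|[|[|]]] //= ?] [[|[|[|]]] //= ?].
Qed.

Lemma jmk_jFk (k : 'I_3) x : jFk k x = jmk 0 0 0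
  ((k == 0%N :> nat)%:R *: x) ((k == 1%N :> nat)%:R *: x) ((k == 2%N :> nat)%:R *: x).
Proof.
congr pair; first by apply/rowP => -[[|[|[|]]] //= ?]; rewrite !mxE.
apply/matrixP => i j; rewrite mxE -val_eqE.
by case: k i => [[|[|[|]]] //= ?] [[|[|[|]]] //= ?]; rewrite !mxE /= ?(mul1r, mul0r).
Qed.

Lemma jmk_mul a b c x y z a' b' c' x' y' z' :
  jmul (jmk a b c x y z) (jmk a' b' c' x' y' z') =
  jmk (a * a' + oip y y' + oip z z') (b * b' + oip z z' + oip x x')
      (c * c' + oip x x' + oip y y')
   (2^-1 *: ((b + c) *: x' + (b' + c') *: x + oct_conj (y ** z') + oct_conj (y' ** z)))
   (2^-1 *: ((c + a) *: y' + (c' + a') *: y + oct_conj (z ** x') + oct_conj (z' ** x)))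
   (2^-1 *: ((a + b) *: z' + (a' + b') *: z + oct_conj (x ** y') + oct_conj (x' ** y))).
Proof.
rewrite jmul.unlock.
(* [M] lists the nine matrix entries over natural number indices, so that they reduce by
   computation. On the diagonal only the real part of the product is read. *)
pose M (a b c : F) (x y z : oct) i j : oct := match i, j with
  | 0, 0 => a *: oct_e F 0 | 0, 1 => z | 0, 2 => oct_conj y
  | 1, 0 => oct_conj z | 1, 1 => b *: oct_e F 0 | 1, 2 => x
  | 2, 0 => y | 2, 1 => oct_conj x | 2, 2 => c *: oct_e F 0 | _, _ => 0%R end%N.
have HM a1 b1 c1 x1 y1 z1 (i j : 'I_3) :
    jmat (jmk a1 b1 c1 x1 y1 z1) i j = M a1 b1 c1 x1 y1 z1 i j.
  rewrite mxE; case: i j => [[|[|[|]]] //= ?] [[|[|[|]]] //= ?];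
   rewrite -?val_eqE /= ?mxE //; congr oct_conj || idtac;
   by apply/rowP => l; rewrite !mxE.
have HS i j : jsym_mx (jmk a b c x y z) (jmk a' b' c' x' y' z') i j =
  2^-1 *: (M a b c x y z i 0%N ** M a' b' c' x' y' z' 0%N j +
           M a b c x y z i 1%N ** M a' b' c' x' y' z' 1%N j +
           M a b c x y z i 2%N ** M a' b' c' x' y' z' 2%N j +
          (M a' b' c' x' y' z' i 0%N ** M a b c x y z 0%N j +
           M a' b' c' x' y' z' i 1%N ** M a b c x y z 1%N j +
           M a' b' c' x' y' z' i 2%N ** M a b c x y z 2%N j)).
  by rewrite mxE; congr (_ *: _); rewrite !mxE !big_ord_recl !big_ord0 !addr0 !HM !addrA.
have oip0 (u v : oct) : oct_mul u (oct_conj v) 0 0 = oip u v by exact: oct_mul_conj0.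
have oip0' (u v : oct) : oct_mul (oct_conj u) v 0 0 = oip u v.
  by rewrite -{1}[v]oct_conjK oip0 oip_conj.
have e0 (u v : F) : ((u *: oct_e F 0) ** (v *: oct_e F 0)) 0 0 = u * v.
  by rewrite oct_mulZl oct_mulZr oct_mul1 !mxE /= mulr1.
have addE (u v : oct) : (u + v) 0 0 = u 0 0 + v 0 0 by rewrite mxE.
have sclE t (u : oct) : (t *: u) 0 0 = t * u 0 0 by rewrite mxE.
congr pair.
- apply/rowP => -[[|[|[|]]] //= ?]; rewrite [LHS]mxE [RHS]mxE HS /= sclE !addE;
  rewrite !(oip0, oip0', e0); rewrite !(oipC x' x, oipC y' y, oipC z' z); field => //.
- apply/matrixP => -[[|[|[|]]] //= ?] j; rewrite [LHS]mxE [RHS]mxE HS /=;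
  apply: (congr1 (fun u : oct => (2^-1 *: u) 0 j));
  rewrite !oct_conj_mul !(oct_mulZl, oct_mulZr, oct_mul1, oct_mulr1); vring.
Qed.

Lemma jmk_tr a b c x y z : jtr (jmk a b c x y z) = a + b + c.
Proof. by rewrite /jtr !big_ord_recl big_ord0 !mxE /= addr0 addrA. Qed.

Lemma jmk_dot a b c x y z a' b' c' x' y' z' :
  jdot (jmk a b c x y z) (jmk a' b' c' x' y' z') =
  a * a' + b * b' + c * c' + 2 * (oip x x' + oip y y' + oip z z').
Proof. by rewrite /jdot jmk_mul jmk_tr; ring. Qed.

Lemma jmk_cross a b c x y z a' b' c' x' y' z' :
  jcross (jmk a b c x y z) (jmk a' b' c' x' y' z') =
  jmk (2^-1 * (b * c' + b' * c) - oip x x') (2^-1 * (c * a' + c' * a) - oip y y')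
      (2^-1 * (a * b' + a' * b) - oip z z')
   (2^-1 *: (oct_conj (y ** z') + oct_conj (y' ** z) - a *: x' - a' *: x))
   (2^-1 *: (oct_conj (z ** x') + oct_conj (z' ** x) - b *: y' - b' *: y))
   (2^-1 *: (oct_conj (x ** y') + oct_conj (x' ** y) - c *: z' - c' *: z)).
Proof.
rewrite /jcross jmk_mul jmk_dot !jmk_tr jmk_jE !(jmkZ, jmkN, jmkD).
congr jmk; by [field | vfield].
Qed.

Lemma oip_mul (x y : oct) : oip (x ** y) (x ** y) = oip x x * oip y y.
Proof.
by elim/oct8_ind: x => *; elim/oct8_ind: y => *; rewrite !oct8E; ring.
Qed.

(* With [X# = X x X] this is the adjoint identity [X## = det(X) X]. *)
Lemma jcross_adj (X : jord) : jcross (jcross X X) (jcross X X) =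
  (3^-1 * jdot X (jcross X X)) *: X.
Proof.
elim/jord_ind3: X => a b c x y z.
have sharp u v w (p q r : oct) : jcross (jmk u v w p q r) (jmk u v w p q r) =
  jmk (v * w - oip p p) (w * u - oip q q) (u * v - oip r r)
    (oct_conj (q ** r) - u *: p) (oct_conj (r ** p) - v *: q)
    (oct_conj (p ** q) - w *: r).
  by rewrite jmk_cross; congr jmk; by [field | vfield].
have Nconj (p q r : oct) u : oip (oct_conj (q ** r) - u *: p) (oct_conj (q ** r) - u *: p) =
    oip q q * oip r r - 2 * u * oip (oct_conj (q ** r)) p + u ^+ 2 * oip p p.
  by rewrite !oip_lin !(oipC p) oip_conj oip_mul; ring.
(* The off-diagonal entries: the leading term is the Moufang product [(p ** q) ** (r ** p)], and the
   mixed terms collapse by [conj x (x y) = N(x) y]. *)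
have off (p q r : oct) u v w :
    oct_conj ((oct_conj (r ** p) - v *: q) ** (oct_conj (p ** q) - w *: r)) -
    (v * w - oip p p) *: (oct_conj (q ** r) - u *: p) =
    (u * v * w - u * oip p p - v * oip q q - w * oip r r +
      2 * oip (oct_conj (q ** r)) p) *: p.
  rewrite !oct_mul_lin !oct_conj_lin.
  have -> : oct_conj (oct_conj (r ** p) ** oct_conj (p ** q)) =
      (p ** q) ** (r ** p) by rewrite oct_conj_mul !oct_conjK.
  have -> : oct_conj (oct_conj (r ** p) ** r) = oip r r *: p.
    by rewrite oct_conj_mul oct_conjK oct_conj_mulK.
  have -> : oct_conj (q ** oct_conj (p ** q)) = oip q q *: p.
    by rewrite oct_conj_mul oct_conjK oct_mul_conjK.
  by rewrite oct_moufang; vring.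
rewrite !sharp jmk_dot jmkZ !Nconj !off !oip_lin.
rewrite !(oipC x (oct_conj _)) !(oipC y (oct_conj _)) !(oipC z (oct_conj _)).
rewrite (oip_conj_mulC z x y) !(oip_conj_mulC x y z).
by congr jmk; by [field | congr (_ *: _); field].
Qed.

(** The form [(X, Y x Z)] is, up to a factor, the full polarisation of the determinant. In
    coordinates its symmetry is the cyclic invariance of the real part of a triple product. *)
Lemma jdot_crossC (X Y Z : jord) : jdot X (jcross Y Z) = jdot Y (jcross X Z).
Proof.
elim/jord_ind3: X => a b c x y z; elim/jord_ind3: Y => a' b' c' x' y' z'.
elim/jord_ind3: Z => p q r u v w.
rewrite !jmk_cross !jmk_dot !oip_lin.
rewrite !(oipC _ (oct_conj _)).
rewrite -!(oip_conj_mulC _ y) -!(oip_conj_mulC _ y') -!(oip_conj_mulC _ v).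
rewrite !(oip_conj_mulC z) !(oip_conj_mulC z') !(oip_conj_mulC w).
rewrite !(oipC x' x, oipC y' y, oipC z' z); field => //.
Qed.

Lemma jmul_jE (X : jord) : jmul (jE F) X = X.
Proof.
elim/jord_ind3: X => *; rewrite jmk_jE jmk_mul !oct_mul_lin !oct_conj_lin !oip_lin.
by congr jmk; by [ring | vfield].
Qed.

End JordanCoordinates.

(** * Polarisation and the identities of the cubic form *)

Section Polarization.
Context (F : numFieldType) (V W : vectType F).

(** The coefficient of [t] in [f] on the diagonal at [t y + x] is [3 f(x, x, y)]; one more
    polarisation in the first two arguments separates them. Trilinear identities can then be checked
    on equal arguments. *)
Lemma polar3 (f : V -> V -> V -> W) :
  (forall a x y z w, f (a *: x + y) z w = a *: f x z w + f y z w) ->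
  (forall x y z, f x y z = f y x z) -> (forall x y z, f x y z = f x z y) ->
  (forall x, f x x x = 0) -> forall x y z, f x y z = 0.
Proof.
move=> lin s12 s23 f0.
have lin2 a x y z w : f z (a *: x + y) w = a *: f z x w + f z y w.
  by rewrite s12 lin !(s12 z).
have lin3 a x y z w : f z w (a *: x + y) = a *: f z w x + f z w y.
  by rewrite s23 lin2 !(s23 z w).
have f1 x y : f x x y = 0.
  have H : 3 *: f x x y = 0.
    apply: (@vpoly_eq0 F W 4
      (fun i => [:: f x x x; 3 *: f x x y; 3 *: f x y y; f y y y]`_i) _ 1%N) => // t.
    rewrite !big_ord_recl big_ord0 /= -[RHS](f0 (t *: y + x)).
    rewrite !(lin, lin2, lin3) !(s12 y x) !(s23 _ y x) !(s12 y x) f0; vring.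
  by apply/eqP; move/eqP: H; rewrite scaler_eq0 pnatr_eq0.
move=> x y z.
have := f1 (1 *: x + y) z; rewrite lin !lin2 !scale1r !f1 (s12 y x).
rewrite addr0 add0r -mulr2n -scaler_nat => /eqP.
by rewrite scaler_eq0 pnatr_eq0 => /eqP.
Qed.

End Polarization.

(* [jcross], locked to keep unification from unfolding it. *)
HB.lock Definition jxp (F : numFieldType) (X Y : jord F) : jord F := jcross X Y.

Section CubicForm.
Context (F : numFieldType).
Notation jord := (jord F).
Implicit Types (X Y Z A B T : jord).

Lemma jxpC X Y : jxp X Y = jxp Y X.
Proof. by rewrite jxp.unlock jcrossC. Qed.
Lemma jxp_linl X a Y Z : jxp (a *: Y + Z) X = a *: jxp Y X + jxp Z X.
Proof. by rewrite jxp.unlock jcross_linl. Qed.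
Lemma jxp0l X : jxp 0 X = 0.
Proof. by have := jxp_linl X (-1) 0 0; rewrite scaler0 addr0 scaleN1r addNr. Qed.
Lemma jxpDl X Y Z : jxp (X + Y) Z = jxp X Z + jxp Y Z.
Proof. by rewrite -[X]scale1r jxp_linl !scale1r. Qed.
Lemma jxpZl a X Z : jxp (a *: X) Z = a *: jxp X Z.
Proof. by rewrite -[a *: X]addr0 jxp_linl jxp0l addr0. Qed.
Lemma jxpNl X Z : jxp (- X) Z = - jxp X Z.
Proof. by rewrite -scaleN1r jxpZl scaleN1r. Qed.
Lemma jxp0r X : jxp X 0 = 0.
Proof. by rewrite jxpC jxp0l. Qed.
Lemma jxpDr X Y Z : jxp Z (X + Y) = jxp Z X + jxp Z Y.
Proof. by rewrite !(jxpC Z) jxpDl. Qed.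
Lemma jxpZr a X Z : jxp Z (a *: X) = a *: jxp Z X.
Proof. by rewrite !(jxpC Z) jxpZl. Qed.
Lemma jxpNr X Z : jxp Z (- X) = - jxp Z X.
Proof. by rewrite !(jxpC Z) jxpNl. Qed.
Definition jxp_lin := (jxpDl, jxpDr, jxpZl, jxpZr, jxpNl, jxpNr,
  jxp0l, jxp0r).

Lemma jdot0l X : jdot 0 X = 0.
Proof. by have := jdot_linl X (-1) 0 0; rewrite scaler0 addr0 mulN1r addNr. Qed.
Lemma jdotDl X Y Z : jdot (X + Y) Z = jdot X Z + jdot Y Z.
Proof. by rewrite -[X]scale1r jdot_linl mul1r !scale1r. Qed.
Lemma jdotZl a X Z : jdot (a *: X) Z = a * jdot X Z.
Proof. by rewrite -[a *: X]addr0 jdot_linl jdot0l addr0. Qed.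
Lemma jdotNl X Z : jdot (- X) Z = - jdot X Z.
Proof. by rewrite -scaleN1r jdotZl mulN1r. Qed.
Lemma jdot0r X : jdot X 0 = 0.
Proof. by rewrite jdotC jdot0l. Qed.
Lemma jdotDr X Y Z : jdot Z (X + Y) = jdot Z X + jdot Z Y.
Proof. by rewrite !(jdotC Z) jdotDl. Qed.
Lemma jdotZr a X Z : jdot Z (a *: X) = a * jdot Z X.
Proof. by rewrite !(jdotC Z) jdotZl. Qed.
Lemma jdotNr X Z : jdot Z (- X) = - jdot Z X.
Proof. by rewrite !(jdotC Z) jdotNl. Qed.
Definition jdot_lin := (jdotDl, jdotDr, jdotZl, jdotZr, jdotNl, jdotNr, jdot0l, jdot0r).

Lemma jmul0l X : jmul 0 X = 0.
Proof. by have := jmul_linl X (-1) 0 0; rewrite scaler0 addr0 scaleN1r addNr. Qed.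
Lemma jmulDl X Y Z : jmul (X + Y) Z = jmul X Z + jmul Y Z.
Proof. by rewrite -[X]scale1r jmul_linl !scale1r. Qed.
Lemma jmulZl a X Z : jmul (a *: X) Z = a *: jmul X Z.
Proof. by rewrite -[a *: X]addr0 jmul_linl jmul0l addr0. Qed.
Lemma jmulNl X Z : jmul (- X) Z = - jmul X Z.
Proof. by rewrite -scaleN1r jmulZl scaleN1r. Qed.
Lemma jmul0r X : jmul X 0 = 0.
Proof. by rewrite jmulC jmul0l. Qed.
Lemma jmulDr X Y Z : jmul Z (X + Y) = jmul Z X + jmul Z Y.
Proof. by rewrite !(jmulC Z) jmulDl. Qed.
Lemma jmulZr a X Z : jmul Z (a *: X) = a *: jmul Z X.
Proof. by rewrite !(jmulC Z) jmulZl. Qed.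
Lemma jmulNr X Z : jmul Z (- X) = - jmul Z X.
Proof. by rewrite !(jmulC Z) jmulNl. Qed.
Definition jmul_lin := (jmulDl, jmulDr, jmulZl, jmulZr, jmulNl, jmulNr, jmul0l, jmul0r).

Lemma jdot_nondeg X : (forall Y, jdot X Y = 0) -> X = 0.
Proof.
move=> H; apply: jord_eq => [k|k l].
  by rewrite -jdotEk H mxE.
have := jdotFk X k l; rewrite H => /esym/eqP.
by rewrite mulf_eq0 pnatr_eq0 /= mxE => /eqP.
Qed.

Lemma jdot_ext X Y : (forall Z, jdot X Z = jdot Y Z) -> X = Y.
Proof.
move=> H; apply/eqP; rewrite -subr_eq0; apply/eqP; apply: jdot_nondeg => Z.
by rewrite !jdot_lin H subrr.
Qed.

Lemma jtr0 : jtr (0 : jord) = 0.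
Proof. by rewrite /jtr big1 // => i _; rewrite mxE. Qed.
Lemma jtrD X Y : jtr (X + Y) = jtr X + jtr Y.
Proof. by rewrite -[X]scale1r jtr_lin mul1r scale1r. Qed.
Lemma jtrZ a X : jtr (a *: X) = a * jtr X.
Proof. by rewrite -[a *: X]addr0 jtr_lin jtr0 addr0. Qed.
Lemma jtrN X : jtr (- X) = - jtr X.
Proof. by rewrite -scaleN1r jtrZ mulN1r. Qed.
Definition jtr_linE := (jtrD, jtrZ, jtrN, jtr0).

Lemma jdot_jE X : jdot X (jE F) = jtr X.
Proof. by rewrite jdotC /jdot jmul_jE. Qed.

Lemma jtr_jE : jtr (jE F) = 3.
Proof. by rewrite jmk_jE jmk_tr; ring. Qed.

Lemma jxp_jE X : jxp (jE F) X = 2^-1 *: (jtr X *: jE F - X).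
Proof. by rewrite jxp.unlock /jcross jmul_jE jtr_jE (jdotC (jE F)) jdot_jE; vring. Qed.

Lemma jmulE X Y : jmul X Y = jxp X Y +
  2^-1 *: (jtr X *: Y + jtr Y *: X - (jtr X * jtr Y - jdot X Y) *: jE F).
Proof. by rewrite jxp.unlock /jcross; vfield. Qed.

Lemma jdot_jxpC X Y Z : jdot X (jxp Y Z) = jdot Y (jxp X Z).
Proof. by rewrite jxp.unlock jdot_crossC. Qed.

Lemma jdot_jxpA X Y Z : jdot (jxp X Y) Z = jdot X (jxp Y Z).
Proof. by rewrite jdotC jdot_jxpC [jxp Z Y]jxpC. Qed.

Lemma jdot_mulA X Y Z : jdot (jmul X Y) Z = jdot X (jmul Y Z).
Proof.
rewrite !jmulE !jdot_lin jdot_jxpA (jdotC (jE F)) !jdot_jE; ring.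
Qed.

Lemma jxp_adj X : jxp (jxp X X) (jxp X X) = (3^-1 * jdot X (jxp X X)) *: X.
Proof. by rewrite jxp.unlock jcross_adj. Qed.

(** This is the coefficient of [t] in the adjoint identity at [X + t A]; in the proof, [v] lists all
    five coefficients of that quartic. *)
Lemma jxp_adj_lin X A : 4 *: jxp (jxp X X) (jxp X A) =
  jdot A (jxp X X) *: X + (3^-1 * jdot X (jxp X X)) *: A.
Proof.
apply/eqP; rewrite -subr_eq0; apply/eqP.
pose v := [:: jxp (jxp X X) (jxp X X) - (3^-1 * jdot X (jxp X X)) *: X;
   4 *: jxp (jxp X X) (jxp X A) -
     (jdot A (jxp X X) *: X + (3^-1 * jdot X (jxp X X)) *: A);
   2 *: jxp (jxp X X) (jxp A A) + 4 *: jxp (jxp X A) (jxp X A)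
     - (jdot X (jxp A A) *: X + jdot A (jxp X X) *: A);
   4 *: jxp (jxp X A) (jxp A A) -
     (jdot X (jxp A A) *: A + (3^-1 * jdot A (jxp A A)) *: X);
   jxp (jxp A A) (jxp A A) - (3^-1 * jdot A (jxp A A)) *: A].
apply: (@vpoly_eq0 F jord 5 (fun i => v`_i) _ 1%N) => // t.
rewrite !big_ord_recl big_ord0 /=.
have := jxp_adj (X + t *: A).
rewrite !jxp_lin !(jxpC A X) !(jxpC (jxp A A)) !(jxpC (jxp X A) (jxp X X)).
have e1 : jdot X (jxp X A) = jdot A (jxp X X) by rewrite jxpC jdot_jxpC.
rewrite !jdot_lin e1 (jdot_jxpC A X A) => /eqP; rewrite -subr_eq0 => /eqP H.
by rewrite -[RHS]H; vfield.
Qed.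

(** Take [A = E] in [jxp_adj_lin]: products with [E] are given by [jxp_jE], and what is left
    expresses [X x (X x X)], hence [X o (X x X)]. *)
Lemma jmul_adj X : jmul X (jxp X X) = (3^-1 * jdot X (jxp X X)) *: jE F.
Proof.
have := jxp_adj_lin X (jE F).
rewrite (jxpC X (jE F)) jxp_jE (jdotC (jE F)) jdot_jE !jxp_lin.
rewrite (jxpC _ (jE F)) jxp_jE (jxpC _ X) => H.
rewrite jmulE; move: H.
move: (jxp X (jxp X X)) => u; move: (jxp X X) => v.
move: (jdot X v) (jtr v) (jtr X) => d b a H.
have -> : u = u + 2^-1 *: (4 *: (2^-1 *: (a *: (2^-1 *: (b *: jE F - v)) - u))) -
    2^-1 *: (b *: X + (3^-1 * d) *: jE F) by rewrite -H addrK.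
vfield.
Qed.

Lemma jmul_adj_lin A B X : jmul A (jxp B X) + jmul B (jxp A X) + jmul X (jxp A B) =
  jdot A (jxp B X) *: jE F.
Proof.
apply/eqP; rewrite -subr_eq0; apply/eqP.
pose f A B X : jord := jmul A (jxp B X) + jmul B (jxp A X) + jmul X (jxp A B) -
  jdot A (jxp B X) *: jE F.
apply: (@polar3 F _ _ f) => [a x y z w|x y z|x y z|x]; rewrite /f.
- by rewrite !jxp_lin !jmul_lin !jdot_lin; vring.
- by rewrite (jxpC y x) jdot_jxpC; vring.
- by rewrite (jxpC z y); vring.
- by rewrite jmul_adj; vfield.
Qed.

Lemma jmul_jEr X : jmul X (jE F) = X.
Proof. by rewrite jmulC jmul_jE. Qed.

Lemma jmultE A X : jmult A X = jmul A X.
Proof. exact: lfunE. Qed.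

Lemma lieE (V : vectType F) (f g : 'End(V)) x : lie f g x = f (g x) - g (f x).
Proof. by rewrite /lie add_lfunE opp_lfunE !comp_lfunE. Qed.

(** After expansion of [x] into Jordan products, the difference of the two sides is a multiple of
    [jmul_adj_lin]. The formula lets later computations with [v] use only [x] and the inner product,
    both of which behave well under e_6. *)
Lemma jvee_jxp A B X : 2 *: jvee A B X =
  jdot B X *: A - 4 *: jxp B (jxp A X) + (3^-1 * jdot A B) *: X.
Proof.
have -> : jvee A B X = jmul A (jmul B X) - jmul B (jmul A X) + jmul (jmul A B) X
    - (jdot A B / 3) *: X.
  by rewrite /jvee add_lfunE lieE !jmultE !jmul_lin jmul_jE addrA.
have := jmul_adj_lin A B X.
have xpE Y Z : jxp Y Z = jmul Y Z - 2^-1 *: (jtr Y *: Z + jtr Z *: Y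
    - (jtr Y * jtr Z - jdot Y Z) *: jE F) by rewrite jmulE; vring.
have trE Y Z : jtr (jmul Y Z) = jdot Y Z by [].
rewrite !xpE !(jmul_lin, jmul_jEr, jdot_lin, jdot_jE, jtr_linE, jtr_jE, trE).
rewrite -?jdot_mulA !(jmulC X) ?(jmulC B A) -?jdot_mulA ?(jmulC B A) ?(jdotC X) ?(jdotC B A).
move: (jmul A (jmul B X)) (jmul B (jmul A X)) (jmul (jmul A B) X) => t1 t2 t3.
move: (jmul A B) (jmul A X) (jmul B X) (jdot (jmul A B) X) => v1 v2 v3 d.
move: (jdot A B) (jdot A X) (jdot B X) (jtr A) (jtr B) (jtr X) => d1 d2 d3 a b c.
move/eqP; rewrite -subr_eq0 => /eqP H; apply/eqP; rewrite -subr_eq0; apply/eqP.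
by rewrite -[RHS](scaler0 _ 2) -H; vfield.
Qed.
End CubicForm.

(* [jvee], locked like [jxp]. *)
HB.lock Definition jve (F : numFieldType) (X Y : jord F) : 'End(jord F) := jvee X Y.

Ltac solve_half :=
  first [ reflexivity | match goal with |- ?a = 0 => match goal with H : a = _ |- _ =>
    move: H; rewrite !(mul0r, mulr0, mul1r, mulr1, addr0, add0r, scale0r, scaler0) //;
    by rewrite -[LHS]addr0 => /addrI <- end end ].

(* From [p = 2 * 0], [q = 2 * (u + q)] and [r = 2 * u] to [p + q + r = 0]. *)
Ltac solve_tr Hp Hq Hr :=
  match type of Hq with ?q = ?e => transitivity (e - q);
    [rewrite Hp Hr; ring | by rewrite -Hq subrr] end.

(** * The Lie algebra e_6 as the invariance algebra of the cubic form *)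

Section E6.
Context (F : numFieldType).
Notation jord := (jord F).
Implicit Types (X Y Z A B T : jord) (D phi psi : 'End(jord)).

Definition cubic_inv phi := forall X Y Z,
  jdot (phi X) (jxp Y Z) + jdot X (jxp (phi Y) Z) + jdot X (jxp Y (phi Z)) = 0.

Lemma jtranspE phi psi : (forall X Y, jdot (phi X) Y = jdot X (psi Y)) ->
  jtransp phi = psi.
Proof.
move=> H; apply/lfunP => Y; apply: jdot_ext => Z.
by rewrite jdotC -jtranspP H jdotC.
Qed.

Lemma jtranspK phi : jtransp (jtransp phi) = phi.
Proof. by apply: jtranspE => X Y; rewrite jdotC -jtranspP jdotC. Qed.

Lemma jtransp_mult A : jtransp (jmult A) = jmult A.
Proof.
by apply: jtranspE => X Y; rewrite !jmultE (jmulC A) jdot_mulA.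
Qed.

Lemma jtranspD phi psi : jtransp (phi + psi) = jtransp phi + jtransp psi.
Proof.
by apply: jtranspE => X Y; rewrite !add_lfunE !jdot_lin !jtranspP.
Qed.

Lemma jtranspZ a phi : jtransp (a *: phi) = a *: jtransp phi.
Proof.
by apply: jtranspE => X Y; rewrite !scale_lfunE !jdot_lin !jtranspP.
Qed.

Lemma jtranspN phi : jtransp (- phi) = - jtransp phi.
Proof. by rewrite -scaleN1r jtranspZ scaleN1r. Qed.

Lemma jtransp_lie phi psi : jtransp (lie phi psi) = lie (jtransp psi) (jtransp phi).
Proof.
by apply: jtranspE => X Y; rewrite !lieE !jdot_lin !jtranspP.
Qed.

Lemma f4_jE D : f4 D -> D (jE F) = 0.
Proof.
move=> HD; have := HD (jE F) (jE F); rewrite jmul_jE jmul_jEr jmul_jE.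
by rewrite -[LHS]addr0 => /addrI/esym.
Qed.

Let idem1 : jmul (jmk 1 0 0 0 0 0) (jmk 1 0 0 0 0 0) = jmk (1 : F) 0 0 0 0 0.
Proof. by rewrite jmk_mul !(oct_mul_lin, oct_conj_lin, oip_lin); congr jmk; by [ring|vring]. Qed.
Let idem2 : jmul (jmk 0 1 0 0 0 0) (jmk 0 1 0 0 0 0) = jmk (0 : F) 1 0 0 0 0.
Proof. by rewrite jmk_mul !(oct_mul_lin, oct_conj_lin, oip_lin); congr jmk; by [ring|vring]. Qed.
Let idem3 : jmul (jmk 0 0 1 0 0 0) (jmk 0 0 1 0 0 0) = jmk (0 : F) 0 1 0 0 0.
Proof. by rewrite jmk_mul !(oct_mul_lin, oct_conj_lin, oip_lin); congr jmk; by [ring|vring]. Qed.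
Let F1half w : jmk 0 0 0 w 0 0 = 2 *: jmul (jmk 0 1 0 0 0 0) (jmk (0 : F) 0 0 w 0 0).
Proof. by rewrite jmk_mul jmkZ !(oct_mul_lin, oct_conj_lin, oip_lin); congr jmk; by [ring|vfield]. Qed.
Let F2half w : jmk 0 0 0 0 w 0 = 2 *: jmul (jmk 0 0 1 0 0 0) (jmk (0 : F) 0 0 0 w 0).
Proof. by rewrite jmk_mul jmkZ !(oct_mul_lin, oct_conj_lin, oip_lin); congr jmk; by [ring|vfield]. Qed.
Let F3half w : jmk 0 0 0 0 0 w = 2 *: jmul (jmk 1 0 0 0 0 0) (jmk (0 : F) 0 0 0 0 w).
Proof. by rewrite jmk_mul jmkZ !(oct_mul_lin, oct_conj_lin, oip_lin); congr jmk; by [ring|vfield]. Qed.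

(* [D E_k] lies in the Peirce 1/2-space of [E_k]; differentiating
   [F_k(w) = 2 E_l o F_k(w)] then shows that [D F_k(w)] is traceless too. *)
Lemma f4_tr D X : f4 D -> jtr (D X) = 0.
Proof.
move=> HD.
have D1 : exists y z, D (jmk 1 0 0 0 0 0) = jmk 0 0 0 0 y z.
  have := HD (jmk 1 0 0 0 0 0) (jmk 1 0 0 0 0 0); rewrite idem1.
  elim/jord_ind3: (D _) => a b c x y z.
  rewrite !jmk_mul jmkD !(oct_mul_lin, oct_conj_lin, oip_lin).
  by case/jmk_inj => -[Ha Hb Hc] [Hx Hy Hz]; exists y, z; congr jmk; solve_half.
have D2 : exists x z, D (jmk 0 1 0 0 0 0) = jmk 0 0 0 x 0 z.
  have := HD (jmk 0 1 0 0 0 0) (jmk 0 1 0 0 0 0); rewrite idem2.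
  elim/jord_ind3: (D _) => a b c x y z.
  rewrite !jmk_mul jmkD !(oct_mul_lin, oct_conj_lin, oip_lin).
  by case/jmk_inj => -[Ha Hb Hc] [Hx Hy Hz]; exists x, z; congr jmk; solve_half.
have D3 : exists x y, D (jmk 0 0 1 0 0 0) = jmk 0 0 0 x y 0.
  have := HD (jmk 0 0 1 0 0 0) (jmk 0 0 1 0 0 0); rewrite idem3.
  elim/jord_ind3: (D _) => a b c x y z.
  rewrite !jmk_mul jmkD !(oct_mul_lin, oct_conj_lin, oip_lin).
  by case/jmk_inj => -[Ha Hb Hc] [Hx Hy Hz]; exists x, y; congr jmk; solve_half.
case: D1 => y1 [z1 D1]; case: D2 => x2 [z2 D2]; case: D3 => x3 [y3 D3].
have F1 w : jtr (D (jmk 0 0 0 w 0 0)) = 0.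
  have := congr1 D (F1half w); rewrite linearZ /= HD D2.
  elim/jord_ind3: (D (jmk 0 0 0 w 0 0)) => a b c x y z.
  rewrite !jmk_mul jmkD jmkZ jmk_tr !(oct_mul_lin, oct_conj_lin, oip_lin).
  by case/jmk_inj => -[Ha Hb Hc] _; solve_tr Ha Hb Hc.
have F2 w : jtr (D (jmk 0 0 0 0 w 0)) = 0.
  have := congr1 D (F2half w); rewrite linearZ /= HD D3.
  elim/jord_ind3: (D (jmk 0 0 0 0 w 0)) => a b c x y z.
  rewrite !jmk_mul jmkD jmkZ jmk_tr !(oct_mul_lin, oct_conj_lin, oip_lin).
  by case/jmk_inj => -[Ha Hb Hc] _; solve_tr Hb Hc Ha.
have F3 w : jtr (D (jmk 0 0 0 0 0 w)) = 0.
  have := congr1 D (F3half w); rewrite linearZ /= HD D1.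
  elim/jord_ind3: (D (jmk 0 0 0 0 0 w)) => a b c x y z.
  rewrite !jmk_mul jmkD jmkZ jmk_tr !(oct_mul_lin, oct_conj_lin, oip_lin).
  by case/jmk_inj => -[Ha Hb Hc] _; solve_tr Hc Ha Hb.
elim/jord_ind3: X => a b c x y z.
have -> : jmk a b c x y z = a *: jmk 1 0 0 0 0 0 + b *: jmk 0 1 0 0 0 0 +
    c *: jmk 0 0 1 0 0 0 + jmk 0 0 0 x 0 0 + jmk 0 0 0 0 y 0 + jmk 0 0 0 0 0 z.
  by rewrite !jmkZ !jmkD; congr jmk; by [ring|vring].
rewrite !linearD !linearZ /= !jtr_linE D1 D2 D3 !jmk_tr F1 F2 F3; ring.
Qed.

Lemma f4_dot D X Y : f4 D -> jdot (D X) Y = - jdot X (D Y).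
Proof.
move=> HD; apply/eqP; rewrite -addr_eq0; apply/eqP.
have := f4_tr (jmul X Y) HD; rewrite HD jtrD /jdot //.
Qed.

Lemma f4_transp D : f4 D -> jtransp D = - D.
Proof. by move=> HD; apply: jtranspE => X Y; rewrite opp_lfunE jdot_lin f4_dot. Qed.

Lemma f4_jxp D X Y : f4 D -> D (jxp X Y) = jxp (D X) Y + jxp X (D Y).
Proof.
move=> HD; rewrite jxp.unlock /jcross !(linearD, linearN, linearZ) /= HD f4_jE //.
rewrite !(f4_tr _ HD) (f4_dot X Y HD); vring.
Qed.

Lemma cubic_inv_mult T : jtr T = 0 -> cubic_inv (jmult T).
Proof.
move=> HT X Y Z; rewrite !jmultE (jxpC Y (jmul T Z)) !(jdot_jxpC X (jmul T _)).
by rewrite !jdot_mulA -!jdotDr jmul_adj_lin jdotZr jdot_jE HT mulr0.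
Qed.

Lemma cubic_inv_lin a phi psi :
  cubic_inv phi -> cubic_inv psi -> cubic_inv (a *: phi + psi).
Proof.
move=> H K X Y Z; rewrite !(add_lfunE, scale_lfunE) !jxp_lin !jdot_lin.
transitivity (a * (jdot (phi X) (jxp Y Z) + jdot X (jxp (phi Y) Z) +
  jdot X (jxp Y (phi Z))) + (jdot (psi X) (jxp Y Z) + jdot X (jxp (psi Y) Z) +
  jdot X (jxp Y (psi Z)))); first by ring.
by rewrite H K mulr0 addr0.
Qed.

(** In this description, closure under brackets and membership of [A v B] become direct checks. For
    the converse, [phi] minus the multiplication by [T = phi(E)] kills [E]; invariance then shows in
    turn that it kills traces, is skew for the inner product and is a derivation of [x], hence of
    the Jordan product. *)
Lemma e6_cubic phi : e6 phi <-> cubic_inv phi.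
Proof.
split=> [[D [T [HD HT ->]]]|H].
  rewrite -[D]scale1r; apply: cubic_inv_lin; last exact: cubic_inv_mult.
  by move=> X Y Z; rewrite (f4_dot X _ HD) (f4_jxp Y Z HD) !jdot_lin; ring.
have EE : jxp (jE F) (jE F) = jE F by rewrite jxp_jE jtr_jE; vfield.
pose T := phi (jE F); have HT : jtr T = 0.
  have := H (jE F) (jE F) (jE F).
  rewrite jdot_jxpC (jxpC _ (phi _)) (jdot_jxpC _ (phi _)) EE !jdot_jE -/T.
  have -> : jtr T + jtr T + jtr T = 3 * jtr T by ring.
  by move/eqP; rewrite mulf_eq0 pnatr_eq0 /= => /eqP.
exists (phi - jmult T), T; split => //; last by rewrite subrK.
have : cubic_inv (phi - jmult T).
  by rewrite addrC -scaleN1r; apply: cubic_inv_lin => //; exact: cubic_inv_mult.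
have : (phi - jmult T) (jE F) = 0 by rewrite add_lfunE opp_lfunE jmultE jmul_jEr subrr.
move: (phi - _) => D DE HD.
have Dtr X : jtr (D X) = 0.
  by have := HD X (jE F) (jE F); rewrite EE DE jxp0l jxp0r !jdot0r !addr0 jdot_jE.
have Ddot X Y : jdot (D X) Y = - jdot X (D Y).
  have := HD (jE F) X Y; rewrite DE jdot0l add0r -!jdot_jxpA !jxp_jE !jdot_lin.
  rewrite !Dtr !(jdotC (jE F)) !jdot_jE !Dtr => /eqP.
  rewrite (_ : _ + _ = - (2^-1 * (jdot (D X) Y + jdot X (D Y)))); last by ring.
  by rewrite oppr_eq0 mulf_eq0 invr_eq0 pnatr_eq0 /= addr_eq0 => /eqP.
have Dxp X Y : D (jxp X Y) = jxp (D X) Y + jxp X (D Y).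
  apply: jdot_ext => Z; have := HD Z X Y; rewrite Ddot !jdot_lin => /eqP.
  by rewrite -addrA addrC subr_eq0 !(jdotC Z) => /eqP.
move=> X Y; rewrite !jmulE !(linearD, linearN, linearZ) /= DE Dxp !Dtr Ddot; vring.
Qed.

Lemma e6_transp phi : e6 phi -> e6 (jtransp phi).
Proof.
case=> D [T [HD HT ->]]; exists (- D), T; split=> //.
  by move=> X Y; rewrite !opp_lfunE HD !jmul_lin opprD.
by rewrite jtranspD f4_transp // jtransp_mult.
Qed.

(** Invariance of the cubic form, with one argument moved across the nondegenerate inner product. *)
Lemma e6_jxp phi X Y : e6 phi ->
  jxp (phi X) Y + jxp X (phi Y) = - jtransp phi (jxp X Y).
Proof.
move/e6_cubic => H; apply: jdot_ext => Z; have := H Z X Y.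
rewrite jtranspP !jdot_lin !(jdotC Z) => /eqP; rewrite -addrA addrC addr_eq0.
by move/eqP => ->.
Qed.

Lemma e6_jxpt phi X Y : e6 phi ->
  jxp (jtransp phi X) Y + jxp X (jtransp phi Y) = - phi (jxp X Y).
Proof. by move/e6_transp => H; rewrite e6_jxp // jtranspK. Qed.

(** Invariance under [phi] with one argument shifted by [psi] gives three relations, and exchanging
    the roles gives three more. In their difference all terms where [phi] and [psi] hit different
    arguments cancel. *)
Lemma e6_lie phi psi : e6 phi -> e6 psi -> e6 (lie phi psi).
Proof.
move=> H K; apply/e6_cubic => X Y Z; rewrite !lieE !jxp_lin !jdot_lin.
move/e6_cubic: H => H; move/e6_cubic: K => K.
have := H (psi X) Y Z; have := H X (psi Y) Z; have := H X Y (psi Z).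
have := K (phi X) Y Z; have := K X (phi Y) Z; have := K X Y (phi Z).
move: (jdot (phi (psi X)) _) (jdot (psi (phi X)) _) (jdot X (jxp (phi (psi Y)) _)).
move: (jdot X (jxp (psi (phi Y)) _)) (jdot X (jxp _ (phi (psi Z)))) (jdot X (jxp _ (psi (phi Z)))).
move: (jdot (phi X) _) (jdot (phi X) _) (jdot (psi X) _) (jdot (psi X) _).
move: (jdot X (jxp (phi Y) _)) (jdot X (jxp (psi Y) _)) =>
  a0 a1 a2 a3 a4 a5 a6 a7 a8 a9 a10 a11 h0 h1 h2 h3 h4 h5.
transitivity ((a9 + a4 + a5) + (a3 + a11 + a1) + (a2 + a0 + a7) -
  (a10 + a3 + a2) - (a4 + a6 + a0) - (a5 + a1 + a8)); first by ring.
by rewrite h0 h1 h2 h3 h4 h5; ring.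
Qed.

Lemma jve_jxpE A B X : jve A B X =
  2^-1 *: (jdot B X *: A - 4 *: jxp B (jxp A X) + (3^-1 * jdot A B) *: X).
Proof. by rewrite -jvee_jxp jve.unlock; vfield. Qed.

(** By polarisation the invariance can be tested on equal arguments, where it is [jxp_adj_lin]
    paired with [B]. *)
Lemma e6_jve A B : e6 (jve A B).
Proof.
apply/e6_cubic.
pose f X Y Z : F^o := jdot (jve A B X) (jxp Y Z) + jdot (jve A B Y) (jxp X Z) +
  jdot (jve A B Z) (jxp X Y).
suff f0 X Y Z : f X Y Z = 0.
  move=> X Y Z; rewrite -[RHS](f0 X Y Z) /f (jxpC Y (jve _ _ _)).
  by rewrite !(jdot_jxpC X (jve _ _ _)).
apply: (@polar3 F _ _ f) => {X Y Z} [a x y z w|x y z|x y z|x]; rewrite /f.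
- by rewrite !linearP !jxp_lin !jdot_lin /GRing.scale /=; ring.
- by rewrite (jxpC x y); ring.
- by rewrite (jxpC y z); ring.
rewrite jve_jxpE !jdot_lin jdot_jxpA -(jdotC (jxp x x)) (jxpC (jxp A x)) (jxpC A).
have := congr1 (jdot B) (jxp_adj_lin x A); rewrite !jdot_lin (jdotC A) (jdotC B).
by move=> H; rewrite H (jdotC B A); field.
Qed.

Lemma jtransp_jve A B : jtransp (jve A B) = jve B A.
Proof.
rewrite jve.unlock /jvee jtranspD jtransp_lie !jtransp_mult (jmulC B) (jdotC B) /lie.
by [].
Qed.

Lemma jve_linl a A B C : jve (a *: A + B) C = a *: jve A C + jve B C.
Proof.
apply/lfunP => X; rewrite [RHS]add_lfunE scale_lfunE !jve_jxpE !jxp_lin !jdot_lin; vring.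
Qed.
Lemma jve_linr a A B C : jve C (a *: A + B) = a *: jve C A + jve C B.
Proof.
apply/lfunP => X; rewrite [RHS]add_lfunE scale_lfunE !jve_jxpE !jxp_lin !jdot_lin; vring.
Qed.

(** Equivariance of [v]: the second argument lives in the dual representation, on which [phi] acts
    by [- jtransp phi]. *)
Lemma e6_lie_jve phi A B : e6 phi ->
  lie phi (jve A B) = jve (phi A) B - jve A (jtransp phi B).
Proof.
move=> H; apply/lfunP => X; rewrite lieE add_lfunE opp_lfunE !jve_jxpE.
rewrite !(linearD, linearN, linearZ) /=.
have -> : phi (jxp B (jxp A X)) = jxp B (jxp (phi A) X) + jxp B (jxp A (phi X))
    - jxp (jtransp phi B) (jxp A X).
  rewrite -[LHS]opprK -e6_jxpt // -[jtransp phi (jxp A X)]opprK -e6_jxp //.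
  rewrite !jxp_lin; vring.
have -> : jdot B (phi X) = jdot (jtransp phi B) X by rewrite jdotC jtranspP jdotC.
by rewrite (jtranspP phi A B); vring.
Qed.

(* Linearization of [X v (X x X) = 0]. *)
Lemma jve_adj X A : jve A (jxp X X) + 2 *: jve X (jxp X A) = 0.
Proof.
pose f A B C : 'End(jord) := jve A (jxp B C) + jve B (jxp A C) + jve C (jxp A B).
have f0 : forall x y z, f x y z = 0.
  apply: (@polar3 F _ _ f) => [a x y z w|x y z|x y z|x]; rewrite /f.
  - rewrite !jxp_lin !jve_linl -[X in _ + X](addr0 _).
    by rewrite !jve_linr; vring.
  - by rewrite (jxpC y x); vring.
  - by rewrite (jxpC y z); vring.
  suff -> : jve x (jxp x x) = 0 by rewrite !addr0.
  apply/lfunP => X'; rewrite jve_jxpE jxp_adj_lin zero_lfunE (jdotC X') ; vring.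
have := f0 A X X; rewrite /f !(jxpC A X) => <-; vring.
Qed.

End E6.

Section LinearMaps.
Context (F : fieldType) (U V : vectType F).
Implicit Types (f g : 'Hom(U, V)) (u v : U).

Lemma lfD f u v : f (u + v) = f u + f v. Proof. exact: linearD. Qed.
Lemma lfN f u : f (- u) = - f u. Proof. exact: linearN. Qed.
Lemma lfZ f a u : f (a *: u) = a *: f u. Proof. exact: linearZ. Qed.
Lemma lf0 f : f 0 = 0. Proof. exact: linear0. Qed.
Definition lf_lin := (lfD, lfN, lfZ, lf0).

End LinearMaps.

Section LinearFunctions.
Context (F : fieldType) (U V : lmodType F) (g : U -> V).
Hypothesis glin : forall a x y, g (a *: x + y) = a *: g x + g y.

Lemma linD_of x y : g (x + y) = g x + g y.
Proof. by have := glin 1 x y; rewrite !scale1r. Qed.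
Lemma lin0_of : g 0 = 0.
Proof. by have := glin (-1) 0 0; rewrite scaler0 addr0 scaleN1r addNr. Qed.
Lemma linZ_of a x : g (a *: x) = a *: g x.
Proof. by have := glin a x 0; rewrite lin0_of !addr0. Qed.
Lemma linN_of x : g (- x) = - g x.
Proof. by rewrite -scaleN1r linZ_of scaleN1r. Qed.

End LinearFunctions.

(** * The Freudenthal space and the Lie algebra e_7 *)

Section E7.
Context (F : numFieldType).
Notation jord := (jord F).
Notation freud := (freud F).
Notation e7 := (e7 F).
Implicit Types (X Y Z A B T : jord) (phi psi : 'End(jord)) (P Q R : freud).
Implicit Types (f g : 'End(freud)).

Lemma Phi_tuple phi A B (nu : F) X Y (xi eta : F) : Phi phi A B nu (X, Y, xi, eta) =
  (phi X - (nu / 3) *: X + 2 *: jxp B Y + eta *: A,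
   2 *: jxp A X - jtransp phi Y + (nu / 3) *: Y + xi *: B,
   jdot A Y + nu * xi, jdot B X - nu * eta).
Proof. by rewrite PhiE jxp.unlock. Qed.

Lemma fcross_tuple X Y (xi eta : F) Z W (zeta omega : F) :
  fcross (X, Y, xi, eta) (Z, W, zeta, omega) =
  Phi (- 2^-1 *: (jve X W + jve Z Y))
      (- 4^-1 *: (2 *: jxp Y W - xi *: Z - zeta *: X))
      (4^-1 *: (2 *: jxp X Z - eta *: W - omega *: Y))
      (8^-1 * (jdot X W + jdot Z Y - 3 * (xi * omega + zeta * eta))).
Proof. by rewrite /fcross jxp.unlock jve.unlock. Qed.

Lemma freud_eq X Y (xi eta : F) X' Y' (xi' eta' : F) :
  X = X' -> Y = Y' -> xi = xi' -> eta = eta' ->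
  (X, Y, xi, eta) = (X', Y', xi', eta') :> freud.
Proof. by move=> -> -> -> ->. Qed.

Lemma Phi_eq phi A B (nu : F) phi' A' B' (nu' : F) :
  phi = phi' -> A = A' -> B = B' -> nu = nu' -> Phi phi A B nu = Phi phi' A' B' nu'.
Proof. by move=> -> -> -> ->. Qed.

Lemma jveDl (c : jord) (x y : jord) : jve (x + y) c = jve x c + jve y c.
Proof. exact: linD_of (fun a x y => jve_linl a x y c) x y. Qed.
Lemma jveZl a (c : jord) (x : jord) : jve (a *: x) c = a *: jve x c.
Proof. exact: linZ_of (fun a x y => jve_linl a x y c) a x. Qed.
Lemma jveNl (c : jord) (x : jord) : jve (- x) c = - jve x c.
Proof. exact: linN_of (fun a x y => jve_linl a x y c) x. Qed.
Lemma jve0l (c : jord) : jve 0 c = 0.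
Proof. exact: lin0_of (fun a x y => jve_linl a x y c). Qed.
Lemma jveDr (c : jord) (x y : jord) : jve c (x + y) = jve c x + jve c y.
Proof. exact: linD_of (fun a x y => jve_linr a x y c) x y. Qed.
Lemma jveZr a (c : jord) (x : jord) : jve c (a *: x) = a *: jve c x.
Proof. exact: linZ_of (fun a x y => jve_linr a x y c) a x. Qed.
Lemma jveNr (c : jord) (x : jord) : jve c (- x) = - jve c x.
Proof. exact: linN_of (fun a x y => jve_linr a x y c) x. Qed.
Lemma jve0r (c : jord) : jve c 0 = 0.
Proof. exact: lin0_of (fun a x y => jve_linr a x y c). Qed.
Definition jve_lin := (jveDl, jveDr, jveZl, jveZr, jveNl, jveNr, jve0l, jve0r).

Lemma jtransp0 : jtransp (0 : 'End(jord)) = 0.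
Proof. by rewrite -[X in jtransp X](scale0r (0 : 'End(jord))) jtranspZ scale0r. Qed.

Lemma Phi0 : Phi 0 0 0 0 = 0 :> 'End(freud).
Proof.
have := Phi_lin (-1) (0 : 'End(jord)) 0 0 (0 : F) 0 0 0 0.
by rewrite !scaleN1r mulN1r !addNr.
Qed.

Lemma PhiZ a phi A B (nu : F) :
  a *: Phi phi A B nu = Phi (a *: phi) (a *: A) (a *: B) (a * nu).
Proof. by have := Phi_lin a phi A B nu 0 0 0 0; rewrite Phi0 !addr0. Qed.

(** An [A] meeting a [B] produces [A v B]; everything else is the action of [phi] and [nu] on [A]
    and [B], and [e6_jxp], [e6_jxpt] move [phi] and its transpose through [x]. *)
Lemma lie_Phi phi A B nu phi' A' B' nu' : e6 phi -> e6 phi' ->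
  lie (Phi phi A B nu) (Phi phi' A' B' nu') =
  Phi (lie phi phi' + 2 *: jve A B' - 2 *: jve A' B)
      (phi A' - phi' A + (2 / 3 * nu) *: A' - (2 / 3 * nu') *: A)
      (jtransp phi' B - jtransp phi B' - (2 / 3 * nu) *: B' + (2 / 3 * nu') *: B)
      (jdot A B' - jdot A' B).
Proof.
move=> H H'; apply/lfunP => -[[[X Y] xi] eta].
rewrite lieE !Phi_tuple.
rewrite !(jtranspD, jtranspN, jtranspZ, jtransp_jve, jtransp_lie).
rewrite !(lieE, add_lfunE, opp_lfunE, scale_lfunE) !jve_jxpE.
have pA := e6_jxp _ _ H; have pA' := e6_jxp _ _ H'.
have pB := e6_jxpt _ _ H; have pB' := e6_jxpt _ _ H'.
apply: freud_eq; rewrite /= ?(lf_lin, jxp_lin, jdot_lin) /=.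
- have -> : phi (jxp B' Y) = - jxp (jtransp phi B') Y - jxp B' (jtransp phi Y).
    by rewrite -[LHS]opprK -pB opprD.
  have -> : phi' (jxp B Y) = - jxp (jtransp phi' B) Y - jxp B (jtransp phi' Y).
    by rewrite -[LHS]opprK -pB' opprD.
  by rewrite (jxpC B' B); vfield.
- have -> : jtransp phi (jxp A' X) = - jxp (phi A') X - jxp A' (phi X).
    by rewrite -[LHS]opprK -pA opprD.
  have -> : jtransp phi' (jxp A X) = - jxp (phi' A) X - jxp A (phi' X).
    by rewrite -[LHS]opprK -pA' opprD.
  by rewrite (jxpC A' A) (jdotC B' A) (jdotC B A'); vfield.
- by rewrite (jdot_jxpC A A' X) -!jtranspP; field.
- have adj psi U : jdot B (psi U) = jdot (jtransp psi B) U by rewrite jdotC jtranspP jdotC.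
  have adj' psi U : jdot B' (psi U) = jdot (jtransp psi B') U by rewrite jdotC jtranspP jdotC.
  by rewrite (jdot_jxpC B B' Y) adj adj' (jdotC B A') (jdotC B' A); field.
Qed.

Lemma e6_0 : e6 (0 : 'End(jord)).
Proof. by apply/e6_cubic => X Y Z; rewrite !zero_lfunE jxp0l jxp0r !jdot0l !jdot0r !addr0. Qed.

Lemma e6D phi psi : e6 phi -> e6 psi -> e6 (phi + psi).
Proof. by move=> H K; rewrite -[phi]scale1r; apply: e6_lin. Qed.
Lemma e6Z a phi : e6 phi -> e6 (a *: phi).
Proof. by move=> H; rewrite -[_ *: _]addr0; apply: e6_lin => //; exact: e6_0. Qed.
Lemma e6N phi : e6 phi -> e6 (- phi).
Proof. by move=> H; rewrite -scaleN1r; apply: e6Z. Qed.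

Lemma e7_lie f g : f \in e7 -> g \in e7 -> lie f g \in e7.
Proof.
move=> /e7P[phi [A [B [nu [H ->]]]]] /e7P[phi' [A' [B' [nu' [H' ->]]]]].
apply/e7P; rewrite lie_Phi //; do 4 eexists; split; last by [].
by repeat first [exact: e6_lie | exact: e6_jve | apply: e6D | apply: e6N | apply: e6Z].
Qed.

Lemma e7_fcross P Q : fcross P Q \in e7.
Proof.
case: P => [[[X Y] xi] eta]; case: Q => [[[Z W] zeta] omega].
apply/e7P; rewrite fcross_tuple; do 4 eexists; split; last by [].
by apply: e6Z; apply: e6D; exact: e6_jve.
Qed.

Lemma fcrossC P Q : fcross P Q = fcross Q P.
Proof.
case: P => [[[X Y] xi] eta]; case: Q => [[[Z W] zeta] omega].
rewrite !fcross_tuple; apply: Phi_eq.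
- by rewrite [jve Z Y + _]addrC.
- by rewrite (jxpC W); vring.
- by rewrite (jxpC Z); vring.
- ring.
Qed.

Lemma fcross_linl a P P' Q : fcross (a *: P + P') Q = a *: fcross P Q + fcross P' Q.
Proof.
case: P => [[[X Y] xi] eta]; case: P' => [[[X' Y'] xi'] eta'].
case: Q => [[[Z W] zeta] omega].
have -> : a *: (X, Y, xi, eta) + (X', Y', xi', eta') =
  (a *: X + X', a *: Y + Y', (a * xi + xi' : F), (a * eta + eta' : F)) :> freud by [].
rewrite !fcross_tuple Phi_lin; apply: Phi_eq.
- by rewrite jve_linl jve_linr; vring.
- by rewrite !jxp_lin; vring.
- by rewrite !jxp_lin; vring.
- by rewrite !jdot_lin; ring.
Qed.

Lemma fskewN P Q : fskew P Q = - fskew Q P.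
Proof.
case: P => [[[X Y] xi] eta]; case: Q => [[[Z W] zeta] omega].
by rewrite /= (jdotC Z Y) (jdotC X W) -[jdot W X]opprK; ring.
Qed.

Lemma fskew_linl a P P' Q : fskew (a *: P + P') Q = a * fskew P Q + fskew P' Q.
Proof.
case: P => [[[X Y] xi] eta]; case: P' => [[[X' Y'] xi'] eta'].
case: Q => [[[Z W] zeta] omega].
by rewrite /= !jdot_lin /GRing.scale /=; ring.
Qed.

Lemma fskew_inv f P Q : f \in e7 -> fskew (f P) Q = - fskew P (f Q).
Proof.
case/e7P => phi [A [B [nu [H ->]]]].
case: P => [[[X Y] xi] eta]; case: Q => [[[Z W] zeta] omega].
rewrite !Phi_tuple /fskew !jdot_lin.
have adj psi U V : jdot V (psi U) = jdot (jtransp psi V) U by rewrite jdotC jtranspP jdotC.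
rewrite !jdot_jxpA !adj jtranspK.
rewrite (jdot_jxpC X A Z) (jdot_jxpC Z A X) (jxpC Z X) (jxpC W Y).
by rewrite (jdotC Z B) (jdotC X B); field.
Qed.

Lemma fcross_linr a P P' Q : fcross Q (a *: P + P') = a *: fcross Q P + fcross Q P'.
Proof. by rewrite !(fcrossC Q) fcross_linl. Qed.

Lemma fcrossDl (c : freud) (x y : freud) : fcross (x + y) c = fcross x c + fcross y c.
Proof. exact: linD_of (fun a x y => fcross_linl a x y c) x y. Qed.
Lemma fcrossZl a (c : freud) (x : freud) : fcross (a *: x) c = a *: fcross x c.
Proof. exact: linZ_of (fun a x y => fcross_linl a x y c) a x. Qed.
Lemma fcrossNl (c : freud) (x : freud) : fcross (- x) c = - fcross x c.
Proof. exact: linN_of (fun a x y => fcross_linl a x y c) x. Qed.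
Lemma fcross0l (c : freud) : fcross 0 c = 0.
Proof. exact: lin0_of (fun a x y => fcross_linl a x y c). Qed.
Lemma fcrossDr (c : freud) (x y : freud) : fcross c (x + y) = fcross c x + fcross c y.
Proof. exact: linD_of (fun a x y => fcross_linr a x y c) x y. Qed.
Lemma fcrossZr a (c : freud) (x : freud) : fcross c (a *: x) = a *: fcross c x.
Proof. exact: linZ_of (fun a x y => fcross_linr a x y c) a x. Qed.
Lemma fcrossNr (c : freud) (x : freud) : fcross c (- x) = - fcross c x.
Proof. exact: linN_of (fun a x y => fcross_linr a x y c) x. Qed.
Lemma fcross0r (c : freud) : fcross c 0 = 0.
Proof. exact: lin0_of (fun a x y => fcross_linr a x y c). Qed.
Definition fcross_lin := (fcrossDl, fcrossDr, fcrossZl, fcrossZr, fcrossNl, fcrossNr, fcross0l, fcross0r).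

Lemma fskew_linr a P P' Q : fskew Q (a *: P + P') = a * fskew Q P + fskew Q P'.
Proof. by rewrite !(fskewN Q) fskew_linl; ring. Qed.
Lemma fskewDl (c : freud) (x y : freud) : fskew (x + y) c = fskew x c + fskew y c.
Proof. exact: (@linD_of F freud F^o (fun x => fskew x c)) (fun a x y => fskew_linl a x y c) x y. Qed.
Lemma fskewZl a (c : freud) (x : freud) : fskew (a *: x) c = a * fskew x c.
Proof. exact: (@linZ_of F freud F^o (fun x => fskew x c)) (fun a x y => fskew_linl a x y c) a x. Qed.
Lemma fskewNl (c : freud) (x : freud) : fskew (- x) c = - fskew x c.
Proof. exact: (@linN_of F freud F^o (fun x => fskew x c)) (fun a x y => fskew_linl a x y c) x. Qed.
Lemma fskew0l (c : freud) : fskew 0 c = 0.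
Proof. exact: (@lin0_of F freud F^o (fun x => fskew x c)) (fun a x y => fskew_linl a x y c). Qed.
Lemma fskewDr (c : freud) (x y : freud) : fskew c (x + y) = fskew c x + fskew c y.
Proof. exact: (@linD_of F freud F^o (fskew c)) (fun a x y => fskew_linr a x y c) x y. Qed.
Lemma fskewZr a (c : freud) (x : freud) : fskew c (a *: x) = a * fskew c x.
Proof. exact: (@linZ_of F freud F^o (fskew c)) (fun a x y => fskew_linr a x y c) a x. Qed.
Lemma fskewNr (c : freud) (x : freud) : fskew c (- x) = - fskew c x.
Proof. exact: (@linN_of F freud F^o (fskew c)) (fun a x y => fskew_linr a x y c) x. Qed.
Lemma fskew0r (c : freud) : fskew c 0 = 0.
Proof. exact: (@lin0_of F freud F^o (fskew c)) (fun a x y => fskew_linr a x y c). Qed.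
Definition fskew_lin := (fskewDl, fskewDr, fskewZl, fskewZr, fskewNl, fskewNr, fskew0l, fskew0r).

Lemma lie_linl (V : vectType F) a (f g h : 'End(V)) :
  lie (a *: f + g) h = a *: lie f h + lie g h.
Proof.
apply/lfunP => x; rewrite [RHS]add_lfunE scale_lfunE !lieE !(add_lfunE, scale_lfunE).
by rewrite !lf_lin; vring.
Qed.

Lemma lieN (V : vectType F) (f g : 'End(V)) : lie f g = - lie g f.
Proof. by rewrite /lie opprB. Qed.

Lemma lie_linr (V : vectType F) a (f g h : 'End(V)) :
  lie h (a *: f + g) = a *: lie h f + lie h g.
Proof. by rewrite !(lieN h) lie_linl scalerN opprD. Qed.

Section LieLinear.
Context (V : vectType F).
Lemma lieDl (c : 'End(V)) (x y : 'End(V)) : lie (x + y) c = lie x c + lie y c.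
Proof. exact: linD_of (fun a x y => lie_linl a x y c) x y. Qed.
Lemma lieZl a (c : 'End(V)) (x : 'End(V)) : lie (a *: x) c = a *: lie x c.
Proof. exact: linZ_of (fun a x y => lie_linl a x y c) a x. Qed.
Lemma lieNl (c : 'End(V)) (x : 'End(V)) : lie (- x) c = - lie x c.
Proof. exact: linN_of (fun a x y => lie_linl a x y c) x. Qed.
Lemma lie0l (c : 'End(V)) : lie 0 c = 0.
Proof. exact: lin0_of (fun a x y => lie_linl a x y c). Qed.
Lemma lieDr (c : 'End(V)) (x y : 'End(V)) : lie c (x + y) = lie c x + lie c y.
Proof. exact: linD_of (fun a x y => lie_linr a x y c) x y. Qed.
Lemma lieZr a (c : 'End(V)) (x : 'End(V)) : lie c (a *: x) = a *: lie c x.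
Proof. exact: linZ_of (fun a x y => lie_linr a x y c) a x. Qed.
Lemma lieNr (c : 'End(V)) (x : 'End(V)) : lie c (- x) = - lie c x.
Proof. exact: linN_of (fun a x y => lie_linr a x y c) x. Qed.
Lemma lie0r (c : 'End(V)) : lie c 0 = 0.
Proof. exact: lin0_of (fun a x y => lie_linr a x y c). Qed.
Definition lie_lin := (lieDl, lieDr, lieZl, lieZr, lieNl, lieNr, lie0l, lie0r).

End LieLinear.

Lemma fcross_inv f P Q : f \in e7 ->
  lie f (fcross P Q) = fcross (f P) Q + fcross P (f Q).
Proof.
move=> Hf.
(* Both sides are symmetric and bilinear in [P] and [Q], so the diagonal is enough. *)
suff diag S : lie f (fcross S S) = 2 *: fcross (f S) S.
  have := diag (1 *: P + Q).
  rewrite !lf_lin !fcross_linl !fcross_linr !lie_linr !diag !scale1r (fcrossC Q P).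
  rewrite (fcrossC (f Q) P).
  move: (lie f (fcross P Q)) (fcross (f P) Q) (fcross P (f Q)) => u v w.
  move: (fcross _ _) (fcross _ _) => p q /eqP; rewrite -subr_eq0 => /eqP H.
  apply/eqP; rewrite -subr_eq0; apply/eqP; rewrite -[RHS](scaler0 _ 2^-1) -H.
  by vfield.
case/e7P: Hf => phi [A [B [nu [H ->]]]].
case: S => [[[X Y] xi] eta].
rewrite Phi_tuple !fcross_tuple lie_Phi //; last first.
  by apply: e6Z; apply: e6D; exact: e6_jve.
rewrite PhiZ.
apply: Phi_eq.
- rewrite !(lie_lin, jve_lin) !(e6_lie_jve _ _ H).
  (* [jve_adj] turns [A v (X x X)] into the mixed term that the other side produces; its transpose
     does the same for [Y x Y]. *)
  have -> : jve A (jxp X X) = - (2 *: jve X (jxp A X)).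
    by apply/eqP; rewrite -addr_eq0 (jxpC A) jve_adj.
  have -> : jve (jxp Y Y) B = - (2 *: jve (jxp B Y) Y).
    apply/eqP; rewrite -addr_eq0 (jxpC B); apply/eqP.
    have := congr1 (@jtransp F) (jve_adj Y B).
    by rewrite jtranspD jtranspZ !jtransp_jve jtransp0.
  by vfield.
- rewrite !(lf_lin, scale_lfunE, add_lfunE, jxp_lin) jve_jxpE.
  have -> : phi (jxp Y Y) = - (2 *: jxp (jtransp phi Y) Y).
    by rewrite -[LHS]opprK -e6_jxpt // (jxpC Y) -mulr2n scaler_nat.
  by rewrite (jxpC X A) (jxpC Y (jxp _ _)) (jdotC A Y); vfield.
- rewrite !(lf_lin, jtranspZ, jtranspD, jtransp_jve, scale_lfunE, add_lfunE, jxp_lin) jve_jxpE.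
  have -> : jtransp phi (jxp X X) = - (2 *: jxp (phi X) X).
    by rewrite -[LHS]opprK -e6_jxp // (jxpC X) -mulr2n scaler_nat.
  by rewrite (jxpC Y B) (jxpC X (jxp _ _)) (jdotC B X) (jdotC Y X); vfield.
- rewrite !jdot_lin (jdotC (jxp Y Y) B) (jdotC X B) (jdot_jxpA B Y Y) (jdot_jxpC X A X).
  by rewrite (jtranspP phi X Y); field.
Qed.

(* The Freudenthal identity behind the Jacobi identity of [e8]. *)
Lemma fcross_swap P1 P2 Q : fcross P1 Q P2 - fcross P2 Q P1 =
  (4^-1 * fskew P1 P2) *: Q + (8^-1 * fskew P1 Q) *: P2 - (8^-1 * fskew P2 Q) *: P1.
Proof.
case: P1 => [[[X1 Y1] xi1] eta1]; case: P2 => [[[X2 Y2] xi2] eta2].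
case: Q => [[[Z W] zeta] omega].
rewrite !fcross_tuple !Phi_tuple !(jtranspZ, jtranspD, jtransp_jve) /fskew.
rewrite !(scale_lfunE, add_lfunE) !jve_jxpE.
have swap U V T : jdot (jxp U V) T = jdot (jxp T V) U.
  by rewrite jdot_jxpA jdotC jxpC.
apply: freud_eq; rewrite /= ?(jxp_lin, jdot_lin).
- rewrite (jxpC X2 X1) (jxpC (jxp X1 Z)) (jxpC X1 Z) (jxpC (jxp X2 Z)) (jxpC X2 Z).
  rewrite (jxpC W Y2) (jxpC W Y1) (jxpC Y2 Y1) (jdotC W X1) (jdotC W X2).
  by rewrite (jdotC Y1 X2) (jdotC Y2 X1); vfield.
- rewrite (jxpC (jxp Y1 W)) (jxpC Y1 W) (jxpC (jxp Y2 W)) (jxpC Y2 W).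
  rewrite (jxpC X2 X1) (jxpC Y2 Y1) (jxpC X1 Z) (jxpC X2 Z).
  by rewrite (jdotC W X1) (jdotC W X2) (jdotC Y1 Z) (jdotC Y2 Z); vfield.
- by rewrite (swap Y2 W Y1) /GRing.scale /=; field.
- rewrite (swap X2 Z X1) (jdotC W X1) (jdotC W X2) (jdotC Y1 X2) (jdotC Y2 X1).
  by rewrite /GRing.scale /=; field.
Qed.

End E7.

(** * The bracket of e_8 and its Jacobi identity *)

Section E8.
Context (F : numFieldType).
Notation freud := (freud F).
Notation e7 := (e7 F).
Notation e8 := (e8 F).
Implicit Types (P Q : freud) (f g h : 'End(freud)) (x y z R : e8) (u v w : subvs_of e7).

Lemma bracketE u1 P1 Q1 (r1 s1 t1 : F) u2 P2 Q2 (r2 s2 t2 : F) :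
  bracket (u1, P1, Q1, r1, s1, t1) (u2, P2, Q2, r2, s2, t2) =
  (vsproj e7 (lie (vsval u1) (vsval u2) + fcross P1 Q2 - fcross P2 Q1),
   vsval u1 P2 - vsval u2 P1 + r1 *: P2 - r2 *: P1 + s1 *: Q2 - s2 *: Q1,
   vsval u1 Q2 - vsval u2 Q1 - r1 *: Q2 + r2 *: Q1 + t1 *: P2 - t2 *: P1,
   - (8^-1 * fskew P1 Q2) + 8^-1 * fskew P2 Q1 + s1 * t2 - s2 * t1,
   4^-1 * fskew P1 P2 + 2 * r1 * s2 - 2 * r2 * s1,
   - (4^-1 * fskew Q1 Q2) - 2 * r1 * t2 + 2 * r2 * t1).
Proof. by []. Qed.

Lemma e8_eq (u1 : subvs_of e7) P1 Q1 (r1 s1 t1 : F) u2 P2 Q2 (r2 s2 t2 : F) :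
  u1 = u2 -> P1 = P2 -> Q1 = Q2 -> r1 = r2 -> s1 = s2 -> t1 = t2 ->
  (u1, P1, Q1, r1, s1, t1) = (u2, P2, Q2, r2, s2, t2) :> e8.
Proof. by move=> -> -> -> -> -> ->. Qed.

Lemma e8_lin_tuple a (u1 : subvs_of e7) P1 Q1 (r1 s1 t1 : F) u2 P2 Q2 (r2 s2 t2 : F) :
  a *: ((u1, P1, Q1, r1, s1, t1) : e8) + (u2, P2, Q2, r2, s2, t2) =
  (a *: u1 + u2, a *: P1 + P2, a *: Q1 + Q2, a * r1 + r2, a * s1 + s2, a * t1 + t2).
Proof. by []. Qed.

Lemma vsvalD u v : vsval (u + v) = vsval u + vsval v. Proof. exact: linearD. Qed.
Lemma vsvalZ a u : vsval (a *: u) = a *: vsval u. Proof. exact: linearZ. Qed.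

Lemma e7_bracket u v P1 Q1 P2 Q2 :
  lie (vsval u) (vsval v) + fcross P1 Q2 - fcross P2 Q1 \in e7.
Proof.
apply: memvB; last exact: e7_fcross; apply: memvD; last exact: e7_fcross.
by apply: e7_lie; exact: subvsP.
Qed.

Lemma bracketC R1 R2 : bracket R1 R2 = - bracket R2 R1.
Proof.
case: R1 => [[[[[u1 P1] Q1] r1] s1] t1]; case: R2 => [[[[[u2 P2] Q2] r2] s2] t2].
rewrite -[RHS]addr0 -scaleN1r.
have -> : 0 = (0, 0, 0, 0, 0, 0) :> e8 by [].
rewrite !bracketE e8_lin_tuple.
rewrite (fskewN Q1) (fskewN P1 P2) (lieN (vsval u1)).
apply: e8_eq; rewrite ?addr0.
- rewrite scaleN1r -linearN; congr (vsproj _ _).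
  move: (lie _ _) (fcross _ _) (fcross _ _) => a b c; rewrite !opprD !opprK addrAC -addrA.
  by rewrite addrA.
- vring.
- vring.
- ring.
- ring.
- ring.
Qed.

Lemma bracket_linr a x y z : bracket z (a *: x + y) = a *: bracket z x + bracket z y.
Proof.
case: x => [[[[[u1 P1] Q1] r1] s1] t1]; case: y => [[[[[u2 P2] Q2] r2] s2] t2].
case: z => [[[[[u3 P3] Q3] r3] s3] t3].
rewrite e8_lin_tuple !bracketE e8_lin_tuple vsvalD vsvalZ.
rewrite !(lie_lin, fcross_lin, fskew_lin).
apply: e8_eq.
- rewrite -linearP; congr (vsproj _ _).
  move: (lie _ _) (lie _ _) (fcross _ _) (fcross _ _) (fcross _ _) (fcross _ _) => *.
  by vring.
- by rewrite !(lf_lin, add_lfunE, scale_lfunE); vring.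
- by rewrite !(lf_lin, add_lfunE, scale_lfunE); vring.
- by ring.
- by ring.
- by ring.
Qed.

Lemma bracket_linl a x y z : bracket (a *: x + y) z = a *: bracket x z + bracket y z.
Proof. by rewrite !(bracketC _ z) bracket_linr scalerN opprD. Qed.

Lemma lie_jacobi (V : vectType F) (a b c : 'End(V)) :
  lie a (lie b c) = lie (lie a b) c + lie b (lie a c).
Proof. by apply/lfunP => i; rewrite [RHS]add_lfunE !lieE !lf_lin; vring. Qed.

(** Component by component: the e_7 part is the invariance of [P x Q] under e_7 together with the
    Jacobi identity for operators, the [P] and [Q] parts are [fcross_swap], and the scalar parts are
    the invariance of [{P, Q}]. *)
Lemma bracket_jacobi x y z :
  bracket x (bracket y z) = bracket (bracket x y) z + bracket y (bracket x z).
Proof.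
case: x => [[[[[u1 P1] Q1] r1] s1] t1]; case: y => [[[[[u2 P2] Q2] r2] s2] t2].
case: z => [[[[[u3 P3] Q3] r3] s3] t3].
rewrite -[X in X + _]scale1r !bracketE e8_lin_tuple !vsprojK ?e7_bracket // !mul1r.
have H1 := subvsP u1; have H2 := subvsP u2; have H3 := subvsP u3.
move: (vsval u1) (vsval u2) (vsval u3) H1 H2 H3 => f1 f2 f3 H1 H2 H3.
have S1 P Q := fskew_inv P Q H1; have S2 P Q := fskew_inv P Q H2.
have S3 P Q := fskew_inv P Q H3.
have J := lie_jacobi f1 f2 f3.
have E12 := lieE f1 f2; have E13 := lieE f1 f3; have E23 := lieE f2 f3.
move: (lie f1 f2) (lie f1 f3) (lie f2 f3) J E12 E13 E23 => f12 f13 f23 J E12 E13 E23.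
apply: e8_eq.
- rewrite scale1r -linearD; congr (vsproj _ _).
  rewrite !lie_lin !fcross_lin !(lieN (fcross _ _)).
  rewrite !(fcross_inv _ _ H1) !(fcross_inv _ _ H2) !(fcross_inv _ _ H3).
  rewrite J (fcrossC P3 P1) (fcrossC P2 P1) (fcrossC P3 P2).
  rewrite (fcrossC Q3 Q1) (fcrossC Q2 Q1) (fcrossC Q3 Q2).
  by vring.
- rewrite !(E12, E13, E23, add_lfunE, opp_lfunE) !lf_lin scale1r.
  have swap (A B C : freud) : fcross B C A = fcross A C B - ((4^-1 * fskew A B) *: C +
    (8^-1 * fskew A C) *: B - (8^-1 * fskew B C) *: A) by rewrite -fcross_swap subKr.
  rewrite (swap P1 P2 Q3) (swap P1 P3 Q2) (swap P2 P3 Q1).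
  by vfield.
- rewrite !(E12, E13, E23, add_lfunE, opp_lfunE) !lf_lin scale1r.
  have swap (A B C : freud) : fcross C B A = fcross C A B - ((4^-1 * fskew A B) *: C +
    (8^-1 * fskew A C) *: B - (8^-1 * fskew B C) *: A).
    by rewrite !(fcrossC C) -fcross_swap subKr.
  rewrite (swap Q1 Q3 P2) (swap Q1 Q2 P3) (swap Q2 Q3 P1).
  rewrite !(fskewN Q1 P2, fskewN Q1 P3, fskewN Q2 P1, fskewN Q2 P3, fskewN Q3 P1, fskewN Q3 P2).
  by vfield.
- rewrite !fskew_lin !(S1, S2, S3).
  rewrite ?(fskewN Q3 Q1) ?(fskewN Q2 Q1) ?(fskewN Q3 Q2) ?(fskewN P3 P1) ?(fskewN P3 P2) ?(fskewN P2 P1).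
  by field.
- rewrite !fskew_lin !(S1, S2, S3).
  rewrite (fskewN P1 (f3 P2)) S3 ?(fskewN P3 P1) ?(fskewN P3 P2) (fskewN P2 P1).
  rewrite !(fskewN Q1 P2, fskewN Q1 P3, fskewN Q2 P1, fskewN Q2 P3, fskewN Q3 P1, fskewN Q3 P2).
  by field.
- rewrite !fskew_lin !(S1, S2, S3).
  rewrite (fskewN Q1 (f3 Q2)) S3 ?(fskewN Q3 Q1) ?(fskewN Q3 Q2) (fskewN Q2 Q1).
  rewrite !(fskewN Q1 P2, fskewN Q1 P3, fskewN Q2 P1, fskewN Q2 P3, fskewN Q3 P1, fskewN Q3 P2).
  by field.
Qed.

End E8.

(** * Automorphisms of e_8 induced by automorphisms of the Jordan algebra *)

Section JordanAutomorphism.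
Context (F : numFieldType).
Notation jord := (jord F).
Notation freud := (freud F).
Notation e7 := (e7 F).
Notation e8 := (e8 F).
Variable a : 'End(jord).
Hypothesis a_mul : forall X Y, a (jmul X Y) = jmul (a X) (a Y).
Hypothesis a_tr : forall X, jtr (a X) = jtr X.
Hypothesis a_inj : lker a == 0%VS.
Local Notation b := (F4_E7 a).

Let aK x : (a^-1)%VF (a x) = x. Proof. exact: lker0_lfunK. Qed.
Let aVK x : a ((a^-1)%VF x) = x. Proof. exact: lker0_lfunVK. Qed.

Lemma aut_jE : a (jE F) = jE F.
Proof. by rewrite -[LHS]jmul_jEr -{2}[jE F]aVK -a_mul jmul_jE aVK. Qed.

Lemma aut_dot X Y : jdot (a X) (a Y) = jdot X Y.
Proof. by rewrite /jdot -a_mul a_tr. Qed.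

Lemma aut_jxp X Y : a (jxp X Y) = jxp (a X) (a Y).
Proof.
have jxpE U V : jxp U V = jmul U V - 2^-1 *: (jtr U *: V + jtr V *: U
    - (jtr U * jtr V - jdot U V) *: jE F) by rewrite jmulE; vring.
by rewrite !jxpE !lf_lin a_mul aut_jE aut_dot !a_tr.
Qed.

Lemma aut_dotV X Y : jdot (a X) Y = jdot X ((a^-1)%VF Y).
Proof. by rewrite -{1}[Y]aVK aut_dot. Qed.

Definition aconj (phi : 'End(jord)) : 'End(jord) := (a \o phi \o a^-1)%VF.

Lemma aconjE phi X : aconj phi X = a (phi ((a^-1)%VF X)).
Proof. by rewrite /aconj !comp_lfunE. Qed.

Lemma e6_aconj phi : e6 phi -> e6 (aconj phi).
Proof.
case=> D [T [HD HT ->]]; exists (aconj D), (a T); split; last 1 first.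
- apply/lfunP => X; rewrite add_lfunE !aconjE add_lfunE !jmultE lf_lin a_mul aVK.
  by [].
- move=> X Y; rewrite !aconjE.
  have -> : (a^-1)%VF (jmul X Y) = jmul ((a^-1)%VF X) ((a^-1)%VF Y).
    by rewrite -[RHS]aK a_mul !aVK.
  by rewrite HD lf_lin !a_mul !aVK.
- by rewrite a_tr.
Qed.

Lemma jtransp_aconj phi : jtransp (aconj phi) = aconj (jtransp phi).
Proof.
apply: jtranspE => X Y; rewrite !aconjE aut_dotV jtranspP.
by rewrite -[in RHS](aVK X) aut_dot.
Qed.

Lemma jve_aconj A B : jve (a A) (a B) = aconj (jve A B).
Proof.
apply/lfunP => X; rewrite aconjE !jve_jxpE !lf_lin !aut_jxp !aVK aut_dot.
by rewrite aut_dotV.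
Qed.

Lemma F4_E7E X Y (xi eta : F) : b (X, Y, xi, eta) = (a X, a Y, xi, eta).
Proof. by rewrite lfunE. Qed.

Lemma lker0_F4_E7 : lker b == 0%VS.
Proof.
have inj : injective a by exact/lker0P.
apply/lker0P => -[[[X Y] xi] eta] [[[X' Y'] xi'] eta']; rewrite !F4_E7E.
by case=> /inj -> /inj -> -> ->.
Qed.

Let bK x : (b^-1)%VF (b x) = x. Proof. exact/lker0_lfunK/lker0_F4_E7. Qed.
Let bVK x : b ((b^-1)%VF x) = x. Proof. exact/lker0_lfunVK/lker0_F4_E7. Qed.

Definition bconj (f : 'End(freud)) : 'End(freud) := (b \o f \o b^-1)%VF.

Lemma bconjE f P : bconj f P = b (f ((b^-1)%VF P)).
Proof. by rewrite /bconj !comp_lfunE. Qed.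

Lemma Phi_bconj phi A B (nu : F) :
  bconj (Phi phi A B nu) = Phi (aconj phi) (a A) (a B) nu.
Proof.
apply/lfunP => P; rewrite bconjE -[in RHS](bVK P); move: ((b^-1)%VF P).
move=> [[[X Y] xi] eta]; rewrite F4_E7E !Phi_tuple F4_E7E.
by apply: freud_eq; rewrite ?(lf_lin, jtransp_aconj, aconjE, aut_jxp, aK, aut_dot).
Qed.

Lemma e7_bconj f : f \in e7 -> bconj f \in e7.
Proof.
case/e7P => phi [A [B [nu [H ->]]]]; apply/e7P; rewrite Phi_bconj.
by do 4 eexists; split; last by []; exact: e6_aconj.
Qed.

Lemma fcross_bconj P Q : bconj (fcross P Q) = fcross (b P) (b Q).
Proof.
case: P => [[[X Y] xi] eta]; case: Q => [[[Z W] zeta] omega].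
rewrite !F4_E7E !fcross_tuple Phi_bconj.
apply: Phi_eq; rewrite ?(lf_lin, jve_aconj, aut_jxp, aut_dot) //.
by apply/lfunP => V; rewrite !(aconjE, scale_lfunE, add_lfunE, lf_lin).
Qed.

Lemma fskew_aut P Q : fskew (b P) (b Q) = fskew P Q.
Proof.
case: P => [[[X Y] xi] eta]; case: Q => [[[Z W] zeta] omega].
by rewrite !F4_E7E /fskew !aut_dot.
Qed.

Lemma lie_bconj f g : bconj (lie f g) = lie (bconj f) (bconj g).
Proof. by apply/lfunP => P; rewrite lieE !bconjE lieE !bK !lf_lin. Qed.

Lemma bconj_lin k f g : bconj (k *: f + g) = k *: bconj f + bconj g.
Proof.
apply/lfunP => P; rewrite [RHS]add_lfunE scale_lfunE !bconjE.
by rewrite add_lfunE scale_lfunE !lf_lin.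
Qed.

Lemma E7_E8_tuple (u : subvs_of e7) P Q (r s t : F) :
  E7_E8 b (u, P, Q, r, s, t) = (vsproj e7 (bconj (vsval u)), b P, b Q, r, s, t).
Proof. by rewrite lfunE. Qed.

Lemma E7_E8_bracket R1 R2 :
  E7_E8 b (bracket R1 R2) = bracket (E7_E8 b R1) (E7_E8 b R2).
Proof.
case: R1 => [[[[[u1 P1] Q1] r1] s1] t1]; case: R2 => [[[[[u2 P2] Q2] r2] s2] t2].
rewrite !bracketE !E7_E8_tuple !bracketE !vsprojK ?e7_bconj ?subvsP ?e7_bracket //.
have bvE u P : bconj (vsval u) (b P) = b (vsval u P) by rewrite bconjE bK.
apply: e8_eq; rewrite ?(lf_lin, bvE, fskew_aut) //.
congr (vsproj _ _).
have bD f g : bconj (f + g) = bconj f + bconj g by apply: linD_of bconj_lin _ _.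
have bN f : bconj (- f) = - bconj f by apply: linN_of bconj_lin _.
by rewrite (bD (_ + _)) (bD (lie _ _)) bN !fcross_bconj lie_bconj.
Qed.

End JordanAutomorphism.

(** * The automorphism sigma'_4 *)

Section Sigma4.
Context (F : numFieldType).
Notation oct := 'rV[F]_8.
Notation jord := (jord F).
Local Notation "x ** y" := (@oct_mul F x y) (at level 40, left associativity).
Local Notation e1 := (oct_e F 1).
Local Notation s4 := (linfun (@sigma4_fun F)).

Lemma sigma4_jmk (a b c : F) x y z : s4 (jmk a b c x y z) =
  jmk a b c (- (e1 ** x ** e1)) (e1 ** y) (- (z ** e1)).
Proof.
rewrite lfunE /sigma4_fun; congr pair; apply/row_matrixP => -[[|[|[|]]] //= ?];
  rewrite rowK -?val_eqE /=; apply/rowP => j; rewrite !mxE /=;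
  (congr (- _) || idtac);
  apply: eq_bigr => k _; apply: eq_bigr => l _; rewrite !mxE //;
  congr (_ * _ * _); apply: eq_bigr => k' _; apply: eq_bigr => l' _; rewrite !mxE //.
Qed.

(** This and the next two identities say that [x -> - e1 x e1], [y -> e1 y], [z -> - z e1] form a
    triality triple, that is, they are compatible with the products of off-diagonal entries in the
    Jordan algebra. *)
Lemma oct_e1_conj1 x y : oct_conj (- (e1 ** x ** e1) ** (e1 ** y)) = - (oct_conj (x ** y) ** e1).
Proof.
elim/oct8_ind: x => *; elim/oct8_ind: y => *; rewrite oct8_e !oct8E /=.
congr oct8; ring.
Qed.
Lemma oct_e1_conj2 y z : oct_conj ((e1 ** y) ** - (z ** e1)) = - (e1 ** oct_conj (y ** z) ** e1).
Proof.
elim/oct8_ind: z => *; elim/oct8_ind: y => *; rewrite oct8_e !oct8E /=.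
congr oct8; ring.
Qed.
Lemma oct_e1_conj3 z x : oct_conj (- (z ** e1) ** - (e1 ** x ** e1)) = e1 ** oct_conj (z ** x).
Proof.
elim/oct8_ind: x => *; elim/oct8_ind: z => *; rewrite oct8_e !oct8E /=.
congr oct8; ring.
Qed.

Lemma oct_e1_ip x y : [/\ oip (- (e1 ** x ** e1)) (- (e1 ** y ** e1)) = oip x y,
  oip (e1 ** x) (e1 ** y) = oip x y & oip (- (x ** e1)) (- (y ** e1)) = oip x y].
Proof.
elim/oct8_ind: x => *; elim/oct8_ind: y => *; rewrite oct8_e !oct8E /=.
by split; ring.
Qed.

Lemma sigma4_mul X Y : s4 (jmul X Y) = jmul (s4 X) (s4 Y).
Proof.
elim/jord_ind3: X => a b c x y z; elim/jord_ind3: Y => a' b' c' x' y' z'.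
rewrite jmk_mul !sigma4_jmk jmk_mul.
rewrite !oct_e1_conj1 !oct_e1_conj2 !oct_e1_conj3.
have ip1 u v := let: And3 h _ _ := oct_e1_ip u v in h.
have ip2 u v := let: And3 _ h _ := oct_e1_ip u v in h.
have ip3 u v := let: And3 _ _ h := oct_e1_ip u v in h.
rewrite !ip1 !ip2 !ip3 !oct_mul_lin.
by congr jmk; vring.
Qed.

Lemma sigma4_tr X : jtr (s4 X) = jtr X.
Proof. by elim/jord_ind3: X => *; rewrite sigma4_jmk !jmk_tr. Qed.

(** A multiplicative map that preserves the trace preserves the inner product, and the latter is
    nondegenerate. *)
Lemma lker0_sigma4 : lker s4 == 0%VS.
Proof.
apply/eqP/eqP; rewrite -subv0; apply/subvP => X; rewrite memv_ker memv0 => /eqP H.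
apply/eqP/jdot_nondeg => Y.
have dot U V : jdot (s4 U) (s4 V) = jdot U V by rewrite /jdot -sigma4_mul sigma4_tr.
by rewrite -dot H jdot0l.
Qed.

Lemma sigma4_bracket R1 R2 :
  sigma4 F (bracket R1 R2) = bracket (sigma4 F R1) (sigma4 F R2).
Proof. exact: (E7_E8_bracket sigma4_mul sigma4_tr lker0_sigma4). Qed.

Lemma sigma4_tuple (u : subvs_of (e7 F)) P Q (r s t : F) :
  sigma4 F (u, P, Q, r, s, t) = (vsproj (e7 F) (bconj s4 (vsval u)),
    F4_E7 s4 P, F4_E7 s4 Q, r, s, t).
Proof. exact: E7_E8_tuple. Qed.

End Sigma4.

(** * Exponentials of nilpotent derivations *)

Section NilpotentExponential.
Context (F : numFieldType) (V : vectType F).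
Implicit Types (D : 'End(V)) (u v : V).

Fixpoint divpow D n : 'End(V) :=
  if n is m.+1 then (m.+1%:R)^-1 *: (D \o divpow D m)%VF else \1%VF.

Lemma divpow0 D v : divpow D 0 v = v.
Proof. by rewrite id_lfunE. Qed.

Lemma divpowS D n v : D (divpow D n v) = n.+1%:R *: divpow D n.+1 v.
Proof.
by rewrite [divpow D n.+1]/= scale_lfunE comp_lfunE scalerA divff ?scale1r // pnatr_eq0.
Qed.

Lemma divpow_comm D n v : D (divpow D n v) = divpow D n (D v).
Proof.
elim: n => [|n IH]; first by rewrite !divpow0.
rewrite [divpow D n.+1]/= !scale_lfunE !comp_lfunE lfZ IH.
by [].
Qed.

Definition nexp N D : 'End(V) := \sum_(i < N) divpow D i.

Lemma nexpE N D v : nexp N D v = \sum_(i < N) divpow D i v.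
Proof. by rewrite /nexp sum_lfunE. Qed.

Lemma divpow_eq0 N D : (forall v, divpow D N v = 0) ->
  forall i v, (N <= i)%N -> divpow D i v = 0.
Proof.
move=> H i v Ni; rewrite -(subnK Ni); elim: (i - N)%N => [|k IH]; first exact: H.
by rewrite addSn [divpow _ _.+1]/= scale_lfunE comp_lfunE IH lf0 scaler0.
Qed.

(** The square is regrouped by antidiagonals: those of index below [N + N] cover it, and [a]
    vanishes outside it. *)
Lemma sum_triangle (W : zmodType) N (a : nat -> nat -> W) :
  (forall i j, (N <= i)%N || (N <= j)%N -> a i j = 0) ->
  \sum_(n < N + N) \sum_(i < n.+1) a i (n - i)%N = \sum_(i < N) \sum_(j < N) a i j.
Proof.
move=> a0.
transitivity (\sum_(0 <= n < N + N) \sum_(0 <= i < N + N | (i <= n)%N) a i (n - i)%N).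
  rewrite big_mkord; apply: eq_bigr => n _.
  rewrite (big_ord_widen_cond (N + N) xpredT (fun i => a i (n - i)%N)) //.
  by rewrite big_mkord; apply: eq_bigl => i.
rewrite (exchange_big_dep_nat predT) //=.
have -> : \sum_(0 <= i < N + N) \sum_(0 <= n < N + N | (i <= n)%N) a i (n - i)%N =
  \sum_(0 <= i < N + N) \sum_(0 <= j < N) a i j.
  apply: eq_big_nat => i /andP[_ iNN].
  have [Ni|iN] := leqP N i.
    by rewrite !big1 // => *; rewrite a0 ?Ni.
  have -> : \sum_(0 <= n < N + N | (i <= n)%N) a i (n - i)%N =
      \sum_(i <= n < N + N) a i (n - i)%N.
    by rewrite [RHS](big_nat_widenl _ 0).
  rewrite -[X in \sum_(X <= _ < _) _]add0n big_addn (@big_cat_nat _ _ _ N) //=; last first.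
    by rewrite leq_subRL ?leq_add2r ?(ltnW iN) // (leq_trans (ltnW iN)) ?leq_addr.
  rewrite [X in _ + X]big_nat_cond [X in _ + X]big1 => [|j /andP[/andP[Nj _] _]].
    by rewrite addr0; apply: eq_bigr => j _; rewrite addnK.
  by rewrite addnK a0 // Nj orbT.
rewrite (@big_cat_nat _ _ _ N) ?leq_addr //= [X in _ + X]big_nat_cond.
rewrite [X in _ + X]big1 => [|i /andP[/andP[Ni _] _]].
  by rewrite addr0 big_mkord; apply: eq_bigr => i _; rewrite big_mkord.
by rewrite big1 // => j _; rewrite a0 ?Ni.
Qed.

Lemma sum_shift (W : zmodType) n (b : nat -> W) :
  \sum_(i < n) b i.+1 *+ i.+1 = \sum_(i < n.+1) b i *+ i.
Proof. by rewrite [RHS]big_ord_recl mulr0n add0r. Qed.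

(* Both sums of divided powers satisfy the recursion [n S_n = D S_(n-1)]. *)
Lemma divpow_leibniz (m : V -> V -> V) D :
  (forall u, linear (m u)) -> (forall v, linear (m^~ v)) ->
  (forall u v, D (m u v) = m (D u) v + m u (D v)) ->
  forall n u v, divpow D n (m u v) =
    \sum_(i < n.+1) m (divpow D i u) (divpow D (n - i) v).
Proof.
move=> linr linl leib n u v.
have mZr c x y : m x (c *: y) = c *: m x y by exact: linZ_of (linr x) c y.
have mZl c x y : m (c *: x) y = c *: m x y by exact: linZ_of (linl y) c x.
elim: n => [|n IH]; first by rewrite big_ord1 !divpow0.
apply: (@scalerI _ _ n.+1%:R); first by rewrite pnatr_eq0.
rewrite -divpowS IH linear_sum.
pose b i := m (divpow D i u) (divpow D (n.+1 - i) v).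
transitivity (\sum_(i < n.+1) b i.+1 *+ i.+1 + \sum_(i < n.+1) b i *+ (n.+1 - i)).
  rewrite -big_split; apply: eq_bigr => i _ /=.
  rewrite leib !divpowS mZl mZr !scaler_nat /b subSS.
  by rewrite subSn // -ltnS.
have -> : \sum_(i < n.+1) b i *+ (n.+1 - i) = \sum_(i < n.+2) b i *+ (n.+1 - i).
  by rewrite [RHS]big_ord_recr /= subnn mulr0n addr0.
rewrite sum_shift -big_split /=.
rewrite scaler_sumr; apply: eq_bigr => i _.
by rewrite -mulrnDr subnKC ?scaler_nat // -ltnS.
Qed.

(** The Leibniz rule for divided powers matches antidiagonal sums with the terms of the left series;
    the orders from [N] to [2N - 1] may be added since they vanish. *)
Lemma nexp_morph (m : V -> V -> V) N D :
  (forall u, linear (m u)) -> (forall v, linear (m^~ v)) ->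
  (forall u v, D (m u v) = m (D u) v + m u (D v)) ->
  (forall v, divpow D N v = 0) ->
  forall u v, nexp N D (m u v) = m (nexp N D u) (nexp N D v).
Proof.
move=> linr linl leib D0 u v; have D0' := divpow_eq0 D0.
have m0r x : m x 0 = 0 by exact: lin0_of (linr x).
have m0l x : m 0 x = 0 by exact: lin0_of (linl x).
have mDr x y z : m x (y + z) = m x y + m x z by exact: linD_of (linr x) y z.
have mDl x y z : m (y + z) x = m y x + m z x by exact: linD_of (linl x) y z.
rewrite !nexpE (big_morph (m^~ _) (mDl _) (m0l _)).
under [RHS]eq_bigr => i _ do rewrite (big_morph (m _) (mDr _) (m0r _)).
rewrite -(@sum_triangle _ N (fun i j => m (divpow D i u) (divpow D j v))).
  rewrite big_split_ord /= [X in _ + X]big1 ?addr0 => [|i _].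
    by apply: eq_bigr => i _; rewrite (divpow_leibniz linr linl).
  by rewrite -(divpow_leibniz linr linl) // D0' ?leq_addr.
by move=> i j /orP[] h; rewrite (D0' _ _ h) ?m0l ?m0r.
Qed.

Lemma divpowN D n v : divpow (- D) n v = (-1) ^+ n *: divpow D n v.
Proof.
elim: n v => [|n IH] v; first by rewrite !divpow0 scale1r.
rewrite ![divpow _ n.+1]/= !scale_lfunE !comp_lfunE opp_lfunE IH lfZ exprS.
vring.
Qed.

Lemma nexpNK N D : (forall v, divpow D N v = 0) ->
  forall v, nexp N (- D) (nexp N D v) = v.
Proof.
move=> D0 v; have D0' := divpow_eq0 D0.
case: N D0 D0' => [|N] D0 D0'; first by have := D0 v; rewrite divpow0 => ->; rewrite !lf0.
rewrite !nexpE.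
transitivity (\sum_(i < N.+1) \sum_(j < N.+1) (-1) ^+ i *: divpow D i (divpow D j v)).
  by apply: eq_bigr => i _; rewrite divpowN linear_sum scaler_sumr.
rewrite -(@sum_triangle _ N.+1 (fun i j => (-1) ^+ i *: divpow D i (divpow D j v))).
  rewrite addSn big_ord_recl big_ord1 !divpow0 expr0 scale1r big1 ?addr0 // => n _.
  rewrite lift0; move: (nat_of_ord n) => {}n.
  apply: (@scalerI _ _ n.+1%:R); first by rewrite pnatr_eq0.
  rewrite scaler0 scaler_sumr.
  (* The sum of the [c i] is computed twice, absorbing the extra [D] into the left or into the right
     divided power. The difference of the two results is [n + 1] times the coefficient that has to
     vanish. *)
  pose b i := (-1) ^+ i *: divpow D i (divpow D (n.+1 - i) v).
  pose c i := (-1) ^+ i *: D (divpow D i (divpow D (n - i) v)).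
  have c1 : \sum_(i < n.+1) c i = - \sum_(i < n.+2) b i *+ i.
    rewrite -sum_shift -sumrN; apply: eq_bigr => i _.
    rewrite /c /b divpowS scalerA subSS exprS mulN1r scaleNr mulNrn opprK.
    by rewrite mulrC -scalerA scaler_nat.
  have c2 : \sum_(i < n.+1) c i = \sum_(i < n.+2) b i *+ (n.+1 - i).
    rewrite [RHS]big_ord_recr /= subnn mulr0n addr0; apply: eq_bigr => i _.
    rewrite /c /b divpow_comm divpowS lfZ -subSn -1?ltnS //.
    by rewrite scalerA mulrC -scalerA scaler_nat.
  rewrite -[RHS](subrr (\sum_(i < n.+1) c i)) {2}c1 c2 opprK -big_split.
  apply: eq_bigr => i _ /=; rewrite -mulrnDr subnK -1?ltnS // scaler_nat.
  by [].
by move=> i j /orP[] h; rewrite (D0' _ _ h) ?lf0 ?scaler0.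
Qed.

End NilpotentExponential.

(** * Traces of endomorphisms and the Killing form *)

Section Trace.
Context (F : fieldType).

Definition lmx (V W : vectType F) (f : 'Hom(V, W)) : 'M[F]_(dim V, dim W) :=
  lin1_mx (v2r \o f \o r2v).

Lemma mul_lmx (V W : vectType F) (f : 'Hom(V, W)) u : v2r u *m lmx f = v2r (f u).
Proof. by rewrite mul_rV_lin1 /= v2rK. Qed.

Lemma endo_traceE (V : vectType F) (f : 'End(V)) : endo_trace f = \tr (lmx f).
Proof. by []. Qed.

Lemma lmx_comp (U V W : vectType F) (f : 'Hom(V, W)) (g : 'Hom(U, V)) :
  lmx (f \o g)%VF = lmx g *m lmx f.
Proof.
apply/row_matrixP => i; rewrite row_mul !rowE.
by rewrite -[delta_mx 0 i](@r2vK _ U) !mul_lmx comp_lfunE.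
Qed.

Lemma endo_trace_comm (V W : vectType F) (f : 'Hom(V, W)) (g : 'Hom(W, V)) :
  endo_trace (g \o f)%VF = endo_trace (f \o g)%VF.
Proof. by rewrite !endo_traceE !lmx_comp mxtrace_mulC. Qed.

Lemma lmxD (V W : vectType F) (f g : 'Hom(V, W)) : lmx (f + g) = lmx f + lmx g.
Proof.
apply/row_matrixP => i; rewrite linearD /= !rowE -[delta_mx 0 i](@r2vK _ V) !mul_lmx.
by rewrite add_lfunE linearD.
Qed.

Lemma endo_traceD (V : vectType F) (f g : 'End(V)) :
  endo_trace (f + g) = endo_trace f + endo_trace g.
Proof. by rewrite !endo_traceE lmxD mxtraceD. Qed.

Lemma endo_trace_scale (V : vectType F) (a : F) :
  endo_trace (a *: \1%VF : 'End(V)) = a * (dim V)%:R.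
Proof.
rewrite endo_traceE (_ : lmx _ = a%:M) ?mxtrace_scalar ?mulr_natr //.
apply/row_matrixP => i; rewrite !rowE -[delta_mx 0 i](@r2vK _ V) mul_lmx.
by rewrite scale_lfunE id_lfunE linearZ /= mul_mx_scalar.
Qed.

Lemma endo_trace_ext (V : vectType F) (f g : V -> V) : f =1 g ->
  endo_trace f = endo_trace g.
Proof. by move=> H; congr (endo_trace _); apply/funext. Qed.

Lemma endo_trace0 (V : vectType F) (f : V -> V) : (forall v, f v = 0) -> endo_trace f = 0.
Proof.
move=> H; rewrite (@endo_trace_ext _ _ (0 *: \1%VF : 'End(V))) ?endo_trace_scale ?mul0r //.
by move=> v; rewrite H scale_lfunE scale0r.
Qed.

Section Product.
Variables V W : vectType F.
Let fst_lin : linear (@fst V W). Proof. by []. Qed.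
Let snd_lin : linear (@snd V W). Proof. by []. Qed.
Let inl_lin : linear (fun v : V => (v, 0 : W)).
Proof. by move=> a u v; congr pair; rewrite /= scaler0 addr0. Qed.
Let inr_lin : linear (fun w : W => (0 : V, w)).
Proof. by move=> a u v; congr pair; rewrite /= scaler0 addr0. Qed.

Definition lfun_of (U1 U2 : vectType F) (g : U1 -> U2) (Hg : linear g) : 'Hom(U1, U2) :=
  linfun (HB.pack_for {linear U1 -> U2} g (GRing.isLinear.Build F U1 U2 *:%R g Hg)).

Lemma lfun_ofE (U1 U2 : vectType F) (g : U1 -> U2) (Hg : linear g) x :
  lfun_of Hg x = g x.
Proof. by rewrite lfunE. Qed.

Let p1 := lfun_of fst_lin. Let p2 := lfun_of snd_lin.
Let i1 := lfun_of inl_lin. Let i2 := lfun_of inr_lin.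

Let endo_trace_pair_lfun (f : 'End((V * W)%type)) :
  endo_trace f = endo_trace (fun v : V => (f (v, 0)).1) +
                 endo_trace (fun w : W => (f (0, w)).2).
Proof.
have fE : f = (((i1 \o p1) + (i2 \o p2)) \o f)%VF.
  apply/lfunP => x; rewrite comp_lfunE add_lfunE !comp_lfunE !lfun_ofE.
  by case: (f x) => v w; congr pair; rewrite /= ?addr0 ?add0r.
rewrite [in LHS]fE comp_lfunDl endo_traceD -!comp_lfunA endo_trace_comm [X in _ + X]endo_trace_comm.
congr (_ + _); apply: endo_trace_ext => v; by rewrite !comp_lfunE !lfun_ofE.
Qed.

Lemma endo_trace_pair (f : V * W -> V * W) : linear f ->
  endo_trace f = endo_trace (fun v : V => (f (v, 0)).1) +
                 endo_trace (fun w : W => (f (0, w)).2).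
Proof.
move=> Hf; rewrite (@endo_trace_ext _ f (lfun_of Hf)) => [|x]; last by rewrite lfun_ofE.
rewrite endo_trace_pair_lfun; congr (_ + _); apply: endo_trace_ext => v;
  by rewrite lfun_ofE.
Qed.

Lemma linear_inl (f : V * W -> V * W) : linear f -> linear (fun v : V => (f (v, 0)).1).
Proof.
move=> Hf a u v; rewrite -[RHS]/((a *: f (u, 0) + f (v, 0)).1) -Hf.
by congr ((f (_, _)).1); rewrite /= scaler0 addr0.
Qed.

End Product.

End Trace.

Section Killing.
Context (F : numFieldType).
Notation e8 := (e8 F).

Lemma dim_freud : dim (freud F) = 56%N.
Proof. by []. Qed.

Lemma endo_trace_e8 (f : e8 -> e8) : linear f ->
  endo_trace f = endo_trace (fun u => (f (u, 0, 0, 0, 0, 0)).1.1.1.1.1) +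
    endo_trace (fun P => (f (0, P, 0, 0, 0, 0)).1.1.1.1.2) +
    endo_trace (fun Q => (f (0, 0, Q, 0, 0, 0)).1.1.1.2) +
    endo_trace (fun r : F^o => (f (0, 0, 0, r, 0, 0)).1.1.2) +
    endo_trace (fun s : F^o => (f (0, 0, 0, 0, s, 0)).1.2) +
    endo_trace (fun t : F^o => (f (0, 0, 0, 0, 0, t)).2).
Proof.
move=> Hf; rewrite (endo_trace_pair Hf).
have H1 := linear_inl Hf; rewrite (endo_trace_pair H1).
have H2 := linear_inl H1; rewrite (endo_trace_pair H2).
have H3 := linear_inl H2; rewrite (endo_trace_pair H3).
have H4 := linear_inl H3; rewrite (endo_trace_pair H4).
by [].
Qed.

Lemma endo_trace_scaling (V : vectType F) (f : V -> V) (c : F) :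
  (forall v, f v = c *: v) -> endo_trace f = c * (dim V)%:R.
Proof.
move=> H; rewrite (@endo_trace_ext _ _ _ (c *: \1%VF : 'End(V))) ?endo_trace_scale //.
by move=> v; rewrite H scale_lfunE id_lfunE.
Qed.

Lemma vsval0 : vsval (0 : subvs_of (e7 F)) = 0.
Proof. exact: linear0. Qed.

Lemma bracket_one_minus (u : subvs_of (e7 F)) P Q (r s t : F) :
  bracket (one_minus F) (u, P, Q, r, s, t) = (0, 0, P, - s, 0, 2 * r).
Proof.
rewrite /one_minus bracketE !(linear0, lie_lin, fcross_lin, fskew_lin, lf_lin, zero_lfunE).
apply: e8_eq; rewrite ?(scale0r, scaler0, mul0r, mulr0, subr0, addr0, add0r, oppr0, linear0) //.
- by rewrite scale1r.
- by rewrite mulr1.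
- by rewrite mulr1.
Qed.

(** Only three diagonal blocks of the composite operator contribute: [56 s] from the [Q] summand and
    [2 s] from each of the [r] and [t] summands. Dividing by 30 leaves the [2 s] that makes [1_-]
    satisfy the quadratic equations. *)
Lemma killing_one_minus (u : subvs_of (e7 F)) P Q (r s t : F) :
  killing (one_minus F) (u, P, Q, r, s, t) = 60 * s.
Proof.
rewrite /killing endo_trace_e8; last first.
  by move=> a x y; rewrite !bracket_linr.
rewrite endo_trace0 ?add0r => [|v]; last by rewrite (bracketE u P Q r s t) bracket_one_minus.
rewrite endo_trace0 ?add0r => [|v]; last by rewrite (bracketE u P Q r s t) bracket_one_minus.
rewrite (@endo_trace_scaling _ _ s) => [|v]; last first.
  rewrite (bracketE u P Q r s t) bracket_one_minus vsval0 zero_lfunE /=.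
  by rewrite !lf_lin; vring.
rewrite (@endo_trace_scaling _ _ (2 * s)) => [|v]; last first.
  rewrite (bracketE u P Q r s t) bracket_one_minus !fskew_lin /= /GRing.scale /=; ring.
rewrite endo_trace0 ?addr0 => [|v]; last by rewrite (bracketE u P Q r s t) bracket_one_minus.
rewrite (@endo_trace_scaling _ _ (2 * s)) => [|v]; last first.
  rewrite (bracketE u P Q r s t) bracket_one_minus !fskew_lin /= /GRing.scale /=; ring.
rewrite dim_freud (_ : dim F^o = 1%N) //; ring.
Qed.

End Killing.

Lemma lf_sum (F : fieldType) (U V : vectType F) (f : 'Hom(U, V)) (I : Type)
  (r : seq I) (P : pred I) (E : I -> U) :
  f (\sum_(i <- r | P i) E i) = \sum_(i <- r | P i) f (E i).
Proof. exact: linear_sum. Qed.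

(** * The group G and its subgroup generated by exponentials *)

Section Group.
Context (F : numFieldType).
Notation freud := (freud F).
Notation e7 := (e7 F).
Notation e8 := (e8 F).
Notation G := (E8_sigma4_so6 F).
Implicit Types (x y z R : e8) (P Q : freud) (u : subvs_of e7) (al be g h : 'End(e8)).

HB.instance Definition _ x := GRing.isLinear.Build F e8 e8 *:%R (bracket x)
  (fun a y z => bracket_linr a y z x).

Definition ad x : 'End(e8) := linfun (bracket x).
Lemma adE x y : ad x y = bracket x y. Proof. exact: lfunE. Qed.

Lemma bracket0r z : bracket z 0 = 0. Proof. exact: linear0. Qed.
Lemma bracketDr x y z : bracket z (x + y) = bracket z x + bracket z y.
Proof. exact: linearD. Qed.
Lemma bracketZr a x z : bracket z (a *: x) = a *: bracket z x.
Proof. exact: linearZ. Qed.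
Lemma bracketNr x z : bracket z (- x) = - bracket z x.
Proof. exact: linearN. Qed.
Lemma bracket0l z : bracket 0 z = 0.
Proof. by rewrite bracketC bracket0r oppr0. Qed.
Lemma bracketDl x y z : bracket (x + y) z = bracket x z + bracket y z.
Proof. by rewrite !(bracketC _ z) bracketDr opprD. Qed.
Lemma bracketZl a x z : bracket (a *: x) z = a *: bracket x z.
Proof. by rewrite !(bracketC _ z) bracketZr scalerN. Qed.
Lemma bracketNl x z : bracket (- x) z = - bracket x z.
Proof. by rewrite !(bracketC _ z) bracketNr. Qed.
Definition bracket_lin := (bracketDl, bracketDr, bracketZl, bracketZr, bracketNl,
  bracketNr, bracket0l, bracket0r).

(** The bound 8 covers all the nilpotency orders that occur: 3 for [1_-] and [1^-], 5 for [eP] and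
    [eQ], 7 for [eF f] with [f^4 = 0]. A uniform bound keeps [eexp] a single polynomial expression
    in [ad x]. *)
Definition ad_nilp x := forall v, divpow (ad x) 8 v = 0.

Definition eexp x : 'End(e8) := nexp 8 (ad x).

Lemma adN x : ad (- x) = - ad x.
Proof. by apply/lfunP => v; rewrite opp_lfunE !adE bracketNl. Qed.
Lemma adZ a x : ad (a *: x) = a *: ad x.
Proof. by apply/lfunP => v; rewrite scale_lfunE !adE bracketZl. Qed.

Lemma divpowSE (V : vectType F) (D : 'End(V)) n v :
  divpow D n.+1 v = (n.+1%:R)^-1 *: D (divpow D n v).
Proof. by rewrite /= scale_lfunE comp_lfunE. Qed.

Lemma divpowZ (V : vectType F) (D : 'End(V)) a n v :
  divpow (a *: D) n v = a ^+ n *: divpow D n v.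
Proof.
elim: n v => [|n IH] v; first by rewrite !divpow0 scale1r.
rewrite !divpowSE scale_lfunE IH lfZ exprS.
vring.
Qed.

Lemma ad_nilpZ a x : ad_nilp x -> ad_nilp (a *: x).
Proof. by move=> H v; rewrite adZ divpowZ H scaler0. Qed.

Lemma ad_nilpN x : ad_nilp x -> ad_nilp (- x).
Proof. by move=> H; rewrite -scaleN1r; exact: ad_nilpZ. Qed.

Lemma eexpZ t x v : eexp (t *: x) v = \sum_(i < 8) t ^+ i *: divpow (ad x) i v.
Proof. by rewrite /eexp nexpE; apply: eq_bigr => i _; rewrite adZ divpowZ. Qed.

Lemma eexp_bracket x y z : ad_nilp x ->
  eexp x (bracket y z) = bracket (eexp x y) (eexp x z).
Proof.
move=> H; apply: nexp_morph => //.
- by move=> u a v w; exact: bracket_linr.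
- by move=> u a v w; exact: bracket_linl.
- by move=> u v; rewrite !adE bracket_jacobi.
Qed.

Lemma eexpNK x : ad_nilp x -> cancel (eexp x) (eexp (- x)).
Proof. by move=> H v; rewrite /eexp adN; exact: nexpNK. Qed.

Lemma eexpKN x : ad_nilp x -> cancel (eexp (- x)) (eexp x).
Proof. by move=> /ad_nilpN/eexpNK; rewrite opprK. Qed.

Lemma nexp_comm (V : vectType F) (D A : 'End(V)) n : (forall v, A (D v) = D (A v)) ->
  forall v, A (nexp n D v) = nexp n D (A v).
Proof.
move=> H v; rewrite !nexpE lf_sum; apply: eq_bigr => i _.
elim: (nat_of_ord i) => [|k IH]; first by rewrite !divpow0.
by rewrite !divpowSE lfZ H IH.
Qed.

(* The Lie algebra of [G]. *)
Definition kk x := sigma4 F x = x /\ forall D, so6 D -> bracket (R_D D) x = 0.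

Lemma kk_lin a x y : kk x -> kk y -> kk (a *: x + y).
Proof.
move=> [sx Dx] [sy Dy]; split; first by rewrite lfD lfZ sx sy.
by move=> D HD; rewrite bracket_linr Dx // Dy // scaler0 addr0.
Qed.

Lemma kk0 : kk 0.
Proof. by split; [exact: lf0 | move=> D _; exact: bracket0r]. Qed.
Lemma kkZ a x : kk x -> kk (a *: x).
Proof. by move=> H; rewrite -[_ *: _]addr0; apply: kk_lin => //; exact: kk0. Qed.
Lemma kkN x : kk x -> kk (- x).
Proof. by move=> H; rewrite -scaleN1r; exact: kkZ. Qed.

Lemma kk_bracket x y : kk x -> kk y -> kk (bracket x y).
Proof.
move=> [sx Dx] [sy Dy]; split; first by rewrite sigma4_bracket sx sy.
by move=> D HD; rewrite bracket_jacobi Dx // Dy // bracket0l bracket0r addr0.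
Qed.

Lemma eexp_G x : kk x -> ad_nilp x -> G (eexp x).
Proof.
move=> [sx Dx] nx; split.
- split; first by exists (eexp (- x)); [exact: eexpNK | exact: eexpKN].
  by move=> y z; exact: eexp_bracket.
- apply/lfunP => v; rewrite !comp_lfunE; apply: nexp_comm => w.
  by rewrite !adE sigma4_bracket sx.
- move=> D HD v; rewrite -!adE; apply: nexp_comm => w; rewrite !adE.
  by rewrite bracket_jacobi Dx // bracket0l add0r.
Qed.

Lemma G_id : G \1%VF.
Proof.
split; first split.
- by exists id => v; rewrite id_lfunE.
- by move=> y z; rewrite !id_lfunE.
- by rewrite comp_lfun1r comp_lfun1l.
- by move=> D _ v; rewrite !id_lfunE.
Qed.

Lemma G_comp al be : G al -> G be -> G (al \o be)%VF.
Proof.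
move=> [[ba la] sa Da] [[bb lb] sb Db]; split; first split.
- apply: (eq_bij (bij_comp ba bb)) => v; by rewrite comp_lfunE.
- by move=> y z; rewrite !comp_lfunE lb la.
- by rewrite comp_lfunA sa -!comp_lfunA sb.
- by move=> D HD v; rewrite !comp_lfunE Da // Db.
Qed.

Lemma G_lker0 al : G al -> lker al == 0%VS.
Proof. by case=> -[/bij_inj/lker0P]. Qed.

Lemma G_inv al : G al -> G (al^-1)%VF.
Proof.
move=> Gal; have k0 := G_lker0 Gal; case: Gal => [[ba la] sa Da].
have K1 v : (al^-1)%VF (al v) = v by exact: lker0_lfunK.
have K2 v : al ((al^-1)%VF v) = v by exact: lker0_lfunVK.
split; first split.
- by exists al.
- by move=> y z; rewrite -{1}[y]K2 -{1}[z]K2 -la K1.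
- apply/lfunP => v; rewrite !comp_lfunE.
  have := congr1 (fun f : 'End(e8) => f ((al^-1)%VF v)) sa; rewrite /= !comp_lfunE K2.
  by move=> ->; rewrite K1.
- by move=> D HD v; rewrite -[in RHS](K2 v) Da // K1.
Qed.

Lemma G_K al : G al -> cancel al (al^-1)%VF.
Proof. by move=> H v; rewrite lker0_lfunK // G_lker0. Qed.
Lemma G_VK al : G al -> cancel (al^-1)%VF al.
Proof. by move=> H v; rewrite lker0_lfunVK // G_lker0. Qed.

Lemma G_bracket al : G al -> forall x y, al (bracket x y) = bracket (al x) (al y).
Proof. by case=> [[]]. Qed.

Lemma G_kk al x : G al -> kk x -> kk (al x).
Proof.
case=> [[_ la] sa Da] [sx Dx]; split.
  have := congr1 (fun f : 'End(e8) => f x) sa; rewrite /= !comp_lfunE sx.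
  by [].
by move=> D HD; rewrite Da // Dx // lf0.
Qed.

Lemma killing_G al x y : G al -> killing (al x) (al y) = killing x y.
Proof.
move=> Gal; have K := G_K Gal; have la := G_bracket Gal.
rewrite /killing (@endo_trace_ext _ _ _ (al \o (ad x \o ad y \o al^-1))%VF); last first.
  by move=> v; rewrite !comp_lfunE !adE !la G_VK.
rewrite endo_trace_comm; apply: endo_trace_ext => v.
by rewrite !comp_lfunE K !adE.
Qed.

Lemma G_W8 al x : G al -> W8 x -> W8 (al x).
Proof.
move=> Gal [H x0]; have la := G_bracket Gal; split.
  move=> y; rewrite -[y](G_VK Gal) -!la killing_G // -lfZ -lfD H lf0 //.
by apply: contraNneq x0 => E; rewrite -[x](G_K Gal) E lf0.
Qed.

Lemma G_W8_sigma4 al x : G al -> W8_sigma4_so6 F x -> W8_sigma4_so6 F (al x).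
Proof.
move=> Gal [Wx sx Dx]; have [sax Dax] := G_kk Gal (conj sx Dx).
by split; [exact: G_W8 | exact: sax | exact: Dax].
Qed.

(** Words in the generators, built one exponential at a time, so that induction yields both closure
    properties and a path from the identity. *)
Inductive G0 : 'End(e8) -> Prop :=
| G0_id : G0 \1%VF
| G0_eexp x g : kk x -> ad_nilp x -> G0 g -> G0 (eexp x \o g)%VF.

Lemma G0_G g : G0 g -> G g.
Proof.
elim=> [|x h kx nx _ Gh]; first exact: G_id.
by apply: G_comp => //; exact: eexp_G.
Qed.

Lemma G0_1 x : kk x -> ad_nilp x -> G0 (eexp x).
Proof. by move=> kx nx; rewrite -[eexp x]comp_lfun1r; apply: G0_eexp => //; exact: G0_id. Qed.

Lemma G0_comp g h : G0 g -> G0 h -> G0 (g \o h)%VF.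
Proof.
elim=> [|x g' kx nx _ IH] Gh; first by rewrite comp_lfun1l.
by rewrite -comp_lfunA; apply: G0_eexp => //; exact: IH.
Qed.

Lemma G0_inv g : G0 g -> G0 (g^-1)%VF.
Proof.
(* [g] is already invertible in [G], so a left inverse inside [G0] is its inverse. *)
move=> Gg; suff [h [Gh hg]] : exists h, G0 h /\ (h \o g = \1)%VF.
  suff -> : (g^-1)%VF = h by [].
  apply/lfunP => v; rewrite -[v](G_VK (G0_G Gg)) G_K; last exact: G0_G.
  by rewrite -[LHS]id_lfunE -hg comp_lfunE.
elim: Gg => [|x g' kx nx _ [h [Gh hg]]].
  by exists \1%VF; split; [exact: G0_id | rewrite comp_lfun1l].
exists (h \o eexp (- x))%VF; split.
  by apply: G0_comp => //; apply: G0_1; [exact: kkN | exact: ad_nilpN].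
apply/lfunP => v; rewrite !comp_lfunE eexpNK //.
by rewrite -[LHS]/(h (g' v)) -comp_lfunE hg.
Qed.

End Group.

(** * The subalgebra so(6): its invariants and its centre *)

Section So6.
Context (F : numFieldType).
Notation oct := 'rV[F]_8.
Notation jord := (jord F).
Local Notation "x ** y" := (@oct_mul F x y) (at level 40, left associativity).
Local Notation e := (oct_e F).
Implicit Types (X Y : jord) (D : 'End(jord)).

Definition F1 (x : oct) : jord := jmk 0 0 0 x 0 0.
Definition F2 (x : oct) : jord := jmk 0 0 0 0 x 0.
Definition F3 (x : oct) : jord := jmk 0 0 0 0 0 x.
Definition E1 : jord := jmk 1 0 0 0 0 0.
Definition E2 : jord := jmk 0 1 0 0 0 0.
Definition E3 : jord := jmk 0 0 1 0 0 0.

Definition oct_lin := (@oct_mul_lin F, @oct_conj_lin F, @oip_lin F).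

Lemma jmk_split a b c x y z : jmk a b c x y z =
  a *: E1 + b *: E2 + c *: E3 + F1 x + F2 y + F3 z.
Proof. by rewrite /E1 /E2 /E3 /F1 /F2 /F3 !jmkZ !jmkD; congr jmk; by [ring|vring]. Qed.

Lemma jEk_E : [/\ jEk F 0 = E1, jEk F 1 = E2 & jEk F (inord 2) = E3].
Proof.
by split; rewrite jmk_jEk /= ?inordK.
Qed.

Lemma jFk0_F1 x : jFk 0 x = F1 x.
Proof. by rewrite jmk_jFk /= scale1r !scale0r. Qed.

(** For [a], [b] among e_2, ..., e_7 these are the plane rotations used as test elements of
    [so6]. *)
Definition Dab (a b : oct) : 'End(jord) := lie (jmult (F1 a)) (jmult (F1 b)).

Lemma f4_e6 D : e6 D -> D (jE F) = 0 -> f4 D.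
Proof.
case=> D' [T [HD HT ->]]; rewrite add_lfunE f4_jE // add0r jmultE jmul_jEr => ->.
move=> X Y; rewrite !add_lfunE !jmultE !jmul0l !addr0; exact: HD.
Qed.

(** [[A~, B~]] is half of [A v B - B v A], because the symmetric part of [v] cancels. Hence it lies
    in e_6; since it kills [E], it is a derivation. *)
Lemma f4_Dab a b : f4 (Dab a b).
Proof.
apply: f4_e6; last by rewrite lieE !jmultE !jmul_jEr jmulC subrr.
have -> : Dab a b = 2^-1 *: (jve (F1 a) (F1 b) - jve (F1 b) (F1 a)).
  rewrite jve.unlock /jvee (jmulC (F1 b) (F1 a)) (jdotC (F1 b) (F1 a)) -/(Dab a b).
  rewrite [lie (jmult (F1 b)) _]lieN -/(Dab a b).
  by move: (jmult _) (Dab a b) => f g; vfield.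
by apply: e6Z; apply: e6D; [exact: e6_jve | apply: e6N; exact: e6_jve].
Qed.

Lemma jmul_F1 a p q r x y z : jmul (F1 a) (jmk p q r x y z) =
  jmk 0 (oip a x) (oip a x) ((2^-1 * (q + r)) *: a) (2^-1 *: oct_conj (z ** a))
    (2^-1 *: oct_conj (a ** y)).
Proof. by rewrite jmk_mul !oct_lin; congr jmk; by [ring|vring]. Qed.

(** The infinitesimal rotation in the plane of [a] and [b] appears on F_1, and its two half-spin
    actions on F_2 and F_3. *)
Lemma DabE a b p q r x y z : Dab a b (jmk p q r x y z) =
  jmk 0 0 0 (oip b x *: a - oip a x *: b)
    (4^-1 *: (oct_conj a ** (b ** y) - oct_conj b ** (a ** y)))
    (4^-1 *: ((z ** b) ** oct_conj a - (z ** a) ** oct_conj b)).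
Proof.
rewrite lieE !jmultE !jmul_F1 !oct_lin !oct_conj_mul !oct_conjK jmkN jmkD.
by rewrite (oipC b a); congr jmk; by [ring|vfield].
Qed.

Lemma so6E D : so6 D <-> [/\ f4 D, [/\ D E1 = 0, D E2 = 0 & D E3 = 0]
  & D (F1 (e 0)) = 0 /\ D (F1 (e 1)) = 0].
Proof.
have [H0 H1 H2] := jEk_E; split=> [[HD HE [H3 H4]]|[HD [D1 D2 D3] [H3 H4]]].
  by split=> //; [rewrite -H0 -H1 -H2; split; exact: HE | rewrite -!jFk0_F1].
split=> //; last by rewrite !jFk0_F1.
move=> k; have -> : k = 0 \/ k = 1 \/ k = inord 2 -> D (jEk F k) = 0.
- by case=> [->|[->|->]]; rewrite ?H0 ?H1 ?H2.
- by [].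
case: k => [[|[|[|]]] //= ?]; [left|right; left|right; right]; apply: val_inj => //=.
by rewrite inordK.
Qed.

Lemma so6_Dab (i j : nat) : (1 < i < 8)%N -> (1 < j < 8)%N -> so6 (Dab (e i) (e j)).
Proof.
move=> Hi Hj; apply/so6E; split; first exact: f4_Dab.
  by rewrite !DabE !oct_lin !scale0r !subrr !scaler0 jmk0.
have ip k l : (k < 2)%N -> (1 < l < 8)%N -> oip (e l) (e k) = 0.
  move=> k2 /andP[l1 l8]; rewrite !oct8_e oct8_ip.
  by case: k l k2 l1 l8 => [|[|]] // [|[|[|[|[|[|[|[|]]]]]]]] //= *; ring.
by rewrite !DabE !oct_lin !ip // !scale0r !subrr !scaler0 jmk0.
Qed.

Lemma oct_conj_pol a b y : oct_conj a ** (b ** y) + oct_conj b ** (a ** y) = (2 * oip a b) *: y.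
Proof.
have /eqP := oct_conj_mulK (a + b) y; rewrite -subr_eq0 !oct_lin !oct_conj_mulK (oipC b a).
move/eqP => H; apply/eqP; rewrite -subr_eq0; apply/eqP; rewrite -[RHS]H; vring.
Qed.

Lemma oct_conj_polr a b z : (z ** b) ** oct_conj a + (z ** a) ** oct_conj b = (2 * oip a b) *: z.
Proof.
have := oct_conj_pol (oct_conj a) (oct_conj b) (oct_conj z).
move/(congr1 (@oct_conj F)); rewrite !oct_lin !oct_conj_mul ?oct_conjK oip_conj.
by [].
Qed.

Lemma oip_e (i j : nat) : (i < 8)%N -> (j < 8)%N -> oip (e i) (e j) = (i == j)%:R.
Proof.
rewrite !oct8_e oct8_ip.
by case: i j => [|[|[|[|[|[|[|[|]]]]]]]] // [|[|[|[|[|[|[|[|]]]]]]]] //= *; ring.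
Qed.

Lemma oct_eq0 x : (forall i, (i < 8)%N -> oip (e i) x = 0) -> x = 0.
Proof.
elim/oct8_ind: x => x0 x1 x2 x3 x4 x5 x6 x7 H.
have H0 := H 0 isT; have H1 := H 1 isT; have H2 := H 2 isT; have H3 := H 3 isT.
have H4 := H 4 isT; have H5 := H 5 isT; have H6 := H 6 isT; have H7 := H 7 isT.
move: H0 H1 H2 H3 H4 H5 H6 H7; rewrite !oct8_e !oct8_ip /=.
rewrite !(mul0r, mul1r, add0r, addr0) => -> -> -> -> -> -> -> ->.
by apply/rowP => -[[|[|[|[|[|[|[|[|]]]]]]]] //= ?]; rewrite !mxE.
Qed.

Lemma oct_sum_e x : x = \sum_(i < 8) oip (e i) x *: e i.
Proof.
apply/eqP; rewrite -subr_eq0; apply/eqP; apply: oct_eq0 => i Hi.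
rewrite oipDr oipNr (big_morph (oip (e i)) (fun u v => oipDr u v (e i)) (oip0r (e i))).
rewrite (bigD1 (Ordinal Hi)) //= big1 => [|j ji].
  by rewrite oipZr oip_e // eqxx mulr1 addr0 subrr.
rewrite oipZr oip_e // (_ : (i == j :> nat) = false) ?mulr0 //.
by apply/negbTE; rewrite eq_sym.
Qed.

Lemma oct_span01 x : (forall i, (1 < i < 8)%N -> oip (e i) x = 0) ->
  x = oip (e 0) x *: e 0 + oip (e 1) x *: e 1.
Proof.
move=> H; rewrite {1}(oct_sum_e x) 2!big_ord_recl big1 ?addr0 // => i _.
by rewrite H ?scale0r // lift0 lift0 /= !ltnS; case: i.
Qed.

Lemma DabE' (i j : nat) p q r x y z : (i < 8)%N -> (j < 8)%N -> i != j ->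
  Dab (e i) (e j) (jmk p q r x y z) =
  jmk 0 0 0 (oip (e j) x *: e i - oip (e i) x *: e j)
    (2^-1 *: (oct_conj (e i) ** (e j ** y)))
    (2^-1 *: ((z ** e j) ** oct_conj (e i))).
Proof.
move=> Hi Hj ij; rewrite DabE.
have := oct_conj_pol (e i) (e j) y; have := oct_conj_polr (e i) (e j) z.
rewrite oip_e // (negbTE ij) mulr0 !scale0r => /eqP; rewrite addr_eq0 => /eqP ->.
move/eqP; rewrite addr_eq0 => /eqP ->.
by congr jmk; vfield.
Qed.

Lemma oct_conj_e_inj i j y : (i < 8)%N -> (j < 8)%N ->
  oct_conj (e i) ** (e j ** y) = 0 -> y = 0.
Proof.
move=> Hi Hj H; have := oct_conj_mulK (e j) y; rewrite oip_e // eqxx scale1r => <-.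
have := oct_conj_mulK (oct_conj (e i)) (e j ** y).
by rewrite H oct_mul0r oip_conj oip_e // eqxx scale1r => <-; rewrite oct_mul0r.
Qed.

Lemma oct_conj_e_injr i j z : (i < 8)%N -> (j < 8)%N ->
  (z ** e j) ** oct_conj (e i) = 0 -> z = 0.
Proof.
move=> Hi Hj H; have := oct_mul_conjK (e j) z; rewrite oip_e // eqxx scale1r => <-.
have := oct_mul_conjK (oct_conj (e i)) (z ** e j).
by rewrite H oct_mul0l oip_conj oip_e // eqxx scale1r => <-; rewrite oct_mul0l.
Qed.

(* The elements of [J] annihilated by [so6]. *)
Definition JK X := exists p q r m n : F, X = jmk p q r (m *: e 0 + n *: e 1) 0 0.

Lemma Dab_off1 i j x : (i < 8)%N -> (j < 8)%N -> i != j ->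
  oip (e j) x *: e i - oip (e i) x *: e j = 0 -> oip (e i) x = 0 /\ oip (e j) x = 0.
Proof.
move=> Hi Hj ij H; split.
- have := congr1 (oip (e j)) H; rewrite !oct_lin !oip_e // eqxx eq_sym (negbTE ij).
  by rewrite mulr0 mulr1 add0r => /eqP; rewrite oppr_eq0 => /eqP.
- have := congr1 (oip (e i)) H; rewrite !oct_lin !oip_e // eqxx (negbTE ij).
  by rewrite mulr0 mulr1 subr0.
Qed.

(** The rotations in the planes (2,3), (4,5), (6,7) kill the corresponding coordinates of [x]; on
    [y] and [z] they act by products of injective multiplications, so these entries vanish. *)
Lemma so6_JK X : (forall D, so6 D -> D X = 0) <-> JK X.
Proof.
split=> [|[p [q [r [m [n ->]]]]] D /so6E[_ [d1 d2 d3] [d4 d5]]]; last first.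
  rewrite jmk_split !lf_lin d1 d2 d3.
  have -> : F1 (m *: e 0 + n *: e 1) = m *: F1 (e 0) + n *: F1 (e 1).
    by rewrite /F1 !jmkZ jmkD; congr jmk; by [ring|vring].
  by rewrite /F2 /F3 jmk0 !lf_lin d4 d5 !scaler0 !addr0.
elim/jord_ind3: X => p q r x y z H.
have K i j : (1 < i < 8)%N -> (1 < j < 8)%N -> i != j ->
    [/\ oip (e i) x = 0, oip (e j) x = 0, y = 0 & z = 0].
  move=> Hi Hj ij; have := H _ (so6_Dab Hi Hj).
  case/andP: Hi => _ Hi; case/andP: Hj => _ Hj.
  rewrite DabE' // -jmk0 => /jmk_inj[_ [/(Dab_off1 Hi Hj ij)[x1 x2] y0 z0]].
  split=> //.
  - apply: (@oct_conj_e_inj i j) => //; move/eqP: y0.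
    by rewrite scaler_eq0 invr_eq0 pnatr_eq0 => /eqP.
  - apply: (@oct_conj_e_injr i j) => //; move/eqP: z0.
    by rewrite scaler_eq0 invr_eq0 pnatr_eq0 => /eqP.
have [x2 x3 -> ->] := K 2 3 isT isT isT.
have [x4 x5 _ _] := K 4 5 isT isT isT; have [x6 x7 _ _] := K 6 7 isT isT isT.
exists p, q, r, (oip (e 0) x), (oip (e 1) x); rewrite -oct_span01 //.
by case=> [|[|[|[|[|[|[|[|]]]]]]]].
Qed.

(* The nucleus of the octonions is the ground field; four associators suffice. *)
Lemma oct_nucleus w : (forall i j, (i < 8)%N -> (j < 8)%N -> (e i ** e j) ** w = e i ** (e j ** w)) ->
  w = oip (e 0) w *: e 0.
Proof.
have inj8 a0 a1 a2 a3 a4 a5 a6 a7 b0 b1 b2 b3 b4 b5 b6 b7 :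
    oct8 a0 a1 a2 a3 a4 a5 a6 a7 = oct8 (b0 : F) b1 b2 b3 b4 b5 b6 b7 ->
    [/\ [/\ a0 = b0, a1 = b1, a2 = b2 & a3 = b3] & [/\ a4 = b4, a5 = b5, a6 = b6 & a7 = b7]].
  move/rowP => H; split; split;
  [have := H 0 | have := H 1 | have := H (inord 2) | have := H (inord 3)
  |have := H (inord 4) | have := H (inord 5) | have := H (inord 6) | have := H (inord 7)];
  by rewrite !mxE /= ?inordK.
elim/oct8_ind: w => w0 w1 w2 w3 w4 w5 w6 w7 H.
have eq0 (u v c : F) : u = v -> u - v = c * 2 -> c = 0.
  move=> -> /esym/eqP; rewrite subrr mulf_eq0 pnatr_eq0 orbF => /eqP //.
have eq0N (u v c : F) : u = v -> u - v = - c * 2 -> c = 0.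
  by move=> uv /(eq0 _ _ _ uv) /eqP; rewrite oppr_eq0 => /eqP.
have fin (u v c : F) : u = v -> (u - v = c * 2) \/ (u - v = - c * 2) -> c = 0.
  by move=> uv [/(eq0 _ _ _ uv)|/(eq0N _ _ _ uv)].
have := H 1 2 isT isT; rewrite !oct8_e /= !oct8E => /inj8[_ [h4 h5 h6 h7]].
have := H 1 4 isT isT; rewrite !oct8_e /= !oct8E => /inj8[_ [_ _ h3 h2]].
have := H 2 5 isT isT; rewrite !oct8_e /= !oct8E => /inj8[_ [_ _ h1 _]].
have z1 : w1 = 0 by apply: (fin _ _ _ h1); first [left; ring | right; ring].
have z2 : w2 = 0 by apply: (fin _ _ _ h2); first [left; ring | right; ring].
have z3 : w3 = 0 by apply: (fin _ _ _ h3); first [left; ring | right; ring].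
have z4 : w4 = 0 by apply: (fin _ _ _ h7); first [left; ring | right; ring].
have z5 : w5 = 0 by apply: (fin _ _ _ h6); first [left; ring | right; ring].
have z6 : w6 = 0 by apply: (fin _ _ _ h5); first [left; ring | right; ring].
have z7 : w7 = 0 by apply: (fin _ _ _ h4); first [left; ring | right; ring].
by rewrite z1 z2 z3 z4 z5 z6 z7; congr oct8; ring.
Qed.

Lemma F1_lin a x y : F1 (a *: x + y) = a *: F1 x + F1 y.
Proof. by rewrite /F1 jmkZ jmkD; congr jmk; by [ring|vring]. Qed.
Lemma F2_lin a x y : F2 (a *: x + y) = a *: F2 x + F2 y.
Proof. by rewrite /F2 jmkZ jmkD; congr jmk; by [ring|vring]. Qed.
Lemma F3_lin a x y : F3 (a *: x + y) = a *: F3 x + F3 y.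
Proof. by rewrite /F3 jmkZ jmkD; congr jmk; by [ring|vring]. Qed.

Lemma oct_lin_ext (V : lmodType F) (f g : oct -> V) : linear f -> linear g ->
  (forall i, (i < 8)%N -> f (e i) = g (e i)) -> f =1 g.
Proof.
move=> lf lg H x; rewrite (oct_sum_e x) !(big_morph _ (linD_of _) (lin0_of _)) //.
by apply: eq_bigr => i _; rewrite !(linZ_of _) // H.
Qed.

(** A derivation killing the three idempotents commutes with the multiplications by them, and the
    F_k spaces are joint eigenspaces of these multiplications. *)
Lemma f4_peirce D : f4 D -> [/\ D E1 = 0, D E2 = 0 & D E3 = 0] ->
  forall w, [/\ exists w', D (F1 w) = F1 w', exists w', D (F2 w) = F2 w'
    & exists w', D (F3 w) = F3 w'].
Proof.
move=> HD [d1 d2 d3] w.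
have E_mul p q r x y z :
  [/\ jmul E1 (jmk p q r x y z) = jmk p 0 0 0 (2^-1 *: y) (2^-1 *: z),
      jmul E2 (jmk p q r x y z) = jmk 0 q 0 (2^-1 *: x) 0 (2^-1 *: z) &
      jmul E3 (jmk p q r x y z) = jmk 0 0 r (2^-1 *: x) (2^-1 *: y) 0].
  by split; rewrite /E1 /E2 /E3 jmk_mul !oct_lin; congr jmk; by [ring|vring].
have DE X : [/\ D (jmul E1 X) = jmul E1 (D X), D (jmul E2 X) = jmul E2 (D X)
    & D (jmul E3 X) = jmul E3 (D X)].
  by split; rewrite HD ?d1 ?d2 ?d3 jmul0l add0r.
have half (u : F) : u = 0 * 2 + u + u -> u = 0.
  by rewrite mul0r add0r -[LHS]addr0 => /addrI <-.
have halfv (u : oct) : 2^-1 *: u = 0 -> u = 0.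
  by move/eqP; rewrite scaler_eq0 invr_eq0 pnatr_eq0 => /eqP.
split.
- have [k1 k2 k3] := DE (F1 w); have [m1 m2 m3] := E_mul 0 0 0 w 0 0.
  move: k1 k2 k3; rewrite /F1 m1 m2 m3 !scaler0.
  have -> : jmk 0 0 0 (2^-1 *: w) 0 0 = 2^-1 *: (jmk 0 0 0 w 0 0 : jord).
    by rewrite jmkZ !scaler0 !mulr0.
  rewrite jmk0 lf0 lfZ; elim/jord_ind3: (D _) => p q r x y z.
  have [-> -> ->] := E_mul p q r x y z; rewrite -jmk0 jmkZ.
  case/jmk_inj => -[hp _ _] [_ /esym/halfv hy /esym/halfv hz].
  case/jmk_inj => -[_ hq hr] _; case/jmk_inj => -[_ hq' hr'] _.
  exists x; rewrite -hp hy hz; congr jmk; apply/eqP.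
    by move/eqP: hq'; rewrite mulf_eq0 invr_eq0 pnatr_eq0.
  by move/eqP: hr; rewrite mulf_eq0 invr_eq0 pnatr_eq0.
- have [k1 k2 k3] := DE (F2 w); have [m1 m2 m3] := E_mul 0 0 0 0 w 0.
  move: k1 k2 k3; rewrite /F2 m1 m2 m3 !scaler0.
  have -> : jmk 0 0 0 0 (2^-1 *: w) 0 = 2^-1 *: (jmk 0 0 0 0 w 0 : jord).
    by rewrite jmkZ !scaler0 !mulr0.
  rewrite jmk0 lf0 lfZ; elim/jord_ind3: (D _) => p q r x y z.
  have [-> -> ->] := E_mul p q r x y z; rewrite -jmk0 jmkZ.
  case/jmk_inj => -[_ _ hr] _.
  case/jmk_inj => -[_ hq _] [/esym/halfv hx _ /esym/halfv hz].
  case/jmk_inj => -[hp _ _] _.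
  exists y; rewrite -hq hx hz; congr jmk; apply/eqP.
    by move/eqP: hp; rewrite mulf_eq0 invr_eq0 pnatr_eq0.
  by move/eqP: hr; rewrite mulf_eq0 invr_eq0 pnatr_eq0.
- have [k1 k2 k3] := DE (F3 w); have [m1 m2 m3] := E_mul 0 0 0 0 0 w.
  move: k1 k2 k3; rewrite /F3 m1 m2 m3 !scaler0.
  have -> : jmk 0 0 0 0 0 (2^-1 *: w) = 2^-1 *: (jmk 0 0 0 0 0 w : jord).
    by rewrite jmkZ !scaler0 !mulr0.
  rewrite jmk0 lf0 lfZ; elim/jord_ind3: (D _) => p q r x y z.
  have [-> -> ->] := E_mul p q r x y z; rewrite -jmk0 jmkZ.
  case/jmk_inj => -[_ hq _] _; case/jmk_inj => -[hp _ _] _.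
  case/jmk_inj => -[_ _ hr] [/esym/halfv hx /esym/halfv hy _].
  exists z; rewrite -hr hx hy; congr jmk; apply/eqP.
    by move/eqP: hp; rewrite mulf_eq0 invr_eq0 pnatr_eq0.
  by move/eqP: hq; rewrite mulf_eq0 invr_eq0 pnatr_eq0.
Qed.

Lemma F1_inj : injective F1. Proof. by move=> x y /jmk_inj[_ []]. Qed.
Lemma F2_inj : injective F2. Proof. by move=> x y /jmk_inj[_ []]. Qed.
Lemma F3_inj : injective F3. Proof. by move=> x y /jmk_inj[_ []]. Qed.

Lemma jdot_F1 x y : jdot (F1 x) (F1 y) = 2 * oip x y.
Proof. by rewrite /F1 jmk_dot !oct_lin; ring. Qed.
Lemma jdot_F2 x y : jdot (F2 x) (F2 y) = 2 * oip x y.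
Proof. by rewrite /F2 jmk_dot !oct_lin; ring. Qed.

(** On F_1, the rotation in a plane that contains e_k but not e_i shows that [D F_1(e_i)] has no
    e_k-coefficient. Once [D] kills F_1, the product of F_1 and F_2 forces [D F_2(y) = F_2(y w)] for
    a fixed [w] with [(ab)w = a(bw)]. So [w] is in the nucleus, hence a scalar, and skewness makes
    it zero. *)
Lemma so6_center D : so6 D ->
  (forall i j : nat, (1 < i < 8)%N -> (1 < j < 8)%N -> lie (Dab (e i) (e j)) D = 0) -> D = 0.
Proof.
move/so6E => [HD dE [d0 d1]] comm.
have peirce := f4_peirce HD dE.
have skew X Y : jdot (D X) Y = - jdot X (D Y) by exact: f4_dot.
have e_far (i k : nat) : exists l : nat, [/\ (1 < l < 8)%N, l != i & l != k].
  suff [l /and3P[]] : exists l, [&& (1 < l < 8)%N, l != i & l != k] by exists l.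
  by case: i k => [|[|[|[|[|i]]]]] [|[|[|[|[|k]]]]]; by [exists 2%N|exists 3%N|exists 4%N].
have DF1e i : (i < 8)%N -> D (F1 (e i)) = 0.
  move=> Hi; case: (ltnP 1 i) => [i1|]; last first.
    by case: i Hi => [|[|]] //.
  have [[w Dw] _ _] := peirce (e i); rewrite Dw.
  suff -> : w = 0 by rewrite /F1 jmk0.
  have dd v : oip w v = 0 -> oip v w = 0 by rewrite oipC.
  have dbl0 (u : F) : 2 * u = 0 -> u = 0.
    by move/eqP; rewrite mulf_eq0 pnatr_eq0 => /eqP.
  apply: oct_eq0 => k Hk; case: (eqVneq k i) => [->|ki].
    apply: (@dd _); apply: (@dbl0 _); rewrite -jdot_F1 -Dw.
    have := skew (F1 (e i)) (F1 (e i)); rewrite (jdotC _ (D _)) => /eqP.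
    by rewrite -addr_eq0 -mulr2n -mulr_natl => /eqP/dbl0.
  case: (ltnP 1 k) => [k1|k1]; last first.
    apply: (@dd _); apply: (@dbl0 _); rewrite -jdot_F1 -Dw skew.
    by case: k k1 {Hk ki} => [|[|]] // _; rewrite ?d0 ?d1 jdot0r oppr0.
  have [l [Hl li lk]] := e_far i k.
  have := congr1 (fun f : 'End(jord) => f (F1 (e i))) (comm k l _ Hl).
  rewrite k1 => /(_ Hk); rewrite /= lieE zero_lfunE Dw.
  case/andP: Hl => _ Hl.
  rewrite !DabE' 1?eq_sym // !oip_e // (negbTE li) (negbTE ki) !scale0r subrr.
  rewrite !(oct_mul0r, oct_mul0l, scaler0) jmk0 lf0 subr0 -jmk0.
  by case/jmk_inj => _ [/(Dab_off1 Hk Hl _)[]] //; rewrite eq_sym.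
have DF1 x : D (F1 x) = 0.
  apply: (@oct_lin_ext _ (fun x => D (F1 x)) (fun=> 0)) => [a u v|a u v|//].
    by rewrite F1_lin lfD lfZ.
  by rewrite scaler0 addr0.
have F12 a y : jmul (F1 a) (F2 y) = 2^-1 *: F3 (oct_conj (a ** y)).
  by rewrite jmul_F1 /F3 jmkZ !oct_lin; congr jmk; by [ring|vring].
have D23 y y' : D (F2 y) = F2 y' -> forall a, D (F3 (oct_conj (a ** y))) = F3 (oct_conj (a ** y')).
  move=> Dy a; have := HD (F1 a) (F2 y); rewrite DF1 jmul0l add0r Dy !F12 lfZ.
  by move/scalerI; apply; rewrite invr_eq0 pnatr_eq0.
have [_ [w Dw] _] := peirce (e 0).
have D2 y : D (F2 y) = F2 (y ** w).
  have [_ [y' Dy] _] := peirce y.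
  have := D23 _ _ Dy (e 0); have := D23 _ _ Dw y; rewrite oct_mulr1 !oct_mul1 => -> /F3_inj H.
  by rewrite Dy -[y']oct_conjK -H oct_conjK.
have wE : w = oip (e 0) w *: e 0.
  apply: oct_nucleus => i j Hi Hj.
  have := D23 _ _ (D2 (e j)) (e i); have := D23 _ _ (D2 (e i ** e j)) (e 0).
  by rewrite !oct_mul1 => -> /F3_inj/(can_inj (@oct_conjK F)).
have w0 : w = 0.
  rewrite wE; have := skew (F2 (e 0)) (F2 (e 0)); rewrite Dw !jdot_F2 => /eqP.
  rewrite -addr_eq0 (oipC w) (_ : _ + _ = 4 * oip (e 0) w); last by ring.
  by rewrite mulf_eq0 pnatr_eq0 => /eqP ->; rewrite scale0r.
have DF2 y : D (F2 y) = 0 by rewrite D2 w0 oct_mul0r /F2 jmk0.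
have DF3 z : D (F3 z) = 0.
  have := D23 (oct_conj z) 0; rewrite DF2 {1}/F2 jmk0 => /(_ erefl (e 0)).
  by rewrite oct_mul1 oct_conjK oct_mul0r oct_conj0 /F3 jmk0.
case: dE => k1 k2 k3; apply/lfunP; elim/jord_ind3 => p q r x y z.
by rewrite zero_lfunE jmk_split !lf_lin k1 k2 k3 DF1 DF2 DF3 !scaler0 !addr0.
Qed.

End So6.

(** * Fixed vectors of the Freudenthal space and nilpotent elements of k *)

Section FixedFreudenthal.
Context (F : numFieldType).
Notation oct := 'rV[F]_8.
Notation jord := (jord F).
Notation freud := (freud F).
Notation e7 := (e7 F).
Notation e8 := (e8 F).
Local Notation e := (oct_e F).
Local Notation s4 := (linfun (@sigma4_fun F)).
Implicit Types (X Y : jord) (P Q : freud) (D : 'End(jord)) (u : subvs_of e7).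

Lemma Phi_D_tuple D X Y (xi eta : F) : f4 D ->
  Phi D 0 0 0 (X, Y, xi, eta) = (D X, D Y, 0, 0).
Proof.
move=> HD; rewrite Phi_tuple f4_transp // !jxp_lin !jdot_lin opp_lfunE.
apply: freud_eq; [vring | vring | ring | ring].
Qed.

Lemma Phi_D_e7 D : f4 D -> Phi D 0 0 0 \in e7.
Proof.
move=> HD; apply/e7P; do 4 eexists; split; last by [].
by exists D, 0; split => //; [exact: jtr0 | apply/lfunP => X; rewrite add_lfunE jmultE jmul0l addr0].
Qed.

Definition PK P := F4_E7 s4 P = P /\ forall D, so6 D -> Phi D 0 0 0 P = 0.

(** On the plane of e_0 and e_1 the map [x -> - e1 x e1] is the identity. This is how elements of
    [JK] give elements of [PK]. *)
Lemma sigma4_JK X : JK X -> s4 X = X.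
Proof.
case=> p [q [r [m [n ->]]]]; rewrite sigma4_jmk !oct_lin oppr0; congr jmk.
rewrite !oct8_e /= !oct8E; congr oct8; ring.
Qed.

Lemma PK_JK X Y (xi eta : F) : PK (X, Y, xi, eta) <-> JK X /\ JK Y.
Proof.
split=> [[_ H]|[HX HY]].
  by split; apply/so6_JK => D HD; have := H D HD; rewrite Phi_D_tuple; case: HD => // HD _ _ [].
split; first by rewrite F4_E7E !sigma4_JK.
move=> D HD; have [f4D _ _] := HD; rewrite Phi_D_tuple //.
by rewrite (iffRL (so6_JK X) HX D HD) (iffRL (so6_JK Y) HY D HD).
Qed.

Lemma bracket_R_D D u P Q (r s t : F) : so6 D -> bracket (R_D D) (u, P, Q, r, s, t) =
  (vsproj e7 (lie (Phi D 0 0 0) (vsval u)), Phi D 0 0 0 P, Phi D 0 0 0 Q, 0, 0, 0).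
Proof.
case=> HD _ _; rewrite /R_D bracketE vsprojK ?Phi_D_e7 //.
rewrite !(fcross_lin, fskew_lin, lf_lin) subr0 addr0.
by apply: e8_eq; rewrite ?(scale0r, scaler0, mul0r, mulr0, subr0, addr0, oppr0).
Qed.

Lemma kk_tuple u P Q (r s t : F) : kk (u, P, Q, r, s, t) <->
  [/\ kk (u, 0, 0, 0, 0, 0), PK P & PK Q].
Proof.
have RD0 D : so6 D -> bracket (R_D D) (u, 0, 0, 0, 0, 0) =
  (vsproj e7 (lie (Phi D 0 0 0) (vsval u)), 0, 0, 0, 0, 0).
  by move=> H; rewrite bracket_R_D // !lf0.
have RD := bracket_R_D u P Q r s t.
rewrite /kk !sigma4_tuple; split.
- case=> [[Hu HP HQ] HD]; split; [split|split|split] => //.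
  + by rewrite Hu !lf0.
  + by move=> D H; have := HD D H; rewrite RD // RD0 //; case=> -> _ _.
  + by move=> D H; have := HD D H; rewrite RD //; case.
  + by move=> D H; have := HD D H; rewrite RD //; case.
- case=> -[Hu HD] [HP HDP] [HQ HDQ]; split.
    by rewrite HP HQ; case: Hu => -> _ _.
  move=> D H; rewrite RD // HDP // HDQ //; have := HD D H; rewrite RD0 //.
Qed.

Definition eP P : e8 := (0, P, 0, 0, 0, 0).
Definition eQ Q : e8 := (0, 0, Q, 0, 0, 0).
Definition one_plus : e8 := (0, 0, 0, 0, 1, 0).

Lemma PK0 : PK 0.
Proof. by split=> [|D _]; exact: lf0. Qed.

Lemma kk00 : kk ((0, 0, 0, 0, 0, 0) : e8).
Proof. exact: kk0. Qed.

Lemma kk_scalars (r s t : F) : kk ((0, 0, 0, r, s, t) : e8).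
Proof. apply/kk_tuple; split; [exact: kk00 | exact: PK0 | exact: PK0]. Qed.

Lemma kk_eP P : PK P -> kk (eP P).
Proof. by move=> H; apply/kk_tuple; split; [exact: kk00 | | exact: PK0]. Qed.
Lemma kk_eQ Q : PK Q -> kk (eQ Q).
Proof. by move=> H; apply/kk_tuple; split; [exact: kk00 | exact: PK0 |]. Qed.

Lemma bracket_eP P1 u P Q (r s t : F) : bracket (eP P1) (u, P, Q, r, s, t) =
  (vsproj e7 (fcross P1 Q), - vsval u P1 - r *: P1, - t *: P1,
   - (8^-1 * fskew P1 Q), 4^-1 * fskew P1 P, 0).
Proof.
rewrite /eP bracketE vsval0 !(lie_lin, fcross_lin, fskew_lin, lf_lin, zero_lfunE).
by apply: e8_eq; [congr (vsproj _ _) | | | | |]; by [ring | vring].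
Qed.

Lemma bracket_eQ Q1 u P Q (r s t : F) : bracket (eQ Q1) (u, P, Q, r, s, t) =
  (vsproj e7 (- fcross P Q1), - s *: Q1, - vsval u Q1 + r *: Q1,
   8^-1 * fskew P Q1, 0, - (4^-1 * fskew Q1 Q)).
Proof.
rewrite /eQ bracketE vsval0 !(lie_lin, fcross_lin, fskew_lin, lf_lin, zero_lfunE).
by apply: e8_eq; [congr (vsproj _ _) | | | | |]; by [ring | vring].
Qed.

Lemma bracket_one_plus u P Q (r s t : F) : bracket one_plus (u, P, Q, r, s, t) =
  (0, Q, 0, t, - 2 * r, 0).
Proof.
rewrite /one_plus bracketE vsval0 !(lie_lin, fcross_lin, fskew_lin, lf_lin, zero_lfunE).
apply: e8_eq; [by rewrite !(addr0, subr0) linear0 | | | | |]; by [ring | vring].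
Qed.

Lemma e8_zero : (0 : e8) = (0, 0, 0, 0, 0, 0). Proof. by []. Qed.

Lemma divpow_iter (V : vectType F) (D : 'End(V)) n v :
  divpow D n v = (n`!%:R)^-1 *: iter n D v.
Proof.
elim: n => [|n IH]; first by rewrite divpow0 fact0 invr1 scale1r.
by rewrite divpowSE IH lfZ scalerA factS natrM invfM.
Qed.

Lemma ad_nilp_iter n (x : e8) : (n <= 8)%N -> (forall v, iter n (bracket x) v = 0) -> ad_nilp x.
Proof.
move=> n8 H; have {}H v : divpow (ad x) n v = 0.
  rewrite divpow_iter -(eq_iter (f := bracket x)) ?H ?scaler0 // => y.
  by rewrite adE.
by move=> v; apply: (divpow_eq0 H).
Qed.

Lemma ad_nilp_one_plus : ad_nilp one_plus.
Proof.
apply: (@ad_nilp_iter 3) => // v.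
have a1 : exists P r s, bracket one_plus v = (0, P, 0, r, s, 0).
  by case: v => [[[[[u P] Q] r] s] t]; rewrite bracket_one_plus; do 3 eexists.
have a2 P (r s : F) : exists s', bracket one_plus (0, P, 0, r, s, 0) = (0, 0, 0, 0, s', 0).
  by rewrite bracket_one_plus; eexists.
have a3 (s : F) : bracket one_plus (0, 0, 0, 0, s, 0) = 0 by rewrite bracket_one_plus mulr0.
rewrite !iterS [iter 0 _ _]/=; have [P [r [s ->]]] := a1.
by have [s' ->] := a2 P r s; exact: a3.
Qed.

Lemma ad_nilp_one_minus : ad_nilp (one_minus F).
Proof.
apply: (@ad_nilp_iter 3) => // v.
have a1 : exists P r s, bracket (one_minus F) v = (0, 0, P, r, 0, s).
  by case: v => [[[[[u P] Q] r] s] t]; rewrite bracket_one_minus; do 3 eexists.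
have a2 P (r s : F) : exists s', bracket (one_minus F) (0, 0, P, r, 0, s) = (0, 0, 0, 0, 0, s').
  by rewrite bracket_one_minus oppr0; eexists.
have a3 (s : F) : bracket (one_minus F) (0, 0, 0, 0, 0, s) = 0.
  by rewrite bracket_one_minus oppr0 mulr0.
rewrite !iterS [iter 0 _ _]/=; have [P [r [s ->]]] := a1.
by have [s' ->] := a2 P r s; exact: a3.
Qed.

(** [e8] is graded in degrees -2, ..., 2 by [t], [Q], [(Phi, r)], [P], [s], and [eP P] raises the
    degree by one. The steps [a1] to [a5] record which components survive. *)
Lemma ad_nilp_eP P : ad_nilp (eP P).
Proof.
apply: (@ad_nilp_iter 5) => // v.
have a1 w : exists u P' Q r s, bracket (eP P) w = (u, P', Q, r, s, 0).
  by case: w => [[[[[u P'] Q] r] s] t]; rewrite bracket_eP; do 5 eexists.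
have a2 u P' Q (r s : F) : exists u' Q' r' s',
    bracket (eP P) (u, P', Q, r, s, 0) = (u', Q', 0, r', s', 0).
  by rewrite bracket_eP oppr0 scale0r; do 4 eexists.
have a3 u P' (r s : F) : exists Q' s',
    bracket (eP P) (u, P', 0, r, s, 0) = (0, Q', 0, 0, s', 0).
  by rewrite bracket_eP !(fcross_lin, fskew_lin) oppr0 mulr0 scale0r linear0 oppr0; do 2 eexists.
have a4 P' (s : F) : exists s', bracket (eP P) (0, P', 0, 0, s, 0) = (0, 0, 0, 0, s', 0).
  rewrite bracket_eP !(fcross_lin, fskew_lin) vsval0 zero_lfunE.
  by rewrite !(oppr0, mulr0, scale0r, linear0, subr0); eexists.
have a5 (s : F) : bracket (eP P) (0, 0, 0, 0, s, 0) = 0.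
  rewrite bracket_eP !(fcross_lin, fskew_lin) vsval0 zero_lfunE.
  by rewrite !(oppr0, mulr0, scale0r, linear0, subr0).
rewrite !iterS [iter 0 _ _]/=; have [u [P' [Q [r [s ->]]]]] := a1 v.
have [u' [P'' [r' [s' ->]]]] := a2 u P' Q r s; have [Q'' [s'' ->]] := a3 u' P'' r' s'.
by have [s3 ->] := a4 Q'' s''; exact: a5.
Qed.

Lemma ad_nilp_eQ Q : ad_nilp (eQ Q).
Proof.
apply: (@ad_nilp_iter 5) => // v.
have a1 w : exists u P' Q' r t, bracket (eQ Q) w = (u, P', Q', r, 0, t).
  by case: w => [[[[[u P'] Q'] r] s] t]; rewrite bracket_eQ; do 5 eexists.
have a2 u P' Q' (r t : F) : exists u' Q'' r' t',
    bracket (eQ Q) (u, P', Q', r, 0, t) = (u', 0, Q'', r', 0, t').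
  by rewrite bracket_eQ oppr0 scale0r; do 4 eexists.
have a3 u Q' (r t : F) : exists Q'' t',
    bracket (eQ Q) (u, 0, Q', r, 0, t) = (0, 0, Q'', 0, 0, t').
  by rewrite bracket_eQ !(fcross_lin, fskew_lin) !oppr0 mulr0 scale0r linear0; do 2 eexists.
have a4 Q' (t : F) : exists t', bracket (eQ Q) (0, 0, Q', 0, 0, t) = (0, 0, 0, 0, 0, t').
  rewrite bracket_eQ !(fcross_lin, fskew_lin) vsval0 zero_lfunE.
  by rewrite !(oppr0, mulr0, scale0r, linear0, addr0); eexists.
have a5 (t : F) : bracket (eQ Q) (0, 0, 0, 0, 0, t) = 0.
  rewrite bracket_eQ !(fcross_lin, fskew_lin) vsval0 zero_lfunE.
  by rewrite !(oppr0, mulr0, scale0r, linear0, addr0).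
rewrite !iterS [iter 0 _ _]/=; have [u [P' [Q' [r [s ->]]]]] := a1 v.
have [u' [P'' [r' [s' ->]]]] := a2 u P' Q' r s; have [Q'' [s'' ->]] := a3 u' P'' r' s'.
by have [s3 ->] := a4 Q'' s''; exact: a5.
Qed.

(* [A] collects the part of the exponential that plays no role. *)
Lemma eexp_modulo (x v : e8) (A : e8 -> Prop) : A 0 ->
  (forall a (u w : e8), A u -> A w -> A (a *: u + w)) ->
  (forall w, A w -> A (bracket x w)) -> A (bracket x (bracket x v)) ->
  exists2 w, A w & eexp x v = v + bracket x v + w.
Proof.
move=> A0 Alin Ab A2; exists (\sum_(i < 6) divpow (ad x) i.+2 v).
  apply: (big_ind A) => // [u' w Au Aw|i _].
    by rewrite -[u']scale1r; exact: Alin.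
  have AZ a (u : e8) : A u -> A (a *: u) by move=> Au; rewrite -[_ *: _]addr0; exact: Alin.
  elim: (nat_of_ord i) => [|k IH].
    by rewrite !divpowSE divpow0 !(lfZ, adE); apply: (AZ _ _ _); rewrite bracketZr; apply: (AZ _ _ _).
  by rewrite divpowSE adE; apply: (AZ _ _ _); exact: Ab.
rewrite /eexp nexpE 2!big_ord_recl divpow0 /= scale_lfunE comp_lfunE invr1 scale1r.
rewrite adE id_lfunE addrA; congr (_ + _); apply: eq_bigr => i _.
Qed.

End FixedFreudenthal.

(** * Explicit exponentials in e_8 *)

Section FreudenthalMoves.
Context (F : numFieldType).
Notation oct := 'rV[F]_8.
Notation jord := (jord F).
Notation freud := (freud F).
Notation e7 := (e7 F).
Notation e8 := (e8 F).
Local Notation e := (oct_e F).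
Local Notation one_plus := (one_plus F).
Implicit Types (X Y : jord) (P Q : freud) (D : 'End(jord)) (u : subvs_of e7).

Lemma e8Z_tuple a u P Q (r s t : F) : a *: ((u, P, Q, r, s, t) : e8) =
  (a *: u, a *: P, a *: Q, a * r, a * s, a * t).
Proof. by []. Qed.

Lemma e8D_tuple u P Q (r s t : F) u' P' Q' (r' s' t' : F) :
  ((u, P, Q, r, s, t) : e8) + (u', P', Q', r', s', t') =
  (u + u', P + P', Q + Q', r + r', s + s', t + t').
Proof. by []. Qed.

Lemma e8D3_tuple u P Q (r s t : F) u' P' Q' (r' s' t' : F) u2 P2 Q2 (r2 s2 t2 : F) :
  ((u, P, Q, r, s, t) : e8) + (u', P', Q', r', s', t') + (u2, P2, Q2, r2, s2, t2) =
  (u + u' + u2, P + P' + P2, Q + Q' + Q2, r + r' + r2, s + s' + s2, t + t' + t2).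
Proof. by []. Qed.

(** The series may stop earlier on one vector than the nilpotency order of [ad x] suggests; only the
    orbit of [v] matters. *)
Lemma eexp_stop n (x v : e8) : (n <= 8)%N -> iter n (bracket x) v = 0 ->
  eexp x v = \sum_(i < n) (i`!%:R)^-1 *: iter i (bracket x) v.
Proof.
move=> n8 H.
have E i : iter i (ad x) v = iter i (bracket x) v.
  by apply: eq_iter => y; exact: adE.
have Z i : (n <= i)%N -> iter i (bracket x) v = 0.
  move=> ni; rewrite -(subnK ni); elim: (i - n)%N => [//|k IH].
  by rewrite addSn iterS IH bracket0r.
rewrite /eexp nexpE (big_ord_widen 8 (fun i => (i`!%:R)^-1 *: iter i (bracket x) v)) //.
rewrite [RHS]big_mkcond; apply: eq_bigr => i _; rewrite divpow_iter E.
by case: ltnP => // /Z ->; rewrite scaler0.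
Qed.

Lemma eexp_fix (x v : e8) : bracket x v = 0 -> eexp x v = v.
Proof. by move=> H; rewrite (@eexp_stop 1) //= big_ord1 fact0 invr1 scale1r. Qed.

Lemma eexp_stop2 (x v w : e8) : bracket x v = w -> bracket x w = 0 -> eexp x v = v + w.
Proof.
move=> H H'; rewrite (@eexp_stop 2) //= ?H ?H' // big_ord_recl big_ord1.
by rewrite /= H fact0 invr1 !scale1r.
Qed.

Lemma eexp_stop3 (x v w z : e8) : bracket x v = w -> bracket x w = z ->
  bracket x z = 0 -> eexp x v = v + w + 2^-1 *: z.
Proof.
move=> H H' H''; rewrite (@eexp_stop 3) //= ?H ?H' // !big_ord_recl big_ord0.
by rewrite /= H H' fact0 invr1 !scale1r addr0 addrA.
Qed.

Lemma fskewPP P : fskew P P = 0.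
Proof.
have /eqP := fskewN P P; rewrite -addr_eq0 -mulr2n -mulr_natl mulf_eq0 pnatr_eq0 /=.
by move/eqP.
Qed.

(** Only the coordinates of low degree are followed: they change to first order, since
    [{P1, P1} = 0] removes the quadratic term of [r]. The remaining coordinates are recovered later
    from the quadratic equations [R x R = 0]. *)
Lemma eexp_eP P1 u P Q (r s t : F) : exists u' P' s',
  eexp (eP P1) (u, P, Q, r, s, t) = (u', P', Q - t *: P1, r - 8^-1 * fskew P1 Q, s', t).
Proof.
pose A (w : e8) := exists u P (s : F), w = (u, P, 0, 0, s, 0).
have [||||w [u' [P' [s' ->]]] ->] := @eexp_modulo _ (eP P1) (u, P, Q, r, s, t) A.
- by exists 0, 0, 0; exact: e8_zero.
- move=> a _ _ [u1 [P1' [s1 ->]]] [u2 [P2 [s2 ->]]]; do 3 eexists.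
  by rewrite e8_lin_tuple !(scaler0, addr0, mulr0).
- move=> _ [u1 [P1' [s1 ->]]]; rewrite bracket_eP.
  have e1 : - 0 *: P1 = 0 by rewrite oppr0 scale0r.
  have e2 : - (8^-1 * fskew P1 0) = 0 by rewrite !fskew_lin mulr0 oppr0.
  by rewrite e1 e2; do 3 eexists.
- rewrite (bracket_eP P1 u) bracket_eP.
  have e1 : - 0 *: P1 = 0 by rewrite oppr0 scale0r.
  have e2 : - (8^-1 * fskew P1 (- t *: P1)) = 0 by rewrite fskewZr fskewPP !mulr0 oppr0.
  by rewrite e1 e2; do 3 eexists.
rewrite bracket_eP e8D3_tuple; do 3 eexists.
by apply: e8_eq; rewrite ?addr0 ?scaleNr.
Qed.

Lemma eexp_eQ Q1 u P Q (r s t : F) : exists u' Q' t',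
  eexp (eQ Q1) (u, P, Q, r, s, t) = (u', P - s *: Q1, Q', r + 8^-1 * fskew P Q1, s, t').
Proof.
pose A (w : e8) := exists u Q (t : F), w = (u, 0, Q, 0, 0, t).
have [||||w [u' [P' [s' ->]]] ->] := @eexp_modulo _ (eQ Q1) (u, P, Q, r, s, t) A.
- by exists 0, 0, 0; exact: e8_zero.
- move=> a _ _ [u1 [P1' [s1 ->]]] [u2 [P2 [s2 ->]]]; do 3 eexists.
  by rewrite e8_lin_tuple !(scaler0, addr0, mulr0).
- move=> _ [u1 [P1' [s1 ->]]]; rewrite bracket_eQ.
  have e1 : - 0 *: Q1 = 0 by rewrite oppr0 scale0r.
  have e2 : 8^-1 * fskew 0 Q1 = 0 by rewrite !fskew_lin mulr0.
  by rewrite e1 e2; do 3 eexists.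
- rewrite (bracket_eQ Q1 u) bracket_eQ.
  have e1 : - 0 *: Q1 = 0 by rewrite oppr0 scale0r.
  have e2 : 8^-1 * fskew (- s *: Q1) Q1 = 0 by rewrite fskewZl fskewPP !mulr0.
  by rewrite e1 e2; do 3 eexists.
rewrite bracket_eQ e8D3_tuple; do 3 eexists.
by apply: e8_eq; rewrite ?addr0 ?scaleNr.
Qed.

Lemma eexp_one_plus l u P Q (r s t : F) :
  eexp (l *: one_plus) (u, P, Q, r, s, t) =
  (u, P + l *: Q, Q, r + l * t, s - 2 * l * r - l ^+ 2 * t, t).
Proof.
have E1 : bracket (l *: one_plus) (u, P, Q, r, s, t) = (0, l *: Q, 0, l * t, - (2 * l * r), 0).
  rewrite bracketZl bracket_one_plus e8Z_tuple.
  by apply: e8_eq; rewrite ?scaler0 //; try vring; ring.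
have E2 : bracket (l *: one_plus) (0, l *: Q, 0, l * t, - (2 * l * r), 0) =
    (0, 0, 0, 0, - (2 * l ^+ 2 * t), 0).
  rewrite bracketZl bracket_one_plus e8Z_tuple.
  by apply: e8_eq; rewrite ?scaler0 //; try vring; ring.
rewrite (eexp_stop3 E1 E2) ?bracketZl ?bracket_one_plus ?mulr0 ?scaler0 //.
rewrite e8Z_tuple e8D3_tuple.
by apply: e8_eq; rewrite ?scaler0 ?mulr0 ?addr0 ?add0r //; field.
Qed.

Lemma eexp_one_minus l u P Q (r s t : F) :
  eexp (l *: one_minus F) (u, P, Q, r, s, t) =
  (u, P, Q + l *: P, r - l * s, s, t + 2 * l * r - l ^+ 2 * s).
Proof.
have E1 : bracket (l *: one_minus F) (u, P, Q, r, s, t) = (0, 0, l *: P, - (l * s), 0, 2 * l * r).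
  rewrite bracketZl bracket_one_minus e8Z_tuple.
  by apply: e8_eq; rewrite ?scaler0 //; try vring; ring.
have E2 : bracket (l *: one_minus F) (0, 0, l *: P, - (l * s), 0, 2 * l * r) =
    (0, 0, 0, 0, 0, - (2 * l ^+ 2 * s)).
  rewrite bracketZl bracket_one_minus e8Z_tuple.
  by apply: e8_eq; rewrite ?scaler0 //; try vring; ring.
rewrite (eexp_stop3 E1 E2) ?bracketZl ?bracket_one_minus ?oppr0 ?mulr0 ?scaler0 //.
rewrite e8Z_tuple e8D3_tuple.
by apply: e8_eq; rewrite ?scaler0 ?mulr0 ?addr0 ?add0r //; field.
Qed.

End FreudenthalMoves.

(** * Tori, and moving a point with nonzero last coordinate to 1_- *)

Section Transitivity.
Context (F : numFieldType).
Notation oct := 'rV[F]_8.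
Notation jord := (jord F).
Notation freud := (freud F).
Notation e7 := (e7 F).
Notation e8 := (e8 F).
Local Notation e := (oct_e F).
Local Notation one_plus := (one_plus F).
Local Notation one_minus := (one_minus F).
Implicit Types (X Y : jord) (P Q : freud) (D : 'End(jord)) (u : subvs_of e7).

(** The decomposition of a diagonal matrix of SL_2 into four elementary matrices. It assumes only
    the action on one pair [v], [w], so all the tori below are instances. *)
Lemma sl2_weights (V : vectType F) (X Y : F -> 'End(V)) (v w : V) :
  (forall a, X a w = w + a *: v) -> (forall a, X a v = v) ->
  (forall a, Y a v = v + a *: w) -> (forall a, Y a w = w) -> forall t, t != 0 ->
  Y (t * (1 - t)) (X (- t^-1) (Y (t - 1) (X 1 w))) = t *: w /\
  Y (t * (1 - t)) (X (- t^-1) (Y (t - 1) (X 1 v))) = t^-1 *: v.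
Proof.
move=> Xw Xv Yv Yw t t0; rewrite !(Xw, Xv, Yv, Yw, lf_lin); split; vfield.
Qed.

Lemma vsproj0 : vsproj e7 0 = 0. Proof. exact: linear0. Qed.

Lemma e8N_tuple u P Q (r s t : F) : - ((u, P, Q, r, s, t) : e8) = (- u, - P, - Q, - r, - s, - t).
Proof. by []. Qed.

Section Torus.
Variables (x y : e8).
Hypotheses (nx : ad_nilp x) (ny : ad_nilp y).

Definition torus (t : F) : 'End(e8) :=
  (eexp ((t * (1 - t)) *: y) \o (eexp ((- t^-1) *: x) \o (eexp ((t - 1) *: y) \o eexp (1 *: x))))%VF.

Lemma torus_G0 t : kk x -> kk y -> G0 (torus t).
Proof.
move=> kx ky; have X a : G0 (eexp (a *: x)) := G0_1 (kkZ a kx) (ad_nilpZ a nx).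
have Y a : G0 (eexp (a *: y)) := G0_1 (kkZ a ky) (ad_nilpZ a ny).
exact: (G0_comp (Y _) (G0_comp (X _) (G0_comp (Y _) (X _)))).
Qed.

Variables (v w : e8).
Hypotheses (xw : bracket x w = v) (xv : bracket x v = 0).
Hypotheses (yv : bracket y v = w) (yw : bracket y w = 0).

Let Xw a : eexp (a *: x) w = w + a *: v.
Proof. by apply: eexp_stop2; rewrite !(bracketZl, bracketZr) ?xw ?xv ?scaler0. Qed.
Let Xv a : eexp (a *: x) v = v.
Proof. by apply: eexp_fix; rewrite bracketZl xv scaler0. Qed.
Let Yv a : eexp (a *: y) v = v + a *: w.
Proof. by apply: eexp_stop2; rewrite !(bracketZl, bracketZr) ?yw ?yv ?scaler0. Qed.
Let Yw a : eexp (a *: y) w = w.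
Proof. by apply: eexp_fix; rewrite bracketZl yw scaler0. Qed.

Lemma torus_w t : t != 0 -> torus t w = t *: w.
Proof. by move=> t0; rewrite /torus !comp_lfunE; case: (sl2_weights Xw Xv Yv Yw t0). Qed.

Lemma torus_v t : t != 0 -> torus t v = t^-1 *: v.
Proof. by move=> t0; rewrite /torus !comp_lfunE; case: (sl2_weights Xw Xv Yv Yw t0). Qed.

End Torus.

Lemma torus_fix x y t z : bracket x z = 0 -> bracket y z = 0 -> torus x y t z = z.
Proof.
move=> xz yz; have X a : eexp (a *: x) z = z by apply: eexp_fix; rewrite bracketZl xz scaler0.
have Y a : eexp (a *: y) z = z by apply: eexp_fix; rewrite bracketZl yz scaler0.
have fix4 (T : Type) (f g h k : T -> T) p : f p = p -> g p = p -> h p = p -> k p = p ->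
    f (g (h (k p))) = p by move=> Hf Hg Hh Hk; rewrite Hk Hh Hg Hf.
by rewrite /torus !comp_lfunE; exact: fix4 (Y _) (X _) (Y _) (X _).
Qed.

Definition pdot : freud := (0, 0, 1, 0).
Definition qdot : freud := (0, 0, 0, 1).

Lemma JK0 : JK (0 : jord).
Proof. by apply/so6_JK => D _; exact: lf0. Qed.

Lemma PK_pdot : PK pdot. Proof. by apply/PK_JK; split; exact: JK0. Qed.
Lemma PK_qdot : PK qdot. Proof. by apply/PK_JK; split; exact: JK0. Qed.

Lemma fcross_pdot_pdot : fcross pdot pdot = 0.
Proof.
rewrite /pdot fcross_tuple !(jve_lin, jxp_lin, jdot_lin) -[RHS]Phi0.
by apply: Phi_eq; [vring | vring | vring | ring].
Qed.

Lemma fskew_qdot_pdot : fskew qdot pdot = - 1.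
Proof. by rewrite /fskew /pdot /qdot !jdot_lin; ring. Qed.

(** The sign and the factor 4 normalise the brackets: the two generators exchange [1_-] and
    [eQ pdot] with coefficient 1, because [[eP pdot, 1_-] = - eQ pdot] and [[eQ qdot, eQ pdot] =
    4^-1 1_-]. *)
Definition ttorus (t : F) := torus (- eP pdot) (4 *: eQ qdot) t.

Lemma ttorus_G0 t : G0 (ttorus t).
Proof.
apply: torus_G0.
- by apply: ad_nilpN; exact: ad_nilp_eP.
- by apply: ad_nilpZ; exact: ad_nilp_eQ.
- by apply: kkN; apply: kk_eP; exact: PK_pdot.
- by apply: kkZ; apply: kk_eQ; exact: PK_qdot.
Qed.

Lemma bracket_ePQ P Q : bracket (eP P) (eQ Q) =
  (vsproj e7 (fcross P Q), 0, 0, - (8^-1 * fskew P Q), 0, 0).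
Proof.
rewrite bracket_eP !fskew_lin vsval0 zero_lfunE.
by apply: e8_eq; rewrite ?(mulr0, scale0r, oppr0, addr0).
Qed.

Lemma bracket_eQQ P Q : bracket (eQ P) (eQ Q) = (0, 0, 0, 0, 0, - (4^-1 * fskew P Q)).
Proof.
rewrite bracket_eQ !(fskew_lin, fcross_lin) vsval0 zero_lfunE.
by apply: e8_eq; rewrite ?(mulr0, scale0r, oppr0, scale0r, addr0, vsproj0).
Qed.

Lemma bracket_eP_one_minus P : bracket (eP P) one_minus = - eQ P.
Proof.
rewrite bracket_eP !(fskew_lin, fcross_lin) vsval0 zero_lfunE e8N_tuple.
by apply: e8_eq; rewrite ?(mulr0, scale0r, oppr0, scaleN1r, addr0, add0r, scale0r, vsproj0).
Qed.

Lemma bracket_eQ_one_minus P : bracket (eQ P) one_minus = 0.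
Proof.
rewrite bracket_eQ !(fskew_lin, fcross_lin) vsval0 zero_lfunE.
by apply: e8_eq; rewrite ?(mulr0, scale0r, oppr0, addr0, vsproj0).
Qed.

Lemma ttorus_one_minus (t : F) : t != 0 -> ttorus t one_minus = t *: one_minus.
Proof.
apply: (torus_w (v := eQ pdot)).
- by rewrite bracketNl bracket_eP_one_minus opprK.
- rewrite bracketNl bracket_ePQ fcross_pdot_pdot fskewPP mulr0 oppr0 vsproj0.
  exact: oppr0.
- rewrite bracketZl bracket_eQQ fskew_qdot_pdot e8Z_tuple.
  by apply: e8_eq; rewrite ?(scaler0, mulr0) //; field.
- by rewrite bracketZl bracket_eQ_one_minus scaler0.
Qed.

(** Evaluate [R x R = 0] at [1^-]. The [t]-coordinate shows that the Killing factor is [2 t]; the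
    other coordinates then read [2 t u = 0], [3 t P = 0] and [4 t s = 0]. *)
Lemma W8_reduce u P (s t : F) : W8 ((u, P, 0, 0, s, t) : e8) -> t != 0 ->
  [/\ u = 0, P = 0 & s = 0].
Proof.
case=> /(_ one_plus) H _ t0; move: H; move: (killing _ _ / 30) => c.
have E1 : bracket ((u, P, 0, 0, s, t) : e8) one_plus = (0, 0, 0, - t, 0, 0).
  rewrite bracketC bracket_one_plus e8N_tuple.
  by apply: e8_eq; rewrite ?(oppr0, mulr0).
have E2 : bracket ((u, P, 0, 0, s, t) : e8) (0, 0, 0, - t, 0, 0) =
    (0, t *: P, 0, 0, 2 * t * s, - (2 * t ^+ 2)).
  rewrite bracketE vsval0 !(lie_lin, fcross_lin, fskew_lin, lf_lin, zero_lfunE).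
  by apply: e8_eq; rewrite ?(subr0, addr0, vsproj0) //; (ring || vring).
rewrite E1 E2 e8Z_tuple e8D_tuple => H.
have Hu : 0 + c *: u = 0 by exact: (congr1 (fun x : e8 => x.1.1.1.1.1) H).
have HP : t *: P + c *: P = 0 by exact: (congr1 (fun x : e8 => x.1.1.1.1.2) H).
have Hs : 2 * t * s + c * s = 0 by exact: (congr1 (fun x : e8 => x.1.2) H).
have Ht : - (2 * t ^+ 2) + c * t = 0 by exact: (congr1 (fun x : e8 => x.2) H).
have c2 : c = 2 * t.
  apply: (mulIf t0); rewrite -[LHS](addKr (- (2 * t ^+ 2))) Ht; ring.
have n0 : c != 0 by rewrite c2 mulf_neq0 // pnatr_eq0.
split.
- by move: Hu; rewrite add0r => /eqP; rewrite scaler_eq0 (negbTE n0) => /eqP.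
- move: HP; rewrite -scalerDl => /eqP; rewrite scaler_eq0 c2 => /orP[|/eqP//].
  rewrite (_ : t + 2 * t = 3 * t); last by ring.
  by rewrite mulf_eq0 pnatr_eq0 (negbTE t0).
- move: Hs; rewrite c2 (_ : _ + _ = 4 * t * s); last by ring.
  by move/eqP; rewrite !mulf_eq0 pnatr_eq0 (negbTE t0) => /eqP.
Qed.

Lemma PKZ a P : PK P -> PK (a *: P).
Proof.
by move=> [sP DP]; split=> [|D HD]; rewrite lfZ ?sP // DP // scaler0.
Qed.

(** The exponential of [eP] clears [Q] and leaves [r] alone because [{Q, Q} = 0]; the one of [1^-]
    then clears [r]. *)
Definition to_line (Q : freud) (r t : F) : 'End(e8) :=
  (eexp ((- (r / t)) *: one_plus) \o eexp (eP (t^-1 *: Q)))%VF.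

Lemma to_lineE u P Q (r s t : F) : W8_sigma4_so6 F (u, P, Q, r, s, t) -> t != 0 ->
  to_line Q r t (u, P, Q, r, s, t) = t *: one_minus.
Proof.
move=> HW t0; have [_ sx Dx] := HW.
have [_ _ KQ] := iffLR (kk_tuple u P Q r s t) (conj sx Dx).
have GQ : G0 (to_line Q r t).
  apply: G0_comp; apply: G0_1.
  - exact/kkZ/kk_scalars.
  - exact/ad_nilpZ/ad_nilp_one_plus.
  - exact/kk_eP/PKZ.
  - exact: ad_nilp_eP.
have [] := G_W8_sigma4 (G0_G GQ) HW; move=> W _ _; move: W.
rewrite /to_line comp_lfunE; have [u' [P' [s' ->]]] := eexp_eP (t^-1 *: Q) u P Q r s t.
rewrite eexp_one_plus scalerA divff // scale1r subrr fskewZl fskewPP !mulr0 subr0.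
rewrite mulNr divfK // subrr scaler0 addr0 => /W8_reduce[] // -> -> ->.
by rewrite e8Z_tuple; apply: e8_eq; rewrite ?scaler0 ?mulr0 ?mulr1.
Qed.

End Transitivity.

(** * Transitivity of G0 on the fixed part of W *)

Section Orbit.
Context (F : numFieldType).
Notation oct := 'rV[F]_8.
Notation jord := (jord F).
Notation freud := (freud F).
Notation e7 := (e7 F).
Notation e8 := (e8 F).
Local Notation e := (oct_e F).
Local Notation one_plus := (one_plus F).
Local Notation one_minus := (one_minus F).
Implicit Types (X Y : jord) (P Q : freud) (D : 'End(jord)) (u : subvs_of e7).

Definition tcoord (x : e8) : F := x.2.

Lemma tcoordZ a x : tcoord (a *: x) = a * tcoord x.
Proof. by []. Qed.

Lemma tcoord_sum n (x : 'I_n -> e8) : tcoord (\sum_(i < n) x i) = \sum_(i < n) tcoord (x i).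
Proof. exact: (big_morph tcoord). Qed.

Definition unreached (x : e8) := kk x /\ forall g, G0 g -> tcoord (g x) = 0.

(** The last coordinate of [g exp(a ad y) x] is a polynomial in [a] that vanishes identically; its
    linear coefficient is the last coordinate of [g [y, x]]. *)
Lemma unreached_bracket x y : unreached x -> kk y -> ad_nilp y -> unreached (bracket y x).
Proof.
move=> [kx Hx] ky ny; split=> [|g Hg]; first exact: kk_bracket.
have H t : \sum_(i < 8) t ^+ i * tcoord (g (divpow (ad y) i x)) = 0.
  have := Hx _ (G0_comp Hg (G0_1 (kkZ t ky) (ad_nilpZ t ny))).
  rewrite comp_lfunE eexpZ lf_sum tcoord_sum => K; rewrite -[RHS]K.
  by apply: eq_bigr => i _; rewrite lfZ tcoordZ.
have := poly_eq0 (v := fun i => tcoord (g (divpow (ad y) i x))) H (isT : (1 < 8)%N).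
by rewrite divpowSE divpow0 adE invr1 scale1r.
Qed.

Lemma kk_one_minus : kk one_minus. Proof. exact: kk_scalars. Qed.

Lemma fskew_tuple X Y Z W (xi eta zeta omega : F) :
  fskew (X, Y, xi, eta) (Z, W, zeta, omega) =
  jdot X W - jdot Z Y + xi * omega - zeta * eta.
Proof. by []. Qed.

Lemma fskew_PK_nondeg Q : PK Q -> (forall P, PK P -> fskew P Q = 0) -> Q = 0.
Proof.
case: Q => [[[X Y] xi] eta] /PK_JK[HX HY] H.
have jk X' : JK X' -> (forall Z, JK Z -> jdot Z X' = 0) -> X' = 0.
  case=> [p [q [r [m [n ->]]]]] K.
  have k1 (a b c i j : F) : jdot (jmk a b c (i *: e 0 + j *: e 1) 0 0)
      (jmk p q r (m *: e 0 + n *: e 1) 0 0) = 0.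
    by apply: K; exists a, b, c, i, j.
  have := k1 1 0 0 0 0; have := k1 0 1 0 0 0; have := k1 0 0 1 0 0.
  have := k1 0 0 0 1 0; have := k1 0 0 0 0 1.
  rewrite !jmk_dot !(scale0r, scale1r, addr0, add0r) !oct_lin !oip_e //=.
  rewrite !(mul0r, mul1r, mulr0, addr0, add0r, mulr1).
  move=> /eqP; rewrite mulf_eq0 pnatr_eq0 /= => /eqP ->.
  move=> /eqP; rewrite mulf_eq0 pnatr_eq0 /= => /eqP -> -> -> ->.
  by rewrite !scale0r addr0 jmk0.
have Y0 : Y = 0.
  apply: jk => // Z HZ; have := H (Z, 0, 0, 0) (iffRL (PK_JK _ _ _ _) (conj HZ (@JK0 F))).
  by rewrite fskew_tuple !jdot_lin => E; rewrite -[RHS]E; ring.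
have X0 : X = 0.
  apply: jk => // Z HZ; have := H (0, Z, 0, 0) (iffRL (PK_JK _ _ _ _) (conj (@JK0 F) HZ)).
  rewrite fskew_tuple !jdot_lin (jdotC X) => E; apply/eqP; rewrite -oppr_eq0; apply/eqP.
  by rewrite -[RHS]E; ring.
have := H _ (PK_pdot F); have := H _ (PK_qdot F).
rewrite X0 Y0 /pdot /qdot !fskew_tuple !jdot_lin !mul0r !mulr0 !mul1r !subr0 !add0r.
by rewrite mulr1 => /eqP; rewrite oppr_eq0 => /eqP -> ->.
Qed.

(** Evaluation at [pdot] and [qdot] kills [B], [nu] and [A]. Then [phi] kills E, E_k, F_1(e_0) and
    F_1(e_1), so it lies in so(6); being in k, it also commutes with so(6). *)
Lemma kk_e7_center u : kk (u, 0, 0, 0, 0, 0) -> (forall P, PK P -> vsval u P = 0) -> u = 0.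
Proof.
move=> [_ ku] HP; apply: val_inj; rewrite -[RHS]/(vsval (0 : subvs_of e7)) vsval0 -[LHS]/(vsval u).
have /e7P[phi [A [B [nu [Hphi uE]]]]] := subvsP u.
rewrite uE in HP *.
have [B0 nu0] : B = 0 /\ nu = 0.
  have := HP _ (PK_pdot F); rewrite /pdot Phi_tuple !lf_lin !jxp_lin !jdot_lin => H.
  split; first by rewrite -[RHS](congr1 (fun P : freud => P.1.1.2) H); vring.
  by rewrite -[RHS](congr1 (fun P : freud => P.1.2) H) /=; ring.
have A0 : A = 0.
  have := HP _ (PK_qdot F); rewrite /qdot Phi_tuple !lf_lin !jxp_lin !jdot_lin => H.
  by rewrite -[RHS](congr1 (fun P : freud => P.1.1.1) H); vring.
rewrite {A}A0 {B}B0 {nu}nu0 in uE HP *.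
have HX X : JK X -> phi X = 0.
  move=> HX; have := HP _ (iffRL (PK_JK X 0 0 0) (conj HX (@JK0 F))).
  rewrite Phi_tuple !jxp_lin => H.
  by rewrite -[RHS](congr1 (fun P : freud => P.1.1.1) H); vring.
have JKE a b c m n : JK (jmk a b c (m *: e 0 + n *: e 1) 0 0) by exists a, b, c, m, n.
have HD : so6 phi.
  have oE m n : m *: e 0 + n *: e 1 = m *: e 0 + n *: e 1 by [].
  apply/so6E; split; first apply: f4_e6 => //.
  - rewrite jmk_jE; have := JKE 1 1 1 0 0; rewrite !scale0r addr0; exact: HX.
  - split; apply: HX; [have := JKE 1 0 0 0 0 | have := JKE 0 1 0 0 0 | have := JKE 0 0 1 0 0];
      by rewrite !scale0r addr0.
  - split; apply: HX; [have := JKE 0 0 0 1 0 | have := JKE 0 0 0 0 1];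
      by rewrite scale0r scale1r ?addr0 ?add0r.
suff -> : phi = 0 by exact: Phi0.
apply: so6_center => // i j Hi Hj.
have Hij := so6_Dab F Hi Hj.
have [Dij _ _] := Hij; have [f4phi _ _] := HD.
have := ku _ Hij; rewrite bracket_R_D // uE => H.
have H0 : lie (Phi (Dab (e i) (e j)) 0 0 0) (Phi phi 0 0 0) = 0.
  rewrite -[LHS](@vsprojK _ _ e7); last by apply: e7_lie; exact: Phi_D_e7.
  by rewrite [vsproj _ _](congr1 (fun x : e8 => x.1.1.1.1.1) H) vsval0.
apply/lfunP => X; rewrite zero_lfunE.
have K : Phi (Dab (e i) (e j)) 0 0 0 (Phi phi 0 0 0 (X, 0, 0, 0)) -
    Phi phi 0 0 0 (Phi (Dab (e i) (e j)) 0 0 0 (X, 0, 0, 0)) = 0.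
  by rewrite -lieE H0 zero_lfunE.
rewrite (Phi_D_tuple X 0 0 0 f4phi) (Phi_D_tuple X 0 0 0 Dij) in K.
rewrite (Phi_D_tuple _ _ 0 0 f4phi) (Phi_D_tuple _ _ 0 0 Dij) in K.
by rewrite lieE; exact: (congr1 (fun P : freud => P.1.1.1) K).
Qed.

(** Brackets carry each coordinate to the last place: [r] by one bracket with [1_-], [s] by two, [Q]
    by one with [eQ Q1]. Then [P] is moved to [Q] by [1_-], and [u Q1] appears as the [Q]-coordinate
    of a bracket with [eQ Q1]. *)
Lemma unreached0 x : unreached x -> x = 0.
Proof.
have t0 u P Q (r s t : F) : unreached (u, P, Q, r, s, t) -> t = 0.
  by case=> _ /(_ _ (G0_id F)); rewrite id_lfunE.
have step u P Q (r s t : F) : unreached (u, P, Q, r, s, t) -> unreached (0, 0, P, - s, 0, 2 * r).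
  move=> H; rewrite -(bracket_one_minus u P Q r s t).
  by apply: unreached_bracket => //; [exact: kk_one_minus | exact: ad_nilp_one_minus].
have two (a : F) : 2 * a = 0 -> a = 0.
  by move/eqP; rewrite mulf_eq0 pnatr_eq0 => /eqP.
have r0 u P Q (r s t : F) : unreached (u, P, Q, r, s, t) -> r = 0.
  by move/step/t0/two.
have s0 u P Q (r s t : F) : unreached (u, P, Q, r, s, t) -> s = 0.
  by move/step/step/t0/two/eqP; rewrite oppr_eq0 => /eqP.
have stepQ u P Q (r s t : F) Q1 : PK Q1 -> unreached (u, P, Q, r, s, t) ->
    unreached (vsproj e7 (- fcross P Q1), - s *: Q1, - vsval u Q1 + r *: Q1,
      8^-1 * fskew P Q1, 0, - (4^-1 * fskew Q1 Q)).
  move=> K H; rewrite -(bracket_eQ Q1 u P Q r s t).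
  by apply: unreached_bracket => //; [exact: kk_eQ | exact: ad_nilp_eQ].
have Q0 u P Q (r s t : F) : unreached (u, P, Q, r, s, t) -> Q = 0.
  move=> H; have [kx _] := H; have [_ _ KQ] := iffLR (kk_tuple _ _ _ _ _ _) kx.
  apply: fskew_PK_nondeg => // Q1 K; have /eqP := t0 _ _ _ _ _ _ (stepQ _ _ _ _ _ _ _ K H).
  by rewrite oppr_eq0 mulf_eq0 invr_eq0 pnatr_eq0 => /eqP.
have P0 u P Q (r s t : F) : unreached (u, P, Q, r, s, t) -> P = 0.
  by move/step/Q0.
have u0 u P Q (r s t : F) : unreached (u, P, Q, r, s, t) -> u = 0.
  move=> H; have [kx _] := H; have [ku _ _] := iffLR (kk_tuple _ _ _ _ _ _) kx.
  apply: kk_e7_center => // P1 K; have /eqP := Q0 _ _ _ _ _ _ (stepQ _ _ _ _ _ _ _ K H).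
  by rewrite (r0 _ _ _ _ _ _ H) scale0r addr0 oppr_eq0 => /eqP.
case: x => [[[[[u P] Q] r] s] t] H.
by rewrite (u0 _ _ _ _ _ _ H) (P0 _ _ _ _ _ _ H) (Q0 _ _ _ _ _ _ H) (r0 _ _ _ _ _ _ H)
  (s0 _ _ _ _ _ _ H) (t0 _ _ _ _ _ _ H).
Qed.

Lemma G0_reach x : W8_sigma4_so6 F x -> exists2 g, G0 g & tcoord (g x) != 0.
Proof.
case=> [[_ x0] sx Dx]; apply: contrapT => H; move/negP: x0; apply.
apply/eqP; apply: unreached0; split=> // g Hg.
by apply/eqP/negP => /negP ?; apply: H; exists g.
Qed.

Lemma W8_one_minus : W8_sigma4_so6 F one_minus.
Proof.
have [s1 D1] := kk_one_minus; split=> //; split.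
  case=> [[[[[u P] Q] r] s] t]; rewrite killing_one_minus (bracket_one_minus u P Q r s t).
  rewrite (bracket_one_minus 0 0 P (- s) 0 (2 * r)).
  rewrite /one_minus e8Z_tuple e8D_tuple.
  by apply: e8_eq; rewrite ?(scaler0, oppr0, mulr0, addr0) //; field.
apply/negP => /eqP H; have /eqP := congr1 (fun x : e8 => x.2) H.
by rewrite /= oner_eq0.
Qed.

(** The inverse of [to_line] composed with the torus that takes [1_-] to [t 1_-]. Only [Q], [r], [t]
    enter, rationally and with powers of [t] as denominators, which is what makes it a smooth local
    section. *)
Definition section_at (Q : freud) (r t : F) : 'End(e8) :=
  (eexp (eP (- (t^-1 *: Q))) \o (eexp ((r / t) *: one_plus) \o ttorus t))%VF.

Lemma section_at_G0 Q (r t : F) : PK Q -> G0 (section_at Q r t).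
Proof.
move=> KQ; apply: G0_comp.
  apply: G0_1; last exact: ad_nilp_eP.
  by apply: kk_eP; rewrite -scaleNr; exact: PKZ.
apply: G0_comp; last exact: ttorus_G0.
apply: G0_1; [exact/kkZ/kk_scalars | exact/ad_nilpZ/ad_nilp_one_plus].
Qed.

Lemma section_atE u P Q (r s t : F) : W8_sigma4_so6 F (u, P, Q, r, s, t) -> t != 0 ->
  section_at Q r t one_minus = (u, P, Q, r, s, t).
Proof.
move=> HW t0; have := to_lineE HW t0; rewrite -ttorus_one_minus // => E.
rewrite /section_at comp_lfunE comp_lfunE -E /to_line comp_lfunE.
have n1 : ad_nilp ((r / t) *: one_plus) by exact/ad_nilpZ/ad_nilp_one_plus.
have n2 := ad_nilp_eP (t^-1 *: Q).
have c4 (T : Type) (f f' g g' : T -> T) y : cancel g' g -> cancel f' f -> f (g (g' (f' y))) = y.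
  by move=> Kg Kf; rewrite Kg Kf.
have -> : eP (- (t^-1 *: Q)) = - eP (t^-1 *: Q) by rewrite /eP e8N_tuple !oppr0.
by rewrite scaleNr; exact: c4 (eexpKN n1) (eexpNK n2).
Qed.

Lemma G0_transitive x : W8_sigma4_so6 F x -> exists2 g, G0 g & g x = one_minus.
Proof.
move=> HW; have [g Gg tg] := G0_reach HW.
have := G_W8_sigma4 (G0_G Gg) HW; move: tg; case Eg: (g x) => [[[[[u P] Q] r] s] t].
rewrite /tcoord /= => t0 HW'.
have [_ sx Dx] := HW'; have [_ _ KQ] := iffLR (kk_tuple u P Q r s t) (conj sx Dx).
have GS := section_at_G0 r t KQ.
exists ((section_at Q r t)^-1 \o g)%VF; first by apply: G0_comp => //; exact: G0_inv.
by rewrite comp_lfunE Eg -(section_atE HW' t0) G_K //; exact: G0_G.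
Qed.

End Orbit.

(** * Elements fixing 1_- and 1^-, and their action on the Freudenthal space *)

Section Stabilizer.
Context (F : numFieldType).
Notation oct := 'rV[F]_8.
Notation jord := (jord F).
Notation freud := (freud F).
Notation e7 := (e7 F).
Notation e8 := (e8 F).
Local Notation e := (oct_e F).
Local Notation one_plus := (one_plus F).
Local Notation one_minus := (one_minus F).
Implicit Types (X Y : jord) (P Q : freud) (D : 'End(jord)) (u : subvs_of e7).

Definition eF (f : 'End(freud)) : e8 := (vsproj e7 f, 0, 0, 0, 0, 0).
(** The grading element: its adjoint action has weights 0, 1, -1, 0, 2, -2 on the six summands. *)
Definition hh : e8 := (0, 0, 0, 1, 0, 0).

Lemma bracket_hh u P Q (r s t : F) : bracket hh (u, P, Q, r, s, t) =
  (0, P, - Q, 0, 2 * s, - (2 * t)).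
Proof.
rewrite /hh bracketE vsval0 !(lie_lin, fcross_lin, fskew_lin, lf_lin, zero_lfunE).
by apply: e8_eq; rewrite ?(subr0, addr0, vsproj0) //; (ring || vring).
Qed.

Lemma eP_lin a P Q : eP (a *: P + Q) = a *: eP P + eP Q.
Proof. by rewrite /eP e8_lin_tuple; apply: e8_eq; rewrite ?(scaler0, addr0, mulr0). Qed.
Lemma eP_inj : injective (@eP F).
Proof. by move=> P Q /(congr1 (fun x : e8 => x.1.1.1.1.2)). Qed.

Lemma bracket_eF_eP f P : f \in e7 -> bracket (eF f) (eP P) = eP (f P).
Proof.
move=> Hf; rewrite /eF /eP bracketE vsprojK // vsval0 !(lie_lin, fcross_lin, fskew_lin, lf_lin, zero_lfunE).
by apply: e8_eq; rewrite ?(subr0, addr0, vsproj0) //; (ring || vring).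
Qed.

Lemma bracket_eF_one_minus f : f \in e7 -> bracket (eF f) one_minus = 0.
Proof.
move=> Hf; rewrite bracketC bracket_one_minus e8N_tuple.
by apply: e8_eq; rewrite ?(oppr0, mulr0).
Qed.

Lemma bracket_eF_one_plus f : f \in e7 -> bracket (eF f) one_plus = 0.
Proof.
move=> Hf; rewrite bracketC bracket_one_plus e8N_tuple.
by apply: e8_eq; rewrite ?(oppr0, mulr0).
Qed.

Lemma e8_split u P Q (r s t : F) : ((u, P, Q, r, s, t) : e8) =
  eF (vsval u) + (eP P + (eQ Q + (r *: hh + (s *: one_plus + t *: one_minus)))).
Proof.
rewrite /eF /eP /eQ /hh /one_plus /one_minus !e8Z_tuple vsvalK.
have e6 (u1 u2 u3 u4 u5 u6 : subvs_of e7) P1 P2 P3 P4 P5 P6 Q1 Q2 Q3 Q4 Q5 Q6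
  (r1 r2 r3 r4 r5 r6 s1 s2 s3 s4 s5 s6 t1 t2 t3 t4 t5 t6 : F) :
  ((u1, P1, Q1, r1, s1, t1) : e8) + ((u2, P2, Q2, r2, s2, t2) + ((u3, P3, Q3, r3, s3, t3)
   + ((u4, P4, Q4, r4, s4, t4) + ((u5, P5, Q5, r5, s5, t5) + (u6, P6, Q6, r6, s6, t6))))) =
  (u1 + (u2 + (u3 + (u4 + (u5 + u6)))), P1 + (P2 + (P3 + (P4 + (P5 + P6)))),
   Q1 + (Q2 + (Q3 + (Q4 + (Q5 + Q6)))), r1 + (r2 + (r3 + (r4 + (r5 + r6)))),
   s1 + (s2 + (s3 + (s4 + (s5 + s6)))), t1 + (t2 + (t3 + (t4 + (t5 + t6))))) by [].
by rewrite e6; apply: e8_eq; rewrite ?(scaler0, mulr0, mulr1, addr0, add0r).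
Qed.

(** Fixing both extreme weight vectors implies fixing their bracket, which is [hh] up to sign, and
    hence preserving all weight spaces. *)
Definition Gs (be : 'End(e8)) :=
  [/\ E8_sigma4_so6 F be, be one_minus = one_minus & be one_plus = one_plus].

Lemma Gs_comp a b : Gs a -> Gs b -> Gs (a \o b)%VF.
Proof.
move=> [Ga a1 a2] [Gb b1 b2]; split; first exact: G_comp.
  by rewrite comp_lfunE b1.
by rewrite comp_lfunE b2.
Qed.

Definition bp (be : 'End(e8)) P : freud := (be (eP P)).1.1.1.1.2.

Section Action.
Variable be : 'End(e8).
Hypothesis Hbe : Gs be.

Let Gbe : E8_sigma4_so6 F be. Proof. by case: Hbe. Qed.
Let b_minus : be one_minus = one_minus. Proof. by case: Hbe. Qed.
Let b_plus : be one_plus = one_plus. Proof. by case: Hbe. Qed.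
Let b_br := G_bracket Gbe.

Lemma Gs_hh : be hh = hh.
Proof.
have E : bracket one_minus one_plus = - hh.
  by rewrite bracket_one_minus /hh e8N_tuple; apply: e8_eq; rewrite ?(oppr0, mulr0).
by have := b_br one_minus one_plus; rewrite b_minus b_plus E lfN => /eqP; rewrite eqr_opp => /eqP.
Qed.

Lemma Gs_eP P : be (eP P) = eP (bp be P).
Proof.
have E : bracket hh (eP P) = eP P.
  by rewrite bracket_hh /eP; apply: e8_eq; rewrite ?(oppr0, mulr0).
have := b_br hh (eP P); rewrite E Gs_hh /bp.
case: (be (eP P)) => [[[[[u P'] Q] r] s] t]; rewrite bracket_hh => H.
have Hu : u = 0 by exact: (congr1 (fun x : e8 => x.1.1.1.1.1) H).
have HQ : Q = - Q by exact: (congr1 (fun x : e8 => x.1.1.1.2) H).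
have Hr : r = 0 by exact: (congr1 (fun x : e8 => x.1.1.2) H).
have Hs : s = 2 * s by exact: (congr1 (fun x : e8 => x.1.2) H).
have Ht : t = - (2 * t) by exact: (congr1 (fun x : e8 => x.2) H).
rewrite /eP Hu Hr; apply: e8_eq => //.
- have half (v : freud) : v = - v -> v = 0.
    move=> E1; have -> : v = 2^-1 *: (v - - v) by vfield.
    by rewrite -E1 subrr scaler0.
  exact: half.
- have : (2 * s : F) - s = 0 by rewrite -Hs subrr.
  by rewrite -{2}[s]mul1r -mulrBl (_ : 2 - 1 = 1) ?mul1r //; ring.
- have /eqP : - (2 * t : F) - t = 0 by rewrite -Ht subrr.
  rewrite -opprD oppr_eq0 -{2}[t]mul1r -mulrDl mulf_eq0 (_ : 2 + 1 = 3); last by ring.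
  by rewrite pnatr_eq0 => /eqP.
Qed.

Lemma Gs_eQ P : be (eQ P) = eQ (bp be P).
Proof.
have E P' : bracket one_minus (eP P') = eQ P'.
  by rewrite bracket_one_minus /eQ; apply: e8_eq; rewrite ?(oppr0, mulr0).
by rewrite -E b_br b_minus Gs_eP E.
Qed.

(** Inside the weight zero space, e_7 is the centraliser of [1^-]; the bracket with [1^-] detects
    the [r]-coordinate. *)
Lemma Gs_eF f : f \in e7 -> exists2 g, g \in e7 & be (eF f) = eF g.
Proof.
move=> Hf.
have E : bracket hh (eF f) = 0.
  by rewrite bracket_hh; apply: e8_eq; rewrite ?(oppr0, mulr0).
have E' : bracket one_plus (eF f) = 0.
  by rewrite bracket_one_plus; apply: e8_eq; rewrite ?(oppr0, mulr0).
have := b_br hh (eF f); have := b_br one_plus (eF f); rewrite E E' Gs_hh b_plus lf0.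
case: (be (eF f)) => [[[[[u P] Q] r] s] t]; rewrite bracket_hh bracket_one_plus => H' H.
have HP : 0 = P by exact: (congr1 (fun x : e8 => x.1.1.1.1.2) H).
have HQ : 0 = Q by exact: (congr1 (fun x : e8 => x.1.1.1.1.2) H').
have Hr : 0 = - 2 * r by exact: (congr1 (fun x : e8 => x.1.2) H').
have Ht : 0 = t by exact: (congr1 (fun x : e8 => x.1.1.2) H').
have Hs : 0 = 2 * s by exact: (congr1 (fun x : e8 => x.1.2) H).
exists (vsval u); first exact: subvsP.
rewrite /eF vsvalK -HP -HQ -Ht; apply: e8_eq => //.
  by move/eqP: Hr; rewrite eq_sym mulf_eq0 oppr_eq0 pnatr_eq0 => /eqP.
by move/eqP: Hs; rewrite eq_sym mulf_eq0 pnatr_eq0 => /eqP.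
Qed.

Lemma bracket_ePQ_split P Q : bracket (eP P) (eQ Q) = eF (fcross P Q) - (8^-1 * fskew P Q) *: hh.
Proof.
rewrite bracket_ePQ /eF /hh e8Z_tuple e8N_tuple e8D_tuple.
by apply: e8_eq; rewrite ?(scaler0, oppr0, addr0, add0r, mulr0, mulr1).
Qed.

Lemma eF_inj f g (a b : F) : f \in e7 -> g \in e7 -> eF f - a *: hh = eF g - b *: hh -> f = g /\ a = b.
Proof.
move=> Hf Hg H; split.
  have H1 := congr1 (fun x : e8 => vsval x.1.1.1.1.1) H.
  rewrite /eF /hh !e8Z_tuple !e8N_tuple !e8D_tuple /= !scaler0 !oppr0 !addr0 in H1.
  by rewrite !vsprojK in H1.
have H1 := congr1 (fun x : e8 => x.1.1.2) H.
rewrite /eF /hh !e8Z_tuple !e8N_tuple !e8D_tuple /= !add0r !mulr1 in H1.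
exact: oppr_inj.
Qed.

(** The bracket of [eP P] and [eQ Q] carries both [P x Q] and [{P, Q}], in the complementary e_7 and
    [hh] directions. *)
Lemma Gs_cross P Q : be (eF (fcross P Q)) = eF (fcross (bp be P) (bp be Q)) /\
  fskew (bp be P) (bp be Q) = fskew P Q.
Proof.
have [g Hg E] := Gs_eF (e7_fcross P Q).
have := b_br (eP P) (eQ Q); rewrite Gs_eP Gs_eQ !bracket_ePQ_split lfD lfN lfZ Gs_hh E.
move=> /(eF_inj Hg (e7_fcross _ _))[-> H]; split=> //.
by apply/esym; apply: mulfI H; rewrite invr_eq0 pnatr_eq0.
Qed.

Lemma bp_cross P Q R : fcross (bp be P) (bp be Q) (bp be R) = bp be (fcross P Q R).
Proof.
have [H _] := Gs_cross P Q.
have := b_br (eF (fcross P Q)) (eP R); rewrite H !bracket_eF_eP ?e7_fcross //.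
by rewrite !Gs_eP bracket_eF_eP ?e7_fcross // => /eP_inj.
Qed.

Lemma bp_skew P Q : fskew (bp be P) (bp be Q) = fskew P Q.
Proof. by case: (Gs_cross P Q). Qed.

Lemma bp_lin a P Q : bp be (a *: P + Q) = a *: bp be P + bp be Q.
Proof.
by apply: eP_inj; rewrite -Gs_eP (eP_lin a (bp be P)) -!Gs_eP eP_lin lfD lfZ.
Qed.

Lemma bp_PK P : PK P -> PK (bp be P).
Proof. by move/kk_eP/(G_kk Gbe); rewrite Gs_eP => /kk_tuple[]. Qed.

Lemma bp_so6 D P : so6 D -> bp be (Phi D 0 0 0 P) = Phi D 0 0 0 (bp be P).
Proof.
move=> HD; have [f4D _ _] := HD; have [_ _ /(_ D HD (eP P))] := Gbe.
by rewrite Gs_eP !bracket_eF_eP ?Phi_D_e7 // Gs_eP => /eP_inj.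
Qed.

(** e_7 acts faithfully on the Freudenthal space, so bracketing with [eP R] determines the image of
    [eF f]. *)
Lemma bp_id : (forall P, bp be P = P) -> be = \1%VF.
Proof.
move=> H; apply/lfunP => -[[[[[u P] Q] r] s] t]; rewrite id_lfunE e8_split.
rewrite !lfD !lfZ b_minus b_plus Gs_hh Gs_eP Gs_eQ !H; congr (_ + _).
have [g Hg E] := Gs_eF (subvsP u); rewrite E; congr eF; apply/lfunP => R.
have := b_br (eF (vsval u)) (eP R); rewrite E !bracket_eF_eP ?subvsP //.
by rewrite !Gs_eP !H bracket_eF_eP // => /eP_inj.
Qed.

Lemma bp_inj P : bp be P = 0 -> P = 0.
Proof.
move=> H; have := Gs_eP P; rewrite H => E.
have inj : injective be by apply/lker0P; exact: G_lker0.
have e0 : eP 0 = 0 :> e8 by exact: e8_zero.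
by apply: eP_inj; apply: inj; rewrite E e0 lf0.
Qed.

End Action.

End Stabilizer.

(** * Normalising 1^- and the scalar directions of the Freudenthal space *)

Section Moves.
Context (F : numFieldType).
Notation oct := 'rV[F]_8.
Notation jord := (jord F).
Notation freud := (freud F).
Notation e7 := (e7 F).
Notation e8 := (e8 F).
Local Notation e := (oct_e F).
Local Notation one_plus := (one_plus F).
Local Notation one_minus := (one_minus F).
Implicit Types (X Y : jord) (P Q : freud) (D : 'End(jord)) (u : subvs_of e7).
Local Notation s4 := (linfun (@sigma4_fun F)).

(** Once [1_-] is fixed, invariance of the Killing form gives the image of [1^-] the [s]-coordinate
    1. Exponentials of [eQ P] and [1_-], which fix [1_-], remove its [P] and [r]. The bracket with
    [1_-] is then [- hh], so [hh] is fixed, and the image has weight 2, which kills its other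
    coordinates. *)
Lemma G_to_Gs al : E8_sigma4_so6 F al -> exists2 g, G0 g & Gs (g \o al)%VF.
Proof.
move=> Gal; have [g Gg gE] := G0_transitive (G_W8_sigma4 Gal (W8_one_minus F)).
have Gga := G_comp (G0_G Gg) Gal.
have ga1 : (g \o al)%VF one_minus = one_minus by rewrite comp_lfunE.
have := killing_G one_minus one_plus Gga; have kx := G_kk Gga (kk_scalars 0 1 0).
have Ehh := G_bracket Gga one_minus one_plus.
move: kx Ehh; rewrite -[X in kk (_ X)]/one_plus ga1; case Ex : ((g \o al)%VF one_plus) => [[[[[u P] Q] r] s] t].
move=> kx _; rewrite /one_plus !killing_one_minus => Es.
have {Es} s1 : s = 1 by apply: (mulfI _ Es); rewrite pnatr_eq0.
rewrite {s}s1 in Ex kx; have [_ KP KQ] := iffLR (kk_tuple _ _ _ _ _ _) kx.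
(* [l] is the [r]-coordinate in the form that [eexp_eQ] returns it, so that the next exponential
   cancels it literally. *)
pose m1 := eexp (eQ P); pose l := r + 8^-1 * fskew P P.
pose m2 := eexp (l *: one_minus).
have Gm : G0 (m2 \o m1)%VF.
  apply: G0_comp; apply: G0_1.
  - exact/kkZ/kk_scalars.
  - exact/ad_nilpZ/ad_nilp_one_minus.
  - exact: kk_eQ.
  - exact: ad_nilp_eQ.
have mm : (m2 \o m1)%VF one_minus = one_minus.
  rewrite comp_lfunE /m1 eexp_fix ?bracket_eQ_one_minus // /m2 eexp_fix //.
  rewrite bracketZl bracket_one_minus; apply/eqP; rewrite scaler_eq0; apply/orP; right.
  by apply/eqP; apply: e8_eq; rewrite ?(oppr0, mulr0).
have mp : exists u' Q' t', (m2 \o m1)%VF (u, P, Q, r, 1, t) = (u', 0, Q', 0, 1, t').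
  rewrite comp_lfunE /m1; have [u' [Q' [t' ->]]] := eexp_eQ P u P Q r 1 t.
  rewrite /m2 eexp_one_minus scale1r subrr mulr1 scaler0 addr0 subrr.
  by do 3 eexists.
exists ((m2 \o m1) \o g)%VF; first exact: G0_comp.
have Gb := G_comp (G0_G Gm) Gga.
have b1 : ((m2 \o m1) \o (g \o al))%VF one_minus = one_minus by rewrite comp_lfunE ga1.
have [u' [Q' [t' b2]]] : exists u' Q' t', ((m2 \o m1) \o (g \o al))%VF one_plus = (u', 0, Q', 0, 1, t').
  by rewrite comp_lfunE Ex.
rewrite -comp_lfunA; move: ((m2 \o m1) \o (g \o al))%VF Gb b1 b2 => be Gb b1 b2.
split=> //; rewrite b2.
have hE : bracket one_minus one_plus = (0, 0, 0, - 1, 0, 0).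
  by rewrite bracket_one_minus; apply: e8_eq; rewrite ?(oppr0, mulr0).
have bh : be (0, 0, 0, - 1, 0, 0) = (0, 0, 0, - 1, 0, 0).
  rewrite -{1}hE (G_bracket Gb) b1 b2 (bracket_one_minus u' 0 Q' 0 1 t').
  by apply: e8_eq; rewrite ?(oppr0, mulr0).
have hp : bracket (0, 0, 0, - 1, 0, 0) one_plus = (-2) *: one_plus.
  rewrite bracketC bracket_one_plus e8N_tuple e8Z_tuple.
  by apply: e8_eq; rewrite ?(scaler0, oppr0, mulr0) //; ring.
have := G_bracket Gb (0, 0, 0, - 1, 0, 0) one_plus; rewrite hp lfZ b2 bh.
rewrite (_ : ((0, 0, 0, - 1, 0, 0) : e8) = - (hh F)); last first.
  by rewrite /hh e8N_tuple; apply: e8_eq; rewrite ?(oppr0).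
rewrite bracketNl bracket_hh e8N_tuple e8Z_tuple => H.
have Hu : (-2) *: u' = - 0 by exact: (congr1 (fun x : e8 => x.1.1.1.1.1) H).
have HQ : (-2) *: Q' = - - Q' by exact: (congr1 (fun x : e8 => x.1.1.1.2) H).
have Ht : (-2) * t' = - - (2 * t') by exact: (congr1 (fun x : e8 => x.2) H).
apply: e8_eq => //.
- have n2 : -2 != 0 :> F by rewrite oppr_eq0 pnatr_eq0.
  by apply: (scalerI n2); rewrite Hu oppr0 scaler0.
- have E (v : freud) : v = (-3)^-1 *: ((-2) *: v - - - v) by vfield.
  by rewrite (E Q') HQ subrr scaler0.
- have E (v : F) : v = (-4)^-1 * ((-2) * v - - - (2 * v)) by field.
  by rewrite (E t') Ht subrr mulr0.
Qed.

(** The seventh commutator expands into terms [f^i w f^j] with [i + j = 7], where [i >= 4] or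
    [j >= 4]. The predicate [A k] expresses this without the binomial expansion. *)
Lemma lie_nilp (V : vectType F) (f w : 'End(V)) :
  (forall v, f (f (f (f v))) = 0) -> iter 7 (lie f) w = 0.
Proof.
move=> f4.
pose A k (g : 'End(V)) := forall i j v, (7 <= i + j + k)%N -> iter i f (g (iter j f v)) = 0.
have i4 i v : (4 <= i)%N -> iter i f v = 0.
  move=> Hi; rewrite -(subnK Hi); elim: (i - 4)%N => [|k IH]; first exact: f4.
  by rewrite addSn iterS IH lf0.
have i0 i : iter i f 0 = 0 by elim: i => // i IH; rewrite iterS IH lf0.
have A0 : A 0%N w.
  move=> i j v; rewrite addn0 => H; case: (leqP 4 i) => Hi; first exact: i4.
  rewrite (i4 j) ?lf0 ?i0 // leqNgt; apply/negP => Hj; move: H; rewrite leqNgt => /negP; apply.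
  by rewrite ltnS; exact: (@leq_add i j 3 3 Hi Hj).
have iB i (u v : V) : iter i f (u - v) = iter i f u - iter i f v.
  by elim: i => // i IH; rewrite !iterS IH !lf_lin.
have AS k g : A k g -> A k.+1 (lie f g).
  move=> H i j v; rewrite addnS => K; rewrite lieE iB -iterSr.
  by rewrite -[f (iter j f v)]/(iter j.+1 f v) !H ?subrr // ?addnS // !addSn.
have A7 k : A k (iter k (lie f) w) by elim: k => // k IH; rewrite iterS; exact: AS.
by apply/lfunP => v; rewrite zero_lfunE; exact: (A7 7 0 0)%N.
Qed.

Lemma bracket_eF f u P Q (r s t : F) : f \in e7 ->
  bracket (eF f) (u, P, Q, r, s, t) = (vsproj e7 (lie f (vsval u)), f P, f Q, 0, 0, 0).
Proof.
move=> Hf; rewrite /eF bracketE vsprojK // !(fcross_lin, fskew_lin, lf_lin) subr0 addr0.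
by apply: e8_eq; rewrite ?(scale0r, scaler0, mul0r, mulr0, subr0, addr0, oppr0).
Qed.

Lemma ad_nilp_eF f : f \in e7 -> (forall v, f (f (f (f v))) = 0) -> ad_nilp (eF f).
Proof.
move=> Hf f4; apply: (@ad_nilp_iter F 7) => // -[[[[[u P] Q] r] s] t].
have H k : exists r' s' t' : F, iter k (bracket (eF f)) (u, P, Q, r, s, t) =
    (vsproj e7 (iter k (lie f) (vsval u)), iter k f P, iter k f Q, r', s', t') /\
    ((0 < k)%N -> [/\ r' = 0, s' = 0 & t' = 0]) /\ iter k (lie f) (vsval u) \in e7.
  elim: k => [|k [r' [s' [t' [E [_ K]]]]]]; first by exists r, s, t; rewrite /= vsvalK subvsP.
  by exists 0, 0, 0; rewrite !iterS E bracket_eF // vsprojK // e7_lie.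
have [r' [s' [t' [-> [/(_ isT)[-> -> ->] _]]]]] := H 7.
by rewrite lie_nilp // /= !f4 ?lf0 vsproj0.
Qed.

Lemma iter_eF f P k : f \in e7 -> iter k (bracket (eF f)) (eP P) = eP (iter k f P).
Proof. by move=> Hf; elim: k => // k IH; rewrite !iterS IH bracket_eF_eP. Qed.

Lemma eP_sum n (P : 'I_n -> freud) : \sum_(i < n) eP (P i) = eP (\sum_(i < n) P i).
Proof.
apply/esym; apply: (big_morph (@eP F)); last exact: e8_zero.
by move=> x y; rewrite -[x]scale1r eP_lin !scale1r.
Qed.

Lemma ePZ a P : eP (a *: P) = a *: eP P.
Proof. by rewrite -[a *: P]addr0 eP_lin (_ : eP 0 = 0) ?addr0 //; exact: e8_zero. Qed.

Lemma eexp_eF f P : f \in e7 -> (forall v, f (f (f (f v))) = 0) ->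
  eexp (eF f) (eP P) = eP (\sum_(i < 4) (i`!%:R)^-1 *: iter i f P).
Proof.
move=> Hf f4; rewrite (@eexp_stop F 4) //; last by rewrite iter_eF //= f4; exact: e8_zero.
by rewrite -eP_sum; apply: eq_bigr => i _; rewrite iter_eF // ePZ.
Qed.

Lemma Gs_eexp f : f \in e7 -> (forall v, f (f (f (f v))) = 0) -> kk (eF f) ->
  Gs (eexp (eF f)).
Proof.
move=> Hf f4 kf; split.
- by apply: eexp_G => //; exact: ad_nilp_eF.
- by apply: eexp_fix; exact: bracket_eF_one_minus.
- by apply: eexp_fix; exact: bracket_eF_one_plus.
Qed.

Lemma bp_eexp f be P : f \in e7 -> (forall v, f (f (f (f v))) = 0) -> kk (eF f) -> Gs be ->
  bp (eexp (eF f) \o be) P = \sum_(i < 4) (i`!%:R)^-1 *: iter i f (bp be P).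
Proof.
move=> Hf f4 kf Hbe; have Hc := Gs_comp (Gs_eexp Hf f4 kf) Hbe.
by apply: eP_inj; rewrite -(Gs_eP Hc) -eexp_eF // -(Gs_eP Hbe) comp_lfunE.
Qed.

Lemma kk_Phi phi A B (nu : F) : e6 phi -> (forall X, s4 (phi X) = phi (s4 X)) ->
  (forall D X, so6 D -> D (phi X) = phi (D X)) -> JK A -> JK B -> kk (eF (Phi phi A B nu)).
Proof.
move=> Hphi sphi Dphi HA HB.
have Hin : Phi phi A B nu \in e7 by apply/e7P; exists phi, A, B, nu.
split.
  rewrite /eF sigma4_tuple !lf0 vsprojK // (Phi_bconj (@sigma4_mul F) (@sigma4_tr F) (lker0_sigma4 F)).
  do 5! congr pair; congr vsproj; apply: Phi_eq => //; try exact: sigma4_JK.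
  by apply/lfunP => X; rewrite aconjE sphi lker0_lfunVK // lker0_sigma4.
move=> D HD; have [f4D _ _] := HD; rewrite /eF bracket_R_D // vsprojK // !lf0.
rewrite (_ : lie _ _ = 0) ?vsproj0 //.
rewrite lie_Phi //; last first.
  by exists D, 0; split; [| exact: jtr0 | apply/lfunP => X; rewrite add_lfunE jmultE jmul0l addr0].
have DA := iffRL (so6_JK A) HA D HD; have DB := iffRL (so6_JK B) HB D HD.
have -> : lie D phi = 0 by apply/lfunP => X; rewrite lieE Dphi // subrr zero_lfunE.
rewrite DA (f4_transp f4D) opp_lfunE DB !lf_lin !jve_lin !jdot_lin -[RHS]Phi0.
by apply: Phi_eq; [vring | vring | vring | ring].
Qed.

Definition fA A : 'End(freud) := Phi 0 A 0 0.
Definition fB B : 'End(freud) := Phi 0 0 B 0.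

Lemma fAE A X Y (xi eta : F) : fA A (X, Y, xi, eta) = (eta *: A, 2 *: jxp A X, jdot A Y, 0).
Proof.
rewrite Phi_tuple jtransp0 !zero_lfunE !jxp_lin !jdot_lin.
by apply: freud_eq; [vring | vring | ring | ring].
Qed.

Lemma fBE B X Y (xi eta : F) : fB B (X, Y, xi, eta) = (2 *: jxp B Y, xi *: B, 0, jdot B X).
Proof.
rewrite Phi_tuple jtransp0 !zero_lfunE !jxp_lin !jdot_lin.
by apply: freud_eq; [vring | vring | ring | ring].
Qed.

Lemma fA_e7 A : fA A \in e7.
Proof. by apply/e7P; do 4 eexists; split; [exact: e6_0 | by []]. Qed.
Lemma fB_e7 B : fB B \in e7.
Proof. by apply/e7P; do 4 eexists; split; [exact: e6_0 | by []]. Qed.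

Lemma kk_fA A : JK A -> kk (eF (fA A)).
Proof.
move=> HA; apply: kk_Phi => //; [exact: e6_0 | | | exact: JK0].
  by move=> X; rewrite !zero_lfunE lf0.
by move=> D X _; rewrite !zero_lfunE lf0.
Qed.
Lemma kk_fB B : JK B -> kk (eF (fB B)).
Proof.
move=> HB; apply: kk_Phi => //; [exact: e6_0 | | | exact: JK0].
  by move=> X; rewrite !zero_lfunE lf0.
by move=> D X _; rewrite !zero_lfunE lf0.
Qed.

(** [fA A] moves along the chain [eta], [X], [Y], [xi]; [fB] goes in the opposite direction. *)
Lemma fA_nilp A v : fA A (fA A (fA A (fA A v))) = 0.
Proof.
case: v => [[[X Y] xi] eta]; rewrite (fAE A X) (fAE A (eta *: A)) (fAE A (0 *: A)) fAE.
by apply: freud_eq; rewrite ?(scale0r, jxp_lin, jdot_lin, scaler0, mul0r, mulr0).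
Qed.

Lemma fB_nilp A v : fB A (fB A (fB A (fB A v))) = 0.
Proof.
case: v => [[[X Y] xi] eta]; rewrite (fBE A X) (fBE A (2 *: jxp A Y)).
rewrite scale0r (fBE A _ 0) fBE.
by apply: freud_eq; rewrite ?(scale0r, jxp_lin, jdot_lin, scaler0, mul0r, mulr0).
Qed.

Lemma exp_fA A X Y (xi eta : F) : \sum_(i < 4) (i`!%:R)^-1 *: iter i (fA A) (X, Y, xi, eta) =
  (X + eta *: A, Y + 2 *: jxp A X + eta *: jxp A A,
   xi + jdot A Y + jdot A (jxp A X) + 3^-1 * eta * jdot A (jxp A A), eta).
Proof.
rewrite !big_ord_recl big_ord0 !lift0 /= !factS fact0 !muln1 invr1.
rewrite (fAE A X) (fAE A (eta *: A)) (fAE A (0 *: A)) !(jxp_lin, jdot_lin).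
have s4E (a b c d : F) X1 Y1 (x1 n1 : F) X2 Y2 (x2 n2 : F) X3 Y3 (x3 n3 : F) X4 Y4 (x4 n4 : F) :
  a *: ((X1, Y1, x1, n1) : freud) + (b *: ((X2, Y2, x2, n2) : freud) +
  (c *: ((X3, Y3, x3, n3) : freud) + (d *: ((X4, Y4, x4, n4) : freud) + 0))) =
  (a *: X1 + (b *: X2 + (c *: X3 + (d *: X4 + 0))), a *: Y1 + (b *: Y2 + (c *: Y3 + (d *: Y4 + 0))),
   a * x1 + (b * x2 + (c * x3 + (d * x4 + 0))), a * n1 + (b * n2 + (c * n3 + (d * n4 + 0)))) by [].
by rewrite s4E; apply: freud_eq; [vfield | vfield | field | field].
Qed.

Lemma exp_fB B X Y (xi eta : F) : exists X' eta',
  \sum_(i < 4) (i`!%:R)^-1 *: iter i (fB B) (X, Y, xi, eta) = (X', Y + xi *: B, xi, eta').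
Proof.
do 2 eexists.
rewrite !big_ord_recl big_ord0 !lift0 /= !factS fact0 !muln1 invr1.
rewrite (fBE B X) (fBE B (2 *: jxp B Y)) (fBE B _ (0 *: B)) !(jxp_lin, jdot_lin).
have s4E (a b c d : F) X1 Y1 (x1 n1 : F) X2 Y2 (x2 n2 : F) X3 Y3 (x3 n3 : F) X4 Y4 (x4 n4 : F) :
  a *: ((X1, Y1, x1, n1) : freud) + (b *: ((X2, Y2, x2, n2) : freud) +
  (c *: ((X3, Y3, x3, n3) : freud) + (d *: ((X4, Y4, x4, n4) : freud) + 0))) =
  (a *: X1 + (b *: X2 + (c *: X3 + (d *: X4 + 0))), a *: Y1 + (b *: Y2 + (c *: Y3 + (d *: Y4 + 0))),
   a * x1 + (b * x2 + (c * x3 + (d * x4 + 0))), a * n1 + (b * n2 + (c * n3 + (d * n4 + 0)))) by [].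
by rewrite s4E; apply: freud_eq; [by [] | vfield | field | by []].
Qed.

Lemma jtr_jxp_jE X : jdot (jE F) (jxp (jE F) X) = jtr X.
Proof.
by rewrite jdotC jdot_jE jxp_jE !jtr_linE jtr_jE; field.
Qed.

Lemma JKE : JK (jE F).
Proof. by exists 1, 1, 1, 0, 0; rewrite jmk_jE !scale0r addr0. Qed.

Lemma JK_lin a X Y : JK X -> JK Y -> JK (a *: X + Y).
Proof.
move=> /so6_JK HX /so6_JK HY; apply/so6_JK => D HD.
by rewrite lfD lfZ HX // HY // scaler0 addr0.
Qed.

Lemma JKZ (a : F) X : JK X -> JK (a *: X).
Proof. by move=> /so6_JK HX; apply/so6_JK => D HD; rewrite lfZ HX // scaler0. Qed.

(** The expression is the [xi]-coordinate after the exponential of [fA A], a cubic polynomial in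
    [A]. If it vanished for every [A], so would its homogeneous parts: the linear one gives [Y = 0],
    [A = E] gives [eta = 0] and [tr X = 0], and polarising the quadratic part at [E] gives
    [X = 0]. *)
Lemma exists_fA X Y (xi eta : F) : JK X -> JK Y -> (X, Y, xi, eta) != 0 :> freud ->
  exists2 A, JK A &
  xi + jdot A Y + jdot A (jxp A X) + 3^-1 * eta * jdot A (jxp A A) != 0.
Proof.
move=> HX HY p0; apply: contrapT => H.
have {}H A : JK A -> xi + jdot A Y + jdot A (jxp A X) + 3^-1 * eta * jdot A (jxp A A) = 0.
  by move=> HA; apply/eqP/negP => /negP ?; apply: H; exists A.
have Ht A : JK A -> [/\ xi = 0, jdot A Y = 0, jdot A (jxp A X) = 0 & 3^-1 * eta * jdot A (jxp A A) = 0].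
  move=> HA; pose v i := nth 0 [:: xi; jdot A Y; jdot A (jxp A X); 3^-1 * eta * jdot A (jxp A A)] i.
  have K (t : F) : \sum_(i < 4) t ^+ i * v i = 0.
    rewrite -[RHS](H (t *: A) (JKZ t HA)) !big_ord_recl big_ord0 !lift0 /v /= !jxp_lin !jdot_lin; ring.
  have := poly_eq0 K; move=> V.
  split; [exact: (V 0%N) | exact: (V 1%N) | exact: (V 2%N) | exact: (V 3%N)].
have jk0 (Z : jord) : JK Z -> (forall A, JK A -> jdot A Z = 0) -> Z = 0.
  move=> HZ K.
  suff : (Z, 0, 0, 0) = 0 :> freud by move/(congr1 (fun P : freud => P.1.1.1)).
  apply: fskew_PK_nondeg; first by apply/PK_JK; split=> //; exact: JK0.
  move=> [[[X1 Y1] xi1] eta1] /PK_JK[H1 H2]; rewrite fskew_tuple !jdot_lin (jdotC Z) K //; ring.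
have [xi0 _ trX etaE] := Ht _ JKE; rewrite jtr_jxp_jE in trX.
have eta0 : eta = 0.
  move: etaE; rewrite jtr_jxp_jE jtr_jE => E; rewrite -[RHS]E; field => //.
have Y0 : Y = 0 by apply: jk0 => // A HA; case: (Ht A HA).
have X0 : X = 0.
  apply: jk0 => // A HA.
  have [_ _ E1 _] := Ht _ (JK_lin 1 HA JKE); have [_ _ E2 _] := Ht _ HA.
  move: E1; rewrite scale1r !jxp_lin !jdot_lin E2 jtr_jxp_jE trX (jdot_jxpC (jE F) A X).
  rewrite jxp_jE !jdot_lin jdot_jE trX => E3.
  apply/eqP; rewrite -oppr_eq0; apply/eqP; rewrite -[RHS]E3; field => //.
by move: p0; rewrite X0 Y0 xi0 eta0 eqxx.
Qed.

Lemma bp_rank1 be P : Gs be -> fcross P P = 0 -> fcross (bp be P) (bp be P) = 0.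
Proof.
move=> Hbe PP; have [H _] := Gs_cross Hbe P P.
rewrite PP in H; have e0 : eF (0 : 'End(freud)) = 0 by rewrite /eF vsproj0; exact: e8_zero.
move: H; rewrite e0 lf0 /eF => /(congr1 (fun x : e8 => vsval x.1.1.1.1.1)) /=.
by rewrite vsprojK ?e7_fcross // vsval0.
Qed.

(** The equations of the cone of rank one elements, extracted by evaluating the zero map at [pdot]
    and [qdot]. *)
Lemma fcross_diag X Y (xi eta : F) : fcross (X, Y, xi, eta) (X, Y, xi, eta) = 0 ->
  [/\ jxp Y Y = xi *: X, jxp X X = eta *: Y & jdot X Y = 3 * (xi * eta)].
Proof.
rewrite fcross_tuple.
set A := - 4^-1 *: _; set B := 4^-1 *: _; set nu := 8^-1 * _.
set phi := - 2^-1 *: _ => H.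
have H1 : Phi phi A B nu (0, 0, 1, 0) = 0 by rewrite H zero_lfunE.
have H2 : Phi phi A B nu (0, 0, 0, 1) = 0 by rewrite H zero_lfunE.
rewrite Phi_tuple !lf_lin !jxp_lin !jdot_lin in H1.
rewrite Phi_tuple !lf_lin !jxp_lin !jdot_lin in H2.
have A0 : A = 0 by rewrite -[RHS](congr1 (fun P : freud => P.1.1.1) H2); vring.
have B0 : B = 0 by rewrite -[RHS](congr1 (fun P : freud => P.1.1.2) H1); vring.
have nu0 : nu = 0 by rewrite -[RHS](congr1 (fun P : freud => P.1.2) H1) /=; ring.
split.
- have -> : jxp Y Y = xi *: X - 2 *: A by rewrite /A; vfield.
  by rewrite A0 scaler0 subr0.
- have -> : jxp X X = eta *: Y + 2 *: B by rewrite /B; vfield.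
  by rewrite B0 scaler0 addr0.
- have -> : jdot X Y = 3 * (xi * eta) + 4 * nu by rewrite /nu; field.
  by rewrite nu0 mulr0 addr0.
Qed.

Lemma fcross_qdot_qdot : fcross (qdot F) (qdot F) = 0.
Proof.
rewrite /qdot fcross_tuple !(jve_lin, jxp_lin, jdot_lin) -[RHS]Phi0.
by apply: Phi_eq; [vring | vring | vring | ring].
Qed.

Definition Gc be (c : F) := [/\ Gs be, c != 0, bp be (pdot F) = c *: pdot F
  & bp be (qdot F) = c^-1 *: qdot F].

(** The image of [pdot] lies on the rank one cone. After [fA] has made [xi] nonzero and [fB] has
    cleared [Y], the cone equations force [X = 0] and [eta = 0]. The image of [qdot] then has
    [eta = c^-1] by invariance of [{P, Q}], and one more [fA], which fixes the line of [pdot],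
    clears its [X]. *)
Lemma Gs_to_Gc be : Gs be -> exists g c, G0 g /\ Gc (g \o be)%VF c.
Proof.
move=> Hbe.
have moveA A b : JK A -> Gs b -> G0 (eexp (eF (fA A))) /\ Gs (eexp (eF (fA A)) \o b)%VF.
  move=> HA Hb; split.
    by apply: G0_1; [exact: kk_fA | apply: ad_nilp_eF; [exact: fA_e7 | exact: fA_nilp]].
  by apply: Gs_comp => //; apply: Gs_eexp; [exact: fA_e7 | exact: fA_nilp | exact: kk_fA].
have moveB A b : JK A -> Gs b -> G0 (eexp (eF (fB A))) /\ Gs (eexp (eF (fB A)) \o b)%VF.
  move=> HA Hb; split.
    by apply: G0_1; [exact: kk_fB | apply: ad_nilp_eF; [exact: fB_e7 | exact: fB_nilp]].
  by apply: Gs_comp => //; apply: Gs_eexp; [exact: fB_e7 | exact: fB_nilp | exact: kk_fB].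
have bpA A b P : JK A -> Gs b -> bp (eexp (eF (fA A)) \o b)%VF P =
    \sum_(i < 4) (i`!%:R)^-1 *: iter i (fA A) (bp b P).
  by move=> HA Hb; apply: bp_eexp => //; [exact: fA_e7 | exact: fA_nilp | exact: kk_fA].
have bpB A b P : JK A -> Gs b -> bp (eexp (eF (fB A)) \o b)%VF P =
    \sum_(i < 4) (i`!%:R)^-1 *: iter i (fB A) (bp b P).
  by move=> HA Hb; apply: bp_eexp => //; [exact: fB_e7 | exact: fB_nilp | exact: kk_fB].
have [g1 [G1 [H1 xi1]]] : exists g, G0 g /\ (Gs (g \o be)%VF /\ (bp (g \o be)%VF (pdot F)).1.2 != 0).
  case E : (bp be (pdot F)) => [[[X Y] xi] eta].
  have := bp_PK Hbe (PK_pdot F); rewrite E => /PK_JK[HX HY].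
  have p0 : (X, Y, xi, eta) != 0 :> freud.
    rewrite -E; apply/negP => /eqP /(bp_inj Hbe) /(congr1 (fun P : freud => P.1.2)) /= /eqP.
    by rewrite oner_eq0.
  have [A HA n0] := exists_fA HX HY p0; have [GA HbA] := moveA A be HA Hbe.
  exists (eexp (eF (fA A))); split=> //; split=> //; rewrite bpA // E.
  by rewrite exp_fA.
have [g2 [G2 [H2 [c [c0 E2]]]]] : exists g, G0 g /\ (Gs (g \o be)%VF /\
    exists c, c != 0 /\ bp (g \o be)%VF (pdot F) = c *: pdot F).
  move: xi1; case E : (bp _ (pdot F)) => [[[X Y] xi] eta] /= xi1.
  have := bp_PK H1 (PK_pdot F); rewrite E => /PK_JK[HX HY].
  have HB : JK (- xi^-1 *: Y) by exact: JKZ.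
  have [GB HbB] := moveB _ _ HB H1.
  have EB := bpB _ _ (pdot F) HB H1; rewrite E in EB.
  have [X' [eta' EB']] := exp_fB (- xi^-1 *: Y) X Y xi eta.
  rewrite EB' scalerA mulrN divff // scaleN1r subrr in EB.
  exists (eexp (eF (fB (- xi^-1 *: Y))) \o g1)%VF; split; first exact: G0_comp.
  rewrite -comp_lfunA; split=> //; exists xi; split=> //.
  have := bp_rank1 HbB (fcross_pdot_pdot F); rewrite EB => /fcross_diag[]; rewrite !(jxp_lin, jdot_lin).
  move=> /esym/eqP; rewrite scaler_eq0 (negbTE xi1) => /eqP -> _ /esym/eqP.
  rewrite !mulf_eq0 pnatr_eq0 (negbTE xi1) => /eqP ->.
  by apply: freud_eq; rewrite ?scaler0 ?mulr0 //; exact: esym (mulr1 _).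
set b2 := (g2 \o be)%VF in H2 E2.
case E : (bp b2 (qdot F)) => [[[X Y] xi] eta].
have := bp_PK H2 (PK_qdot F); rewrite E => /PK_JK[HX HY].
have c_eta : c * eta = 1.
  have := bp_skew H2 (pdot F) (qdot F).
  rewrite E E2 fskewZl /pdot /qdot !fskew_tuple !jdot_lin !(mulr1, mul0r, mulr0, subr0, mul1r, add0r).
  by [].
have etaE : eta = c^-1 by rewrite -[eta]mul1r -(mulVf c0) -mulrA c_eta mulr1.
have eta0 : eta != 0 by rewrite etaE invr_eq0.
have HA : JK (- c *: X) by exact: JKZ.
have [GA HbA] := moveA _ _ HA H2.
exists (eexp (eF (fA (- c *: X))) \o g2)%VF, c; split; first exact: G0_comp.
rewrite -comp_lfunA -/b2; split=> //.
  rewrite bpA // E2.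
  have -> : c *: pdot F = (0, 0, c, 0) by apply: freud_eq; rewrite ?scaler0 //; exact: mulr1.
  rewrite exp_fA !(jxp_lin, jdot_lin).
  by apply: freud_eq; rewrite ?(scaler0, scale0r, addr0, mulr0, mul0r).
have EA := bpA _ _ (qdot F) HA H2; rewrite E exp_fA in EA.
have X0 : X + eta *: (- c *: X) = 0 by rewrite scalerA mulrN mulrC c_eta scaleN1r subrr.
rewrite X0 in EA; move: EA.
set Y' := Y + _ + _; set xi' := xi + _ + _ + _ => EA.
have := bp_rank1 HbA fcross_qdot_qdot; rewrite EA => /fcross_diag[_].
rewrite !(jxp_lin, jdot_lin) => /esym/eqP; rewrite scaler_eq0 (negbTE eta0) => /eqP ->.
move=> /esym/eqP; rewrite !mulf_eq0 pnatr_eq0 /= (negbTE eta0) orbF => /eqP ->.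
by apply: freud_eq; rewrite ?(scaler0, mulr0) //; rewrite etaE; exact: esym (mulr1 _).
Qed.

End Moves.

(** * The induced action on the two Jordan components *)

Section Peirce.
Context (F : numFieldType).
Notation oct := 'rV[F]_8.
Notation jord := (jord F).
Notation freud := (freud F).
Notation e7 := (e7 F).
Notation e8 := (e8 F).
Local Notation e := (oct_e F).
Local Notation one_plus := (one_plus F).
Local Notation one_minus := (one_minus F).
Implicit Types (X Y : jord) (P Q : freud) (D : 'End(jord)) (u : subvs_of e7).
Local Notation pdot := (pdot F).
Local Notation qdot := (qdot F).
Local Notation "x ** y" := (oct_mul x y) (at level 40, left associativity).

Lemma jxp_jmk a b c (x y z : oct) a' b' c' x' y' z' :
  jxp (jmk a b c x y z) (jmk a' b' c' x' y' z') =
  jmk (2^-1 * (b * c' + b' * c) - oip x x') (2^-1 * (c * a' + c' * a) - oip y y')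
      (2^-1 * (a * b' + a' * b) - oip z z')
   (2^-1 *: (oct_conj (y ** z') + oct_conj (y' ** z) - a *: x' - a' *: x))
   (2^-1 *: (oct_conj (z ** x') + oct_conj (z' ** x) - b *: y' - b' *: y))
   (2^-1 *: (oct_conj (x ** y') + oct_conj (x' ** y) - c *: z' - c' *: z)).
Proof. by rewrite jxp.unlock jmk_cross. Qed.

Lemma fcross_pdot X Y : fcross pdot (X, Y, 0, 0) = Phi 0 (4^-1 *: X) 0 0.
Proof.
rewrite /pdot fcross_tuple !(jve_lin, jxp_lin, jdot_lin).
by apply: Phi_eq; [vring | vring | vring | ring].
Qed.

Lemma fcross_qdot X Y : fcross qdot (X, Y, 0, 0) = Phi 0 0 (- 4^-1 *: Y) 0.
Proof.
rewrite /qdot fcross_tuple !(jve_lin, jxp_lin, jdot_lin).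
by apply: Phi_eq; [vring | vring | vring | ring].
Qed.

Definition gam (be : 'End(e8)) X : jord := (bp be (X, 0, 0, 0)).1.1.1.
Definition gam' (be : 'End(e8)) Y : jord := (bp be (0, Y, 0, 0)).1.1.2.

Lemma freud_lin_tuple a X Y (xi eta : F) X' Y' (xi' eta' : F) :
  a *: ((X, Y, xi, eta) : freud) + (X', Y', xi', eta') =
  (a *: X + X', a *: Y + Y', a * xi + xi', a * eta + eta').
Proof. by []. Qed.

Section Linear.
Variables (be : 'End(e8)) (c : F).
Hypothesis Hbe : Gc be c.
Let Gb : Gs be. Proof. by case: Hbe. Qed.
Let c0 : c != 0. Proof. by case: Hbe. Qed.
Let bp1 : bp be pdot = c *: pdot. Proof. by case: Hbe. Qed.
Let bq1 : bp be qdot = c^-1 *: qdot. Proof. by case: Hbe. Qed.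

Lemma pdotE (a : F) : a *: pdot = (0, 0, a, 0).
Proof. by apply: freud_eq; rewrite ?scaler0 //; exact: mulr1. Qed.
Lemma qdotE (a : F) : a *: qdot = (0, 0, 0, a).
Proof. by apply: freud_eq; rewrite ?scaler0 //; exact: mulr1. Qed.

Lemma bp0 : bp be 0 = 0.
Proof. by have := bp_lin Gb (-1) 0 0; rewrite scaler0 addr0 scaleN1r addNr. Qed.

Lemma bp_jord X Y : exists X' Y', bp be (X, Y, 0, 0) = (X', Y', 0, 0).
Proof.
case E : (bp be (X, Y, 0, 0)) => [[[X' Y'] xi] eta].
have := bp_skew Gb pdot (X, Y, 0, 0); have := bp_skew Gb qdot (X, Y, 0, 0).
rewrite bp1 bq1 E fskewZl fskewZl /pdot /qdot !fskew_tuple !jdot_lin.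
rewrite !(mul0r, mul1r, mulr0, subr0, sub0r, addr0, add0r, mulr1).
move=> /eqP; rewrite oppr0 mulrN oppr_eq0 mulf_eq0 invr_eq0 (negbTE c0) => /eqP ->.
by move=> /eqP; rewrite mulf_eq0 (negbTE c0) => /eqP ->; exists X', Y'.
Qed.

(** The first Jordan summand is singled out by [qdot x (X, 0, 0, 0) = 0]; the image satisfies the
    same equation, which kills its second component. *)
Lemma bpX X : bp be (X, 0, 0, 0) = (gam be X, 0, 0, 0).
Proof.
rewrite /gam; have [X' [Y' E]] := bp_jord X 0; rewrite E /=.
have H : fcross qdot (X, 0, 0, 0) = 0.
  by rewrite fcross_qdot scaler0 Phi0.
have := bp_cross Gb qdot (X, 0, 0, 0) pdot; rewrite H zero_lfunE bp0 E bp1 bq1.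
rewrite fcrossZl fcross_qdot scale_lfunE pdotE Phi_tuple.
move/(congr1 (fun P : freud => P.1.1.2)) => /=; rewrite !jxp_lin !lf_lin => E2.
suff -> : Y' = 0 by [].
by rewrite -[RHS](scaler0 _ (- 4)) -E2; vfield.
Qed.

Lemma bpY Y : bp be (0, Y, 0, 0) = (0, gam' be Y, 0, 0).
Proof.
rewrite /gam'; have [X' [Y' E]] := bp_jord 0 Y; rewrite E /=.
have H : fcross pdot (0, Y, 0, 0) = 0.
  by rewrite fcross_pdot scaler0 Phi0.
have := bp_cross Gb pdot (0, Y, 0, 0) qdot; rewrite H zero_lfunE bp0 E bp1 bq1.
rewrite fcrossZl fcross_pdot scale_lfunE qdotE Phi_tuple.
move/(congr1 (fun P : freud => P.1.1.1)) => /=; rewrite !jxp_lin !lf_lin => E2.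
suff -> : X' = 0 by [].
by rewrite -[RHS](scaler0 _ 4) -E2; vfield.
Qed.

Lemma gam_lin a X Y : gam be (a *: X + Y) = a *: gam be X + gam be Y.
Proof.
have := bp_lin Gb a (X, 0, 0, 0) (Y, 0, 0, 0); rewrite !bpX.
have -> : a *: ((X, 0, 0, 0) : freud) + (Y, 0, 0, 0) = (a *: X + Y, 0, 0, 0).
  by rewrite freud_lin_tuple; apply: freud_eq; rewrite ?(scaler0, mulr0, addr0).
by rewrite bpX => /(congr1 (fun P : freud => P.1.1.1)).
Qed.

(** Together with [gam_dot], this says that [gam] multiplies the cubic form by [c^-1] and that
    [gam'] is its contragredient. The factor comes from the scaling of [pdot]. *)
Lemma gam_cross X Z : c *: jxp (gam be X) (gam be Z) = gam' be (jxp X Z).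
Proof.
have := bp_cross Gb pdot (X, 0, 0, 0) (Z, 0, 0, 0).
rewrite !bpX bp1 fcrossZl !fcross_pdot scale_lfunE.
have P0 (W V : jord) : Phi 0 (4^-1 *: W) 0 0 (V, 0, 0, 0) = 2^-1 *: (0, jxp W V, 0, 0).
  rewrite Phi_tuple jtransp0 !zero_lfunE !jxp_lin !jdot_lin.
  apply: freud_eq; by [vfield | exact: esym (mulr0 _) | rewrite /GRing.scale /=; field].
rewrite !P0; have bpZ a P : bp be (a *: P) = a *: bp be P.
  by have := bp_lin Gb a P 0; rewrite bp0 !addr0.
rewrite bpZ bpY => /(congr1 (fun P : freud => P.1.1.2)) /= E2.
have -> : gam' be (jxp X Z) = 2 *: (2^-1 *: gam' be (jxp X Z)) by vfield.
by rewrite -E2; vfield.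
Qed.

Lemma gam_cross' X Z : c^-1 *: jxp (gam' be X) (gam' be Z) = gam be (jxp X Z).
Proof.
have := bp_cross Gb qdot (0, X, 0, 0) (0, Z, 0, 0).
rewrite !bpY bq1 fcrossZl !fcross_qdot scale_lfunE.
have P0 (W V : jord) : Phi 0 0 (- 4^-1 *: W) 0 (0, V, 0, 0) = - 2^-1 *: (jxp W V, 0, 0, 0).
  rewrite Phi_tuple jtransp0 !zero_lfunE !jxp_lin !jdot_lin.
  apply: freud_eq; by [vfield | exact: esym (mulr0 _) | rewrite /GRing.scale /=; field].
rewrite !P0; have bpZ a P : bp be (a *: P) = a *: bp be P.
  by have := bp_lin Gb a P 0; rewrite bp0 !addr0.
rewrite bpZ bpX => /(congr1 (fun P : freud => P.1.1.1)) /= E2.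
have -> : gam be (jxp X Z) = - 2 *: (- 2^-1 *: gam be (jxp X Z)) by vfield.
by rewrite -E2; vfield.
Qed.

Lemma gam_dot X Y : jdot (gam be X) (gam' be Y) = jdot X Y.
Proof.
have := bp_skew Gb (X, 0, 0, 0) (0, Y, 0, 0); rewrite bpX bpY !fskew_tuple !jdot_lin.
by rewrite !(mul0r, subr0, addr0).
Qed.

Lemma gam_JK X : JK X -> JK (gam be X).
Proof.
move=> HX; have := bp_PK Gb (iffRL (PK_JK X 0 0 0) (conj HX (@JK0 F))).
by rewrite bpX => /PK_JK[].
Qed.

Lemma gam'_JK X : JK X -> JK (gam' be X).
Proof.
move=> HX; have := bp_PK Gb (iffRL (PK_JK 0 X 0 0) (conj (@JK0 F) HX)).
by rewrite bpY => /PK_JK[].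
Qed.

Lemma gam_so6 D X : so6 D -> gam be (D X) = D (gam be X).
Proof.
move=> HD; have [f4D _ _] := HD; have := bp_so6 Gb (X, 0, 0, 0) HD.
rewrite bpX (Phi_D_tuple _ 0 0 0 f4D) (Phi_D_tuple _ 0 0 0 f4D) lf0 bpX.
by move/(congr1 (fun P : freud => P.1.1.1)).
Qed.

Lemma gam'_so6 D X : so6 D -> gam' be (D X) = D (gam' be X).
Proof.
move=> HD; have [f4D _ _] := HD; have := bp_so6 Gb (0, X, 0, 0) HD.
rewrite bpY (Phi_D_tuple 0 _ 0 0 f4D) (Phi_D_tuple 0 _ 0 0 f4D) lf0 bpY.
by move/(congr1 (fun P : freud => P.1.1.2)).
Qed.

Lemma gam_inj X : gam be X = 0 -> X = 0.
Proof.
move=> H; apply: jdot_nondeg => Y; by rewrite -gam_dot H jdot_lin.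
Qed.

Lemma gam'_lin a X Y : gam' be (a *: X + Y) = a *: gam' be X + gam' be Y.
Proof.
have := bp_lin Gb a (0, X, 0, 0) (0, Y, 0, 0); rewrite !bpY.
have -> : a *: ((0, X, 0, 0) : freud) + (0, Y, 0, 0) = (0, a *: X + Y, 0, 0).
  by rewrite freud_lin_tuple; apply: freud_eq; rewrite ?(scaler0, mulr0, addr0).
by rewrite bpY => /(congr1 (fun P : freud => P.1.1.2)).
Qed.

Lemma gam_id : c = 1 -> (forall X, gam be X = X) -> be = \1%VF.
Proof.
move=> c1 H; apply: (bp_id Gb) => -[[[X Y] xi] eta].
have E' Z : gam' be Z = Z.
  by apply: jdot_ext => W; rewrite jdotC -[X in jdot X (gam' _ _)]H gam_dot jdotC.
have -> : (X, Y, xi, eta) = 1 *: ((X, 0, 0, 0) : freud) + (1 *: ((0, Y, 0, 0) : freud) +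
    (xi *: pdot + eta *: qdot)).
  rewrite pdotE qdotE.
  have s4E X1 Y1 (x1 n1 : F) X2 Y2 (x2 n2 : F) X3 Y3 (x3 n3 : F) X4 Y4 (x4 n4 : F) :
    1 *: ((X1, Y1, x1, n1) : freud) + (1 *: ((X2, Y2, x2, n2) : freud) +
    (((X3, Y3, x3, n3) : freud) + (X4, Y4, x4, n4))) =
    (1 *: X1 + (1 *: X2 + (X3 + X4)), 1 *: Y1 + (1 *: Y2 + (Y3 + Y4)),
     1 * x1 + (1 * x2 + (x3 + x4)), 1 * n1 + (1 * n2 + (n3 + n4))) by [].
  by rewrite s4E; apply: freud_eq; [vring | vring | ring | ring].
have e1 : bp be (X, 0, 0, 0) = (X, 0, 0, 0) by rewrite bpX H.
have e2 : bp be (0, Y, 0, 0) = (0, Y, 0, 0) by rewrite bpY E'.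
have e3 : bp be pdot = pdot by rewrite bp1 c1 scale1r.
have e4 : bp be (eta *: qdot) = eta *: qdot.
  by have := bp_lin Gb eta qdot 0; rewrite bp0 !addr0 => ->; rewrite bq1 c1 invr1 scale1r.
by rewrite (bp_lin Gb 1) (bp_lin Gb 1) (bp_lin Gb xi) e1 e2 e3 e4.
Qed.

End Linear.

End Peirce.

(** * Commuting with so(6), and recognition of E_1 *)

Section Frame.
Context (F : numFieldType).
Notation oct := 'rV[F]_8.
Notation jord := (jord F).
Notation freud := (freud F).
Notation e7 := (e7 F).
Notation e8 := (e8 F).
Local Notation e := (oct_e F).
Local Notation one_plus := (one_plus F).
Local Notation one_minus := (one_minus F).
Implicit Types (X Y : jord) (P Q : freud) (D : 'End(jord)) (u : subvs_of e7).
Local Notation pdot := (pdot F).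
Local Notation qdot := (qdot F).
Local Notation "x ** y" := (oct_mul x y) (at level 40, left associativity).
Local Notation F1 := (@F1 F).
Local Notation F2 := (@F2 F).
Local Notation F3 := (@F3 F).
Local Notation E1 := (E1 F).
Local Notation E2 := (E2 F).
Local Notation E3 := (E3 F).

Lemma jmk_ex X : exists a b c x y z, X = jmk a b c x y z.
Proof. by elim/jord_ind3: X => a b c x y z; do 6 eexists. Qed.

(** Schur's lemma by hand. Rotations in planes avoiding e_i kill F_1(e_i), hence its image, which
    leaves the e_i-direction and the so(6)-invariants. Rotations taking e_2 to e_i show that the
    scalar is the same for all [i]. *)
Lemma so6_comm_scalar (f : jord -> jord) : linear f ->
  (forall D X, so6 D -> f (D X) = D (f X)) ->
  exists k : F, forall i : nat, (1 < i < 8)%N -> f (F1 (e i)) = k *: F1 (e i).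
Proof.
move=> flin fD.
have f0 : f 0 = 0 := lin0_of flin.
have fN X : f (- X) = - f X := linN_of flin X.
have far (i k : nat) : exists l : nat, [/\ (1 < l < 8)%N, i != l & k != l].
  have [->|i2] := eqVneq i 2%N; last have [->|k2] := eqVneq k 2%N; last by exists 2%N.
    by have [->|k3] := eqVneq k 3%N; [exists 4%N | exists 3%N].
  by have [->|i3] := eqVneq i 3%N; [exists 4%N | exists 3%N].
have DF1 (i j : nat) x : (1 < i < 8)%N -> (1 < j < 8)%N -> i != j ->
    Dab (e i) (e j) (F1 x) = F1 (oip (e j) x *: e i - oip (e i) x *: e j).
  move=> /andP[_ Hi] /andP[_ Hj] ij; rewrite /F1 DabE' // !oct_lin.
  by rewrite ?scaler0.
have ei i j : (1 < i < 8)%N -> (1 < j < 8)%N -> oip (e i) (e j) = (i == j)%:R.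
  by move=> /andP[_ Hi] /andP[_ Hj]; exact: oip_e.
have F10 : F1 0 = 0 by exact: jmk0.
have F1N (x : oct) : F1 (- x) = - F1 x := linN_of (@F1_lin F) x.
have F1Z a (x : oct) : F1 (a *: x) = a *: F1 x := linZ_of (@F1_lin F) a x.
have one i : (1 < i < 8)%N -> exists k : F, f (F1 (e i)) = k *: F1 (e i).
  move=> Hi; have [p [q [r [x [y [z E]]]]]] := jmk_ex (f (F1 (e i))).
  have kill j k : (1 < j < 8)%N -> (1 < k < 8)%N -> j != k -> i != j -> i != k ->
      [/\ oip (e j) x *: e k - oip (e k) x *: e j = 0, y = 0 & z = 0].
    move=> Hj Hk jk ij ik; have := fD _ (F1 (e i)) (so6_Dab F Hj Hk).
    rewrite DF1 // !ei // eq_sym (negbTE ik) eq_sym (negbTE ij) !scale0r subrr F10 f0 E.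
    have [_ Hj8] := andP Hj; have [_ Hk8] := andP Hk.
    rewrite DabE' // -(jmk0 F) => /jmk_inj[_ [/esym /eqP Hx /esym/eqP Hy /esym/eqP Hz]].
    split.
    - by apply/eqP; rewrite -oppr_eq0 opprB.
    - by move: Hy; rewrite scaler_eq0 invr_eq0 pnatr_eq0 => /eqP; exact: oct_conj_e_inj.
    - by move: Hz; rewrite scaler_eq0 invr_eq0 pnatr_eq0 => /eqP; exact: oct_conj_e_injr.
  have x0 l : (1 < l < 8)%N -> i != l -> oip (e l) x = 0.
    move=> Hl il; have [k [Hk ik lk]] := far i l; have [Hx _ _] := kill l k Hl Hk lk il ik.
    have [_ Hl8] := andP Hl; have [_ Hk8] := andP Hk; have kl : k != l by rewrite eq_sym.
    by have [] := Dab_off1 Hk8 Hl8 kl Hx.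
  have [j [Hj ij _]] := far i i; have [k [Hk ik jk]] := far i j.
  have [_ y0 z0] := kill j k Hj Hk jk ij ik.
  have HD := so6_Dab F Hi Hj; exists (oip (e i) x).
  have ji : (j == i) = false by rewrite eq_sym; apply/negbTE.
  have [_ Hi8] := andP Hi; have [_ Hj8] := andP Hj.
  (* Applied twice, the rotation in the plane of e_i and e_j is -1 on F_1(e_i) and kills the
     invariant part of the image. *)
  have DD : Dab (e i) (e j) (Dab (e i) (e j) (F1 (e i))) = - F1 (e i).
    rewrite (DF1 i j) // !ei // eqxx ji scale0r sub0r scale1r F1N lfN (DF1 i j) // !ei // eqxx (negbTE ij).
    by rewrite scale1r scale0r subr0.
  apply: oppr_inj; rewrite -fN -DD !fD // E y0 z0.
  rewrite DabE' // !oct_lin !scaler0 (x0 _ Hj ij) scale0r sub0r -[jmk 0 0 0 _ 0 0]/(F1 _).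
  by rewrite F1N F1Z lfN lfZ DF1 // !ei // eqxx (negbTE ij) scale1r scale0r subr0.
have [k Ek] := one 2%N isT; exists k => i Hi; have [->//|i2] := eqVneq i 2%N.
have D12 : Dab (e i) (e 2) (F1 (e 2)) = F1 (e i).
  by rewrite DF1 // !ei // eqxx (negbTE i2) scale1r scale0r subr0.
by rewrite -D12 (fD _ _ (so6_Dab F Hi (isT : (1 < 2 < 8)%N))) Ek lfZ.
Qed.

Lemma F1Z a (x : oct) : F1 (a *: x) = a *: F1 x. Proof. exact: linZ_of (@F1_lin F) a x. Qed.
Lemma F2Z a (x : oct) : F2 (a *: x) = a *: F2 x. Proof. exact: linZ_of (@F2_lin F) a x. Qed.
Lemma F3Z a (x : oct) : F3 (a *: x) = a *: F3 x. Proof. exact: linZ_of (@F3_lin F) a x. Qed.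

Lemma jord_neq0 (a : F) x : a != 0 -> a *: x = 0 :> jord -> x = 0.
Proof. by move=> a0 /eqP; rewrite scaler_eq0 (negbTE a0) => /eqP. Qed.

Lemma oct_neq0 (a : F) (x : oct) : a != 0 -> a *: x = 0 -> x = 0.
Proof. by move=> a0 /eqP; rewrite scaler_eq0 (negbTE a0) => /eqP. Qed.

Lemma e_neq0 i : (i < 8)%N -> e i != 0.
Proof.
move=> Hi; apply/negP => /eqP /(congr1 (oip (e i))); rewrite oip_e // eqxx oip_lin => /eqP.
by rewrite oner_eq0.
Qed.

Lemma gam_V6 be c : Gc be c -> exists k k' : F, k * k' = 1 /\
  forall i : nat, (1 < i < 8)%N -> gam be (F1 (e i)) = k *: F1 (e i) /\ gam' be (F1 (e i)) = k' *: F1 (e i).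
Proof.
move=> Hbe.
have [k Hk] := so6_comm_scalar (gam_lin Hbe) (fun D X => @gam_so6 F be c Hbe D X).
have [k' Hk'] := so6_comm_scalar (gam'_lin Hbe) (fun D X => @gam'_so6 F be c Hbe D X).
exists k, k'; split; last by move=> i Hi; rewrite Hk // Hk'.
have := gam_dot Hbe (F1 (e 2)) (F1 (e 2)); rewrite Hk // Hk' // !jdot_lin jdot_F1 oip_e // mulr1.
by move=> H; apply: (@mulIf _ (2 : F)); rewrite ?pnatr_eq0 // mul1r -mulrA.
Qed.

Lemma rank1_E1 a b d x : jxp (jmk a b d x 0 0) (jmk a b d x 0 0) = 0 -> a != 0 ->
  jmk a b d x 0 0 = a *: E1.
Proof.
move=> + a0; rewrite jxp_jmk !oct_lin -(jmk0 F) => /jmk_inj[[_ Hd Hb] [Hx _ _]].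
have d0 : d = 0 by apply: (mulfI a0); rewrite mulr0 -Hd; field.
have b0 : b = 0 by apply: (mulfI a0); rewrite mulr0 -Hb; field.
have x0 : x = 0 by apply: (oct_neq0 a0); rewrite -[RHS](oppr0) -Hx; vfield.
by rewrite d0 b0 x0 /E1 jmkZ !mulr0 mulr1 !scaler0.
Qed.

Lemma jxp_JK_F1 a b d x v : jxp (jmk a b d x 0 0) (F1 v) = jmk (- oip x v) 0 0 (- (2^-1 * a) *: v) 0 0.
Proof. by rewrite /F1 jxp_jmk !oct_lin; congr jmk; by [ring | vfield]. Qed.

Lemma oip_01 m n (i : nat) : (1 < i < 8)%N -> oip (m *: e 0 + n *: e 1) (e i) = 0.
Proof.
move=> /andP[i1 i8]; rewrite !oct_lin !oip_e //.
by case: i i1 i8 => [|[|i]] //= _ _; rewrite !mulr0 addr0.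
Qed.

Lemma jxp_JK_V6 a b d m n (i : nat) : (1 < i < 8)%N ->
  jxp (jmk a b d (m *: e 0 + n *: e 1) 0 0) (F1 (e i)) = (- (2^-1 * a)) *: F1 (e i).
Proof. by move=> Hi; rewrite jxp_JK_F1 oip_01 // oppr0 -F1Z. Qed.

Lemma JK_E1 : JK E1. Proof. by exists 1, 0, 0, 0, 0; rewrite !scale0r addr0. Qed.
Lemma JK_E2 : JK E2. Proof. by exists 0, 1, 0, 0, 0; rewrite !scale0r addr0. Qed.
Lemma JK_E3 : JK E3. Proof. by exists 0, 0, 1, 0, 0; rewrite !scale0r addr0. Qed.

Lemma jxp_E1_E1 : jxp E1 E1 = 0.
Proof. by rewrite /E1 jxp_jmk !oct_lin -(jmk0 F); congr jmk; by [ring | vring]. Qed.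

(** On F_1(e_2), an element of [JK] with first diagonal entry [a] acts through [x] as [- a / 2],
    while [gam] and [gam'] are nonzero scalars there. So the image of E_1 has nonzero first entry,
    and having rank one it is a multiple of E_1. *)
Lemma gam_E1 be c : Gc be c -> exists p : F, [/\ p != 0, gam be E1 = p *: E1 & gam' be E1 = p^-1 *: E1].
Proof.
move=> Hbe; have [k [k' [kk Hk]]] := gam_V6 Hbe; have [_ c0 _ _] := Hbe.
have [H2 H2'] := Hk 2%N isT.
have [k0 k0'] : k != 0 /\ k' != 0.
  by split; apply/negP => /eqP E; move: kk; rewrite E ?mul0r ?mulr0 => /esym/eqP; rewrite oner_eq0.
have E1F v : jxp E1 (F1 v) = - 2^-1 *: F1 v.
  rewrite /E1 jxp_JK_F1 !oct_lin oppr0 /F1 jmkZ; congr jmk; by [ring | vring].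
have e20 := e_neq0 (isT : (2 < 8)%N).
have [a [b [d [m [n EE]]]]] := gam_JK Hbe JK_E1.
have [a' [b' [d' [m' [n' EE']]]]] := gam'_JK Hbe JK_E1.
have g'0 : gam' be 0 = 0 := lin0_of (gam'_lin Hbe).
have g0 : gam be 0 = 0 := lin0_of (gam_lin Hbe).
have F20 : F1 (e 2) != 0.
  by apply/negP => /eqP; rewrite -(jmk0 F) => /F1_inj E; move: e20; rewrite E eqxx.
have a0 : a != 0.
  apply/negP => /eqP a0; have := gam_cross Hbe E1 (F1 (e 2)).
  rewrite E1F (linZ_of (gam'_lin Hbe)) H2 H2' EE a0 jxp_lin jxp_JK_V6 // mulr0 oppr0 scale0r !scaler0.
  by move/esym/eqP; rewrite !scaler_eq0 oppr_eq0 invr_eq0 pnatr_eq0 (negbTE k0') (negbTE F20).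
have a0' : a' != 0.
  apply/negP => /eqP a0'; have := gam_cross' Hbe E1 (F1 (e 2)).
  rewrite E1F (linZ_of (gam_lin Hbe)) H2 H2' EE' a0' jxp_lin jxp_JK_V6 // mulr0 oppr0 scale0r !scaler0.
  by move/esym/eqP; rewrite !scaler_eq0 oppr_eq0 invr_eq0 pnatr_eq0 (negbTE k0) (negbTE F20).
have G1 : gam be E1 = a *: E1.
  rewrite EE; apply: rank1_E1 => //; rewrite -EE; apply: (jord_neq0 c0).
  by rewrite (gam_cross Hbe) jxp_E1_E1 g'0.
have G1' : gam' be E1 = a' *: E1.
  have ci : c^-1 != 0 by rewrite invr_eq0.
  rewrite EE'; apply: rank1_E1 => //; rewrite -EE'; apply: (jord_neq0 ci).
  by rewrite (gam_cross' Hbe) jxp_E1_E1 g0.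
exists a; split=> //; rewrite G1'; congr (_ *: _).
have := gam_dot Hbe E1 E1; rewrite G1 G1' !jdot_lin /E1 jmk_dot !oct_lin.
by rewrite !(mulr0, mulr1, addr0) => H; apply: (mulfI a0); rewrite H divff.
Qed.

End Frame.

(** * Transvections between E_2 and E_3 *)

Section FrameMoves.
Context (F : numFieldType).
Notation oct := 'rV[F]_8.
Notation jord := (jord F).
Notation freud := (freud F).
Notation e7 := (e7 F).
Notation e8 := (e8 F).
Local Notation e := (oct_e F).
Local Notation one_plus := (one_plus F).
Local Notation one_minus := (one_minus F).
Implicit Types (X Y : jord) (P Q : freud) (D : 'End(jord)) (u : subvs_of e7).
Local Notation pdot := (pdot F).
Local Notation qdot := (qdot F).
Local Notation "x ** y" := (oct_mul x y) (at level 40, left associativity).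
Local Notation F1 := (@F1 F).
Local Notation F2 := (@F2 F).
Local Notation F3 := (@F3 F).
Local Notation E1 := (E1 F).
Local Notation E2 := (E2 F).
Local Notation E3 := (E3 F).
Local Notation s4 := (linfun (@sigma4_fun F)).

Section Move.
Variables (A B : jord).
Hypotheses (HA : JK A) (HB : JK B).
Let phi : 'End(jord) := 2 *: jve A B.
Hypothesis phi3 : forall X, phi (phi (phi X)) = 0.
Let f : 'End(freud) := Phi phi 0 0 0.

Lemma move_e6 : e6 phi. Proof. by apply: e6Z; exact: e6_jve. Qed.

Lemma move_kk : kk (eF f).
Proof.
apply: kk_Phi; [exact: move_e6 | | | exact: JK0 | exact: JK0].
- move=> X; rewrite /phi !scale_lfunE lf_lin; congr (_ *: _).
  rewrite !jve_jxpE !lf_lin !(aut_jxp (@sigma4_mul F) (@sigma4_tr F) (lker0_sigma4 F)).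
  rewrite !(sigma4_JK HA) !(sigma4_JK HB).
  have -> : jdot B (s4 X) = jdot B X.
    by rewrite -{1}(sigma4_JK HB) (aut_dot (@sigma4_mul F) (@sigma4_tr F)).
  by [].
- move=> D X HD; have [f4D _ _] := HD.
  have e6D' : e6 D.
    by exists D, 0; split; [| exact: jtr0 | apply/lfunP => Z; rewrite add_lfunE jmultE jmul0l addr0].
  have := e6_lie_jve A B e6D'; rewrite f4_transp // opp_lfunE.
  rewrite (iffRL (so6_JK A) HA D HD) (iffRL (so6_JK B) HB D HD) oppr0 !jve_lin subrr.
  move/(congr1 (fun g : 'End(jord) => g X)); rewrite /= lieE zero_lfunE => /eqP.
  by rewrite subr_eq0 => /eqP H; rewrite /phi !scale_lfunE lf_lin H.
Qed.

Lemma moveE X Y (xi eta : F) : f (X, Y, xi, eta) = (phi X, - jtransp phi Y, 0, 0).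
Proof.
rewrite /f Phi_tuple !jxp_lin !jdot_lin.
by apply: freud_eq; [vring | vring | ring | ring].
Qed.

Lemma move_e7 : f \in e7.
Proof. by apply/e7P; exists phi, 0, 0, 0; split; [exact: move_e6 | by []]. Qed.

Lemma move_nilp P : f (f (f (f P))) = 0.
Proof.
have t3 Y : jtransp phi (jtransp phi (jtransp phi Y)) = 0.
  by apply: jdot_nondeg => Z; rewrite jdotC -!jtranspP phi3 jdot_lin.
case: P => [[[X Y] xi] eta]; rewrite (moveE X Y) (moveE (phi X)) (moveE (phi (phi X))) moveE.
by rewrite phi3 !lf_lin t3 !oppr0.
Qed.

Lemma move_G0 : G0 (eexp (eF f)).
Proof. by apply: G0_1; [exact: move_kk | apply: ad_nilp_eF; [exact: move_e7 | exact: move_nilp]]. Qed.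

Lemma move_bp be P : Gs be -> bp (eexp (eF f) \o be) P =
  bp be P + f (bp be P) + 2^-1 *: f (f (bp be P)) + 6^-1 *: f (f (f (bp be P))).
Proof.
move=> Hbe; rewrite bp_eexp //; [| exact: move_e7 | exact: move_nilp | exact: move_kk].
rewrite !big_ord_recl big_ord0 !lift0 addr0 /= !factS fact0 !muln1 invr1 scale1r.
by rewrite !addrA scale1r.
Qed.

Lemma move_Gc be c : Gc be c -> Gc (eexp (eF f) \o be)%VF c.
Proof.
case=> Hbe c0 Hp Hq; have fpq (a b : F) : f (0, 0, a, b) = 0 by rewrite moveE !lf_lin oppr0.
split=> //.
- by apply: Gs_comp => //; apply: Gs_eexp; [exact: move_e7 | exact: move_nilp | exact: move_kk].
- by rewrite move_bp // Hp lfZ fpq !(scaler0, lf0, addr0).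
- by rewrite move_bp // Hq lfZ fpq !(scaler0, lf0, addr0).
Qed.

Lemma move_gam be c X : Gc be c ->
  gam (eexp (eF f) \o be) X = gam be X + phi (gam be X) + 2^-1 *: phi (phi (gam be X)).
Proof.
move=> Hbe; have [Gb _ _ _] := Hbe.
rewrite /gam move_bp // -/(gam be X) (bpX Hbe) (moveE (gam be X)) lf0 oppr0.
rewrite (moveE (phi (gam be X))) lf0 oppr0 (moveE (phi (phi (gam be X)))) phi3 lf0 oppr0.
by rewrite -[RHS]addr0 -[X in _ = _ + X](scaler0 _ (6^-1)).
Qed.

End Move.

(** With [E_3] or [E_2] against [F_1(a)], the operator [v] gives the elementary transvections of the
    lower right 2 by 2 block; the factor 2 cancels the one half in [jve_jxpE]. *)
Lemma phE a p q r x y z : (2 *: jve E3 (F1 a)) (jmk p q r x y z) =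
  jmk 0 0 (2 * oip a x) (q *: a) (oct_conj (z ** a)) 0.
Proof.
rewrite scale_lfunE jve_jxpE /E3 /F1 !jxp_jmk !jmk_dot !oct_lin.
by rewrite !(jmkZ, jmkN, jmkD); congr jmk; by [field | vfield].
Qed.

Lemma psE a p q r x y z : (2 *: jve E2 (F1 a)) (jmk p q r x y z) =
  jmk 0 (2 * oip a x) 0 (r *: a) 0 (oct_conj (a ** y)).
Proof.
rewrite scale_lfunE jve_jxpE /E2 /F1 !jxp_jmk !jmk_dot !oct_lin.
by rewrite !(jmkZ, jmkN, jmkD); congr jmk; by [field | vfield].
Qed.

Lemma ps_E1 a : (2 *: jve E2 (F1 a)) E1 = 0.
Proof. by rewrite /E1 psE !oct_lin !(mulr0, scale0r) jmk0. Qed.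

Lemma ps_E2 a : (2 *: jve E2 (F1 a)) E2 = 0.
Proof. by rewrite {2}/E2 psE !oct_lin !(mulr0, scale0r) jmk0. Qed.

Lemma ph3 a X : (2 *: jve E3 (F1 a)) ((2 *: jve E3 (F1 a)) ((2 *: jve E3 (F1 a)) X)) = 0.
Proof.
have [p [q [r [x [y [z ->]]]]]] := jmk_ex X.
by rewrite !phE !oct_lin !(scale0r, mulr0, mul0r) jmk0.
Qed.

Lemma ps3 a X : (2 *: jve E2 (F1 a)) ((2 *: jve E2 (F1 a)) ((2 *: jve E2 (F1 a)) X)) = 0.
Proof.
have [p [q [r [x [y [z ->]]]]]] := jmk_ex X.
by rewrite !psE !oct_lin !(scale0r, mulr0, mul0r) jmk0.
Qed.

Lemma JK_F1 m n : JK (F1 (m *: e 0 + n *: e 1)).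
Proof. by exists 0, 0, 0, m, n. Qed.

Lemma ph_exp a q r x : jmk 0 q r x 0 0 + (2 *: jve E3 (F1 a)) (jmk 0 q r x 0 0) +
  2^-1 *: (2 *: jve E3 (F1 a)) ((2 *: jve E3 (F1 a)) (jmk 0 q r x 0 0)) =
  jmk 0 q (r + 2 * oip a x + q * oip a a) (x + q *: a) 0 0.
Proof.
rewrite !phE !oct_lin !(jmkZ, jmkD); congr jmk; by [field | vfield].
Qed.

Lemma ps_exp a q r x : jmk 0 q r x 0 0 + (2 *: jve E2 (F1 a)) (jmk 0 q r x 0 0) +
  2^-1 *: (2 *: jve E2 (F1 a)) ((2 *: jve E2 (F1 a)) (jmk 0 q r x 0 0)) =
  jmk 0 (q + 2 * oip a x + r * oip a a) r (x + r *: a) 0 0.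
Proof.
rewrite !psE !oct_lin !(jmkZ, jmkD); congr jmk; by [field | vfield].
Qed.

(** The relation [c p q r = 1] is the scaling of the cubic form by [c^-1], read on the frame. *)
Definition Gframe be (c p q r : F) :=
  [/\ Gc be c, [/\ gam be E1 = p *: E1, gam be E2 = q *: E2 & gam be E3 = r *: E3],
   [/\ p != 0, q != 0 & r != 0] & c * p * q * r = 1].

(** [gam'] preserves the line of E_1, so the contragredient map [gam] preserves its orthogonal
    complement. *)
Lemma gam_E23 be c X : Gc be c -> JK X -> jdot X E1 = 0 ->
  exists q r m n, gam be X = jmk 0 q r (m *: e 0 + n *: e 1) 0 0.
Proof.
move=> Hbe HX X1; have [a [b [d [m [n EE]]]]] := gam_JK Hbe HX.
have [p [p0 _ E1']] := gam_E1 Hbe.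
have := gam_dot Hbe X E1; rewrite E1' EE X1 jdot_lin /E1 jmk_dot !oct_lin.
rewrite !(mulr0, mulr1, addr0) => /eqP; rewrite mulf_eq0 invr_eq0 (negbTE p0) => /eqP a0.
by exists b, d, m, n; rewrite a0.
Qed.

Lemma rank1_E23 be c X q r x : Gc be c -> jxp X X = 0 ->
  gam be X = jmk 0 q r x 0 0 -> q * r = oip x x.
Proof.
move=> Hbe XX EE; have [_ c0 _ _] := Hbe.
have g'0 : gam' be 0 = 0 := lin0_of (gam'_lin Hbe).
have := gam_cross Hbe X X; rewrite XX g'0 EE => /(jord_neq0 c0).
rewrite jxp_jmk -(jmk0 F) => /jmk_inj[[H _ _] _]; apply/eqP; rewrite -subr_eq0; apply/eqP.
by rewrite -[RHS]H; field.
Qed.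

Lemma Gc_to_frame be c : Gc be c -> exists g p q r, G0 g /\ Gframe (g \o be)%VF c p q r.
Proof.
move=> Hbe; have [_ c0 _ _] := Hbe.
have E22 : jxp E2 E2 = 0.
  by rewrite /E2 jxp_jmk !oct_lin -(jmk0 F); congr jmk; by [ring | vring].
have E33 : jxp E3 E3 = 0.
  by rewrite /E3 jxp_jmk !oct_lin -(jmk0 F); congr jmk; by [ring | vring].
have d21 : jdot E2 E1 = 0 by rewrite /E1 /E2 jmk_dot !oct_lin; ring.
have d31 : jdot E3 E1 = 0 by rewrite /E1 /E3 jmk_dot !oct_lin; ring.
have o00 : oip (e 0) (e 0) = 1 by rewrite oip_e // eqxx.
have o11 : oip (e 1) (e 1) = 1 by rewrite oip_e // eqxx.
have o01 : oip (e 0) (e 1) = 0 by rewrite oip_e.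
have o10 : oip (e 1) (e 0) = 0 by rewrite oip_e.
have [g1 [G1 [b1 [q [r [m [n [q0 EE]]]]]]]] : exists g, G0 g /\ (Gc (g \o be)%VF c /\
    exists q r m n, q != 0 /\ gam (g \o be) E2 = jmk 0 q r (m *: e 0 + n *: e 1) 0 0).
  have [q [r [m [n EE]]]] := gam_E23 Hbe (JK_E2 F) d21.
  suff [i [j n0]] : exists i j : F, q + 2 * oip (i *: e 0 + j *: e 1) (m *: e 0 + n *: e 1)
      + r * oip (i *: e 0 + j *: e 1) (i *: e 0 + j *: e 1) != 0.
    exists (eexp (eF (Phi (2 *: jve E2 (F1 (i *: e 0 + j *: e 1))) 0 0 0))).
    have H3 := @ps3 (i *: e 0 + j *: e 1).
    split; first exact: (move_G0 (JK_E2 F) (JK_F1 i j) H3).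
    split; first exact: (move_Gc (JK_E2 F) (JK_F1 i j) H3 Hbe).
    have EG := move_gam (JK_E2 F) (JK_F1 i j) H3 E2 Hbe; rewrite EE in EG.
    exists (q + 2 * oip (i *: e 0 + j *: e 1) (m *: e 0 + n *: e 1) +
      r * oip (i *: e 0 + j *: e 1) (i *: e 0 + j *: e 1)), r, (m + r * i), (n + r * j).
    split; first exact: n0.
    by apply: (etrans EG); apply: (etrans (ps_exp _ _ _ _)); congr jmk; vring.
  (* The new entry is a quadratic polynomial in [(i, j)]; its values at (0,0), (1,0), (-1,0), (0,1)
     determine [q], [r], [m], [n]. These cannot all vanish, since [gam] is injective. *)
  apply: contrapT => H.
  have {}H i j : q + 2 * (i * m + j * n) + r * (i ^+ 2 + j ^+ 2) = 0.
    apply/eqP/negP => /negP H0; apply: H; exists i, j.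
    move: H0; rewrite !oct_lin o00 o11 o01 o10.
    by congr (~~ (_ == _)); ring.
  have h00 := H 0 0; have h10 := H 1 0; have h20 := H (-1) 0; have h01 := H 0 1.
  have q0 : q = 0 by rewrite -[RHS]h00; ring.
  have r0 : r = 0.
    have -> : r = 2^-1 * ((q + 2 * (1 * m + 0 * n) + r * (1 ^+ 2 + 0 ^+ 2)) +
      (q + 2 * (-1 * m + 0 * n) + r * ((-1) ^+ 2 + 0 ^+ 2))) - q by field.
    by rewrite h10 h20 q0; ring.
  have m0 : m = 0.
    have -> : m = 2^-1 * ((q + 2 * (1 * m + 0 * n) + r * (1 ^+ 2 + 0 ^+ 2)) - q - r) by field.
    by rewrite h10 q0 r0; ring.
  have n0 : n = 0.
    have -> : n = 2^-1 * ((q + 2 * (0 * m + 1 * n) + r * (0 ^+ 2 + 1 ^+ 2)) - q - r) by field.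
    by rewrite h01 q0 r0; ring.
  have : E2 = 0 by apply: (gam_inj Hbe); rewrite EE q0 r0 m0 n0 !scale0r addr0 jmk0.
  by rewrite -(jmk0 F) => /jmk_inj[[_ /eqP]]; rewrite oner_eq0.
have [g2 [G2 [b2 EE2]]] : exists g, G0 g /\ (Gc (g \o be)%VF c /\ gam (g \o be) E2 = q *: E2).
  (* The parameter [- x / q] clears the off-diagonal entry; rank one then says that [q] times the
     last entry is zero. *)
  have H3 := @ph3 ((- q^-1 * m) *: e 0 + (- q^-1 * n) *: e 1).
  have HF := JK_F1 (- q^-1 * m) (- q^-1 * n).
  have Hc := move_Gc (JK_E3 F) HF H3 b1.
  exists (eexp (eF (Phi (2 *: jve E3 (F1 ((- q^-1 * m) *: e 0 + (- q^-1 * n) *: e 1))) 0 0 0)) \o g1)%VF.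
  split; first by apply: G0_comp => //; exact: (move_G0 (JK_E3 F) HF H3).
  rewrite -comp_lfunA; split=> //.
  have EG := move_gam (JK_E3 F) HF H3 E2 b1; rewrite EE in EG.
  have := etrans EG (ph_exp _ _ _ _).
  set r' := r + _ + _; have -> : m *: e 0 + n *: e 1 + q *: ((- q^-1 * m) *: e 0 + (- q^-1 * n) *: e 1) = 0.
    by vfield.
  move=> EE'; have := rank1_E23 Hc E22 EE'; rewrite !oct_lin => /eqP.
  rewrite mulf_eq0 (negbTE q0) => /eqP r'0; rewrite EE' r'0 /E2 jmkZ !mulr0 mulr1 !scaler0.
  by [].
set b := (g2 \o be)%VF in b2 EE2.
have [p [p0 E1E _]] := gam_E1 b2.
(* Since [E_3 = 2 E_1 x E_2], the map [gam'] scales E_3 by [c p q]. Pairing with [gam E_3] shows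
   that the E_3-entry of the latter is invertible, so the last off-diagonal entry can be cleared
   too. *)
have E3E : gam' b E3 = (c * p * q) *: E3.
  have -> : E3 = 2 *: jxp E1 E2.
    by rewrite /E1 /E2 jxp_jmk !oct_lin jmkZ; congr jmk; by [field | vfield].
  rewrite (linZ_of (gam'_lin b2)) -(gam_cross b2) E1E EE2 !jxp_lin.
  by vring.
have [q' [r' [m' [n' EE3]]]] := gam_E23 b2 (JK_E3 F) d31.
have r'E : c * p * q * r' = 1.
  have := gam_dot b2 E3 E3; rewrite E3E EE3 !jdot_lin /E3 !jmk_dot !oct_lin => H.
  by apply: (etrans (etrans _ H) _); ring.
have r'0 : r' != 0.
  by apply/negP => /eqP E; move: r'E; rewrite E mulr0 => /esym/eqP; rewrite oner_eq0.
have H3 := @ps3 ((- r'^-1 * m') *: e 0 + (- r'^-1 * n') *: e 1).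
have HF := JK_F1 (- r'^-1 * m') (- r'^-1 * n').
have Hc := move_Gc (JK_E2 F) HF H3 b2.
exists (eexp (eF (Phi (2 *: jve E2 (F1 ((- r'^-1 * m') *: e 0 + (- r'^-1 * n') *: e 1))) 0 0 0)) \o g2)%VF.
exists p, q, r'; split; first by apply: G0_comp => //; exact: (move_G0 (JK_E2 F) HF H3).
rewrite -comp_lfunA -/b; split=> //; split.
- apply: (etrans (move_gam (JK_E2 F) HF H3 E1 b2)); rewrite E1E !lfZ ps_E1.
  by rewrite !(scaler0, lf0, addr0).
- apply: (etrans (move_gam (JK_E2 F) HF H3 E2 b2)); rewrite EE2 !lfZ ps_E2.
  by rewrite !(scaler0, lf0, addr0).
- have EG := move_gam (JK_E2 F) HF H3 E3 b2; rewrite EE3 in EG.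
  have := etrans EG (ps_exp _ _ _ _).
  set q2 := q' + _ + _; have -> : m' *: e 0 + n' *: e 1 + r' *: ((- r'^-1 * m') *: e 0 + (- r'^-1 * n') *: e 1) = 0.
    by vfield.
  move=> EE'; have := rank1_E23 Hc E33 EE'; rewrite !oct_lin => /eqP.
  rewrite mulf_eq0 (negbTE r'0) orbF => /eqP q20; rewrite EE' q20 /E3 jmkZ !mulr0 mulr1 !scaler0.
  by [].
Qed.

End FrameMoves.

(** * Tori attached to pairs of rank one elements *)

Section Tori.
Context (F : numFieldType).
Notation oct := 'rV[F]_8.
Notation jord := (jord F).
Notation freud := (freud F).
Notation e7 := (e7 F).
Notation e8 := (e8 F).
Local Notation e := (oct_e F).
Local Notation one_plus := (one_plus F).
Local Notation one_minus := (one_minus F).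
Implicit Types (X Y : jord) (P Q : freud) (D : 'End(jord)) (u : subvs_of e7).
Local Notation pdot := (pdot F).
Local Notation qdot := (qdot F).
Local Notation "x ** y" := (oct_mul x y) (at level 40, left associativity).
Local Notation F1 := (@F1 F).
Local Notation F2 := (@F2 F).
Local Notation F3 := (@F3 F).
Local Notation E1 := (E1 F).
Local Notation E2 := (E2 F).
Local Notation E3 := (E3 F).

Lemma gam_comp a b c d : Gc a c -> Gc b d ->
  Gc (a \o b)%VF (c * d) /\ forall X, gam (a \o b) X = gam a (gam b X).
Proof.
move=> Ha Hb; have [Ga c0 ap aq] := Ha; have [Gb d0 bp' bq] := Hb.
have Gab := Gs_comp Ga Gb.
have E P : bp (a \o b) P = bp a (bp b P).
  by apply: eP_inj; rewrite -(Gs_eP Gab) -(Gs_eP Ga) -(Gs_eP Gb) comp_lfunE.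
have aZ t P : bp a (t *: P) = t *: bp a P := linZ_of (bp_lin Ga) t P.
split; first split.
- exact: Gab.
- exact: mulf_neq0.
- by rewrite E bp' aZ ap scalerA mulrC.
- by rewrite E bq aZ aq scalerA invfM mulrC.
- by move=> X; rewrite {1}/gam E (bpX Hb).
Qed.

Section OneTorus.
Variables (A B : jord).
Hypotheses (HA : JK A) (HB : JK B) (AA : jxp A A = 0) (BB : jxp B B = 0) (AB : jdot A B = 1).
Let x := eF (fB B).
Let y := eF (fA A).
Let nx : ad_nilp x. Proof. by apply: ad_nilp_eF; [exact: fB_e7 | exact: fB_nilp]. Qed.
Let ny : ad_nilp y. Proof. by apply: ad_nilp_eF; [exact: fA_e7 | exact: fA_nilp]. Qed.

(** A pair of rank one elements with [(A, B) = 1] spans with its bracket a copy of sl_2 in e_7; this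
    is its torus, with weights 1, 0, -1 on the vectors treated below. *)
Definition jtorus (t : F) := torus x y t.

Lemma jtorus_G0 t : G0 (jtorus t).
Proof. by apply: torus_G0 => //; [exact: kk_fB | exact: kk_fA]. Qed.

Let brx P : bracket x (eP P) = eP (fB B P). Proof. by apply: bracket_eF_eP; exact: fB_e7. Qed.
Let bry P : bracket y (eP P) = eP (fA A P). Proof. by apply: bracket_eF_eP; exact: fA_e7. Qed.

Let bpair P Q t : t != 0 -> fB B P = Q -> fB B Q = 0 -> fA A Q = P -> fA A P = 0 ->
  jtorus t (eP P) = t *: eP P /\ jtorus t (eP Q) = t^-1 *: eP Q.
Proof.
move=> t0 H1 H2 H3 H4; split.
  by apply: (torus_w (v := eP Q)) => //; rewrite ?brx ?bry ?H1 ?H2 ?H3 ?H4.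
by apply: (torus_v (w := eP P)) => //; rewrite ?brx ?bry ?H1 ?H2 ?H3 ?H4.
Qed.

Lemma jtorus_pdot t : t != 0 -> jtorus t (eP pdot) = t *: eP pdot.
Proof.
move=> t0; have [] := @bpair pdot (0, B, 0, 0) t t0; rewrite /pdot ?fBE ?fAE //.
- by apply: freud_eq; rewrite ?(jxp_lin, jdot_lin, scaler0, scale1r).
- by apply: freud_eq; rewrite ?(jxp_lin, jdot_lin, scaler0, scale1r, BB, scale0r).
- by apply: freud_eq; rewrite ?(jxp_lin, jdot_lin, scaler0, scale1r, AB, scale0r).
- by apply: freud_eq; rewrite ?(jxp_lin, jdot_lin, scaler0, scale1r, scale0r).
Qed.

Lemma jtorus_qdot t : t != 0 -> jtorus t (eP (A, 0, 0, 0)) = t *: eP (A, 0, 0, 0) /\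
  jtorus t (eP qdot) = t^-1 *: eP qdot.
Proof.
move=> t0; apply: bpair => //; rewrite /qdot ?fBE ?fAE.
- by apply: freud_eq; rewrite ?(jxp_lin, jdot_lin, scaler0, scale0r) // jdotC.
- by apply: freud_eq; rewrite ?(jxp_lin, jdot_lin, scaler0, scale1r, scale0r).
- by apply: freud_eq; rewrite ?(jxp_lin, jdot_lin, scaler0, scale1r, scale0r).
- by apply: freud_eq; rewrite ?(jxp_lin, jdot_lin, scaler0, scale1r, scale0r, AA).
Qed.

Lemma jtorus_Gs t : t != 0 -> Gs (jtorus t).
Proof.
move=> t0; split; first by apply: G0_G; exact: jtorus_G0.
- by apply: torus_fix; apply: bracket_eF_one_minus; [exact: fB_e7 | exact: fA_e7].
- by apply: torus_fix; apply: bracket_eF_one_plus; [exact: fB_e7 | exact: fA_e7].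
Qed.

Let bpE P Q t : t != 0 -> jtorus t (eP P) = eP Q -> bp (jtorus t) P = Q.
Proof. by move=> t0 H; apply: eP_inj; rewrite -(Gs_eP (jtorus_Gs t0)). Qed.

Lemma jtorus_Gc t : t != 0 -> Gc (jtorus t) t.
Proof.
move=> t0; split=> //; first exact: jtorus_Gs.
- by apply: bpE => //; rewrite jtorus_pdot // ePZ.
- by apply: bpE => //; have [_ ->] := jtorus_qdot t0; rewrite ePZ.
Qed.

Let gamE X Y t : t != 0 -> jtorus t (eP (X, 0, 0, 0)) = eP (Y, 0, 0, 0) -> gam (jtorus t) X = Y.
Proof. by move=> t0 H; rewrite /gam (bpE t0 H). Qed.

Let smulX (a : F) X : eP (a *: X, 0, 0, 0) = a *: eP (X, 0, 0, 0).
Proof. by rewrite -ePZ; congr eP; apply: freud_eq; rewrite ?scaler0 //; exact: esym (mulr0 _). Qed.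

Lemma jtorus_A t : t != 0 -> gam (jtorus t) A = t *: A.
Proof. by move=> t0; apply: gamE => //; have [-> _] := jtorus_qdot t0; rewrite smulX. Qed.

(** The two conditions on [X] make [X] and [2 A x X] a pair exchanged by the generators, [X] being
    the vector of weight -1; [A x A = 0] stops the chain at the other end. *)
Lemma jtorus_minus X t : t != 0 -> 4 *: jxp B (jxp A X) = X -> jdot B X = 0 ->
  gam (jtorus t) X = t^-1 *: X.
Proof.
move=> t0 H1 H2; apply: gamE => //; rewrite smulX.
have [] // := @bpair (0, 2 *: jxp A X, 0, 0) (X, 0, 0, 0) t t0; rewrite ?fBE ?fAE.
- by apply: freud_eq; rewrite ?(jxp_lin, jdot_lin, scaler0, scale0r) // scalerA -[RHS]H1; congr (_ *: _); ring.
- by apply: freud_eq; rewrite ?(jxp_lin, jdot_lin, scaler0, scale0r, H2).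
- by apply: freud_eq; rewrite ?(jxp_lin, jdot_lin, scaler0, scale0r).
- apply: freud_eq; rewrite ?(jxp_lin, jdot_lin, scaler0, scale0r) //.
  by rewrite -jdot_jxpA AA jdot_lin mulr0.
Qed.

Lemma jtorus_zero X t : t != 0 -> jxp A X = 0 -> jdot B X = 0 -> gam (jtorus t) X = X.
Proof.
move=> t0 H1 H2; apply: gamE => //; apply: torus_fix; rewrite ?brx ?bry ?fBE ?fAE.
- by rewrite H2 !jxp_lin !scaler0 scale0r.
- by rewrite H1 !jdot_lin !scaler0 scale0r.
Qed.

End OneTorus.

Definition h1 (t : F) := jtorus E1 E1 t.
Definition h2 (t : F) := jtorus E2 E2 t.
Definition h3 (t : F) := jtorus E3 E3 t.

Let jm := (@jxp_jmk F, @jmk_dot F, oct_lin F).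

Lemma EkEk : [/\ jxp E1 E1 = 0, jxp E2 E2 = 0 & jxp E3 E3 = 0].
Proof. by split; rewrite /E1 /E2 /E3 !jm -(jmk0 F); congr jmk; by [ring | vring]. Qed.
Lemma EkEk1 : [/\ jdot E1 E1 = 1, jdot E2 E2 = 1 & jdot E3 E3 = 1].
Proof. by split; rewrite /E1 /E2 /E3 !jm; ring. Qed.

Ltac jcomp := rewrite /E1 /E2 /E3 /F1 /F2 /F3 ?jmkZ ?jm ?jmkZ -?(jmk0 F); first [ring | (congr jmk; by [field | vfield])].

Lemma h1_spec t : t != 0 -> [/\ G0 (h1 t), Gc (h1 t) t,
  [/\ gam (h1 t) E1 = t *: E1, gam (h1 t) E2 = t^-1 *: E2 & gam (h1 t) E3 = t^-1 *: E3]
  & forall x, gam (h1 t) (F1 x) = t^-1 *: F1 x].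
Proof.
move=> t0; have [a _ _] := EkEk; have [b _ _] := EkEk1; have K := JK_E1 F.
split; [exact: jtorus_G0 | exact: jtorus_Gc | split | move=> x].
- exact: jtorus_A.
- by apply: jtorus_minus => //; jcomp.
- by apply: jtorus_minus => //; jcomp.
- by apply: jtorus_minus => //; jcomp.
Qed.

Lemma h2_spec t : t != 0 -> [/\ G0 (h2 t), Gc (h2 t) t,
  [/\ gam (h2 t) E1 = t^-1 *: E1, gam (h2 t) E2 = t *: E2 & gam (h2 t) E3 = t^-1 *: E3]
  & forall x, [/\ gam (h2 t) (F1 x) = F1 x, gam (h2 t) (F2 x) = t^-1 *: F2 x & gam (h2 t) (F3 x) = F3 x]].
Proof.
move=> t0; have [_ a _] := EkEk; have [_ b _] := EkEk1; have K := JK_E2 F.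
split; [exact: jtorus_G0 | exact: jtorus_Gc | split | move=> x; split].
- by apply: jtorus_minus => //; jcomp.
- exact: jtorus_A.
- by apply: jtorus_minus => //; jcomp.
- by apply: jtorus_zero => //; jcomp.
- by apply: jtorus_minus => //; jcomp.
- by apply: jtorus_zero => //; jcomp.
Qed.

Lemma h3_spec t : t != 0 -> [/\ G0 (h3 t), Gc (h3 t) t,
  [/\ gam (h3 t) E1 = t^-1 *: E1, gam (h3 t) E2 = t^-1 *: E2 & gam (h3 t) E3 = t *: E3]
  & forall x, [/\ gam (h3 t) (F1 x) = F1 x, gam (h3 t) (F2 x) = F2 x & gam (h3 t) (F3 x) = t^-1 *: F3 x]].
Proof.
move=> t0; have [_ _ a] := EkEk; have [_ _ b] := EkEk1; have K := JK_E3 F.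
split; [exact: jtorus_G0 | exact: jtorus_Gc | split | move=> x; split].
- by apply: jtorus_minus => //; jcomp.
- by apply: jtorus_minus => //; jcomp.
- exact: jtorus_A.
- by apply: jtorus_zero => //; jcomp.
- by apply: jtorus_zero => //; jcomp.
- by apply: jtorus_minus => //; jcomp.
Qed.

Section Isotropic.
Variable i : F.
Hypothesis i2 : i * i = -1.

(** [F_1(w) x F_1(w)] is [- N(w) E_1], so [F_1(w)] has rank one only for isotropic [w]. These are
    the two isotropic directions in the plane of e_0 and e_1. *)
Definition wp : oct := e 0 + i *: e 1.
Definition wm : oct := e 0 - i *: e 1.

Lemma oip_w : [/\ oip wp wp = 0, oip wm wm = 0 & oip wp wm = 2].
Proof.
have o00 : oip (e 0) (e 0) = 1 by rewrite oip_e // eqxx.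
have o11 : oip (e 1) (e 1) = 1 by rewrite oip_e // eqxx.
have o01 : oip (e 0) (e 1) = 0 by rewrite oip_e.
have o10 : oip (e 1) (e 0) = 0 by rewrite oip_e.
rewrite /wp /wm; split; rewrite !(oct_lin F) o00 o11 o01 o10.
- by apply: (etrans (y := 1 + i * i)); [ring | rewrite i2 subrr].
- by apply: (etrans (y := 1 + i * i)); [ring | rewrite i2 subrr].
- by apply: (etrans (y := 1 - i * i)); [ring | rewrite i2; ring].
Qed.

Lemma oip_wV j : (1 < j < 8)%N -> oip wp (e j) = 0 /\ oip wm (e j) = 0.
Proof.
move=> Hj; split.
  by have := oip_01 1 i Hj; rewrite scale1r.
by have := oip_01 1 (- i) Hj; rewrite scale1r scaleNr.
Qed.

(** The factor [4^-1] normalises the pair, because [(F_1(wp), F_1(wm)) = 4]. *)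
Definition hw (t : F) := jtorus (F1 wp) (4^-1 *: F1 wm) t.

Lemma hw_spec t : t != 0 -> [/\ G0 (hw t), Gc (hw t) t,
  [/\ gam (hw t) E1 = t^-1 *: E1, gam (hw t) E2 = E2 & gam (hw t) E3 = E3],
  [/\ gam (hw t) (F1 wp) = t *: F1 wp & gam (hw t) (F1 wm) = t^-1 *: F1 wm]
  & forall j : nat, (1 < j < 8)%N -> gam (hw t) (F1 (e j)) = F1 (e j)].
Proof.
move=> t0; have [pp mm pm] := oip_w; have mp : oip wm wp = 2 by rewrite oipC.
have KA : JK (F1 wp) by have := JK_F1 1 i; rewrite scale1r.
have KB : JK (4^-1 *: F1 wm) by apply: JKZ; have := JK_F1 1 (- i); rewrite scale1r scaleNr.
have FF (u v : oct) : jxp (F1 u) (F1 v) = (- oip u v) *: E1 by jcomp.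
have FE (u : oct) : jxp (F1 u) E1 = - 2^-1 *: F1 u by jcomp.
have EF (u : oct) : jxp E1 (F1 u) = - 2^-1 *: F1 u by jcomp.
have wE1 : jdot (F1 wm) E1 = 0 by jcomp.
have wE2 : jdot (F1 wm) E2 = 0 by jcomp.
have wE3 : jdot (F1 wm) E3 = 0 by jcomp.
have AA : jxp (F1 wp) (F1 wp) = 0 by rewrite FF pp oppr0 scale0r.
have BB : jxp (4^-1 *: F1 wm) (4^-1 *: F1 wm) = 0 by rewrite !jxp_lin FF mm oppr0 scale0r !scaler0.
have AB : jdot (F1 wp) (4^-1 *: F1 wm) = 1 by rewrite jdot_lin jdot_F1 pm; field.
split; [exact: jtorus_G0 | exact: jtorus_Gc | split | split | move=> j Hj].
- apply: jtorus_minus => //; last by rewrite jdot_lin; rewrite wE1 mulr0.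
  by rewrite FE !jxp_lin FF mp !scalerA -[RHS]scale1r; congr (_ *: _); field.
- apply: jtorus_zero => //; first by jcomp.
  by rewrite jdot_lin; rewrite wE2 mulr0.
- apply: jtorus_zero => //; first by jcomp.
  by rewrite jdot_lin; rewrite wE3 mulr0.
- exact: jtorus_A.
- apply: jtorus_minus => //; last by rewrite jdot_lin jdot_F1 mm !mulr0.
  by rewrite FF pm !jxp_lin FE !scalerA -[RHS]scale1r; congr (_ *: _); field.
- have [u1 u2] := oip_wV Hj; apply: jtorus_zero => //; first by rewrite FF u1 oppr0 scale0r.
  by rewrite jdot_lin jdot_F1 u2 !mulr0.
Qed.

End Isotropic.

End Tori.

(** * Triality triples of maps fixing the frame *)

Section Triality.
Context (F : numFieldType).
Notation oct := 'rV[F]_8.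
Notation jord := (jord F).
Notation freud := (freud F).
Notation e7 := (e7 F).
Notation e8 := (e8 F).
Local Notation e := (oct_e F).
Local Notation one_plus := (one_plus F).
Local Notation one_minus := (one_minus F).
Implicit Types (X Y : jord) (P Q : freud) (D : 'End(jord)) (u : subvs_of e7).
Local Notation pdot := (pdot F).
Local Notation qdot := (qdot F).
Local Notation "x ** y" := (oct_mul x y) (at level 40, left associativity).
Local Notation F1 := (@F1 F).
Local Notation F2 := (@F2 F).
Local Notation F3 := (@F3 F).
Local Notation E1 := (E1 F).
Local Notation E2 := (E2 F).
Local Notation E3 := (E3 F).

Let jm := (@jxp_jmk F, @jmk_dot F, oct_lin F).
Ltac jcomp := rewrite /E1 /E2 /E3 /F1 /F2 /F3 ?jmkZ ?jm ?jmkZ -?(jmk0 F); first [ring | (congr jmk; by [field | vfield])].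

Lemma oct8_inj a0 a1 a2 a3 a4 a5 a6 a7 b0 b1 b2 b3 b4 b5 b6 b7 :
  oct8 a0 a1 a2 a3 a4 a5 a6 a7 = oct8 (b0 : F) b1 b2 b3 b4 b5 b6 b7 ->
  [/\ [/\ a0 = b0, a1 = b1, a2 = b2 & a3 = b3] & [/\ a4 = b4, a5 = b5, a6 = b6 & a7 = b7]].
Proof.
move/rowP => H; split; split;
[have := H 0 | have := H 1 | have := H (inord 2) | have := H (inord 3)
|have := H (inord 4) | have := H (inord 5) | have := H (inord 6) | have := H (inord 7)];
by rewrite !mxE /= ?inordK.
Qed.

(** On the quaternion subalgebra containing e_1, e_a, e_b, left multiplication by e_a after e_b is
    left multiplication by e_1. The first equation therefore kills the coordinates 0 to 3, and the
    other two kill 4, 5 and 6, 7. *)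
Lemma oct_antiassoc0 z :
  (- e 1) ** z = e 2 ** (e 3 ** z) -> (- e 1) ** z = e 4 ** (e 5 ** z) ->
  (- e 1) ** z = e 6 ** (e 7 ** z) -> z = 0.
Proof.
elim/oct8_ind: z => z0 z1 z2 z3 z4 z5 z6 z7.
rewrite !oct_lin !oct8_e /= !oct8E => /oct8_inj[[a0 a1 a2 a3] _].
move=> /oct8_inj[_ [b4 b5 _ _]] /oct8_inj[_ [_ _ c6 c7]].
have fin (u v c : F) : u = v -> (u - v = c * 2) \/ (u - v = - c * 2) -> c = 0.
  move=> -> []; rewrite subrr => /esym/eqP; rewrite mulf_eq0 pnatr_eq0 orbF ?oppr_eq0; by move/eqP.
have -> : z1 = 0 by apply: (fin _ _ _ a0); first [left; ring | right; ring].
have -> : z0 = 0 by apply: (fin _ _ _ a1); first [left; ring | right; ring].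
have -> : z3 = 0 by apply: (fin _ _ _ a2); first [left; ring | right; ring].
have -> : z2 = 0 by apply: (fin _ _ _ a3); first [left; ring | right; ring].
have -> : z5 = 0 by apply: (fin _ _ _ b4); first [left; ring | right; ring].
have -> : z4 = 0 by apply: (fin _ _ _ b5); first [left; ring | right; ring].
have -> : z7 = 0 by apply: (fin _ _ _ c6); first [left; ring | right; ring].
have -> : z6 = 0 by apply: (fin _ _ _ c7); first [left; ring | right; ring].
by apply/rowP => -[[|[|[|[|[|[|[|[|]]]]]]]] //= ?]; rewrite !mxE.
Qed.

Lemma oct_e23 : [/\ e 2 ** e 3 = e 1, e 4 ** e 5 = e 1 & e 6 ** e 7 = e 1].
Proof. by split; rewrite !oct8_e /= oct8E; congr oct8; ring. Qed.

Lemma Gframe_comp (a b : 'End(e8)) (c p q r c' p' q' r' : F) : Gframe a c p q r -> Gframe b c' p' q' r' ->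
  Gframe (a \o b)%VF (c * c') (p * p') (q * q') (r * r').
Proof.
move=> [Ha [a1 a2 a3] [p0 q0 r0] pr] [Hb [b1 b2 b3] [p0' q0' r0'] pr'].
have [Hab E] := gam_comp Ha Hb; have gZ := linZ_of (gam_lin Ha).
split=> //; first split.
- by rewrite E b1 gZ a1 scalerA mulrC.
- by rewrite E b2 gZ a2 scalerA mulrC.
- by rewrite E b3 gZ a3 scalerA mulrC.
- by split; exact: mulf_neq0.
- by rewrite -[RHS]mulr1 -{1}pr -pr'; ring.
Qed.

Lemma G0_left (h be : 'End(e8)) : G0 h -> G0 (h \o be)%VF -> G0 be.
Proof.
move=> Hh Hb; have -> : be = (h^-1 \o (h \o be))%VF.
  by apply/lfunP => v; rewrite !comp_lfunE G_K //; exact: G0_G.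
by apply: G0_comp => //; exact: G0_inv.
Qed.

Lemma h1_frame (t : F) : t != 0 -> Gframe (h1 t) t t t^-1 t^-1.
Proof.
move=> t0; have [_ ? ? _] := h1_spec t0; split=> //; last by field.
by rewrite invr_eq0.
Qed.
Lemma h2_frame (t : F) : t != 0 -> Gframe (h2 t) t t^-1 t t^-1.
Proof.
move=> t0; have [_ ? ? _] := h2_spec t0; split=> //; last by field.
by rewrite invr_eq0.
Qed.
Lemma h3_frame (t : F) : t != 0 -> Gframe (h3 t) t t^-1 t^-1 t.
Proof.
move=> t0; have [_ ? ? _] := h3_spec t0; split=> //; last by field.
by rewrite invr_eq0.
Qed.
Lemma hw_frame (i t : F) : i * i = -1 -> t != 0 -> Gframe (hw i t) t t^-1 1 1.
Proof.
move=> i2 t0; have [_ ? [a b d] _ _] := hw_spec i2 t0; split=> //; last by field.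
  by rewrite !scale1r.
by rewrite invr_eq0 oner_eq0.
Qed.

Lemma jxp_E_inj (a b d : F) (u v w : oct) : [/\ jxp E1 (jmk a b d u v w) = 0 -> [/\ b = 0, d = 0 & u = 0],
  jxp E2 (jmk a b d u v w) = 0 -> [/\ a = 0, d = 0 & v = 0]
  & jxp E3 (jmk a b d u v w) = 0 -> [/\ a = 0, b = 0 & w = 0]].
Proof.
have hf (x y : F) : x = 0 -> y = 2 * x -> y = 0 by move=> -> ->; rewrite mulr0.
have hv (x y : oct) : x = 0 -> y = (- 2) *: x -> y = 0 by move=> -> ->; rewrite scaler0.
by split; rewrite /E1 /E2 /E3 jxp_jmk !oct_lin -(jmk0 F) => /jmk_inj[[A B C] [D K L]]; split;
  first [by apply: (hf _ _ A); field | by apply: (hf _ _ B); field | by apply: (hf _ _ C); field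
  | by apply: (hv _ _ D); vfield | by apply: (hv _ _ K); vfield | by apply: (hv _ _ L); vfield].
Qed.

(** A triality triple: the maps induced on the three off-diagonal spaces, tied together by the
    product of F_1 and F_2. *)
Definition Gtri (be : 'End(e8)) (g1 g2 g3 : oct -> oct) :=
  [/\ Gframe be 1 1 1 1, forall x, [/\ gam be (F1 x) = F1 (g1 x), gam be (F2 x) = F2 (g2 x) & gam be (F3 x) = F3 (g3 x)],
   forall x y, oip (g1 x) (g1 y) = oip x y /\ oip (g2 x) (g2 y) = oip x y,
   forall x y, g3 (oct_conj (x ** y)) = oct_conj (g1 x ** g2 y)
   & linear g1 /\ linear g2].

(** Each off-diagonal space is the joint annihilator, under [x], of the other two idempotents, and
    these are fixed. The relations between the three maps come from the products of F_1 and F_2 with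
    themselves and with each other. *)
Lemma Gframe_tri (be : 'End(e8)) : Gframe be 1 1 1 1 -> exists g1 g2 g3, Gtri be g1 g2 g3.
Proof.
move=> HF; have [Hbe [e1 e2 e3] _ _] := HF; rewrite !scale1r in e1 e2 e3.
have g'0 : gam' be 0 = 0 := lin0_of (gam'_lin Hbe).
have cr X Z : jxp (gam be X) (gam be Z) = gam' be (jxp X Z).
  by rewrite -(gam_cross Hbe) scale1r.
have EF (x : oct) : [/\ [/\ jxp E2 (F1 x) = 0 & jxp E3 (F1 x) = 0], [/\ jxp E1 (F2 x) = 0 & jxp E3 (F2 x) = 0]
   & [/\ jxp E1 (F3 x) = 0 & jxp E2 (F3 x) = 0]].
  by split; split; jcomp.
have EF' (x : oct) : [/\ jxp E1 (F1 x) = - 2^-1 *: F1 x, jxp E2 (F2 x) = - 2^-1 *: F2 x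
   & jxp E3 (F3 x) = - 2^-1 *: F3 x].
  by split; jcomp.
have ex1 x : exists y, gam be (F1 x) = F1 y.
  have [a [b [d [u [v [w E]]]]]] := jmk_ex (gam be (F1 x)); have [[c2 c3] _ _] := EF x.
  have k2 := cr E2 (F1 x); have k3 := cr E3 (F1 x); rewrite c2 g'0 e2 E in k2; rewrite c3 g'0 e3 E in k3.
  have [_ /(_ k2)[a0 d0 v0] /(_ k3)[_ b0 w0]] := jxp_E_inj a b d u v w.
  by exists u; rewrite E a0 d0 v0 b0 w0.
have ex2 x : exists y, gam be (F2 x) = F2 y.
  have [a [b [d [u [v [w E]]]]]] := jmk_ex (gam be (F2 x)); have [_ [c2 c3] _] := EF x.
  have k2 := cr E1 (F2 x); have k3 := cr E3 (F2 x); rewrite c2 g'0 e1 E in k2; rewrite c3 g'0 e3 E in k3.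
  have [/(_ k2)[b0 d0 u0] _ /(_ k3)[a0 _ w0]] := jxp_E_inj a b d u v w.
  by exists v; rewrite E a0 d0 u0 b0 w0.
have ex3 x : exists y, gam be (F3 x) = F3 y.
  have [a [b [d [u [v [w E]]]]]] := jmk_ex (gam be (F3 x)); have [_ _ [c2 c3]] := EF x.
  have k2 := cr E1 (F3 x); have k3 := cr E2 (F3 x); rewrite c2 g'0 e1 E in k2; rewrite c3 g'0 e2 E in k3.
  have [/(_ k2)[b0 d0 u0] /(_ k3)[a0 _ v0] _] := jxp_E_inj a b d u v w.
  by exists w; rewrite E a0 d0 u0 b0 v0.
have [g1 G1] := boolp.choice ex1; have [g2 G2] := boolp.choice ex2; have [g3 G3] := boolp.choice ex3.
have hv (x y : jord) : - 2^-1 *: x = - 2^-1 *: y -> x = y.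
  by move=> H; have E (z : jord) : z = (-2) *: (- 2^-1 *: z) by [vfield]; rewrite (E x) H -E.
have g'Z := linZ_of (gam'_lin Hbe).
have G3' x : gam' be (F3 x) = F3 (g3 x).
  have [_ _ K] := EF' x; have [_ _ K'] := EF' (g3 x).
  by apply: hv; rewrite -g'Z -K -cr e3 G3 K'.
have gE1 : gam' be E1 = E1.
  have K : E1 = 2 *: jxp E2 E3 by jcomp.
  by rewrite {1}K g'Z -cr e2 e3 -K.
have gE2 : gam' be E2 = E2.
  have K : E2 = 2 *: jxp E1 E3 by jcomp.
  by rewrite {1}K g'Z -cr e1 e3 -K.
exists g1, g2, g3; split=> //.
- move=> x y; split.
    have K (u0 v : oct) : jxp (F1 u0) (F1 v) = (- oip u0 v) *: E1 by jcomp.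
    have := cr (F1 x) (F1 y); rewrite !G1 !K g'Z gE1 /E1 !jmkZ => /jmk_inj[[+ _ _] _].
    by rewrite !mulr1 => /oppr_inj.
  have K (u0 v : oct) : jxp (F2 u0) (F2 v) = (- oip u0 v) *: E2 by jcomp.
  have := cr (F2 x) (F2 y); rewrite !G2 !K g'Z gE2 /E2 !jmkZ => /jmk_inj[[_ + _] _].
  by rewrite !mulr1 => /oppr_inj.
- move=> x y; apply: (@F3_inj F); rewrite -G3'.
  have K (u0 v : oct) : F3 (oct_conj (u0 ** v)) = 2 *: jxp (F1 u0) (F2 v) by jcomp.
  by rewrite !K g'Z -cr G1 G2.
- split=> a x y; [apply: (@F1_inj F) | apply: (@F2_inj F)].
    by rewrite -G1 !F1_lin (gam_lin Hbe) !G1.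
  by rewrite -G2 !F2_lin (gam_lin Hbe) !G2.
Qed.

Lemma Gtri_mul (be : 'End(e8)) g1 g2 g3 : Gtri be g1 g2 g3 -> g1 (e 0) = e 0 ->
  [/\ forall x, g2 x = g1 x ** g2 (e 0), forall y, g3 (oct_conj y) = oct_conj (g2 y)
   & forall x y, g1 (x ** y) ** g2 (e 0) = g1 x ** (g1 y ** g2 (e 0))].
Proof.
case=> _ _ _ H _ g10.
have A y : g3 (oct_conj y) = oct_conj (g2 y) by rewrite -[in LHS](oct_mul1 y) H g10 oct_mul1.
have B x y : g2 (x ** y) = g1 x ** g2 y.
  by rewrite -[LHS]oct_conjK -A H oct_conjK.
have C x : g2 x = g1 x ** g2 (e 0) by rewrite -B oct_mulr1.
by split=> // x y; rewrite -C B C.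
Qed.

(** Otherwise [g1] would have determinant -1, and triality lifts only rotations. Concretely, e_2 e_3
    = e_4 e_5 = e_6 e_7 = e_1 gives the three equations of [oct_antiassoc0] for [z = g2(e_0)], the
    sign [k] cancelling since [k k = 1]. So [z = 0], although [g2] preserves the norm. *)
Lemma Gtri_e1 (be : 'End(e8)) g1 g2 g3 (k : F) : Gtri be g1 g2 g3 -> g1 (e 0) = e 0 -> k * k = 1 ->
  (forall j : nat, (1 < j < 8)%N -> g1 (e j) = k *: e j) -> g1 (e 1) <> - e 1.
Proof.
move=> HT g10 kk Hk g11; have [_ _ M] := Gtri_mul HT g10; have [_ _ N _ _] := HT.
have [m1 m2 m3] := oct_e23.
have A (a b : nat) : (1 < a < 8)%N -> (1 < b < 8)%N -> e a ** e b = e 1 ->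
    (- e 1) ** g2 (e 0) = e a ** (e b ** g2 (e 0)).
  move=> Ha Hb ab; have := M (e a) (e b); rewrite ab g11 !Hk // => ->.
  by rewrite !oct_lin scalerA kk scale1r.
have z0 : g2 (e 0) = 0 by apply: oct_antiassoc0; apply: A.
have [_] := N (e 0) (e 0); rewrite z0 oip_e // eqxx oct_lin => /esym/eqP.
by rewrite oner_eq0.
Qed.

End Triality.

(** * Generation of G by exponentials over an algebraically closed field *)

Section Generation.
Context (F : numClosedFieldType).
Notation oct := 'rV[F]_8.
Notation jord := (jord F).
Notation freud := (freud F).
Notation e7 := (e7 F).
Notation e8 := (e8 F).
Local Notation e := (oct_e F).
Local Notation one_plus := (one_plus F).
Local Notation one_minus := (one_minus F).
Implicit Types (X Y : jord) (P Q : freud) (D : 'End(jord)) (u : subvs_of e7).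
Local Notation pdot := (pdot F).
Local Notation qdot := (qdot F).
Local Notation "x ** y" := (oct_mul x y) (at level 40, left associativity).
Local Notation F1 := (@F1 F).
Local Notation F2 := (@F2 F).
Local Notation F3 := (@F3 F).
Local Notation E1 := (E1 F).
Local Notation E2 := (E2 F).
Local Notation E3 := (E3 F).

Lemma ii : 'i * 'i = -1 :> F. Proof. by rewrite -expr2 sqrCi. Qed.
Lemma i_neq0 : 'i != 0 :> F. Proof. exact: neq0Ci. Qed.

Lemma h1_ex (t : F) : t != 0 -> exists h, [/\ G0 h, Gframe h t t t^-1 t^-1
  & forall x, gam h (F1 x) = t^-1 *: F1 x].
Proof. by move=> t0; exists (h1 t); have [? _ _ ?] := h1_spec t0; split=> //; exact: h1_frame. Qed.

Lemma h2_ex (t : F) : t != 0 -> exists h, [/\ G0 h, Gframe h t t^-1 t t^-1 &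
  forall x, [/\ gam h (F1 x) = F1 x, gam h (F2 x) = t^-1 *: F2 x & gam h (F3 x) = F3 x]].
Proof. by move=> t0; exists (h2 t); have [? _ _ ?] := h2_spec t0; split=> //; exact: h2_frame. Qed.

Lemma h3_ex (t : F) : t != 0 -> exists h, [/\ G0 h, Gframe h t t^-1 t^-1 t &
  forall x, [/\ gam h (F1 x) = F1 x, gam h (F2 x) = F2 x & gam h (F3 x) = t^-1 *: F3 x]].
Proof. by move=> t0; exists (h3 t); have [? _ _ ?] := h3_spec t0; split=> //; exact: h3_frame. Qed.

Lemma hw_ex (t : F) : t != 0 -> exists h, [/\ G0 h, Gframe h t t^-1 1 1,
  gam h (F1 (wp 'i)) = t *: F1 (wp 'i), gam h (F1 (wm 'i)) = t^-1 *: F1 (wm 'i)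
  & forall j : nat, (1 < j < 8)%N -> gam h (F1 (e j)) = F1 (e j)].
Proof.
move=> t0; exists (hw 'i t); have [? _ _ [? ?] ?] := hw_spec ii t0; split=> //.
exact: hw_frame ii t0.
Qed.

Lemma comp4 (a b c d : 'End(e8)) : ((a \o (b \o c)) \o d = a \o (b \o (c \o d)))%VF.
Proof. by rewrite -!comp_lfunA. Qed.

Lemma Gframe_one (be : 'End(e8)) (c p q r : F) : Gframe be c p q r ->
  exists h, G0 h /\ Gframe (h \o be)%VF 1 1 1 1.
Proof.
move=> HF; have [Hbe _ [p0 q0 r0] cpqr] := HF; have [_ c0 _ _] := Hbe.
have [l [l0 l2]] : exists l, l != 0 /\ l ^+ 2 = (c * p)^-1.
  exists (sqrtC (c * p)^-1); rewrite sqrtCK; split=> //.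
  by rewrite sqrtC_eq0 invr_eq0 mulf_neq0.
have [m [m0 m2]] : exists m, m != 0 /\ m ^+ 2 = (c * q)^-1.
  exists (sqrtC (c * q)^-1); rewrite sqrtCK; split=> //.
  by rewrite sqrtC_eq0 invr_eq0 mulf_neq0.
(* With [n = (c l m)^-1], the tori [h1 l], [h2 m], [h3 n] bring [c] to 1 and turn [p], [q] into
   [l^2 c p] and [m^2 c q]. This explains the two square roots; [r] follows from [c p q r = 1]. *)
have n0 : (c * l * m)^-1 != 0 by rewrite invr_eq0 !mulf_neq0.
have [x1 [G1 X1 _]] := h1_ex l0; have [x2 [G2 X2 _]] := h2_ex m0; have [x3 [G3 X3 _]] := h3_ex n0.
exists (x1 \o (x2 \o x3))%VF; split; first by apply: G0_comp => //; exact: G0_comp.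
rewrite comp4.
have := Gframe_comp X1 (Gframe_comp X2 (Gframe_comp X3 HF)).
have -> : l * (m * ((c * l * m)^-1 * c)) = 1 by field; rewrite c0 l0 m0.
have -> : l * (m^-1 * ((c * l * m)^-1^-1 * p)) = 1.
  apply: (etrans (y := l ^+ 2 * (c * p))); first by field; rewrite ?c0 ?l0 ?m0.
  by rewrite l2 mulVf // mulf_neq0.
have -> : l^-1 * (m * ((c * l * m)^-1^-1 * q)) = 1.
  apply: (etrans (y := m ^+ 2 * (c * q))); first by field; rewrite ?c0 ?l0 ?m0.
  by rewrite m2 mulVf // mulf_neq0.
have -> : l^-1 * (m^-1 * ((c * l * m)^-1 * r)) = 1.
  apply: (etrans (y := (l ^+ 2)^-1 * ((m ^+ 2)^-1 * (c^-1 * r)))); first by field; rewrite c0 l0 m0.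
  by rewrite l2 m2 !invrK -[RHS]cpqr; field; rewrite ?c0.
by [].
Qed.

Lemma torus_w_frame (t : F) : t != 0 -> exists h : 'End(e8), [/\ G0 h, Gframe h 1 1 1 1,
  gam h (F1 (wp 'i)) = t *: F1 (wp 'i), gam h (F1 (wm 'i)) = t^-1 *: F1 (wm 'i)
  & forall j : nat, (1 < j < 8)%N -> gam h (F1 (e j)) = F1 (e j)].
Proof.
(* [hw t] scales [pdot] by [t] and E_1 by [t^-1]. With [s^2 = t^-1], the product of [h2 s] and
   [h3 s] undoes both and fixes F_1 pointwise. *)
move=> t0; pose s := sqrtC t^-1.
have s2 : s * s = t^-1 by rewrite -expr2 sqrtCK.
have s0 : s != 0 by rewrite sqrtC_eq0 invr_eq0.
have [x2 [G2 X2 A2]] := h2_ex s0; have [x3 [G3 X3 A3]] := h3_ex s0.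
have [xw [Gw Xw Aw Bw Vw]] := hw_ex t0.
have [C2 _ _ _] := X2; have [C3 _ _ _] := X3; have [Cw _ _ _] := Xw.
have [C23 E23] := gam_comp C2 C3; have [Ch Eh] := gam_comp Cw C23.
exists (xw \o (x2 \o x3))%VF; split.
- by apply: G0_comp => //; exact: G0_comp.
- have := Gframe_comp Xw (Gframe_comp X2 X3).
  have -> : t * (s * s) = 1 by rewrite s2 divff.
  have -> : t^-1 * (s^-1 * s^-1) = 1 by rewrite -invfM s2 invrK mulVf.
  by have -> : 1 * (s * s^-1) = 1 :> F; [rewrite divff // mulr1 | rewrite mul1r mulVf].
- by rewrite Eh E23; have [-> _ _] := A3 (wp 'i); have [-> _ _] := A2 (wp 'i).
- by rewrite Eh E23; have [-> _ _] := A3 (wm 'i); have [-> _ _] := A2 (wm 'i).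
- by move=> j Hj; rewrite Eh E23; have [-> _ _] := A3 (e j); have [-> _ _] := A2 (e j); exact: Vw.
Qed.

Lemma e01_w : e 0 = 2^-1 *: (wp 'i + wm 'i) :> oct /\ e 1 = (- 2^-1 * 'i) *: (wp 'i - wm 'i) :> oct.
Proof.
rewrite /wp /wm; split; first by vfield.
have -> : (- 2^-1 * 'i) *: (e 0 + 'i *: e 1 - (e 0 - 'i *: e 1)) = (- ('i * 'i)) *: e 1 by vfield.
by rewrite ii opprK scale1r.
Qed.

(** [g1] is an isometry of the plane of e_0 and e_1, so it permutes its two isotropic lines, and a
    torus adjusts the scalars to 1. Preserved lines give the identity on the plane; exchanged lines
    give a sign on e_1. *)
Lemma Gframe_w (be : 'End(e8)) : Gframe be 1 1 1 1 -> exists h, [/\ G0 h, Gframe (h \o be)%VF 1 1 1 1,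
  gam (h \o be) (F1 (e 0)) = F1 (e 0) &
  gam (h \o be) (F1 (e 1)) = F1 (e 1) \/ gam (h \o be) (F1 (e 1)) = - F1 (e 1)].
Proof.
move=> HF; have [g1 [g2 [g3 HT]]] := Gframe_tri HF; have [_ Hg N _ [L1 _]] := HT.
have [Hbe _ _ _] := HF.
have [pp mm pm] := oip_w ii.
have iso m n : oip (g1 (m *: e 0 + n *: e 1)) (g1 (m *: e 0 + n *: e 1)) = 0 ->
    exists k, g1 (m *: e 0 + n *: e 1) = k *: wp 'i \/ g1 (m *: e 0 + n *: e 1) = k *: wm 'i.
  move=> N0; have [a [b [d [m' [n' E]]]]] := gam_JK Hbe (JK_F1 m n).
  have [K _ _] := Hg (m *: e 0 + n *: e 1); rewrite K in E; have [_ [E' _ _]] := jmk_inj E.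
  rewrite E' in N0 *; move: N0; rewrite !oct_lin !oip_e // eqxx /= => N0.
  have : (n' - 'i * m') * (n' + 'i * m') = 0.
    by apply: (etrans (y := n' * n' - ('i * 'i) * (m' * m'))); [ring | rewrite ii -[RHS]N0; ring].
  move/eqP; rewrite mulf_eq0 subr_eq0 addr_eq0 => /orP[]/eqP n'E; exists m'; [left | right];
    by rewrite n'E /wp /wm; vring.
have wpE : wp 'i = 1 *: e 0 + 'i *: e 1 :> oct by rewrite /wp scale1r.
have wmE : wm 'i = 1 *: e 0 + (- 'i) *: e 1 :> oct by rewrite /wm scale1r scaleNr.
have [k Hk] : exists k, g1 (wp 'i) = k *: wp 'i \/ g1 (wp 'i) = k *: wm 'i.
  have := iso 1 'i; rewrite -wpE; apply; by have [-> _] := N (wp 'i) (wp 'i).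
have [l Hl] : exists k, g1 (wm 'i) = k *: wp 'i \/ g1 (wm 'i) = k *: wm 'i.
  have := iso 1 (- 'i); rewrite -wmE; apply; by have [-> _] := N (wm 'i) (wm 'i).
have Np : oip (g1 (wp 'i)) (g1 (wm 'i)) = 2 by have [-> _] := N (wp 'i) (wm 'i).
have Hg1 x : gam be (F1 x) = F1 (g1 x) by case: (Hg x).
have two0 : (2 : F) <> 0 by move/eqP; rewrite pnatr_eq0.
have kl0 (K : k * l * 2 = 2) : [/\ k * l = 1, k != 0 & l != 0].
  have kl : k * l = 1 by apply: (@mulIf _ (2 : F)); rewrite ?pnatr_eq0 // K mul1r.
  by split=> //; apply/negP => /eqP E; move: kl; rewrite E ?mul0r ?mulr0 => /esym/eqP; rewrite oner_eq0.
have fin h (s : F) : s = 1 \/ s = -1 -> G0 h -> Gframe h 1 1 1 1 ->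
    gam h (F1 (g1 (wp 'i))) + gam h (F1 (g1 (wm 'i))) = F1 (wp 'i) + F1 (wm 'i) ->
    gam h (F1 (g1 (wp 'i))) - gam h (F1 (g1 (wm 'i))) = s *: (F1 (wp 'i) - F1 (wm 'i)) ->
    exists h, [/\ G0 h, Gframe (h \o be)%VF 1 1 1 1,
  gam (h \o be) (F1 (e 0)) = F1 (e 0) &
  gam (h \o be) (F1 (e 1)) = F1 (e 1) \/ gam (h \o be) (F1 (e 1)) = - F1 (e 1)].
  move=> Hs Gh Fh S1 S2; exists h; have [Ch _ _ _] := Fh; have [_ E] := gam_comp Ch Hbe.
  have F1D (x y : oct) : F1 (x + y) = F1 x + F1 y := linD_of (@F1_lin F) x y.
  have F1N (x : oct) : F1 (- x) = - F1 x := linN_of (@F1_lin F) x.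
  have gZ := linZ_of (gam_lin Ch); have gD := linD_of (gam_lin Ch); have gN := linN_of (gam_lin Ch).
  have g1Z := linZ_of L1; have g1D := linD_of L1; have g1N := linN_of L1.
  have [e0E e1E] := e01_w.
  split=> //; first by have := Gframe_comp Fh HF; rewrite !mulr1.
    rewrite E Hg1 {1}e0E g1Z g1D F1Z F1D gZ gD S1 -F1D -F1Z -e0E.
    by [].
  have -> : gam (h \o be) (F1 (e 1)) = s *: F1 (e 1).
    rewrite E Hg1 {1}e1E g1Z g1D g1N F1Z F1D F1N gZ gD gN S2 [in RHS]e1E F1Z (F1D (wp 'i) (- wm 'i)) (F1N (wm 'i)).
    by rewrite !scalerA [s * _]mulrC.
  by case: Hs => ->; [left; rewrite scale1r | right; rewrite scaleN1r].
have oipZZ (a b : F) (x y : oct) : oip (a *: x) (b *: y) = a * (b * oip x y) by rewrite !oct_lin.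
case: Hk => Hk; case: Hl => Hl; move: Np; rewrite Hk Hl oipZZ ?pp ?mm ?pm.
- by rewrite !mulr0 => /esym.
- rewrite mulrA => /kl0[kl k0 l0]; have [h [Gh Fh Ap Am _]] := torus_w_frame l0.
  have [Ch _ _ _] := Fh; have gZ := linZ_of (gam_lin Ch).
  have e1 : gam h (F1 (g1 (wp 'i))) = F1 (wp 'i) by rewrite Hk F1Z gZ Ap scalerA kl scale1r.
  have e2 : gam h (F1 (g1 (wm 'i))) = F1 (wm 'i) by rewrite Hl F1Z gZ Am scalerA divff // scale1r.
  by apply: (fin h 1) => //; [left | rewrite e1 e2 | rewrite e1 e2 scale1r].
- rewrite (oipC (wm _)) pm mulrA => /kl0[kl k0 l0]; have [h [Gh Fh Ap Am _]] := torus_w_frame k0.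
  have [Ch _ _ _] := Fh; have gZ := linZ_of (gam_lin Ch).
  have e1 : gam h (F1 (g1 (wp 'i))) = F1 (wm 'i) by rewrite Hk F1Z gZ Am scalerA divff // scale1r.
  have e2 : gam h (F1 (g1 (wm 'i))) = F1 (wp 'i) by rewrite Hl F1Z gZ Ap scalerA mulrC kl scale1r.
  apply: (fin h (-1)) => //; [by right | by rewrite e1 e2 addrC | by rewrite e1 e2 scaleN1r opprB].
- by rewrite !mulr0 => /esym.
Qed.

(** [h1 (-1)] is -1 on F_1 and [hw (-1)] restores the plane of e_0 and e_1. [h2 'i] and [h3 (- 'i)]
    fix F_1 and bring the scalars on the frame back to 1. *)
Lemma torus_kappa : exists h : 'End(e8), [/\ G0 h, Gframe h 1 1 1 1,
  gam h (F1 (e 0)) = F1 (e 0), gam h (F1 (e 1)) = F1 (e 1)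
  & forall j : nat, (1 < j < 8)%N -> gam h (F1 (e j)) = - F1 (e j)].
Proof.
have n1 : -1 != 0 :> F by rewrite oppr_eq0 oner_eq0.
have ni : - 'i != 0 :> F by rewrite oppr_eq0 i_neq0.
have [x1 [G1 X1 A1]] := h1_ex n1; have [x2 [G2 X2 A2]] := h2_ex i_neq0.
have [x3 [G3 X3 A3]] := h3_ex ni; have [xw [Gw Xw Aw Bw Vw]] := hw_ex n1.
have [C1 _ _ _] := X1; have [C2 _ _ _] := X2; have [C3 _ _ _] := X3; have [Cw _ _ _] := Xw.
have [C23 E23] := gam_comp C2 C3; have [C123 E123] := gam_comp C1 C23; have [Ch Eh] := gam_comp Cw C123.
have vi : ('i)^-1 = - 'i :> F by apply: (mulfI i_neq0); rewrite divff ?i_neq0 // mulrN ii opprK.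
have E x : gam (xw \o (x1 \o (x2 \o x3))) (F1 x) = - gam xw (F1 x).
  rewrite Eh E123 E23; have [-> _ _] := A3 x; have [-> _ _] := A2 x; rewrite A1 invrN1.
  by rewrite (linZ_of (gam_lin Cw)) scaleN1r.
have Ep : gam (xw \o (x1 \o (x2 \o x3))) (F1 (wp 'i)) = F1 (wp 'i).
  by rewrite E Aw scaleN1r opprK.
have Em : gam (xw \o (x1 \o (x2 \o x3))) (F1 (wm 'i)) = F1 (wm 'i).
  by rewrite E Bw invrN1 scaleN1r opprK.
exists (xw \o (x1 \o (x2 \o x3)))%VF.
have gZ := linZ_of (gam_lin Ch); have gD := linD_of (gam_lin Ch); have gN := linN_of (gam_lin Ch).
have F1D (x y : oct) : F1 (x + y) = F1 x + F1 y := linD_of (@F1_lin F) x y.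
have F1N (x : oct) : F1 (- x) = - F1 x := linN_of (@F1_lin F) x.
have [e0E e1E] := e01_w; split.
- by apply: G0_comp => //; apply: G0_comp => //; exact: G0_comp.
- have := Gframe_comp Xw (Gframe_comp X1 (Gframe_comp X2 X3)).
  rewrite invrN1 invrN vi opprK.
  have -> : -1 * (-1 * ('i * - 'i)) = 1 :> F by rewrite mulrN ii; ring.
  have -> : -1 * (-1 * (- 'i * 'i)) = 1 :> F by rewrite (mulNr 'i) ii; ring.
  have -> : 1 * (-1 * ('i * 'i)) = 1 :> F by rewrite ii; ring.
  have -> : 1 * (-1 * (- 'i * - 'i)) = 1 :> F by rewrite (mulrNN 'i 'i) ii; ring.
  by [].
- by rewrite e0E F1Z F1D gZ gD Ep Em.
- by rewrite e1E F1Z F1D F1N gZ gD gN Ep Em.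
- by move=> j Hj; rewrite E Vw.
Qed.

Lemma torus_zeta : exists h : 'End(e8), [/\ G0 h, Gframe h 1 1 1 1
  & forall x, [/\ gam h (F1 x) = F1 x, gam h (F2 x) = - F2 x & gam h (F3 x) = - F3 x]].
Proof.
have n1 : -1 != 0 :> F by rewrite oppr_eq0 oner_eq0.
have [x2 [G2 X2 A2]] := h2_ex n1; have [x3 [G3 X3 A3]] := h3_ex n1.
have [C2 _ _ _] := X2; have [C3 _ _ _] := X3.
have [C23 E23] := gam_comp C2 C3; have gZ := linZ_of (gam_lin C2).
exists (x2 \o x3)%VF; split; first exact: G0_comp.
  have := Gframe_comp X2 X3; rewrite !invrN1.
  by rewrite mulrNN mulr1.
move=> x; rewrite !E23; have [-> -> ->] := A3 x; have [-> a2 a3] := A2 x.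
by rewrite gZ a3 a2 !invrN1 !scaleN1r.
Qed.

(** With [g1] the identity, [g2] is right multiplication by an element of the nucleus, hence by a
    scalar [z] with [z z = 1]. The case [z = -1] is realised by [torus_zeta]. *)
Lemma Gframe_F1_id (be : 'End(e8)) : Gframe be 1 1 1 1 -> (forall x, gam be (F1 x) = F1 x) -> G0 be.
Proof.
move=> HF H1; have [g1 [g2 [g3 HT]]] := Gframe_tri HF; have [_ Hg N _ _] := HT.
have [Hbe [eE1 eE2 eE3] _ _] := HF; rewrite !scale1r in eE1 eE2 eE3.
have g1E x : g1 x = x by apply: (@F1_inj F); have [<- _ _] := Hg x.
have [Z2 Z3 M] := Gtri_mul HT (g1E _).
have nuc : g2 (e 0) = oip (e 0) (g2 (e 0)) *: e 0.
  by apply: oct_nucleus => i j _ _; have := M (e i) (e j); rewrite !g1E.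
set z := oip (e 0) (g2 (e 0)) in nuc.
have z2 : z * z = 1.
  by have [_] := N (e 0) (e 0); rewrite nuc !oct_lin oip_e // eqxx mulr1.
have g2E x : g2 x = z *: x by rewrite Z2 g1E nuc oct_lin oct_mulr1.
have g3E x : g3 x = z *: x by rewrite -[x]oct_conjK Z3 g2E !oct_lin.
have Fb x : gam be (F2 x) = z *: F2 x /\ gam be (F3 x) = z *: F3 x.
  by have [_ -> ->] := Hg x; rewrite g2E g3E F2Z F3Z.
have done_ (b : 'End(e8)) : Gframe b 1 1 1 1 -> (forall x, [/\ gam b (F1 x) = F1 x, gam b (F2 x) = F2 x & gam b (F3 x) = F3 x]) ->
    b = \1%VF.
  move=> HFb Hb; have [Hcb [b1 b2 b3] _ _] := HFb; rewrite !scale1r in b1 b2 b3.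
  apply: (gam_id Hcb) => // X; have [a [c [d [x [y [w ->]]]]]] := jmk_ex X.
  have gZ := linZ_of (gam_lin Hcb); have gD := linD_of (gam_lin Hcb).
  rewrite jmk_split !gD !gZ b1 b2 b3.
  by have [-> _ _] := Hb x; have [_ -> _] := Hb y; have [_ _ ->] := Hb w.
have : (z - 1) * (z + 1) = 0 by apply: (etrans (y := z * z - 1)); [ring | rewrite z2 subrr].
move/eqP; rewrite mulf_eq0 subr_eq0 addr_eq0 => /orP[]/eqP zE.
  rewrite (done_ be HF); first exact: G0_id.
  by move=> x; have [-> ->] := Fb x; rewrite H1 zE !scale1r.
have [h [Gh Fh Ah]] := torus_zeta; have [Ch _ _ _] := Fh.
have [_ E] := gam_comp Ch Hbe; have gN := linN_of (gam_lin Ch).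
apply: (G0_left Gh); rewrite (done_ (h \o be)%VF); first exact: G0_id.
  by have := Gframe_comp Fh HF; rewrite !mulr1.
move=> x; rewrite !E H1; have [-> ->] := Fb x; rewrite zE !scaleN1r !gN.
by have [-> -> ->] := Ah x; rewrite !opprK.
Qed.

(** After [Gframe_w], [g1] is a sign [k] on e_2, ..., e_7. [Gtri_e1] excludes a sign on e_1,
    [torus_kappa] realises [k = -1], and what is left fixes F_1 pointwise. *)
Lemma Gframe_G0 (be : 'End(e8)) : Gframe be 1 1 1 1 -> G0 be.
Proof.
move=> HF0; have [h [Gh HF b0 b1]] := Gframe_w HF0; apply: (G0_left Gh).
move: (h \o be)%VF HF b0 b1 => {HF0 Gh h} {}be HF b0 b1.
have [g1 [g2 [g3 HT]]] := Gframe_tri HF; have [_ Hg N _ [L1 _]] := HT.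
have [Hbe _ _ _] := HF; have [k [k' [_ Hk]]] := gam_V6 Hbe.
have g10 : g1 (e 0) = e 0 by apply: (@F1_inj F); have [<- _ _] := Hg (e 0).
have g1k (j : nat) : (1 < j < 8)%N -> g1 (e j) = k *: e j.
  by move=> Hj; apply: (@F1_inj F); have [<- _ _] := Hg (e j); rewrite F1Z; case: (Hk j Hj).
have kk1 : k * k = 1.
  by have [] := N (e 2) (e 2); rewrite g1k // !oct_lin oip_e // eqxx mulr1.
have g11 : g1 (e 1) = e 1.
  have F1N (x : oct) : F1 (- x) = - F1 x := linN_of (@F1_lin F) x.
  apply: (@F1_inj F); have [K _ _] := Hg (e 1); rewrite -K; case: b1 => // b1.
  case: (Gtri_e1 HT g10 kk1 g1k); apply: (@F1_inj F); by rewrite -K b1 F1N.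
have fin (b : 'End(e8)) : Gframe b 1 1 1 1 -> gam b (F1 (e 0)) = F1 (e 0) -> gam b (F1 (e 1)) = F1 (e 1) ->
    (forall j : nat, (1 < j < 8)%N -> gam b (F1 (e j)) = F1 (e j)) -> G0 b.
  move=> HFb c0 c1 cj; apply: Gframe_F1_id => //; have [Hcb _ _ _] := HFb.
  apply: (oct_lin_ext (f := fun x => gam b (F1 x))).
  - by move=> a x y; rewrite F1_lin (gam_lin Hcb).
  - exact: F1_lin.
  - by move=> [|[|j]] // Hj; apply: cj.
have : (k - 1) * (k + 1) = 0 by apply: (etrans (y := k * k - 1)); [ring | rewrite kk1 subrr].
move/eqP; rewrite mulf_eq0 subr_eq0 addr_eq0 => /orP[]/eqP kE.
  apply: fin => //; first by have [-> _ _] := Hg (e 1); rewrite g11.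
  by move=> j Hj; have [-> _] := Hk j Hj; rewrite kE scale1r.
have [h [Gh Fh a0 a1 aj]] := torus_kappa; have [Ch _ _ _] := Fh.
have [_ E] := gam_comp Ch Hbe; have gN := linN_of (gam_lin Ch).
apply: (G0_left Gh); apply: fin.
- by have := Gframe_comp Fh HF; rewrite !mulr1.
- by rewrite E b0.
- by rewrite E; have [-> _ _] := Hg (e 1); rewrite g11.
- by move=> j Hj; rewrite E; have [-> _] := Hk j Hj; rewrite kE scaleN1r gN aj // opprK.
Qed.

Lemma E8_sigma4_so6_G0 (al : 'End(e8)) : E8_sigma4_so6 F al -> G0 al.
Proof.
move=> Gal; have [g1 H1 S1] := G_to_Gs Gal; apply: (G0_left H1).
have [g2 [c [H2 S2]]] := Gs_to_Gc S1; apply: (G0_left H2).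
have [g3 [p [q [r [H3 S3]]]]] := Gc_to_frame S2; apply: (G0_left H3).
have [g4 [H4 S4]] := Gframe_one S3; apply: (G0_left H4).
exact: Gframe_G0.
Qed.

End Generation.

(** * Continuous directional derivatives imply differentiability *)

Section ContinuouslyDifferentiable.
Context (R : realType) (N : nat).
Implicit Types (f : 'rV[R]_N -> R^o) (U : set 'rV[R]_N) (x v : 'rV[R]_N).

Lemma is_derive_line f p v t : derivable f (p + t *: v) v ->
  is_derive t 1 (fun s : R => f (p + s *: v) : R) ('D_v f (p + t *: v)).
Proof.
have E : (fun h : R => h^-1 *: (((fun s : R => f (p + s *: v) : R^o) \o shift t) (h *: (1 : R^o)) - f (p + t *: v)))
  = (fun h : R => h^-1 *: ((f \o shift (p + t *: v)) (h *: v) - f (p + t *: v))).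
  apply/funext => h /=; congr (_ *: (f _ - _)).
  by rewrite [h *: 1]mulr1 scalerDl addrCA addrA [h *: v + p]addrC -addrA addrCA addrA.
move=> df; split; first by rewrite /derivable E.
by rewrite /derive E.
Qed.

Lemma line_mvt f p v a : (forall t, `|t| <= `|a| -> derivable f (p + t *: v) v) ->
  exists2 t, `|t| <= `|a| & f (p + a *: v) - f p = 'D_v f (p + t *: v) * a.
Proof.
move=> df; pose g (s : R) : R := f (p + s *: v).
have dg (t : R) (ta : `|t| <= `|a|) := is_derive_line (df t ta).
have g0 : f p = g 0 by rewrite /g scale0r addr0.
have gc (x y : R) : (forall t, t \in `[x, y] -> `|t| <= `|a|) -> {within `[x, y], continuous g}.
  move=> H; apply: derivable_within_continuous => t tI; by case: (dg t (H t tI)).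
rewrite g0 -/(g a); have [a0|a0] := leP 0 a.
  have H t : t \in `[0, a] -> `|t| <= `|a|.
    by rewrite in_itv /= => /andP[t0 ta]; rewrite !ger0_norm.
  have [|t tI ->] := MVT_segment a0 _ (gc _ _ H) (df := fun t => 'D_v f (p + t *: v)).
    by move=> t /subset_itv_oo_cc tI; apply: dg; exact: H.
  by exists t; [exact: H | rewrite subr0].
have H t : t \in `[a, 0] -> `|t| <= `|a|.
  by rewrite in_itv /= => /andP[t0 ta]; rewrite !ler0_norm ?lerN2 // ltW.
have [|t tI E] := MVT_segment (ltW a0) _ (gc _ _ H) (df := fun t => 'D_v f (p + t *: v)).
  by move=> t /subset_itv_oo_cc tI; apply: dg; exact: H.
by exists t; [exact: H | rewrite -opprB E sub0r mulrN opprK].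
Qed.

Definition lincomb (a : 'I_N -> R) (h : 'rV[R]_N) : R^o := \sum_j h 0 j * a j.

Lemma lincomb_linear a : linear (lincomb a).
Proof.
move=> k h h'; rewrite /lincomb scaler_sumr -big_split; apply: eq_bigr => j _.
by rewrite !mxE mulrDl -mulrA.
Qed.
HB.instance Definition _ a := GRing.isLinear.Build R 'rV[R]_N R^o *:%R (lincomb a) (lincomb_linear a).

Lemma coord_le_norm (h : 'rV[R]_N) j : `|h 0 j| <= `|h|.
Proof.
by rewrite [`|h|]mx_normrE; exact: (le_bigmax 0 (fun ij : 'I_1 * 'I_N => `|h ij.1 ij.2|) (0, j)).
Qed.

Lemma lincomb_continuous a : continuous (lincomb a).
Proof.
rewrite (_ : lincomb a = \sum_j (fun h : 'rV[R]_N => h 0 j *: (a j : R^o))); last first.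
  by apply/funext => h; rewrite fct_sumE.
move=> h; apply: differentiable_continuous; apply: differentiable_sum => j.
by apply: differentiableZl; exact: differentiable_coord.
Qed.

(** [Cn] speaks of directional derivatives, whereas the chain rule asks for differentiability. The
    increment is split along the coordinate axes, and the mean value theorem is applied to each
    piece. *)
Lemma C1_differentiable f U x : open U -> U x ->
  (forall y v, U y -> derivable f y v) -> (forall v, {for x, continuous (fun y => 'D_v f y)}) ->
  differentiable f x.
Proof.
move=> oU Ux df cf; pose E j : 'rV[R]_N := delta_mx 0 j.
pose a j := 'D_(E j) f x.
have Du := @diff_unique R _ _ f (lincomb a) x (@lincomb_continuous a).
(* The remaining goal is the first-order expansion with the candidate [lincomb a]; [diff_unique]
   then identifies it with the differential. *)
lazymatch type of Du with ?P -> _ => suff H : P end.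
  apply/diff_locallyP; rewrite (Du H); split; [exact: lincomb_continuous | exact: H].
apply/eqaddoP => eps e0.
(* The [N] errors add up to at most [eps]; the denominator [N + 1] also covers [N = 0]. *)
pose e := eps / N.+1%:R; have ep : 0 < e by rewrite divr_gt0.
have /nbhs_ballP[d /= d0 Hd] : \forall y \near x, U y /\ forall j, `|'D_(E j) f x - 'D_(E j) f y| <= e.
  near=> y; split; first by near: y; exact: open_nbhs_nbhs.
  near: y; apply: filter_forall => j.
  have := cf (E j); move/cvgrPdist_le => /(_ e ep); exact.
have coordd (h : 'rV[R]_N) (y : 'rV[R]_N) : `|h| < d -> (forall j, `|(y - x) 0 j| <= `|h 0 j|) -> ball x d y.
  move=> hd K; split=> // i j; rewrite ord1 /ball /= distrC.
  by apply: le_lt_trans hd; apply: le_trans (coord_le_norm h j); have := K j; rewrite !mxE.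
near=> h; have hd : `|h| < d.
  near: h; apply/nbhs_ballP; exists d => // h; rewrite mx_norm_ball /ball_ /= sub0r normrN.
  by [].
(* The first [k] coordinates of [h]: the points [x + tr k] lead from [x] to [x + h] one axis at a
   time. *)
pose tr k : 'rV[R]_N := \row_j (if (j < k)%N then h 0 j else 0).
have trS (j : 'I_N) : tr j.+1 = tr j + h 0 j *: E j.
  apply/rowP => l; rewrite !mxE eqxx /= ltnS leq_eqVlt.
  have [->|lj] := eqVneq l j; first by rewrite eqxx ltnn /= mulr1 add0r.
  by rewrite (negbTE lj : (l == j :> nat) = false) /= mulr0 addr0.
have tr0 : tr 0%N = 0 by apply/rowP => l; rewrite !mxE.
have trN : tr N = h by apply/rowP => l; rewrite !mxE ltn_ord.
have inb (j : 'I_N) t : `|t| <= `|h 0 j| -> ball x d (x + tr j + t *: E j).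
  move=> th; apply: (coordd h) => // l.
  have -> : x + tr j + t *: E j - x = tr j + t *: E j by apply/rowP => k; rewrite !mxE; ring.
  rewrite !mxE eqxx /=.
  have [->|lj] := eqVneq l j; first by rewrite ltnn add0r mulr1.
  by rewrite mulr0 addr0; case: ifP; rewrite // normr0.
have [c Hc] : exists c : 'I_N -> R, forall j, `|c j| <= `|h 0 j| /\
    f (x + tr j.+1) - f (x + tr j) = 'D_(E j) f (x + tr j + c j *: E j) * h 0 j.
  have Hc (j : 'I_N) : exists c : R, `|c| <= `|h 0 j| /\
      f (x + tr j.+1) - f (x + tr j) = 'D_(E j) f (x + tr j + c *: E j) * h 0 j.
    have [t th Et] : exists2 t, `|t| <= `|h 0 j| &
        f (x + tr j + h 0 j *: E j) - f (x + tr j) = 'D_(E j) f (x + tr j + t *: E j) * h 0 j.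
      by apply: line_mvt => t th; apply: df; have [] := Hd _ (inb j t th).
    by exists t; split=> //; rewrite trS addrA.
  by have [c' Hc'] := boolp.choice Hc; exists c'.
have tel : f (x + h) - f x = \sum_(j < N) (f (x + tr j.+1) - f (x + tr j)).
  rewrite -(big_mkord xpredT (fun k => f (x + tr k.+1) - f (x + tr k))) telescope_sumr //.
  by rewrite trN tr0 addr0.
suff : `|f (x + h) - f x - lincomb a h| <= eps * `|h| by rewrite -addrA -opprD [x + h]addrC.
rewrite tel /lincomb -sumrB.
apply: le_trans (ler_norm_sum _ _ _) _.
apply: (@le_trans _ _ (\sum_(j < N) (e * `|h|))).
  apply: ler_sum => j _; have [cj ->] := Hc j; rewrite [h 0 j * _]mulrC -mulrBl normrM.
  apply: ler_pM => //; last exact: coord_le_norm.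
  by have [_ /(_ j)] := Hd _ (inb j (c j) cj); rewrite distrC.
rewrite sumr_const card_ord -mulr_natl mulrA; apply: ler_wpM2r => //.
by rewrite /e mulrA ler_pdivrMr ?ltr0n // mulrC ler_wpM2l ?ler_nat // ltW.
Unshelve. all: by end_near. Qed.

End ContinuouslyDifferentiable.

(** * A class of smooth functions closed under the needed operations *)

Section Smoothness.
Context (R : realType).

Lemma for_continuous_ext (T : topologicalType) (f g : T -> R^o) (x : T) :
  (\forall y \near x, f y = g y) -> {for x, continuous f} -> {for x, continuous g}.
Proof.
move=> fg /cvgrPdist_le cf; apply/cvgrPdist_le => eps e0.
rewrite -(nbhs_singleton fg); near=> y; have <- : f y = g y by near: y.
by near: y; exact: cf.
Unshelve. all: by end_near. Qed.

Lemma Cn_ext N (U : set 'rV[R]_N) n (f g : 'rV[R]_N -> R^o) : open U ->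
  (forall x, U x -> f x = g x) -> Cn n U f -> Cn n U g.
Proof.
move=> oU; elim: n f g => [|n IH] f g fg /=.
  move=> cf x Ux; apply: (@for_continuous_ext _ f g x _ (cf x Ux)).
  by apply: filterS (open_nbhs_nbhs (conj oU Ux)) => y; exact: fg.
move=> H v; have [df Df] := H v.
have nfg x : U x -> \near x, f x = g x.
  by move=> Ux; near=> y; apply: fg; near: y; exact: open_nbhs_nbhs.
have Dfg x : U x -> 'D_v f x = 'D_v g x by move=> Ux; exact/near_eq_derive/nfg.
split; last exact: (IH _ _ Dfg).
by move=> x Ux; apply: (near_eq_derivable (nfg x Ux)); exact: df.
Unshelve. all: by end_near. Qed.

Lemma Coo_derive N (U : set 'rV[R]_N) f v : Coo U f -> Coo U (fun x => 'D_v f x).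
Proof. by move=> H n; have [_] := H n.+1 v. Qed.

Lemma Coo_differentiable N (U : set 'rV[R]_N) f : open U -> Coo U f ->
  forall x, U x -> differentiable f x.
Proof.
move=> oU H x Ux; apply: (C1_differentiable oU Ux) => [y v Uy|v].
  by have [df _] := H 1%N v; exact: df.
by have := Coo_derive v H 0%N; exact.
Qed.

(* The smallest class of functions on [D] that contains the smooth ones and is
   closed under the operations below; since it is closed under derivatives, all
   its members are smooth. *)
Inductive smooth_class N (D : set 'rV[R]_N) : ('rV[R]_N -> R^o) -> Prop :=
| Smooth_base f : Coo D f -> smooth_class D f
| Smooth_add f g : smooth_class D f -> smooth_class D g -> smooth_class D (fun x => f x + g x)
| Smooth_mul f g : smooth_class D f -> smooth_class D g ->
    smooth_class D (fun x => (f x : R) * g x)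
| Smooth_inv f : (forall x, D x -> f x != 0) -> smooth_class D f ->
    smooth_class D (fun x => (f x : R)^-1)
| Smooth_comp M (U : set 'rV[R]_M) h (s : 'I_M -> 'rV[R]_N -> R^o) : open U -> Coo U h ->
    (forall j, smooth_class D (s j)) -> (forall x, D x -> U (\row_j s j x)) ->
    smooth_class D (fun x => h (\row_j s j x)).

Lemma Coo_cst N (D : set 'rV[R]_N) (c : R) : Coo D (fun=> c).
Proof.
move=> n; elim: n c => [|n IH] c /=; first by move=> x _; exact: cst_continuous.
move=> v; split=> [x _|]; first exact: derivable_cst.
have E : (fun x => 'D_v (fun=> c : R^o) x) = (fun=> 0) by apply/funext => x; exact: derive_cst.
by have := IH 0; rewrite -E.
Qed.

Lemma differentiable_row M N (s : 'I_M -> 'rV[R]_N -> R^o) x : (forall j, differentiable (s j) x) ->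
  differentiable (fun x => \row_j s j x) x /\
  forall v, 'D_v (fun x => \row_j s j x) x = \row_j 'D_v (s j) x.
Proof.
move=> ds.
have E : (fun x => \row_j s j x) = \sum_j (fun x => s j x *: (delta_mx 0 j : 'rV[R]_M)).
  apply/funext => y; rewrite fct_sumE; apply/rowP => k; rewrite !mxE summxE (bigD1 k) //=.
  rewrite big1 ?addr0 => [|j jk]; first by rewrite !mxE !eqxx mulr1.
  by rewrite !mxE eq_sym (negbTE jk) andbF mulr0.
have dr : differentiable (fun x => \row_j s j x) x.
  by rewrite E; apply: differentiable_sum => j; exact: differentiableZl.
split=> // v; have := derive_mx (diff_derivable (v := v) dr) => ->.
by apply/rowP => k; rewrite !mxE; congr ('D_v _ x); apply/funext => y; rewrite mxE.
Qed.

(** Induction over the closure rules: each rule of calculus expresses the derivative by members of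
    the class. For a composite, the partial derivatives of the outer function are again smooth. *)
Lemma smooth_class_deriv N (D : set 'rV[R]_N) f : open D -> smooth_class D f ->
  (forall x, D x -> differentiable f x) /\
  forall v, exists2 g, smooth_class D g & forall x, D x -> 'D_v f x = g x.
Proof.
move=> oD; elim=> {f} [f Hf|f g Cf [df Df] Cg [dg Dg]|f g Cf [df Df] Cg [dg Dg]|f f0 Cf [df Df]|
   M U h s oU Hh Cs Hs sU].
- split=> [x|v]; first exact: Coo_differentiable.
  by exists (fun x => 'D_v f x) => //; apply: Smooth_base; exact: Coo_derive.
- split=> [x Dx|v]; first exact: (differentiableD (df x Dx) (dg x Dx)).
  have [f' Cf' Ef] := Df v; have [g' Cg' Eg] := Dg v.
  exists (fun x => f' x + g' x); first exact: Smooth_add.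
  move=> x Dx; rewrite -Ef // -Eg //.
  exact: (deriveD (diff_derivable (v := v) (df x Dx)) (diff_derivable (v := v) (dg x Dx))).
- split=> [x Dx|v]; first exact: (differentiableM (df x Dx) (dg x Dx)).
  have [f' Cf' Ef] := Df v; have [g' Cg' Eg] := Dg v.
  exists (fun x => (f x : R) * g' x + (g x : R) * f' x).
    by apply: Smooth_add; exact: Smooth_mul.
  move=> x Dx; rewrite -Ef // -Eg //.
  exact: (deriveM (diff_derivable (v := v) (df x Dx)) (diff_derivable (v := v) (dg x Dx))).
- split=> [x Dx|v]; first exact: (differentiableV (df x Dx) (f0 x Dx)).
  have [f' Cf' Ef] := Df v.
  exists (fun x => (-1) * (((f x : R)^-1 * (f x : R)^-1) * f' x)).
    apply: Smooth_mul; first by apply: Smooth_base; exact: Coo_cst.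
    by apply: Smooth_mul => //; apply: Smooth_mul; exact: Smooth_inv.
  move=> x Dx; rewrite -Ef //.
  rewrite (deriveV (f0 x Dx) (diff_derivable (v := v) (df x Dx))) /GRing.scale /=.
  by rewrite -exprVn expr2 mulN1r mulNr.
- have dr x : D x -> differentiable (fun x => \row_j s j x) x.
    by move=> Dx; apply: (differentiable_row _).1 => j; have [ds _] := Hs j; exact: ds.
  have dh x : D x -> differentiable h (\row_j s j x).
    by move=> Dx; apply: (Coo_differentiable oU Hh); exact: sU.
  split=> [x Dx|v]; first exact: (differentiable_comp (dr x Dx) (dh x Dx)).
  have [s' Hs'] : exists s' : 'I_M -> 'rV[R]_N -> R^o, forall j, smooth_class D (s' j) /\
      forall x, D x -> 'D_v (s j) x = s' j x.
    have Hc j : exists g : 'rV[R]_N -> R^o, smooth_class D g /\ forall x, D x -> 'D_v (s j) x = g x.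
      by have [_ /(_ v)[g Cg Eg]] := Hs j; exists g.
    by have [s' Hs'] := boolp.choice Hc; exists s'.
  pose E j : 'rV[R]_M := delta_mx 0 j.
  have Csum n (g : 'I_n -> 'rV[R]_N -> R^o) : (forall j, smooth_class D (g j)) ->
      smooth_class D (fun x => \sum_j g j x).
    elim: n g => [|n IH] g Cg.
      by under eq_fun do rewrite big_ord0; apply: Smooth_base; exact: Coo_cst.
    under eq_fun do rewrite big_ord_recl.
    by apply: Smooth_add => //; apply: (IH (fun j => g (lift ord0 j))).
  exists (fun x => \sum_j (s' j x : R) * ('D_(E j) h (\row_i s i x) : R)).
    apply: Csum => j; apply: Smooth_mul; first by have [] := Hs' j.
    by apply: (@Smooth_comp N D M U (fun y => 'D_(E j) h y) s) => //; exact: Coo_derive.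
  move=> x Dx; have dhs := differentiable_comp (dr x Dx) (dh x Dx).
  rewrite (deriveE v dhs) (diff_comp (dr x Dx) (dh x Dx)) /= -(deriveE v (dr x Dx)).
  rewrite (differentiable_row _).2; last by move=> j; have [ds _] := Hs j; exact: ds.
  have -> : \row_j 'D_v (s j) x = \sum_j s' j x *: E j.
    apply/rowP => k; rewrite !mxE summxE (bigD1 k) //= big1 ?addr0 => [|j jk].
      by rewrite !mxE !eqxx mulr1; have [_ ->] := Hs' k.
    by rewrite !mxE eq_sym (negbTE jk) andbF mulr0.
  rewrite linear_sum; apply: eq_bigr => j _.
  by rewrite linearZ (deriveE (E j) (dh x Dx)).
Qed.

Lemma smooth_class_Coo N (D : set 'rV[R]_N) f : open D -> smooth_class D f -> Coo D f.
Proof.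
move=> oD Cf n; elim: n f Cf => [|n IH] f Cf /=; have [df Df] := smooth_class_deriv oD Cf.
  by move=> x Dx; apply: differentiable_continuous; exact: df.
move=> v; split=> [x Dx|]; first by apply: diff_derivable; exact: df.
have [g Cg Eg] := Df v; apply: (@Cn_ext _ _ _ g) => //; last exact: IH.
by move=> x Dx; rewrite Eg.
Qed.

End Smoothness.

(** * Smooth maps into complex vector spaces *)

Section ComplexSmooth.
Context (R : realType) (N : nat) (D : set 'rV[R]_N).
Local Notation C := R[i].
Local Notation S := (smooth_class D).
Local Notation re z := (complex.Re z).
Local Notation im z := (complex.Im z).

Definition smoothC (f : 'rV[R]_N -> C) := S (fun x => re (f x)) /\ S (fun x => im (f x)).

Lemma S_cst (c : R) : S (fun=> c). Proof. by apply: Smooth_base; exact: Coo_cst. Qed.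
Lemma S_opp f : S f -> S (fun x => - (f x : R)).
Proof.
move=> Sf; rewrite (_ : (fun x => - (f x : R)) = (fun x => (-1 : R) * f x)).
  by apply: Smooth_mul => //; exact: S_cst.
by apply/funext => x; rewrite mulN1r.
Qed.

Lemma smoothC_ext f g : f =1 g -> smoothC f -> smoothC g.
Proof. by move=> /funext ->. Qed.

Lemma smoothC_cst (c : C) : smoothC (fun=> c).
Proof. by split; exact: S_cst. Qed.

Lemma smoothC_add f g : smoothC f -> smoothC g -> smoothC (fun x => f x + g x).
Proof.
move=> [f1 f2] [g1 g2]; split.
  rewrite (_ : (fun x => _) = (fun x => re (f x) + re (g x))); first exact: Smooth_add.
  by apply/funext => x; case: (f x) => a b; case: (g x).
rewrite (_ : (fun x => _) = (fun x => im (f x) + im (g x))); first exact: Smooth_add.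
by apply/funext => x; case: (f x) => a b; case: (g x).
Qed.

Lemma smoothC_mul f g : smoothC f -> smoothC g -> smoothC (fun x => f x * g x).
Proof.
move=> [f1 f2] [g1 g2]; split.
  rewrite (_ : (fun x => _) = (fun x => re (f x) * re (g x) + - (im (f x) * im (g x)))).
    by apply: Smooth_add; [exact: Smooth_mul | apply: S_opp; exact: Smooth_mul].
  by apply/funext => x; case: (f x) => a b; case: (g x).
rewrite (_ : (fun x => _) = (fun x => re (f x) * im (g x) + im (f x) * re (g x))).
  by apply: Smooth_add; exact: Smooth_mul.
by apply/funext => x; case: (f x) => a b; case: (g x) => c d /=; ring.
Qed.

Lemma smoothC_inv f : (forall x, D x -> f x != 0) -> smoothC f -> smoothC (fun x => (f x)^-1).
Proof.
move=> f0 [f1 f2]; pose n x : R := re (f x) * re (f x) + im (f x) * im (f x).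
have Sn : S n by apply: Smooth_add; exact: Smooth_mul.
have n0 x : D x -> n x != 0.
  move=> Dx; apply/negP => /eqP H; have := f0 x Dx; case E : (f x) => [a b].
  rewrite /n E /= in H; have : a ^+ 2 + b ^+ 2 == 0 by rewrite !expr2 H.
  by rewrite paddr_eq0 ?sqr_ge0 // !sqrf_eq0 => /andP[/eqP-> /eqP->]; rewrite eqxx.
have Si := Smooth_inv n0 Sn; split.
  rewrite (_ : (fun x => _) = (fun x => re (f x) * (n x)^-1)); first exact: Smooth_mul.
  by apply/funext => x; rewrite /n; case: (f x) => a b /=; rewrite !expr2.
rewrite (_ : (fun x => _) = (fun x => - (im (f x)) * (n x)^-1)).
  by apply: Smooth_mul => //; exact: S_opp.
by apply/funext => x; rewrite /n; case: (f x) => a b /=; rewrite !expr2 mulNr.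
Qed.

Lemma smoothC_sum n (f : 'I_n -> 'rV[R]_N -> C) : (forall j, smoothC (f j)) ->
  smoothC (fun x => \sum_j f j x).
Proof.
elim: n f => [|n IH] f Cf.
  by apply: (smoothC_ext (f := fun=> 0)) (smoothC_cst 0) => x; rewrite big_ord0.
apply: (smoothC_ext (f := fun x => f ord0 x + \sum_j f (lift ord0 j) x)).
  by move=> x; rewrite big_ord_recl.
by apply: smoothC_add => //; exact: IH.
Qed.

Definition smoothV (V : vectType C) (f : 'rV[R]_N -> V) :=
  forall j, smoothC (fun x => v2r (f x) 0 j).

Lemma smoothV_comb (V : vectType C) n (a : 'I_n -> 'rV[R]_N -> C) (w : 'I_n -> V) :
  (forall j, smoothC (a j)) -> smoothV (fun x => \sum_j a j x *: w j).
Proof.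
move=> Ca j; apply: (smoothC_ext (f := fun x => \sum_k a k x * v2r (w k) 0 j)).
  by move=> x; rewrite linear_sum summxE; apply: eq_bigr => k _; rewrite linearZ !mxE.
by apply: smoothC_sum => k; apply: smoothC_mul => //; exact: smoothC_cst.
Qed.

Lemma vect_split (V : vectType C) (v : V) :
  v = \sum_j v2r v 0 j *: r2v (delta_mx 0 j).
Proof.
rewrite -{1}[v]v2rK [X in r2v X]row_sum_delta linear_sum.
by apply: eq_bigr => j _; rewrite linearZ.
Qed.

Lemma smoothV_ext (V : vectType C) (f g : 'rV[R]_N -> V) : f =1 g -> smoothV f -> smoothV g.
Proof. by move=> /funext ->. Qed.

Lemma smoothV_cst (V : vectType C) (v : V) : smoothV (fun=> v).
Proof. by move=> j; exact: smoothC_cst. Qed.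

Lemma smoothV_lin (V W : vectType C) (L : V -> W) f : linear L -> smoothV f -> smoothV (fun x => L (f x)).
Proof.
move=> Llin Cf.
have LD x y : L (x + y) = L x + L y by have := Llin 1 x y; rewrite !scale1r.
have L0 : L 0 = 0 by have := Llin (-1) 0 0; rewrite scaler0 addr0 scaleN1r addNr.
have LZ a x : L (a *: x) = a *: L x by have := Llin a x 0; rewrite L0 !addr0.
apply: (smoothV_ext (f := fun x => \sum_j v2r (f x) 0 j *: L (r2v (delta_mx 0 j)))).
  by move=> x; rewrite [in RHS](vect_split (f x)) (big_morph L LD L0); apply: eq_bigr => j _; rewrite LZ.
exact: smoothV_comb.
Qed.

Lemma smoothV_scale (V : vectType C) a (f : 'rV[R]_N -> V) : smoothC a -> smoothV f ->
  smoothV (fun x => a x *: f x).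
Proof.
move=> Ca Cf j; apply: (smoothC_ext (f := fun x => a x * v2r (f x) 0 j)).
  by move=> x; rewrite linearZ mxE.
exact: smoothC_mul.
Qed.

Lemma smoothV_sum (V : vectType C) n (f : 'I_n -> 'rV[R]_N -> V) : (forall j, smoothV (f j)) ->
  smoothV (fun x => \sum_j f j x).
Proof.
move=> Cf j; apply: (smoothC_ext (f := fun x => \sum_k v2r (f k x) 0 j)).
  by move=> x; rewrite linear_sum summxE.
by apply: smoothC_sum => k; exact: Cf.
Qed.

Lemma smoothV_bilin (V W Z : vectType C) (B : V -> W -> Z) f g :
  (forall w, linear (B^~ w)) -> (forall v, linear (B v)) ->
  smoothV f -> smoothV g -> smoothV (fun x => B (f x) (g x)).
Proof.
move=> Bl Br Cf Cg.
have LD w x y : B (x + y) w = B x w + B y w by have := Bl w 1 x y; rewrite !scale1r.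
have L0 w : B 0 w = 0 by have := Bl w (-1) 0 0; rewrite scaler0 addr0 scaleN1r addNr.
have LZ w a x : B (a *: x) w = a *: B x w by have := Bl w a x 0; rewrite L0 !addr0.
apply: (smoothV_ext (f := fun x => \sum_j v2r (f x) 0 j *: B (r2v (delta_mx 0 j)) (g x))).
  move=> x; rewrite [in RHS](vect_split (f x)).
  by rewrite (big_morph (B^~ (g x)) (LD (g x)) (L0 (g x))); apply: eq_bigr => j _; rewrite LZ.
by apply: smoothV_sum => j; apply: smoothV_scale => //; exact: smoothV_lin.
Qed.

Lemma smoothV_fst (V W : vectType C) (f : 'rV[R]_N -> (V * W)%type) : smoothV f ->
  smoothV (fun x => (f x).1).
Proof. by apply: smoothV_lin => a [x1 x2] [y1 y2]. Qed.

Lemma smoothV_snd (V W : vectType C) (f : 'rV[R]_N -> (V * W)%type) : smoothV f ->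
  smoothV (fun x => (f x).2).
Proof. by apply: smoothV_lin => a [x1 x2] [y1 y2]. Qed.

Lemma smoothC_coord (f : 'rV[R]_N -> C^o) : smoothV f -> smoothC f.
Proof.
move=> Cf; apply: (smoothC_ext (f := fun x => \sum_j v2r (f x) 0 j * r2v (delta_mx 0 j))).
  by move=> x; rewrite [RHS](vect_split (f x)).
by apply: smoothC_sum => j; apply: smoothC_mul => //; exact: smoothC_cst.
Qed.

End ComplexSmooth.

(** * Real coordinates and pullback along smooth maps *)

Section Realify.
Context (R : realType).
Local Notation C := R[i].

Definition unrealify (V : vectType C) (x : 'rV[R]_(dim V + dim V)) : V :=
  r2v (\row_j ((x 0 (lshift _ j)) +i* (x 0 (rshift _ j)))%C).

Lemma realifyK (V : vectType C) : cancel (@realify R V) (@unrealify V).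
Proof.
move=> v; rewrite /unrealify /realify -[RHS]v2rK; congr r2v; apply/rowP => j.
by rewrite mxE row_mxEl row_mxEr !mxE; case: (v2r v 0 j).
Qed.

Lemma Coo_coord N (U : set 'rV[R]_N) (j : 'I_N) : Coo U (fun x => x 0 j).
Proof.
have lin : linear (fun x : 'rV[R]_N => x 0 j : R^o) by move=> a x y; rewrite !mxE.
have D v : (fun x => 'D_v (fun x : 'rV[R]_N => x 0 j : R^o) x) = (fun=> v 0 j).
  apply/funext => x; have dx := @differentiable_coord R 1 N x 0 j.
  rewrite (deriveE v dx).
  have [f fE] : exists f : {linear 'rV[R]_N -> R^o}, forall x, f x = x 0 j.
    by exists (HB.pack_for {linear 'rV[R]_N -> R^o} (fun x : 'rV[R]_N => x 0 j : R^o) (GRing.isLinear.Build R 'rV[R]_N R^o *:%R _ lin)).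
  have fc : continuous f by move=> y; rewrite (_ : (f : _ -> _) = fun x => x 0 j);
    [exact: coord_continuous | apply/funext => z; exact: fE].
  have := @diff_lin R _ _ f x fc.
  by rewrite (_ : (f : _ -> _) = fun x => x 0 j); [move=> -> | apply/funext => z; exact: fE].
case=> [|n] /=; first by move=> x _; exact: coord_continuous.
move=> v; split=> [x _|]; first by apply: diff_derivable; exact: differentiable_coord.
by rewrite D; exact: Coo_cst.
Qed.

Lemma smoothV_unrealify (V : vectType C) (D : set 'rV[R]_(dim V + dim V)) :
  smoothV D (@unrealify V).
Proof.
move=> j; split.
  rewrite (_ : (fun x => complex.Re (v2r (unrealify x) 0 j)) =
      (fun x : 'rV[R]_(dim V + dim V) => x 0 (lshift _ j) : R^o)).
    by apply: Smooth_base; exact: Coo_coord.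
  by apply/funext => x; rewrite /unrealify r2vK mxE.
rewrite (_ : (fun x => complex.Im (v2r (unrealify x) 0 j)) =
      (fun x : 'rV[R]_(dim V + dim V) => x 0 (rshift _ j) : R^o)).
  by apply: Smooth_base; exact: Coo_coord.
by apply/funext => x; rewrite /unrealify r2vK mxE.
Qed.

Lemma smoothV_realify N (D : set 'rV[R]_N) (V : vectType C) (f : 'rV[R]_N -> V) : smoothV D f ->
  exists s : 'I_(dim V + dim V) -> 'rV[R]_N -> R^o, (forall j, smooth_class D (s j)) /\
  forall x, realify (f x) = \row_j s j x.
Proof.
move=> Sf; exists (fun j x => realify (f x) 0 j); split; last by move=> x; apply/rowP => j; rewrite [RHS]mxE.
move=> j; have [k [->|->]] : exists k : 'I_(dim V), j = lshift _ k \/ j = rshift _ k.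
    by case: (splitP j) => k E; exists k; [left | right]; exact: val_inj.
  have [S1 _] := Sf k.
  by rewrite (_ : (fun x => realify (f x) 0 _) = (fun x => complex.Re (v2r (f x) 0 k))) //;
    apply/funext => x; rewrite /realify row_mxEl mxE.
have [_ S2] := Sf k.
by rewrite (_ : (fun x => realify (f x) 0 _) = (fun x => complex.Im (v2r (f x) 0 k))) //;
  apply/funext => x; rewrite /realify row_mxEr mxE.
Qed.

(** The map is controlled only on [D], hence the intersections. The first half is continuity, the
    second the composition rule of [smooth_class]. *)
Lemma smoothV_pullback N (D : set 'rV[R]_N) (V : vectType C) (f : 'rV[R]_N -> V) : open D ->
  smoothV D f ->
  (forall U, open U -> open (D `&` [set x | U (realify (f x))])) /\
  forall U h, open U -> Coo U h -> Coo (D `&` [set x | U (realify (f x))]) (fun x => h (realify (f x))).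
Proof.
move=> oD Sf; have [s [Ss Es]] := smoothV_realify Sf.
have O U : open U -> open (D `&` [set x | U (realify (f x))]).
  move=> oU; rewrite openE => x [Dx Ux]; rewrite /interior.
  have ds : {for x, continuous (fun x => \row_j s j x)}.
    apply: differentiable_continuous; apply: (differentiable_row _).1 => j.
    by have [d _] := smooth_class_deriv oD (Ss j); exact: d.
  have E : (fun x => realify (f x)) = (fun x => \row_j s j x) by apply/funext.
  rewrite -E in ds; apply: filterI; first exact: open_nbhs_nbhs.
  by apply: (ds U); exact: open_nbhs_nbhs.
split=> // U h oU Hh; have oDU := O U oU.
apply: (smooth_class_Coo oDU).
have E : (fun x => h (realify (f x))) = (fun x => h (\row_j s j x)) by apply/funext => x; rewrite Es.
rewrite E; apply: (Smooth_comp oU Hh) => [j|x [_ /=]]; last by rewrite Es.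
have C := smooth_class_Coo oD (Ss j).
apply: Smooth_base => n; have := C n.
elim: n {C} (s j) => [|n IH] g /= H; first by move=> x [Dx _]; exact: H.
by move=> v; have [a b] := H v; split=> [x [Dx _]|]; [exact: a | exact: IH].
Qed.

End Realify.

Lemma sval_inj (T : Type) (P : T -> Prop) : injective (@proj1_sig T P).
Proof. by move=> [x Px] [y Py] /= E; subst y; rewrite (Prop_irrelevance Px Py). Qed.

(** * Surjections with smooth local sections *)

Section LocalSections.
Context (R : realType) (V1 V2 : vectType R[i]) (A : set V1) (B : set V2).
Variables (ev : {a | A a} -> {b | B b}) (e : V1 -> V2).
Hypothesis evE : forall a, sval (ev a) = e (sval a).
Hypothesis e_smooth : smoothV setT (fun x => e (unrealify x)).

(** The section is smooth on an open set of the ambient space but is asked to land in [A] only over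
    [B]. This fits the definition of smoothness on [sub_space] by local extensions. *)
Definition smooth_section (D : set 'rV[R]_(dim V2 + dim V2)) (s : V2 -> V1) :=
  [/\ open D, smoothV D (fun x => s (unrealify x)) &
      forall y, B y -> D (realify y) -> A (s y) /\ e (s y) = y].

Hypothesis ev_section : forall y, B y -> exists D s, smooth_section D s /\ D (realify y).

Let ev_lift D s (y : {b | B b}) : smooth_section D s -> D (realify (sval y)) ->
  exists2 a : {a | A a}, sval a = s (sval y) & ev a = y.
Proof.
move=> [_ _ H] Dy; have [As Es] := H _ (svalP y) Dy.
by exists (exist _ _ As) => //; apply: sval_inj; rewrite evE.
Qed.

(** A set with open preimage is locally the pullback of that preimage along a section; the other
    direction is continuity of [e]. *)
Lemma section_open_iff O :
  is_open (s := sub_space A) (ev @^-1` O) <-> is_open (s := sub_space B) O.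
Proof.
split=> [] [U oU EU].
(* The union, over all local sections, of the pullbacks of [U]. *)
- exists [set x | exists D s, [/\ smooth_section D s, D x & U (realify (s (unrealify x)))]].
    rewrite openE => x [D [s [Hs Dx Ux]]]; have [oD Ss _] := Hs.
    have [oP _] := smoothV_pullback oD Ss.
    apply: (filterS _ (open_nbhs_nbhs (conj (oP U oU) (conj Dx Ux)))).
    by move=> z [Dz Uz]; exists D, s.
  apply/seteqP; split=> [y Oy|y [D [s [Hs Dy]]]] /=.
    have [D [s [Hs Dy]]] := ev_section (svalP y); exists D, s; split=> //.
    have [a Ea Eea] := ev_lift Hs Dy.
    have : (ev @^-1` O) a by rewrite /preimage /= Eea.
    by rewrite EU /= Ea realifyK.
  rewrite realifyK; have [a <- <-] := ev_lift Hs Dy => Ua.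
  by have : [set v : {a | A a} | U (realify (sval v))] a by []; rewrite -EU.
- have [oP _] := smoothV_pullback openT e_smooth.
  exists (setT `&` [set x | U (realify (e (unrealify x)))]); first exact: oP.
  rewrite EU; apply/seteqP; split=> a /=; rewrite realifyK evE; first by split.
  by case.
Qed.

(** Composing a local extension of [g \o ev] with a section gives a local extension of [g]. *)
Lemma section_smooth_iff O (g : {b | B b} -> R) :
  smooth_on (s := sub_space A) (ev @^-1` O) (g \o ev) <-> smooth_on (s := sub_space B) O g.
Proof.
split=> [] Hg.
- move=> y Oy; have [D [s [Hs Dy]]] := ev_section (svalP y); have [oD Ss _] := Hs.
  have [oP cP] := smoothV_pullback oD Ss.
  have [a Ea Eea] := ev_lift Hs Dy.
  have Oa : (ev @^-1` O) a by rewrite /preimage /= Eea.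
  have [U [h [oU Ua ch Hh]]] := Hg a Oa; rewrite Ea in Ua.
  exists (D `&` [set x | U (realify (s (unrealify x)))]), (fun x => h (realify (s (unrealify x)))).
  split; [exact: oP | by split=> //=; rewrite realifyK | exact: cP |].
  move=> z Oz [Dz /=]; rewrite realifyK => Uz; have [b Eb Eeb] := ev_lift Hs Dz.
  by rewrite -Eb -(Hh b) /= ?Eeb // Eb.
- have [oP cP] := smoothV_pullback openT e_smooth.
  move=> a Oa; have [U [h [oU Ua ch Hh]]] := Hg (ev a) Oa.
  exists (setT `&` [set x | U (realify (e (unrealify x)))]), (fun x => h (realify (e (unrealify x)))).
  split; [exact: oP | by split=> //=; rewrite realifyK -evE | exact: cP |].
  by move=> b Ob [_ /=]; rewrite realifyK -evE => Ub; exact: Hh.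
Qed.

End LocalSections.

(** * Connectedness along polynomial paths *)

Section Paths.
Context (R : realType).

Lemma connected_star (T : topologicalType) (A : set T) (x : T) : A x ->
  (forall y, A y -> exists K, [/\ connected K, K `<=` A, K x & K y]) -> connected A.
Proof.
move=> Ax HA; have HK y : exists K, A y -> [/\ connected K, K `<=` A, K x & K y].
  by have [/HA[K HK]|nA] := pselect (A y); [exists K | exists set0].
have [K EK] := boolp.choice HK.
rewrite (_ : A = \bigcup_(y in A) K y).
  apply: bigcup_connected; last by move=> y /EK[].
  by exists x => y /EK[].
apply/seteqP; split=> [y Ay|z [y /EK[_ KA _ _] Kz]]; last exact: KA.
by exists y => //; have [] := EK _ Ay.
Qed.

(** The parameter is treated as a row of length one, so that continuity follows from
    [smoothV_pullback]. *)
Lemma polynomial_path_connected (V : vectType R[i]) n (w : 'I_n -> V) :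
  connected [set realify (\sum_(i < n) (t%:C)%C ^+ i *: w i) | t in `[0 : R, 1]%classic].
Proof.
pose p (z : 'rV[R]_1) := \sum_(i < n) ((z 0 0)%:C)%C ^+ i *: w i.
have Sp : smoothV setT p.
  apply: smoothV_comb => i; elim: (i : nat) => [|k IH].
    by apply: (smoothC_ext (f := fun=> 1)) (smoothC_cst _ 1) => z; rewrite expr0.
  apply: (smoothC_ext (f := fun z : 'rV[R]_1 => ((z 0 0)%:C)%C * ((z 0 0)%:C)%C ^+ k)).
    by move=> z; rewrite exprS.
  apply: smoothC_mul => //; split; first by apply: Smooth_base; exact: Coo_coord.
  exact: S_cst.
have cp : continuous (fun z => realify (p z)).
  by apply/continuousP => U oU; have [/(_ U oU)] := smoothV_pullback openT Sp; rewrite setTI.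
rewrite (_ : [set _ | t in _] = [set realify (p (t *: const_mx 1)) | t in `[0 : R, 1]%classic]).
  apply: connected_continuous_connected; first exact: segment_connected.
  apply: continuous_subspaceT => t.
  apply: (@continuous_comp _ _ _ (fun t : R => t *: (const_mx 1 : 'rV[R]_1)) (fun z => realify (p z))).
    exact: scalel_continuous.
  exact: cp.
by apply: eq_imagel => t _; rewrite /p !mxE mulr1.
Qed.

End Paths.

(** * Smooth dependence of the local section on the point *)

Section SmoothSections.
Context (R : realType) (N : nat) (D : set 'rV[R]_N).
Local Notation C := R[i].
Local Notation e8 := (e8 C).
Local Notation smooth := (smoothV D).

Lemma smoothV_compf (f g : 'rV[R]_N -> 'End(e8)) : smooth f -> smooth g ->
  smooth (fun x => (f x \o g x)%VF).
Proof.
apply: smoothV_bilin => h a f1 f2.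
  by rewrite comp_lfunDl -comp_lfunZl.
by rewrite comp_lfunDr -comp_lfunZr.
Qed.

Lemma ad_linear : linear (@ad C).
Proof.
move=> a x y; apply/lfunP => z.
by rewrite add_lfunE scale_lfunE !adE bracketDl bracketZl.
Qed.

Lemma smoothV_eexp (f : 'rV[R]_N -> e8) : smooth f -> smooth (fun x => eexp (f x)).
Proof.
move=> Sf; apply: smoothV_sum => j; elim: (j : nat) => [|n IH]; first exact: smoothV_cst.
apply: (smoothV_scale (a := fun=> (n.+1%:R)^-1)); first exact: smoothC_cst.
by apply: smoothV_compf => //; apply: smoothV_lin Sf; exact: ad_linear.
Qed.

Lemma smoothV_eP f : smooth f -> smooth (fun x => eP (f x)).
Proof. by apply: smoothV_lin => a P Q; rewrite /eP e8Z_tuple e8D_tuple !scaler0 !mulr0 !addr0. Qed.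

Lemma smoothV_section_at Q r t : (forall x, D x -> t x != 0) ->
  smooth Q -> smoothC D r -> smoothC D t -> smooth (fun x => section_at (Q x) (r x) (t x)).
Proof.
move=> t0 SQ Sr St; have Sti := smoothC_inv t0 St.
have cS (c : C) : smoothC D (fun=> c) by exact: smoothC_cst.
have Sm f g : smoothC D f -> smoothC D g -> smoothC D (fun x => f x * g x) by exact: smoothC_mul.
have SN f : smoothC D f -> smoothC D (fun x => - f x).
  move=> Sf; apply: (smoothC_ext (f := fun x => -1 * f x)) (Sm _ _ (cS (-1)) Sf) => x.
  by rewrite mulN1r.
have eZ a (v : e8) : smoothC D a -> smooth (fun x => eexp (a x *: v)).
  by move=> Sa; apply: smoothV_eexp; apply: smoothV_scale => //; exact: smoothV_cst.
apply: smoothV_compf.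
  apply: smoothV_eexp; apply: smoothV_eP.
  apply: (smoothV_ext (f := fun x => (-1) *: ((t x)^-1 *: Q x))) => [x|]; first by rewrite scaleN1r.
  by apply: smoothV_scale (cS (-1)) _; exact: smoothV_scale.
apply: smoothV_compf; first by apply: eZ; exact: Sm.
have S1t : smoothC D (fun x => 1 - t x) by apply: smoothC_add => //; exact: SN.
have St1 : smoothC D (fun x => t x - 1) by exact: smoothC_add.
apply: smoothV_compf; first by apply: eZ; exact: Sm.
apply: smoothV_compf; first by apply: eZ; exact: SN.
by apply: smoothV_compf; apply: eZ.
Qed.

End SmoothSections.

(** * The orbit map of 1_-, its local sections, and paths in G *)

Section HomogeneousSpace.
Context (R : realType).
Local Notation C := R[i].
Local Notation e8 := (e8 C).
Local Notation G := (E8_sigma4_so6 C).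
Local Notation H := (E8_sigma4_so6_stab C).
Local Notation W := (W8_sigma4_so6 C).
Local Notation o := (one_minus C).

Lemma orbit_one_minus a : G a -> W (a o).
Proof. by move=> Ga; apply: G_W8_sigma4 => //; exact: W8_one_minus. Qed.

Definition orbit_map (a : {a | G a}) : {y | W y} :=
  exist _ (sval a o) (orbit_one_minus (svalP a)).

Lemma orbit_map_surj y : exists a, orbit_map a = y.
Proof.
have [g Gg Eg] := G0_transitive (svalP y); have GG := G0_G (G0_inv Gg).
exists (exist _ _ GG); apply: sval_inj; rewrite /= -Eg.
by rewrite G_K //; exact: G0_G.
Qed.

Lemma lcoset_eq (a b : {a | G a}) : orbit_map a = orbit_map b <->
  lcoset H (sval a) = lcoset H (sval b).
Proof.
case: a b => [a Ga] [b Gb]; split=> /= [E|E].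
  have Eo : a o = b o by exact: (congr1 sval E).
  have sub c d : G c -> G d -> c o = d o -> lcoset H c `<=` lcoset H d.
    move=> Gc Gd cd _ [h [Gh ho] <-]; exists (d^-1 \o (c \o h))%VF.
      split; first by apply: G_comp; [exact: G_inv | exact: G_comp].
      by rewrite !comp_lfunE ho cd G_K.
    by apply/lfunP => v; rewrite !comp_lfunE G_VK.
  by apply/seteqP; split; exact: sub.
apply: sval_inj => /=; have : lcoset H a (a \o \1)%VF.
  by exists \1%VF => //; split; [exact: G_id | exact: id_lfunE].
by rewrite E comp_lfun1r => -[h [_ ho] <-]; rewrite comp_lfunE ho.
Qed.

(** The element [g] that makes the last coordinate nonzero is chosen at [y] and kept constant: the
    condition on [g z] is open in [z], and [section_at] depends rationally on the coordinates of
    [g z]. *)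
Lemma orbit_section y : W y -> exists D s,
  smooth_section G W (fun a : 'End(e8) => a o) D s /\ D (realify y).
Proof.
move=> Wy; have [g Gg tg] := G0_reach Wy; have GG := G0_G Gg.
pose f (x : 'rV[R]_(dim e8 + dim e8)) : e8 := g (unrealify x).
have Sf D : smoothV D f.
  by apply: smoothV_lin (smoothV_unrealify _) => a u v; exact: linearP.
have St D : smoothV D (fun x => (f x).2 : C^o) by exact: smoothV_snd (Sf D).
have S1 D : smoothV D (fun x => (f x).1.1) by exact: smoothV_fst (smoothV_fst (Sf D)).
have Sr D : smoothV D (fun x => (f x).1.1.2 : C^o) by exact: smoothV_snd (S1 D).
have SQ D : smoothV D (fun x => (f x).1.1.1.2) by exact: smoothV_snd (smoothV_fst (S1 D)).
pose D := [set x | tcoord (f x) != 0].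
have oD : open D.
  have [oP _] := smoothV_pullback openT (St setT).
  have oU : open (~` [set realify (0 : C^o)]).
    by apply: closed_openC; apply: accessible_closed_set1; apply: hausdorff_accessible; exact: norm_hausdorff.
  rewrite (_ : D = setT `&` [set x | (~` [set realify (0 : C^o)]) (realify ((f x).2 : C^o))]); first exact: oP.
  apply/seteqP; split=> x; rewrite /D /=.
    move=> /eqP t0; split=> // E; apply: t0.
    exact: (can_inj (@realifyK R C^o) E).
  by case=> _ t0; apply/eqP => E; apply: t0; rewrite -[(f x).2]/(tcoord (f x)) E.
exists D, (fun z => (g^-1 \o section_at (g z).1.1.1.2 (g z).1.1.2 (g z).2)%VF).
split; last by rewrite /D /f /= realifyK.
split=> //.
  apply: smoothV_compf; first exact: smoothV_cst.
  apply: smoothV_section_at => //; exact: smoothC_coord.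
move=> z Wz; rewrite /D /f /= realifyK; have := G_W8_sigma4 GG Wz.
case Eg: (g z) => [[[[[u P] Q] r] s] t]; rewrite /tcoord /= => Wg t0.
have [_ sx Dx] := Wg; have [_ _ KQ] := iffLR (kk_tuple u P Q r s t) (conj sx Dx).
have GS := G0_G (section_at_G0 r t KQ).
split; first by apply: G_comp => //; exact: G_inv.
by rewrite comp_lfunE (section_atE Wg t0) -Eg G_K.
Qed.

Lemma G0_connected_to_id (g : 'End(e8)) : G0 g -> exists K,
  [/\ connected K, K `<=` @realify R _ @` G, K (realify (\1%VF : 'End(e8))) & K (realify g)].
Proof.
elim=> [|x h kx nx Gh [K [cK KG K1 Kh]]].
  exists [set realify (\1%VF : 'End(e8))]; split=> //; first exact: connected1.
  by move=> _ ->; exists \1%VF => //; exact: G_id.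
have pE (t : C) : (\sum_(i < 8) t ^+ i *: (divpow (ad x) i \o h) = eexp (t *: x) \o h)%VF.
  apply/lfunP => v; rewrite sum_lfunE comp_lfunE eexpZ; apply: eq_bigr => i _.
  by rewrite scale_lfunE comp_lfunE.
(* The path [exp(t ad x) h] for [t] in the unit interval, a polynomial with operator coefficients
   that joins [h] to the next word. *)
pose L := [set realify (\sum_(i < 8) (t%:C)%C ^+ i *: (divpow (ad x) i \o h)%VF) |
  t in `[0 : R, 1]%classic].
have cL : connected L by exact: polynomial_path_connected.
have L0 : L (realify h).
  exists 0; first by rewrite /= in_itv /= lexx ler01.
  rewrite pE scale0r; congr realify; apply/lfunP => v; rewrite comp_lfunE.
  by apply: eexp_fix; rewrite bracket_lin.
have L1 : L (realify (eexp x \o h)%VF).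
  exists 1; first by rewrite /= in_itv /= lexx ler01.
  by rewrite pE scale1r.
exists (K `|` L); split; [|move=> z [/KG //|[t _ <-]]|by left|by right].
  by apply: connectedU => //; exists (realify h).
rewrite pE; exists (eexp ((t%:C)%C *: x) \o h)%VF => //.
by apply: G0_G; apply: G0_eexp; [exact: kkZ | exact: ad_nilpZ | exact: Gh].
Qed.

End HomogeneousSpace.

Theorem theorem5p5 (R : realType) :
  diffeomorphic
    (homogeneous_space (E8_sigma4_so6 R[i]) (E8_sigma4_so6_stab R[i]))
    (sub_space (W8_sigma4_so6 R[i])) /\
  connected (@realify R _ @` E8_sigma4_so6 R[i]).
Proof.
split; last first.
  apply: (connected_star (x := realify \1%VF)); first by exists \1%VF => //; exact: G_id.
  by move=> _ [a /E8_sigma4_so6_G0/G0_connected_to_id[K HK] <-]; exists K.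
set X := homogeneous_space _ _; set Y := sub_space _.
pose p := @coset_proj R _ (E8_sigma4_so6 R[i]) (E8_sigma4_so6_stab R[i]).
have Hr (c : X) : exists a, p a = c.
  case: c => c Hc; have [a Ga Ec] := Hc; exists (exist _ a Ga).
  by apply: sval_inj; rewrite /= Ec.
have [r pr] := boolp.choice Hr.
(* [f] is defined on chosen representatives; [fp] below shows that the choice is immaterial, so that
   [f] is the map induced by the orbit map. *)
pose f (c : X) : Y := orbit_map (r c).
have fp : f \o p = @orbit_map R.
  apply/funext => a; apply/lcoset_eq; exact: (congr1 sval (pr (p a))).
have [h fh] := boolp.choice (@orbit_map_surj R).
have ev_s : smoothV setT (fun x => (unrealify x : 'End(e8 R[i])) (one_minus R[i])).
  apply: (smoothV_lin (L := fun a : 'End(e8 R[i]) => a (one_minus R[i]))) (smoothV_unrealify _).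
  by move=> k a b; rewrite add_lfunE scale_lfunE.
exists f; split.
- exists (p \o h) => [c|y] /=; last by rewrite -[LHS]/((f \o p) (h y)) fp fh.
  rewrite -[RHS]pr; apply: sval_inj; apply/lcoset_eq; exact: fh.
(* Open sets and smooth functions on the quotient are defined by pullback along [p], so the claim
   for [f] is the one for [f \o p], the orbit map, which has local sections. *)
- move=> O; rewrite -[is_open (f @^-1` O)]/(is_open (s := sub_space _) ((f \o p) @^-1` O)) fp.
  apply: (@section_open_iff R _ _ _ _ (@orbit_map R) (fun a => a (one_minus R[i]))) => //.
  exact: orbit_section.
- move=> O g _; rewrite -[smooth_on (f @^-1` O) (g \o f)]/(smooth_on (s := sub_space _) ((f \o p) @^-1` O) (g \o (f \o p))) fp.
  apply: (@section_smooth_iff R _ _ _ _ (@orbit_map R) (fun a => a (one_minus R[i]))) => //.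
  exact: orbit_section.
Qed.
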